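(* Consider the Hudson--Parthasarathy type quantum stochastic differential equation (QSDE) on $\mathcal{A}_{loc}\otimes\mathcal{E}$ $$U_t = I+ \int_0^t U_s G\,ds + \int_0^t U_s \overline{\mathcal{C}_r}\, a^\dagger(ds) - \int_0^t U_s\, \mathcal{C}_r^{*}\, a(ds),\qquad t\ge 0,$$ where $a^\dagger, a$ are the creation and annihilation processes respectively. This QSDE admits a unitary solution $(U_t)_{t\ge 0}$ on $\mathcal{H}\otimes\Gamma_{sym}$. Moreover, the expectation semi-group $(\mathcal{T}_t)_{t\ge 0}$ of the family of homomorphisms (the homomorphic co-cycle) $J_t(X)=U_t^*(X\otimes I)U_t$, $X\in\mathcal{B}(\mathcal{H})$, is the unique (minimal) semi-group associated with the formal Lindbladian $\mathcal{L}$ given, for $X\in\mathcal{B}(\mathcal{H})$ and $u,v\in\mathcal{A}_{loc}$, by $$\langle u,\mathcal{L}(X)v\rangle \equiv \langle u,XGv\rangle+\langle Gu,Xv\rangle+\langle \overline{\mathcal{C}_r}u,X\,\overline{\mathcal{C}_r}v\rangle,$$ and $(\mathcal{T}_t)_{t\ge0}$ is conservative.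
   Context: Algebra. Fix positive integers $N,d$. $\mathcal{A}=\overline{\bigotimes_{j\in\mathbb{Z}^d}M_N(\mathbb{C})}^{\,c^*}$ is the UHF $C^*$-algebra (the $C^*$-inductive limit of the finite tensor products of copies of $M_N(\mathbb{C})$ indexed by finite subsets of $\mathbb{Z}^d$). For $\Delta\subset\mathbb{Z}^d$, $\mathcal{A}_\Delta$ is the $*$-subalgebra generated by elements supported in $\Delta$ (i.e. equal to the identity in every tensor component outside $\Delta$). For $j=(j_1,\dots,j_d)\in\mathbb{Z}^d$ put $\|j\|=\max_i|j_i|$, $\Delta_n=\{j:\|j\|\le n\}$, $\partial\Delta_n=\{j:\|j\|=n\}$. $\mathcal{A}_{loc}=\bigcup_n\mathcal{A}_{\Delta_n}$ is the $*$-algebra of local elements. $tr$ is the unique normalized trace on $\mathcal{A}$, and $\mathcal{H}=L^2(\mathcal{A},tr)$ is its GNS Hilbert space, with $\langle x,y\rangle=tr(x^*y)$; $\mathcal{A}_{loc}$ is regarded as a dense subspace of $\mathcal{H}$. $\mathcal{B}(\mathcal{H})$ is the algebra of bounded operators on $\mathcal{H}$. Operators. Let $W_n\in\mathcal{A}_{\partial\Delta_n}$ for $n\ge1$ with $\sum_{n\ge1}\|W_n\|=\infty$, and write formally $r=\sum_{n\ge1}W_n$. The operator $\mathcal{C}_r$ with domain $\mathcal{A}_{loc}$ in $\mathcal{H}$ is $\mathcal{C}_r(x)=[r,x]=\sum_{n\ge1}[W_n,x]$ (a finite sum, since $[W_n,x]=0$ for $n>m$ when $x\in\mathcal{A}_{\Delta_m}$).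 It is densely defined and closable; $\overline{\mathcal{C}_r}$ is its closure and $\mathcal{C}_r^*$ its adjoint. $G:=-\frac12\mathcal{C}_r^*\overline{\mathcal{C}_r}$, a negative self-adjoint operator generating a $C_0$-contraction semi-group in $\mathcal{H}$. Fock space and QSDE. $\Gamma_{sym}=\Gamma_{sym}(L^2(\mathbb{R}_+,\mathbb{C}))$ is the symmetric Fock space, $e(f)=\bigoplus_{n\ge0}\frac{1}{\sqrt{n!}}f^{\otimes n}$ are the exponential vectors, and $\mathcal{A}_{loc}\otimes\mathcal{E}$ is the linear span of $\{x\otimes e(f): x\in\mathcal{A}_{loc},\ f\in L^2(\mathbb{R}_+,\mathbb{C})\}$. The integrals are Hudson--Parthasarathy quantum stochastic integrals of adapted processes, and the equation is required to hold on $\mathcal{A}_{loc}\otimes\mathcal{E}$; in terms of matrix elements, for $u\in\mathcal{H}$, $v\in\mathcal{A}_{loc}$, $f,g\in L^2(\mathbb{R}_+,\mathbb{C})$, $$\langle u\otimes e(f),U_t\,v\otimes e(g)\rangle=\langle u\otimes e(f),v\otimes e(g)\rangle+\int_0^t\big\langle u\otimes e(f),U_s\big((G+\overline{f(s)}\,\overline{\mathcal{C}_r}-g(s)\,\mathcal{C}_r^* )v\big)\otimes e(g)\big\rangle ds.$$ A unitary solution is an adapted process of unitary operators $U_t$ on $\mathcal{H}\otimes\Gamma_{sym}$ satisfying the equation. Semi-groups. A quantum dynamical semi-group (QDS) on $\mathcal{B}(\mathcal{H})$ is a semi-group $(\mathcal{T}_t)_{t\ge0}$ of normal completely positive maps with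 $\mathcal{T}_t(I)\le I$ such that $t\mapsto\mathcal{T}_t(X)$ is ultra-weakly continuous for every $X$; it is conservative if $\mathcal{T}_t(I)=I$ for all $t$. The (vacuum) expectation semi-group of $J_t$ is defined by $\langle u,\mathcal{T}_t(X)v\rangle=\langle u\otimes e(0),J_t(X)\,v\otimes e(0)\rangle$ for $u,v\in\mathcal{H}$. A QDS is associated with the formal Lindbladian $\mathcal{L}$ if $\langle u,\mathcal{T}_t(X)v\rangle=\langle u,Xv\rangle+\int_0^t\langle u,\mathcal{L}(\mathcal{T}_s(X))v\rangle ds$ for all $u,v\in\mathcal{A}_{loc}$, $X\in\mathcal{B}(\mathcal{H})$, $t\ge0$; it is minimal if $\mathcal{T}_t(X)\le\mathcal{T}'_t(X)$ for all $t\ge 0$, all $X\ge0$ and every QDS $(\mathcal{T}'_t)$ associated with $\mathcal{L}$. *)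

(* Defs.v *)
From mathcomp Require Import all_boot all_order all_algebra perm.
From mathcomp Require Import complex.
From mathcomp Require Import all_classical all_reals all_analysis.
Import Order.TTheory GRing.Theory Num.Theory.
Import numFieldNormedType.Exports.

Set Implicit Arguments.
Unset Strict Implicit.
Unset Printing Implicit Defensive.

Local Open Scope classical_set_scope.
Local Open Scope ring_scope.
Local Open Scope complex_scope.

Definition cmod (R : realType) (z : R[i]) : R := complex.Re `|z|.

Definition cintegral (R : realType) (D : set R) (f : R -> R[i]) : R[i] :=
  (\int[lebesgue_measure]_(s in D) complex.Re (f s)) +i*
  (\int[lebesgue_measure]_(s in D) complex.Im (f s)).

Definition cseries_sum (R : realType) (a : nat -> R[i]) : R[i] :=
  limn (series (fun n => complex.Re (a n))) +i*
  limn (series (fun n => complex.Im (a n))).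

Definition ccontinuous_on (R : realType) (D : set R) (f : R -> R[i]) : Prop :=
  {within D, continuous (fun t => complex.Re (f t))} /\
  {within D, continuous (fun t => complex.Im (f t))}.

Definition cmeasurable_on (R : realType) (D : set R) (f : R -> R[i]) : Prop :=
  measurable_fun D (fun t => complex.Re (f t)) /\
  measurable_fun D (fun t => complex.Im (f t)).

(* Representatives of the elements of L^2(R_+, C); values at negative
   arguments are irrelevant. *)
Definition L2_half_line (R : realType) (f : R -> R[i]) : Prop :=
  (fun s => complex.Re (f s)) \_ `[0, +oo[ \in Lfun lebesgue_measure 2%:E /\
  (fun s => complex.Im (f s)) \_ `[0, +oo[ \in Lfun lebesgue_measure 2%:E.

Definition cutoff (R : realType) (D : set R) (f : R -> R[i]) : R -> R[i] :=
  fun s => if s \in D then f s else 0.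

Definition L2_inner (R : realType) (f g : R -> R[i]) : R[i] :=
  cintegral `[0, +oo[ (fun s => Num.conj (f s) * g s).

Definition dot_norm (R : realType) (V : lmodType R[i])
    (b : {dot V for Num.conj}) (u : V) : R :=
  Num.sqrt (complex.Re (b u u)).

Record hilbert (R : realType) := Hilbert {
  hilbert_sort :> lmodType R[i];
  hilbert_dot : {dot hilbert_sort for Num.conj};
  hilbert_complete : forall u : nat -> hilbert_sort,
    (forall e : R, 0 < e -> exists k, forall m n, (k <= m)%N -> (k <= n)%N ->
       dot_norm hilbert_dot (u m - u n) < e) ->
    exists l, (fun n => dot_norm hilbert_dot (u n - l)) @ \oo --> (0 : R) }.

(* {dot _ for _} is linear in its first argument, ⟨ _, _ ⟩ in its second. *)
Definition inner (R : realType) (H : hilbert R) (u v : H) : R[i] :=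
  hilbert_dot H v u.

Notation "⟨ u , v ⟩" := (inner u v)
  (at level 0, u at level 99, v at level 99, format "⟨ u ,  v ⟩").

Definition hnorm (R : realType) (H : hilbert R) (u : H) : R :=
  dot_norm (hilbert_dot H) u.

Definition hlim (R : realType) (H : hilbert R) (u : nat -> H) : H :=
  xget 0 [set l | (fun n => hnorm (u n - l)) @ \oo --> (0 : R)].

Definition hdense (R : realType) (H : hilbert R) (D : set H) : Prop :=
  forall (h : H) (e : R), 0 < e -> exists2 h', D h' & hnorm (h - h') < e.

Definition htotal (R : realType) (H : hilbert R) (E : set H) : Prop :=
  hdense [set h | exists n (c : 'I_n -> R[i]) (x : 'I_n -> H),
                    (forall i, E (x i)) /\ h = \sum_(i < n) c i *: x i].

Definition bounded_op (R : realType) (H : hilbert R) (X : H -> H) : Prop :=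
  linear X /\ exists M : R, forall u, hnorm (X u) <= M * hnorm u.

Definition op_adjoint (R : realType) (H : hilbert R) (X : H -> H) : H -> H :=
  fun u => xget 0 [set w | forall v, ⟨ w, v ⟩ = ⟨ u, X v ⟩].

Definition unitary_op (R : realType) (H : hilbert R) (X : H -> H) : Prop :=
  [/\ linear X, forall u v, ⟨ X u, X v ⟩ = ⟨ u, v ⟩
    & forall w, exists u, X u = w].

(* In the order of R[i], 0 <= z means that z is real and nonnegative. *)
Definition op_le (R : realType) (H : hilbert R) (X Y : H -> H) : Prop :=
  forall u, 0 <= ⟨ u, Y u - X u ⟩.

Definition op_lub (R : realType) (H : hilbert R) (D : set (H -> H))
    (X : H -> H) : Prop :=
  [/\ bounded_op X, forall Y, D Y -> op_le Y X
    & forall Z, bounded_op Z -> (forall Y, D Y -> op_le Y Z) -> op_le X Z].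

Section Graphs.
Variables (R : realType) (H : hilbert R).

Definition gdom (T : set (H * H)) : set H := [set u | exists w, T (u, w)].

(* The value at a point of the domain, and 0 elsewhere. *)
Definition gval (T : set (H * H)) (u : H) : H := xget 0 [set w | T (u, w)].

Definition gclosure (T : set (H * H)) : set (H * H) :=
  [set p | forall e : R, 0 < e -> exists2 q, T q &
             hnorm (p.1 - q.1) < e /\ hnorm (p.2 - q.2) < e].

Definition gadjoint (T : set (H * H)) : set (H * H) :=
  [set p | forall q, T q -> ⟨ p.2, q.1 ⟩ = ⟨ p.1, q.2 ⟩].

Definition gcomp (S T : set (H * H)) : set (H * H) :=
  [set p | exists2 w, T (p.1, w) & S (w, p.2)].

Definition gscale (a : R[i]) (T : set (H * H)) : set (H * H) :=
  [set p | exists2 w, T (p.1, w) & p.2 = a *: w].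

End Graphs.

Record cstar_algebra (R : realType) := CStarAlgebra {
  cstar_sort :> algType R[i];
  star : cstar_sort -> cstar_sort;
  cnorm : cstar_sort -> R;
  star_antilinear : forall (a : R[i]) x y,
    star (a *: x + y) = Num.conj a *: star x + star y;
  star_mul : forall x y, star (x * y) = star y * star x;
  star_involutive : involutive star;
  cnorm_triangle : forall x y, cnorm (x + y) <= cnorm x + cnorm y;
  cnorm_scale : forall (a : R[i]) x, cnorm (a *: x) = cmod a * cnorm x;
  cnorm_eq0 : forall x, cnorm x = 0 -> x = 0;
  cnorm_mul : forall x y, cnorm (x * y) <= cnorm x * cnorm y;
  cnorm_cstar : forall x, cnorm (star x * x) = cnorm x ^+ 2;
  cnorm_complete : forall u : nat -> cstar_sort,
    (forall e : R, 0 < e -> exists k, forall m n, (k <= m)%N -> (k <= n)%N ->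
       cnorm (u m - u n) < e) ->
    exists l, (fun n => cnorm (u n - l)) @ \oo --> (0 : R) }.

Definition star_subalgebra (R : realType) (A : cstar_algebra R) (B : set A)
  : Prop :=
  [/\ B 1, forall (a : R[i]) x y, B x -> B y -> B (a *: x + y),
      forall x y, B x -> B y -> B (x * y) & forall x, B x -> B (star x)].

Definition sup_norm (d : nat) (j : 'rV[int]_d) : nat := \max_(i < d) absz (j ord0 i).

Definition box (d n : nat) : set 'rV[int]_d := [set j | (sup_norm j <= n)%N].

Definition box_boundary (d n : nat) : set 'rV[int]_d :=
  [set j | sup_norm j = n].

Section UHF.
Variables (R : realType) (N d : nat) (A : cstar_algebra R).

Definition generated_by_sites (site : 'rV[int]_d -> 'M[R[i]]_N -> A)
    (Delta : set 'rV[int]_d) : set A :=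
  smallest (@star_subalgebra R A)
    [set x | exists2 j, Delta j & exists m, x = site j m].

(* A is the C*-tensor product of copies of M_N(C) indexed by Z^d: site j embeds
   the j-th copy, the copies commute, and together they generate a dense
   *-subalgebra.  As a finite tensor product of matrix algebras is simple, the
   *-algebra generated by the copies in a finite F is (isometrically) the tensor
   product of the copies indexed by F, so that A is the inductive limit of these
   finite tensor products. *)
Record uhf := UHF {
  site : 'rV[int]_d -> 'M[R[i]]_N -> A;
  site_linear : forall j, linear (site j);
  site_one : forall j, site j 1%:M = 1;
  site_mul : forall j a b, site j (a *m b) = site j a * site j b;
  site_star : forall j a, site j (map_mx Num.conj a^T) = star (site j a);
  site_comm : forall j k a b, j != k ->
    site j a * site k b = site k b * site j a;
  site_dense : forall (x : A) (e : R), 0 < e ->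
    exists2 y, (exists n, generated_by_sites site (@box d n) y) &
               cnorm (x - y) < e }.

Definition local_algebra (S : uhf) (Delta : set 'rV[int]_d) : set A :=
  generated_by_sites (site S) Delta.

Definition local_elements (S : uhf) : set A :=
  \bigcup_n local_algebra S (@box d n).

End UHF.

Definition normalized_trace (R : realType) (A : cstar_algebra R)
    (tr : A -> R[i]) : Prop :=
  [/\ forall (a : R[i]) x y, tr (a *: x + y) = a * tr x + tr y,
      forall x, 0 <= tr (star x * x), tr 1 = 1
    & forall x y, tr (x * y) = tr (y * x)].

(* L^2(A, tr), determined up to unitary equivalence by these properties *)
Record gns (R : realType) (A : cstar_algebra R) (tr : A -> R[i]) := GNS {
  gns_space :> hilbert R;
  gns_vec : A -> gns_space;
  gns_linear : linear gns_vec;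
  gns_inner : forall x y, ⟨ gns_vec x, gns_vec y ⟩ = tr (star x * y);
  gns_dense : hdense (range gns_vec) }.

Section Derivation.
Variables (R : realType) (N d : nat) (A : cstar_algebra R) (S : uhf N d A).
Variables (tr : A -> R[i]) (H : gns tr) (W : nat -> A).

Definition local_vectors : set H := [set gns_vec H x | x in local_elements S].

Definition derivation : set (H * H) :=
  [set p | exists m x, local_algebra S (@box d m) x /\
     p = (gns_vec H x,
          gns_vec H (\sum_(1 <= n < m.+1) (W n * x - x * W n)))].

Definition generator : set (H * H) :=
  gscale (- (2%:R)^-1) (gcomp (gadjoint derivation) (gclosure derivation)).

End Derivation.

Arguments local_vectors {R N d A} S {tr} H _.
Arguments derivation {R N d A} S {tr} H W _.
Arguments generator {R N d A} S {tr} H W _.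

(* Gamma_sym(L^2(R_+, C)) is the Hilbert direct sum over n of the symmetric
   tensor powers; fock_tensor n f is the projection of
   f_0 (x) ... (x) f_(n-1) on symmetric tensors, so that
   fock_tensor n (fun=> f) is f^{(x) n}. *)
Record fock (R : realType) := Fock {
  fock_space :> hilbert R;
  fock_tensor : forall n, ('I_n -> R -> R[i]) -> fock_space;
  fock_inner : forall n (f g : 'I_n -> R -> R[i]),
    (forall i, L2_half_line (f i)) -> (forall i, L2_half_line (g i)) ->
    ⟨ fock_tensor f, fock_tensor g ⟩ =
    (n`!%:R)^-1 * \sum_(p : 'S_n) \prod_(i < n) L2_inner (f i) (g (p i));
  fock_orthogonal : forall m n (f : 'I_m -> R -> R[i]) (g : 'I_n -> R -> R[i]),
    (forall i, L2_half_line (f i)) -> (forall i, L2_half_line (g i)) ->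
    m != n -> ⟨ fock_tensor f, fock_tensor g ⟩ = 0;
  fock_total : htotal [set h | exists n (f : 'I_n -> R -> R[i]),
    (forall i, L2_half_line (f i)) /\ h = fock_tensor f] }.

Definition exp_vec (R : realType) (F : fock R) (f : R -> R[i]) : F :=
  hlim (fun k => \sum_(n < k)
    ((Num.sqrt (n`!%:R : R))^-1)%:C *: fock_tensor F (fun _ : 'I_n => f)).

Record hilbert_tensor (R : realType) (H1 H2 : hilbert R) := HilbertTensor {
  tensor_space :> hilbert R;
  tensor : H1 -> H2 -> tensor_space;
  tensor_inner : forall u v x y,
    ⟨ tensor u x, tensor v y ⟩ = ⟨ u, v ⟩ * ⟨ x, y ⟩;
  tensor_total : htotal [set h | exists u x, h = tensor u x] }.

(* X (x) I on the Hilbert tensor product *)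
Definition ampliation (R : realType) (H1 H2 : hilbert R)
    (K : hilbert_tensor H1 H2) (X : H1 -> H1) : K -> K :=
  xget (fun=> 0) [set Y : K -> K | bounded_op Y /\
    forall u x, Y (tensor K u x) = tensor K (X u) x].

Section QSDE.
Variables (R : realType) (H : hilbert R) (F : fock R) (K : hilbert_tensor H F).
Implicit Type U : R -> K -> K.

(* Adaptedness says U_t = U' (x) I in
   (H (x) Gamma_sym(L^2([0, t]))) (x) Gamma_sym(L^2([t, oo[)); it is expressed
   on exponential vectors, e(f) being e(f 1_[0, t]) (x) e(f 1_[t, oo[). *)
Definition adapted_process U : Prop :=
  (forall t, 0 <= t -> forall (u v : H) (f g : R -> R[i]),
     L2_half_line f -> L2_half_line g ->
     ⟨ tensor K u (exp_vec F f), U t (tensor K v (exp_vec F g)) ⟩ =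
     ⟨ tensor K u (exp_vec F (cutoff `[0, t] f)),
        U t (tensor K v (exp_vec F (cutoff `[0, t] g))) ⟩ *
     ⟨ exp_vec F (cutoff `[t, +oo[ f), exp_vec F (cutoff `[t, +oo[ g) ⟩) /\
  (forall x y : K, cmeasurable_on `[0, +oo[ (fun t => ⟨ x, U t y ⟩)).

(* U_t = I + int U_s G ds + int U_s C a^dagger(ds) - int U_s C' a(ds) on the
   span of D (x) {exponential vectors}, in terms of matrix elements *)
Definition hp_equation (D : set H) (G C C' : set (H * H)) U : Prop :=
  D `<=` gdom G `&` gdom C `&` gdom C' /\
  forall (u v : H) (f g : R -> R[i]), D v ->
    L2_half_line f -> L2_half_line g -> forall t, 0 <= t ->
    ⟨ tensor K u (exp_vec F f), U t (tensor K v (exp_vec F g)) ⟩ =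
    ⟨ tensor K u (exp_vec F f), tensor K v (exp_vec F g) ⟩ +
    cintegral `[0, t] (fun s =>
      ⟨ tensor K u (exp_vec F f),
         U s (tensor K (gval G v + Num.conj (f s) *: gval C v
                        - g s *: gval C' v) (exp_vec F g)) ⟩).

Definition unitary_solution (D : set H) (G C C' : set (H * H)) U : Prop :=
  [/\ forall t, 0 <= t -> unitary_op (U t), adapted_process U
    & hp_equation D G C C' U].

Definition conjugation U (t : R) (X : H -> H) : K -> K :=
  fun x => op_adjoint (U t) (ampliation (K:=K) X (U t x)).

Definition star_homomorphisms (J : R -> (H -> H) -> K -> K) : Prop :=
  forall t, 0 <= t ->
  [/\ forall X, bounded_op X -> bounded_op (J t X), J t id = id,
      forall (a : R[i]) X Y, bounded_op X -> bounded_op Y ->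
        J t (fun u => a *: X u + Y u) = (fun x => a *: J t X x + J t Y x),
      forall X Y, bounded_op X -> bounded_op Y ->
        J t (X \o Y) = J t X \o J t Y
    & forall X, bounded_op X -> J t (op_adjoint X) = op_adjoint (J t X)].

Definition expectation_semigroup (J : R -> (H -> H) -> K -> K)
    (T : R -> (H -> H) -> H -> H) : Prop :=
  forall t, 0 <= t -> forall X, bounded_op X -> forall u v,
    ⟨ u, T t X v ⟩ = ⟨ tensor K u (exp_vec F (fun=> 0)),
                         J t X (tensor K v (exp_vec F (fun=> 0))) ⟩.

End QSDE.

Section QDS.
Variables (R : realType) (H : hilbert R).
Implicit Types (Phi : (H -> H) -> H -> H) (T : R -> (H -> H) -> H -> H).

Definition op_map_linear Phi : Prop :=
  forall (a : R[i]) X Y, bounded_op X -> bounded_op Y ->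
    Phi (fun u => a *: X u + Y u) = (fun u => a *: Phi X u + Phi Y u).

Definition completely_positive Phi : Prop :=
  forall n (X : 'I_n -> 'I_n -> H -> H), (forall i j, bounded_op (X i j)) ->
    (forall u : 'I_n -> H, 0 <= \sum_i \sum_j ⟨ u i, X i j (u j) ⟩) ->
    forall u : 'I_n -> H, 0 <= \sum_i \sum_j ⟨ u i, Phi (X i j) (u j) ⟩.

(* Preservation of suprema of upward directed families of positive operators *)
Definition normal_map Phi : Prop :=
  forall (D : set (H -> H)) (X : H -> H), D !=set0 ->
    (forall Y, D Y -> bounded_op Y /\ op_le (fun=> 0) Y) ->
    (forall Y Z, D Y -> D Z ->
       exists V, [/\ D V, op_le Y V & op_le Z V]) ->
    op_lub D X -> op_lub [set Phi Y | Y in D] (Phi X).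

Definition ultraweakly_continuous (X : R -> H -> H) : Prop :=
  forall u v : nat -> H,
    cvgn (series (fun k => hnorm (u k) ^+ 2)) ->
    cvgn (series (fun k => hnorm (v k) ^+ 2)) ->
    ccontinuous_on `[0, +oo[
      (fun t => cseries_sum (fun k => ⟨ u k, X t (v k) ⟩)).

Record qds T : Prop := QDS {
  qds_bounded : forall t, 0 <= t -> forall X, bounded_op X -> bounded_op (T t X);
  qds_linear : forall t, 0 <= t -> op_map_linear (T t);
  qds_cp : forall t, 0 <= t -> completely_positive (T t);
  qds_normal : forall t, 0 <= t -> normal_map (T t);
  qds_contractive : forall t, 0 <= t -> op_le (T t id) id;
  qds_zero : forall X, bounded_op X -> T 0 X = X;
  qds_semigroup : forall s t, 0 <= s -> 0 <= t -> forall X, bounded_op X ->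
    T (s + t) X = T s (T t X);
  qds_continuous : forall X, bounded_op X ->
    ultraweakly_continuous (fun t => T t X) }.

Definition conservative T : Prop := forall t, 0 <= t -> T t id = id.

(* The sesquilinear form <u, L(X) v> that defines the formal Lindbladian L *)
Definition lindbladian (G C : set (H * H)) (X : H -> H) (u v : H) : R[i] :=
  ⟨ u, X (gval G v) ⟩ + ⟨ gval G u, X v ⟩ + ⟨ gval C u, X (gval C v) ⟩.

Definition associated (D : set H) (L : (H -> H) -> H -> H -> R[i]) T : Prop :=
  forall u v, D u -> D v -> forall X, bounded_op X -> forall t, 0 <= t ->
    ⟨ u, T t X v ⟩ =
    ⟨ u, X v ⟩ + cintegral `[0, t] (fun s => L (T s X) u v).

Definition minimal_semigroup (D : set H) (L : (H -> H) -> H -> H -> R[i]) T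
  : Prop :=
  forall T', qds T' -> associated D L T' -> forall t, 0 <= t ->
    forall X, bounded_op X -> op_le (fun=> 0) X -> op_le (T t X) (T' t X).

Definition unique_semigroup (D : set H) (L : (H -> H) -> H -> H -> R[i]) T
  : Prop :=
  forall T', qds T' -> associated D L T' -> forall t, 0 <= t ->
    forall X, bounded_op X -> T' t X = T t X.

End QDS.

(* Main.v *)
(* The equation is solved through a time discretization.  The commutators with
   the W_n are bounded on the image of each local algebra, which they preserve, and
   the adjoint of [r, .] acts there as [r^*, .], because tr is a trace.  Splitting
   each step function f along the dyadic mesh 2^-k, the Fock space restricts to
   products of cells, and a product of one-cell operators, each matching the
   Hudson-Parthasarathy differential up to second order, gives approximations
   U_k of the solution that converge strongly on the span of
   A_loc (x) {e(f) : f step}.  The Gram matrix of these "toy" vectors solves a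
   discrete Euler scheme whose generator
     phi |-> phi(G_g u, v) + phi(u, G_g' v) + phi(C_g u, C_g' v)
   maps the inner product to a multiple of itself, so the limit U_t is
   isometric.  The adjoint of U_t is the limit of the time-reversed scheme for -r,
   hence isometric too, and U_t is unitary.
   The forms <u, T_t(X) v> satisfy a local second-order estimate around the
   Lindbladian.  This generator is bounded on sesquilinear forms on each local
   algebra, so such a flow of forms is determined by its value at 0 (Euler):
   this gives the semigroup law, and the uniqueness of the semigroup among
   all solutions, since complete positivity bounds any of them uniformly in t. *)

Require Import Defs.
From mathcomp Require Import all_boot all_order all_algebra perm.
From mathcomp Require Import complex.
From mathcomp Require Import all_classical all_reals all_analysis.
From mathcomp Require Import measurable_realfun zify ring lra.
Import Order.TTheory GRing.Theory Num.Theory.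
Import numFieldNormedType.Exports.
Set Implicit Arguments.
Unset Strict Implicit.
Unset Printing Implicit Defensive.
Local Open Scope classical_set_scope.
Local Open Scope ring_scope.
Local Open Scope complex_scope.

(** * Complex numbers and inner products *)

(** On a cell of length [h] the operator sends [v (x) e(g)] to
    [jump g v (x) e(1) + toy0 h g v (x) e(0)]. Only the two constants 1 and 0 occur as cell values,
    and [e(1) - e(0)] stands for the particle created in the cell. Hence every scalar product of
    approximations is an exponential times a word in operators on [H], and no number states are
    handled. At a finite mesh these vectors are not isometric images. Comparing a cell of length [h]
    with [p] cells of length [h / p] gives the Cauchy property and the limiting isometry in one
    estimate; this is why [toy_form] carries two meshes. The commutator is unbounded and its rate
    depends on the local level [m]. All words preserve each level, so the estimates are made at
    fixed [m]; the passage to the whole space relies on isometry or contractivity alone, which do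
    not see [m]. In [U_s dM_s] the new increment stands to the right of [U_s], so the last cell acts
    first on the vector. Adjoints reverse this order and change the sign of [C]: hence the flag [o]
    of [orient] and [neg_coupling]. *)

Lemma ler_eps (R : realType) (x y : R) : (forall e : R, 0 < e -> x <= y + e) -> x <= y.
Proof. by move=> h; apply/ler_addgt0Pr. Qed.

Section ComplexModulus.
Variable R : realType.
Implicit Types (x y : R) (z w : R[i]).

Lemma cmodE z : `|z| = (cmod z)%:C.
Proof. by rewrite /cmod normc_def. Qed.

Lemma cmod_ge0 z : 0 <= cmod z.
Proof. by rewrite -ler0c -cmodE normr_ge0. Qed.

Lemma cmod_real x : cmod x%:C = `|x|.
Proof. by rewrite /cmod normc_def /= expr0n /= addr0 sqrtr_sqr. Qed.

Lemma cmod0 : cmod (0 : R[i]) = 0.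
Proof. by rewrite (cmod_real 0) normr0. Qed.

Lemma cmod1 : cmod (1 : R[i]) = 1.
Proof. by rewrite (cmod_real 1) normr1. Qed.

Lemma cmod_eq0 z : cmod z = 0 -> z = 0.
Proof. by move=> h; apply/eqP; rewrite -normr_eq0 cmodE h. Qed.

Lemma cmodD z w : cmod (z + w) <= cmod z + cmod w.
Proof. by rewrite -lecR rmorphD /= -!cmodE ler_normD. Qed.

Lemma cmodM z w : cmod (z * w) = cmod z * cmod w.
Proof. by apply: complexI; rewrite rmorphM /= -!cmodE normrM. Qed.

Lemma cmodN z : cmod (- z) = cmod z.
Proof. by rewrite /cmod normrN. Qed.

Lemma cmodB z w : cmod (z - w) <= cmod z + cmod w.
Proof. by rewrite -[cmod w]cmodN cmodD. Qed.

Lemma cmod_distC z w : cmod (z - w) = cmod (w - z).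
Proof. by rewrite -cmodN opprB. Qed.

Lemma cmod_distD t z w : cmod (z - w) <= cmod (z - t) + cmod (t - w).
Proof. by rewrite -[z - w](subrKA t) cmodD. Qed.

Lemma cmodJ z : cmod (Num.conj z) = cmod z.
Proof. by rewrite /cmod norm_conjC. Qed.

Lemma cmodX z n : cmod (z ^+ n) = cmod z ^+ n.
Proof. by elim: n => [|n IH]; rewrite ?expr0 ?cmod1// !exprS cmodM IH. Qed.

Lemma cmodV z : cmod z^-1 = (cmod z)^-1.
Proof.
have [->|z0] := eqVneq z 0; first by rewrite invr0 cmod0 invr0.
apply: (@mulfI _ (cmod z)); first by apply: contra_neq z0; exact: cmod_eq0.
rewrite -cmodM divff// cmod1 divff//; apply: contra_neq z0; exact: cmod_eq0.
Qed.

Lemma cmod_sum (I : Type) (r : seq I) (P : pred I) (F : I -> R[i]) :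
  cmod (\sum_(i <- r | P i) F i) <= \sum_(i <- r | P i) cmod (F i).
Proof.
elim/big_ind2: _ => [|z a w b ha hb|//]; first by rewrite cmod0.
by rewrite (le_trans (cmodD _ _))// lerD.
Qed.

Lemma ReD z w : complex.Re (z + w) = complex.Re z + complex.Re w.
Proof. by case: z w => [? ?] [? ?]. Qed.

Lemma ImD z w : complex.Im (z + w) = complex.Im z + complex.Im w.
Proof. by case: z w => [? ?] [? ?]. Qed.

Lemma ReN z : complex.Re (- z) = - complex.Re z.
Proof. by case: z => [? ?]. Qed.

Lemma ImN z : complex.Im (- z) = - complex.Im z.
Proof. by case: z => [? ?]. Qed.

Lemma ReM z w : complex.Re (z * w) =
  complex.Re z * complex.Re w - complex.Im z * complex.Im w.
Proof. by case: z w => [? ?] [? ?]. Qed.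

Lemma ImM z w : complex.Im (z * w) =
  complex.Re z * complex.Im w + complex.Im z * complex.Re w.
Proof. by case: z w => [? ?] [? ?]. Qed.

Lemma ReJ z : complex.Re (Num.conj z) = complex.Re z.
Proof. by case: z. Qed.

Lemma ImJ z : complex.Im (Num.conj z) = - complex.Im z.
Proof. by case: z. Qed.

Lemma conj_real x : Num.conj (x%:C) = x%:C.
Proof. by apply/eqP; rewrite eq_complex ReJ ImJ /= oppr0 !eqxx. Qed.

Lemma cmod_sqr z : cmod z ^+ 2 = complex.Re z ^+ 2 + complex.Im z ^+ 2.
Proof. by rewrite /cmod normc_def /= sqr_sqrtr// addr_ge0 ?sqr_ge0. Qed.

Lemma mul_conj_cmod z : Num.conj z * z = (cmod z ^+ 2)%:C.
Proof.
by apply/eqP; rewrite eq_complex ReM ImM ReJ ImJ cmod_sqr /=; apply/andP; split;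
  apply/eqP; ring.
Qed.

Lemma Re_le_cmod z : complex.Re z <= cmod z.
Proof.
rewrite (le_trans (ler_norm _))// -sqrtr_sqr /cmod normc_def /=.
by apply: ler_wsqrtr; rewrite lerDl sqr_ge0.
Qed.

Lemma norm_Re_le z : `|complex.Re z| <= cmod z.
Proof. by rewrite ler_norml Re_le_cmod andbT lerNl -ReN -(cmodN z) Re_le_cmod. Qed.

Lemma norm_Im_le z : `|complex.Im z| <= cmod z.
Proof.
rewrite -sqrtr_sqr /cmod normc_def /=.
by apply: ler_wsqrtr; rewrite lerDr sqr_ge0.
Qed.

Lemma cmod_le_ReIm z : cmod z <= `|complex.Re z| + `|complex.Im z|.
Proof.
rewrite {1}[z]complexE (le_trans (cmodD _ _))// cmodM !cmod_real lerD//.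
have -> : cmod ('i%C : R[i]) = 1.
  by rewrite /cmod normc_def /= expr0n /= add0r expr1n sqrtr1.
by rewrite mul1r.
Qed.

Lemma complex_eq z w : complex.Re z = complex.Re w ->
  complex.Im z = complex.Im w -> z = w.
Proof. by case: z w => [? ?] [? ?] /= -> ->. Qed.

Lemma eq_by_cmod z w : (forall e, 0 < e -> cmod (z - w) <= e) -> z = w.
Proof.
move=> h; apply/eqP; rewrite -subr_eq0; apply/eqP/cmod_eq0/eqP.
rewrite eq_le cmod_ge0 andbT; apply: ler_eps => e e0.
by rewrite add0r h.
Qed.

Lemma complex_ge0 z : (0 <= z) = (complex.Im z == 0) && (0 <= complex.Re z).
Proof. by rewrite lecE. Qed.

Lemma complex_ge0_closed z :
  (forall e, 0 < e -> exists2 w, 0 <= w & cmod (w - z) <= e) -> 0 <= z.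
Proof.
move=> h; rewrite complex_ge0; apply/andP; split.
  rewrite -normr_le0; apply: ler_eps => e /h[w].
  rewrite complex_ge0 => /andP[/eqP w0 _] /(le_trans (norm_Im_le _)).
  by rewrite ImD ImN w0 !add0r normrN.
apply: ler_eps => e /h[w].
rewrite complex_ge0 => /andP[_ w0] /(le_trans (Re_le_cmod _)).
by rewrite ReD ReN lerBlDl => /(le_trans w0); rewrite addrC.
Qed.

End ComplexModulus.

Section InnerProduct.
Variables (R : realType) (H : hilbert R).
Implicit Types (u v w : H) (a : R[i]).

Lemma inner_conj u v : Num.conj ⟨u, v⟩ = ⟨v, u⟩.
Proof. by rewrite /inner [RHS]hermC /= mul1r. Qed.

Lemma innerDr u v w : ⟨u, v + w⟩ = ⟨u, v⟩ + ⟨u, w⟩.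
Proof. by rewrite /inner linearDl. Qed.

Lemma innerZr a u v : ⟨u, a *: v⟩ = a * ⟨u, v⟩.
Proof. by rewrite /inner linearZl_LR. Qed.

Lemma innerNr u v : ⟨u, - v⟩ = - ⟨u, v⟩.
Proof. by rewrite /inner linearNl. Qed.

Lemma inner0r u : ⟨u, 0⟩ = 0.
Proof. by rewrite /inner linear0l. Qed.

Lemma innerBr u v w : ⟨u, v - w⟩ = ⟨u, v⟩ - ⟨u, w⟩.
Proof. by rewrite innerDr innerNr. Qed.

Lemma innerDl u v w : ⟨u + v, w⟩ = ⟨u, w⟩ + ⟨v, w⟩.
Proof. by rewrite -!(inner_conj w) innerDr rmorphD. Qed.

Lemma innerZl a u v : ⟨a *: u, v⟩ = Num.conj a * ⟨u, v⟩.
Proof. by rewrite -!(inner_conj v) innerZr rmorphM. Qed.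

Lemma innerNl u v : ⟨- u, v⟩ = - ⟨u, v⟩.
Proof. by rewrite -!(inner_conj v) innerNr rmorphN. Qed.

Lemma inner0l u : ⟨0, u⟩ = 0.
Proof. by rewrite -(inner_conj u) inner0r rmorph0. Qed.

Lemma innerBl u v w : ⟨u - v, w⟩ = ⟨u, w⟩ - ⟨v, w⟩.
Proof. by rewrite innerDl innerNl. Qed.

Lemma inner_sumr (I : Type) (r : seq I) (P : pred I) (F : I -> H) u :
  ⟨u, \sum_(i <- r | P i) F i⟩ = \sum_(i <- r | P i) ⟨u, F i⟩.
Proof. exact: (big_morph (inner u) (innerDr u) (inner0r u)). Qed.

Lemma inner_suml (I : Type) (r : seq I) (P : pred I) (F : I -> H) u :
  ⟨\sum_(i <- r | P i) F i, u⟩ = \sum_(i <- r | P i) ⟨F i, u⟩.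
Proof.
by rewrite -inner_conj inner_sumr rmorph_sum; apply: eq_bigr => i _; rewrite /= inner_conj.
Qed.

Definition innerE := (innerDr, innerDl, innerNr, innerNl, innerZr, innerZl).

Lemma inner_ge0 u : 0 <= ⟨u, u⟩.
Proof. exact: dnorm_ge0. Qed.

Lemma inner_self u : ⟨u, u⟩ = (hnorm u ^+ 2)%:C.
Proof.
have := inner_ge0 u; rewrite complex_ge0 => /andP[/eqP i0 r0].
by rewrite /hnorm /dot_norm sqr_sqrtr//; apply: complex_eq.
Qed.

Lemma hnorm_ge0 u : 0 <= hnorm u.
Proof. exact: sqrtr_ge0. Qed.

Lemma hnorm_sqr u : hnorm u ^+ 2 = complex.Re ⟨u, u⟩.
Proof. by rewrite inner_self. Qed.

Lemma hnorm_eq0 u : hnorm u = 0 -> u = 0.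
Proof.
move=> h; apply/eqP; rewrite -(dnorm_eq0 (hilbert_dot H)).
by have := inner_self u; rewrite h expr0n /= /inner => ->.
Qed.

Lemma hnorm0 : hnorm (0 : H) = 0.
Proof. by apply/eqP; rewrite -sqrf_eq0 hnorm_sqr inner0r. Qed.

Lemma hnormZ a u : hnorm (a *: u) = cmod a * hnorm u.
Proof.
apply/eqP; rewrite -(@eqrXn2 _ 2) ?mulr_ge0 ?hnorm_ge0 ?cmod_ge0//.
rewrite hnorm_sqr innerZr innerZl mulrA (mulrC a) mul_conj_cmod inner_self.
by rewrite -rmorphM /= exprMn.
Qed.

Lemma hnormN u : hnorm (- u) = hnorm u.
Proof. by rewrite -scaleN1r hnormZ cmodN cmod1 mul1r. Qed.

Lemma hnorm_distC u v : hnorm (u - v) = hnorm (v - u).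
Proof. by rewrite -hnormN opprB. Qed.

Lemma hnormD_sqr u v :
  hnorm (u + v) ^+ 2 = hnorm u ^+ 2 + 2 * complex.Re ⟨u, v⟩ + hnorm v ^+ 2.
Proof.
rewrite !hnorm_sqr !innerE !ReD -(inner_conj u v) ReJ; ring.
Qed.

Lemma hnormB_sqr u v :
  hnorm (u - v) ^+ 2 = hnorm u ^+ 2 - 2 * complex.Re ⟨u, v⟩ + hnorm v ^+ 2.
Proof. by rewrite hnormD_sqr innerNr ReN hnormN mulrN. Qed.

Lemma Re_inner_le u v : complex.Re ⟨u, v⟩ <= hnorm u * hnorm v.
Proof.
have [->|u0] := eqVneq u 0; first by rewrite inner0l hnorm0 mul0r.
have nu : 0 < hnorm u.
  by rewrite lt_neqAle hnorm_ge0 andbT eq_sym; apply: contra_neq u0; exact: hnorm_eq0.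
have := hnormB_sqr ((hnorm v)%:C *: u) ((hnorm u)%:C *: v).
rewrite innerZr innerZl conj_real mulrA -rmorphM /= !hnormZ !cmod_real !ger0_norm ?hnorm_ge0//.
have -> z : complex.Re ((hnorm u * hnorm v)%:C * z) = hnorm u * hnorm v * complex.Re z.
  by rewrite ReM /= mul0r subr0.
move=> h; have := sqr_ge0 (hnorm ((hnorm v)%:C *: u - (hnorm u)%:C *: v)).
rewrite h => {}h.
have [v0|v0] := eqVneq (hnorm v) 0.
  by rewrite (hnorm_eq0 v0) inner0r hnorm0 mulr0.
have nv : 0 < hnorm v by rewrite lt_neqAle hnorm_ge0 andbT eq_sym.
have nn : 0 < hnorm u * hnorm v by rewrite mulr_gt0.
rewrite -(ler_pM2l nn); nra.
Qed.

Lemma inner_le u v : cmod ⟨u, v⟩ <= hnorm u * hnorm v.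
Proof.
have [z0|z0] := eqVneq ⟨u, v⟩ 0; first by rewrite z0 cmod0 mulr_ge0 ?hnorm_ge0.
have cz : 0 < cmod ⟨u, v⟩.
  by rewrite lt_neqAle cmod_ge0 andbT eq_sym; apply: contra_neq z0; exact: cmod_eq0.
have := Re_inner_le (⟨u, v⟩ *: u) v.
rewrite innerZl mul_conj_cmod /= hnormZ => h.
by rewrite -(ler_pM2l cz) mulrA; apply: le_trans h; rewrite expr2.
Qed.

Lemma hnormD u v : hnorm (u + v) <= hnorm u + hnorm v.
Proof.
rewrite -(@ler_pXn2r _ 2) ?nnegrE ?addr_ge0 ?hnorm_ge0// hnormD_sqr.
have := Re_inner_le u v; nra.
Qed.

Lemma hnormB u v : hnorm (u - v) <= hnorm u + hnorm v.
Proof. by rewrite -[hnorm v]hnormN hnormD. Qed.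

Lemma hnorm_distD w u v : hnorm (u - v) <= hnorm (u - w) + hnorm (w - v).
Proof. by rewrite -[u - v](subrKA w) hnormD. Qed.

Lemma hnorm_sum (I : Type) (r : seq I) (P : pred I) (F : I -> H) :
  hnorm (\sum_(i <- r | P i) F i) <= \sum_(i <- r | P i) hnorm (F i).
Proof.
elim/big_ind2: _ => [|z a w b ha hb|//]; first by rewrite hnorm0.
by rewrite (le_trans (hnormD _ _))// lerD.
Qed.

Lemma hnorm_le_sqr u (c : R) : 0 <= c -> hnorm u ^+ 2 <= c ^+ 2 -> hnorm u <= c.
Proof. by move=> c0; rewrite ler_pXn2r ?nnegrE ?hnorm_ge0. Qed.

Lemma eq_by_hnorm u v : (forall e, 0 < e -> hnorm (u - v) <= e) -> u = v.
Proof.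
move=> h; apply/eqP; rewrite -subr_eq0; apply/eqP/hnorm_eq0/eqP.
rewrite eq_le hnorm_ge0 andbT; apply: ler_eps => e e0.
by rewrite add0r h.
Qed.

Lemma inner_diff u u' v v' : cmod (⟨u, v⟩ - ⟨u', v'⟩) <=
  hnorm (u - u') * hnorm v + hnorm u' * hnorm (v - v').
Proof.
have -> : ⟨u, v⟩ - ⟨u', v'⟩ = ⟨u - u', v⟩ + ⟨u', v - v'⟩.
  by rewrite innerBl innerBr; ring.
by rewrite (le_trans (cmodD _ _))// lerD// inner_le.
Qed.

Lemma inner_eq u v : (forall w, ⟨w, u⟩ = ⟨w, v⟩) -> u = v.
Proof.
move=> h; apply/eqP; rewrite -subr_eq0; apply/eqP/hnorm_eq0/eqP.
by rewrite -sqrf_eq0 hnorm_sqr innerBr h subrr.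
Qed.

Lemma inner_eq_dense (D : set H) u v : hdense D ->
  (forall w, D w -> ⟨w, u⟩ = ⟨w, v⟩) -> u = v.
Proof.
move=> dD h; apply/eqP; rewrite -subr_eq0; apply/eqP/eq_by_hnorm => e e0.
rewrite subr0; set d := u - v.
have [d' Dd' hd'] := dD d e e0.
have h0 : ⟨d', d⟩ = 0 by rewrite innerBr h// subrr.
have : hnorm d ^+ 2 <= hnorm (d - d') * hnorm d.
  have -> : hnorm d ^+ 2 = complex.Re ⟨d - d', d⟩.
    by rewrite innerBl h0 subr0 hnorm_sqr.
  exact: Re_inner_le.
rewrite expr2; have [->|d0] := eqVneq (hnorm d) 0; first by move=> _; exact: ltW.
have nd : 0 < hnorm d by rewrite lt_neqAle hnorm_ge0 andbT eq_sym.
by rewrite ler_pM2r// => /le_trans; apply; exact: ltW hd'.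
Qed.

End InnerProduct.

Lemma inv_succ_lt (R : realType) (e : R) : 0 < e ->
  exists k, forall n, (k <= n)%N -> n.+1%:R^-1 < e.
Proof.
move=> e0; exists (Num.truncn e^-1) => n hn1.
rewrite invf_plt ?posrE//; apply: (lt_le_trans (truncnS_gt _)).
by rewrite ler_nat ltnS.
Qed.

Section HilbertLimits.
Variables (R : realType) (H : hilbert R).
Implicit Types (u v w : H) (x y : nat -> H).

Definition hcvg x (l : H) :=
  forall e : R, 0 < e -> exists k, forall n, (k <= n)%N -> hnorm (x n - l) < e.

Lemma hcvgP x l : hcvg x l <-> (fun n => hnorm (x n - l)) @ \oo --> (0 : R).
Proof.
split=> [h|/cvgrPdist_lt h e /h[k _ hk]].
  apply/cvgrPdist_lt => e /h[k hk]; exists k => // n /hk.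
  by rewrite sub0r normrN ger0_norm ?hnorm_ge0.
by exists k => n /hk; rewrite sub0r normrN ger0_norm ?hnorm_ge0.
Qed.

Lemma hcvg_unique x l l' : hcvg x l -> hcvg x l' -> l = l'.
Proof.
move=> h h'; apply: eq_by_hnorm => e e0.
have e2 : 0 < e / 2 by rewrite divr_gt0.
have [k hk] := h _ e2; have [k' hk'] := h' _ e2.
have a := hk (maxn k k') (leq_maxl _ _); have b := hk' (maxn k k') (leq_maxr _ _).
rewrite (le_trans (hnorm_distD (x (maxn k k')) _ _))// hnorm_distC.
by rewrite [e]splitr lerD// ltW.
Qed.

Lemma hlim_eq x l : hcvg x l -> hlim x = l.
Proof.
move=> h; apply: (@hcvg_unique x) => //; rewrite /hlim.
by case: xgetP => [y _ /hcvgP//|/(_ l)]; move/hcvgP: h.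
Qed.

Lemma hcauchy_cvg x :
  (forall e : R, 0 < e -> exists k, forall m n, (k <= m)%N -> (k <= n)%N ->
    hnorm (x m - x n) < e) -> exists l, hcvg x l.
Proof. by move=> /hilbert_complete[l /hcvgP]; exists l. Qed.

End HilbertLimits.

Section Spans.
Variables (R : realType).

(** The linear relation generated by the pairs [(x i, y i)]. It replaces the map [x i |-> y i] as
    long as it is not known that linear dependences among the [x i] are respected. *)
Inductive pair_span (H1 H2 : hilbert R) (I : Type) (x : I -> H1) (y : I -> H2) :
  H1 -> H2 -> Prop :=
| pair_span0 : pair_span x y 0 0
| pair_spanS (a : R[i]) (i : I) u v : pair_span x y u v ->
    pair_span x y (a *: x i + u) (a *: y i + v).

Definition span_of (H : hilbert R) (I : Type) (x : I -> H) (u : H) :=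
  pair_span x x u u.

Section PairSpan.
Variables (H1 H2 : hilbert R) (I : Type) (x : I -> H1) (y : I -> H2).

Lemma pair_spanD u v u' v' : pair_span x y u v -> pair_span x y u' v' ->
  pair_span x y (u + u') (v + v').
Proof.
move=> h h'; elim: h => [|a i u1 v1 _ IH]; first by rewrite !add0r.
by rewrite -!addrA; constructor.
Qed.

Lemma pair_spanZ b u v : pair_span x y u v -> pair_span x y (b *: u) (b *: v).
Proof.
elim=> [|a i u1 v1 _ IH]; first by rewrite !scaler0; constructor.
by rewrite !scalerDr !scalerA; constructor.
Qed.

Lemma pair_spanB u v u' v' : pair_span x y u v -> pair_span x y u' v' ->
  pair_span x y (u - u') (v - v').
Proof.
by move=> h h'; rewrite -!(scaleN1r u') -(scaleN1r v'); apply/pair_spanD/pair_spanZ.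
Qed.

Lemma pair_span_gen i : pair_span x y (x i) (y i).
Proof.
rewrite -[x i]scale1r -[y i]scale1r -[_ *: x i]addr0 -[_ *: y i]addr0.
by constructor; constructor.
Qed.

Lemma pair_span_inner u v u' v' :
  (forall i j, ⟨y i, y j⟩ = ⟨x i, x j⟩) ->
  pair_span x y u v -> pair_span x y u' v' -> ⟨v, v'⟩ = ⟨u, u'⟩.
Proof.
move=> hxy h h'; elim: h => [|a i u1 v1 _ IH]; first by rewrite !inner0l.
rewrite !innerDl !innerZl IH; congr (_ * _ + _).
elim: h' => [|b j u2 v2 _ IH']; first by rewrite !inner0r.
by rewrite !innerDr !innerZr IH' hxy.
Qed.

Lemma span_of_pair u : span_of x u -> exists v, pair_span x y u v.
Proof.
rewrite /span_of; elim=> [|a i u1 v1 _ [v IH]]; first by exists 0; constructor.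
by exists (a *: y i + v); constructor.
Qed.

End PairSpan.

Lemma span_of_sum (H : hilbert R) (I : Type) (x : I -> H) n (c : 'I_n -> R[i])
  (f : 'I_n -> I) : span_of x (\sum_(i < n) c i *: x (f i)).
Proof.
elim/big_ind: _ => [|u v|i _]; first by constructor.
  exact: pair_spanD.
exact/pair_spanZ/pair_span_gen.
Qed.

Lemma span_of_trans (H : hilbert R) (I J : Type) (x : I -> H) (y : J -> H) :
  hdense (span_of x) ->
  (forall i (e : R), 0 < e -> exists2 u, span_of y u & hnorm (x i - u) < e) ->
  hdense (span_of y).
Proof.
move=> dx hxy h e e0; have e2 : 0 < e / 2 by rewrite divr_gt0.
have [h' sh' hh'] := dx h _ e2.
suff [u su hu] : exists2 u, span_of y u & hnorm (h' - u) < e / 2.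
  exists u => //; rewrite (le_lt_trans (hnorm_distD h' _ _))//.
  by rewrite [e]splitr ltrD.
move: sh'; rewrite /span_of => sh'; move: (e / 2) e2 => {hh' e e0} e e0.
elim: sh' e e0 => [|a i u1 v1 _ IH] e e0.
  by exists 0; [constructor | rewrite subrr hnorm0].
have e2 : 0 < e / 2 by rewrite divr_gt0.
have [w sw hw] := IH _ e2.
have c0 : 0 < cmod a + 1 by rewrite ltr_wpDl ?cmod_ge0.
have [w' sw' hw'] := hxy i (e / 2 / (cmod a + 1)) (divr_gt0 e2 c0).
exists (a *: w' + w); first by apply: pair_spanD => //; exact: pair_spanZ.
rewrite opprD addrACA -scalerBr (le_lt_trans (hnormD _ _))//.
rewrite [e]splitr ler_ltD// hnormZ.
rewrite (@le_trans _ _ ((cmod a + 1) * hnorm (x i - w')))//.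
  by rewrite ler_wpM2r ?hnorm_ge0// lerDl.
by rewrite mulrC -ler_pdivlMr// ltW.
Qed.

Lemma htotal_span (H : hilbert R) (E : set H) (I : Type) (x : I -> H) :
  htotal E -> (forall u, E u -> exists i, u = x i) -> hdense (span_of x).
Proof.
move=> tE hE h e /(tE h)[_ [n [c [f [Ef ->]]]] hlt].
exists (\sum_(i < n) c i *: f i) => //.
elim/big_ind: _ => [|u v|i _]; first by constructor.
  exact: pair_spanD.
have [j ->] := hE _ (Ef i).
exact/pair_spanZ/pair_span_gen.
Qed.

Lemma inner_eq_span (H : hilbert R) (I : Type) (x : I -> H) u v :
  hdense (span_of x) -> (forall i, ⟨x i, u⟩ = ⟨x i, v⟩) -> u = v.
Proof.
move=> dx h; apply: (inner_eq_dense dx) => w; rewrite /span_of.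
elim=> [|a i u1 v1 _ IH]; first by rewrite !inner0l.
by rewrite !innerDl !innerZl IH h.
Qed.

End Spans.

(** * Bounded operators *)

Section BoundedMaps.
Variable R : realType.

Definition bounded_map (H1 H2 : hilbert R) (X : H1 -> H2) :=
  linear X /\ exists M : R, forall u, hnorm (X u) <= M * hnorm u.

Definition hadj (H1 H2 : hilbert R) (X : H1 -> H2) : H2 -> H1 :=
  fun u => xget 0 [set w | forall v, ⟨w, v⟩ = ⟨u, X v⟩].

Lemma bounded_map_nneg (H1 H2 : hilbert R) (X : H1 -> H2) : bounded_map X ->
  exists2 M : R, 0 <= M & forall u, hnorm (X u) <= M * hnorm u.
Proof.
move=> [_ [M hM]]; exists `|M| => // u.
by rewrite (le_trans (hM u))// ler_wpM2r ?hnorm_ge0// ler_norm.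
Qed.

Section Linear.
Variables (V W : lmodType R[i]) (X : V -> W).
Hypothesis lX : linear X.

Lemma linearmap0 : X 0 = 0.
Proof. by have := lX (-1) 0 0; rewrite !scaleN1r oppr0 addr0 addNr. Qed.

Lemma linearmapD u v : X (u + v) = X u + X v.
Proof. by have := lX 1 u v; rewrite !scale1r. Qed.

Lemma linearmapZ a u : X (a *: u) = a *: X u.
Proof. by have := lX a u 0; rewrite linearmap0 !addr0. Qed.

Lemma linearmapN u : X (- u) = - X u.
Proof. by rewrite -scaleN1r linearmapZ scaleN1r. Qed.

Lemma linearmapB u v : X (u - v) = X u - X v.
Proof. by rewrite linearmapD linearmapN. Qed.

Lemma linearmap_sum (I : Type) (r : seq I) (P : pred I) (F : I -> V) :
  X (\sum_(i <- r | P i) F i) = \sum_(i <- r | P i) X (F i).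
Proof. exact: (big_morph X linearmapD linearmap0). Qed.

End Linear.

(** The representing vector minimizes the energy [J]. A minimizing sequence is Cauchy by the
    parallelogram identity [par], the first variation [var] at its limit identifies the real parts,
    and the imaginary parts follow by testing on ['i *: u]. *)
Lemma riesz (H : hilbert R) (f : H -> R[i]) :
  (forall a u v, f (a *: u + v) = a * f u + f v) ->
  (exists M : R, forall u, cmod (f u) <= M * hnorm u) ->
  exists w, forall u, f u = ⟨w, u⟩.
Proof.
move=> lf [M0 hM0].
pose M := `|M0|.
have hM u : cmod (f u) <= M * hnorm u.
  by rewrite (le_trans (hM0 u))// ler_wpM2r ?hnorm_ge0// ler_norm.
have f0 : f 0 = 0.
  by have := lf (-1) 0 0; rewrite scaleN1r oppr0 addr0 mulN1r addNr.
have fD u v : f (u + v) = f u + f v by have := lf 1 u v; rewrite scale1r mul1r.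
have fZ a u : f (a *: u) = a * f u by have := lf a u 0; rewrite f0 !addr0.
pose J u := hnorm u ^+ 2 - 2 * complex.Re (f u).
pose S := [set J u | u in [set: H]].
have Jlb u : - M ^+ 2 <= J u.
  rewrite /J; have := le_trans (Re_le_cmod _) (hM u).
  have := sqr_ge0 (hnorm u - M); nra.
have hS : has_inf S.
  split; first by exists (J 0), 0.
  by exists (- M ^+ 2) => _ [u _ <-].
have mJ u : inf S <= J u by apply: ge_inf; [exact: hS.2 | exists u].
have /choice[s hs] : forall n, exists u, J u < inf S + n.+1%:R^-1.
  move=> n; have n0 : (0 : R) < n.+1%:R^-1 by rewrite invr_gt0.
  by have [_ [u _ <-] hu] := inf_adherent n0 hS; exists u.
have half_real (x : R) z : complex.Re (x%:C * z) = x * complex.Re z.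
  by rewrite ReM /= mul0r subr0.
have par u v : hnorm (u - v) ^+ 2 = 2 * J u + 2 * J v - 4 * J ((2^-1 : R)%:C *: (u + v)).
  rewrite /J hnormB_sqr hnormZ cmod_real ger0_norm ?invr_ge0// exprMn hnormD_sqr.
  rewrite fZ fD half_real ReD; by field.
have cau u v d : J u <= inf S + d -> J v <= inf S + d -> hnorm (u - v) ^+ 2 <= 4 * d.
  move=> hu hv; rewrite par; have := mJ ((2^-1 : R)%:C *: (u + v)); lra.
have [|w hw] := @hcauchy_cvg _ _ s.
  move=> e e0; have e2 : 0 < (e / 4) ^+ 2 by rewrite exprn_gt0// divr_gt0.
  have [k hk] := inv_succ_lt e2; exists k => m n km kn.
  have hmn l : (k <= l)%N -> J (s l) <= inf S + (e / 4) ^+ 2.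
    by move=> /hk hl; rewrite (le_trans (ltW (hs l)))// lerD2l ltW.
  have h := cau _ _ _ (hmn _ km) (hmn _ kn).
  apply: (@le_lt_trans _ _ (e / 2)); last by lra.
  apply: hnorm_le_sqr; first lra.
  by apply: (le_trans h); rewrite !exprMn; lra.
have var v (t : R) : 0 <= 2 * t * (complex.Re ⟨w, v⟩ - complex.Re (f v)) + t ^+ 2 * hnorm v ^+ 2.
  apply: ler_eps => e e0.
  pose N := 2 * `|t| * hnorm v + 1.
  have N0 : 0 < N by rewrite /N ltr_wpDl// !mulr_ge0 ?hnorm_ge0.
  have e2 : 0 < e / 2 by rewrite divr_gt0.
  have [k hk] := inv_succ_lt e2; have [k' hk'] := hw _ (divr_gt0 e2 N0).
  pose n := maxn k k'.
  have h1 := mJ (s n + t%:C *: v).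
  have h2 := hs n.
  have h3 : n.+1%:R^-1 < e / 2 by apply: hk; rewrite leq_maxl.
  have h4 : hnorm (s n - w) < e / 2 / N by apply: hk'; rewrite leq_maxr.
  have h5 : J (s n + t%:C *: v) = J (s n) + 2 * t * (complex.Re ⟨s n, v⟩ - complex.Re (f v))
      + t ^+ 2 * hnorm v ^+ 2.
    rewrite /J hnormD_sqr innerZr half_real fD fZ ReD half_real hnormZ cmod_real exprMn.
    by rewrite -[in `|t| ^+ 2]normrX ger0_norm ?sqr_ge0//; ring.
  have h6 : `|2 * t * (complex.Re ⟨s n, v⟩ - complex.Re ⟨w, v⟩)| <= e / 2.
    rewrite -ReN -ReD -innerNl -innerDl normrM normrM (@ger0_norm _ 2)//.
    rewrite (@le_trans _ _ (2 * `|t| * (hnorm (s n - w) * hnorm v)))//.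
      rewrite ler_wpM2l ?mulr_ge0// (le_trans (norm_Re_le _))// inner_le//.
    rewrite (@le_trans _ _ (N * hnorm (s n - w)))//.
      by rewrite [hnorm _ * _]mulrC mulrA ler_wpM2r ?hnorm_ge0// lerDl.
    by rewrite mulrC -ler_pdivlMr// ltW.
  move: h6; rewrite ler_norml => /andP[_ h6].
  move: h1 h2 h3 h5 h6; clear; move: (n.+1%:R^-1) (complex.Re _) (complex.Re _) (complex.Re _) (J _) (J _) (inf S) (hnorm _).
  intros; lra.
have Req v : complex.Re (f v) = complex.Re ⟨w, v⟩.
  apply/eqP; rewrite eq_sym -subr_eq0; set a := _ - _.
  pose b := hnorm v ^+ 2; have b0 : 0 <= b by rewrite sqr_ge0.
  (* For this [t] the quadratic in [var] is negative unless [a = 0]; the shift [b + 1] covers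
     [v = 0]. *)
  have := var v (- a / (b + 1)); rewrite -/a -/b.
  have b1 : 0 < b + 1 by rewrite ltr_wpDl.
  have -> : 2 * (- a / (b + 1)) * a + (- a / (b + 1)) ^+ 2 * b
    = - (a ^+ 2 * ((b + 2) / (b + 1) ^+ 2)) by field; rewrite gt_eqF.
  rewrite oppr_ge0 pmulr_lle0; last by rewrite divr_gt0 ?exprn_gt0// ltr_wpDl.
  by move=> h; rewrite -sqrf_eq0 eq_le h sqr_ge0.
exists w => u; apply: complex_eq; first exact: Req.
have := Req ('i%C *: u).
rewrite fZ innerZr !ReM /= !mul0r !sub0r !mul1r => /oppr_inj //.
Qed.

Lemma hadjP (H1 H2 : hilbert R) (X : H1 -> H2) : bounded_map X ->
  forall u v, ⟨hadj X u, v⟩ = ⟨u, X v⟩.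
Proof.
move=> [lX [M hM]] u v; rewrite /hadj; case: xgetP => [w _ //|hn].
have [|| w hw] := @riesz _ (fun v => ⟨u, X v⟩).
- by move=> a x y; rewrite lX innerDr innerZr.
- exists (hnorm u * M) => x; rewrite (le_trans (inner_le _ _))//.
  by rewrite -mulrA ler_wpM2l ?hnorm_ge0.
by have := hn w; case=> x; rewrite hw.
Qed.

Lemma hadjE (H1 H2 : hilbert R) (X : H1 -> H2) (Y : H2 -> H1) :
  (forall u v, ⟨Y u, v⟩ = ⟨u, X v⟩) -> hadj X = Y.
Proof.
move=> h; apply/funext => u; apply: inner_eq => w.
rewrite -[LHS]inner_conj -[RHS]inner_conj; congr Num.conj.
by rewrite h /hadj; case: xgetP => [z _ //|/(_ (Y u))]; case=> v; rewrite h.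
Qed.

Lemma hadjPr (H1 H2 : hilbert R) (X : H1 -> H2) : bounded_map X ->
  forall u v, ⟨v, hadj X u⟩ = ⟨X v, u⟩.
Proof. by move=> bX u v; rewrite -inner_conj hadjP// inner_conj. Qed.

Lemma linear_of_inner (H1 H2 : hilbert R) (X : H1 -> H2) (Y : H2 -> H1) :
  (forall u v, ⟨Y u, v⟩ = ⟨u, X v⟩) -> linear Y.
Proof.
move=> h a u v; apply: inner_eq => w.
rewrite -[LHS]inner_conj -[RHS]inner_conj; congr Num.conj.
by rewrite !(h, innerDl, innerZl).
Qed.

Lemma hadj_bounded (H1 H2 : hilbert R) (X : H1 -> H2) : bounded_map X ->
  bounded_map (hadj X).
Proof.
move=> bX; split; first exact: linear_of_inner (hadjP bX).
have [M M0 hM] := bounded_map_nneg bX; exists M => u.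
have [->|n0] := eqVneq (hnorm (hadj X u)) 0; first by rewrite mulr_ge0 ?hnorm_ge0.
have n1 : 0 < hnorm (hadj X u) by rewrite lt_neqAle hnorm_ge0 eq_sym n0.
rewrite -(ler_pM2r n1) -expr2 hnorm_sqr hadjP// (le_trans (Re_inner_le _ _))//.
by rewrite mulrAC mulrC ler_wpM2r ?hnorm_ge0.
Qed.

Lemma bounded_map_comp (H1 H2 H3 : hilbert R) (X : H2 -> H3) (Y : H1 -> H2) :
  bounded_map X -> bounded_map Y -> bounded_map (X \o Y).
Proof.
move=> bX bY; split; first by move=> a u v /=; rewrite bY.1 bX.1.
have [M M0 hM] := bounded_map_nneg bX; have [N N0 hN] := bounded_map_nneg bY.
by exists (M * N) => u /=; rewrite (le_trans (hM _))// -mulrA ler_wpM2l.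
Qed.

Lemma bounded_map_lin (H1 H2 : hilbert R) (X Y : H1 -> H2) (a : R[i]) :
  bounded_map X -> bounded_map Y -> bounded_map (fun u => a *: X u + Y u).
Proof.
move=> bX bY; split.
  move=> b u v /=; rewrite bY.1 bX.1 !scalerDr !scalerA addrACA.
  by rewrite [a * b]mulrC.
have [M M0 hM] := bounded_map_nneg bX; have [N N0 hN] := bounded_map_nneg bY.
exists (cmod a * M + N) => u /=; rewrite (le_trans (hnormD _ _))// hnormZ mulrDl lerD//.
by rewrite -mulrA ler_wpM2l ?cmod_ge0.
Qed.

Lemma isometry_bounded (H1 H2 : hilbert R) (X : H1 -> H2) : linear X ->
  (forall u v, ⟨X u, X v⟩ = ⟨u, v⟩) -> bounded_map X.
Proof.
move=> lX h; split=> //; exists 1 => u; rewrite mul1r.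
by apply: hnorm_le_sqr; rewrite ?hnorm_ge0// !hnorm_sqr h.
Qed.

Lemma isometry_hnorm (H1 H2 : hilbert R) (X : H1 -> H2) u :
  (forall u v, ⟨X u, X v⟩ = ⟨u, v⟩) -> hnorm (X u) = hnorm u.
Proof.
by move=> h; apply/eqP; rewrite -(@eqrXn2 _ 2) ?hnorm_ge0// !hnorm_sqr h.
Qed.

Lemma bounded_map_eq (H1 H2 : hilbert R) (I : Type) (x : I -> H1) (X Y : H1 -> H2) :
  hdense (span_of x) -> bounded_map X -> bounded_map Y ->
  (forall i, X (x i) = Y (x i)) -> X = Y.
Proof.
move=> dx bX bY h; apply/funext => u; apply: inner_eq => w.
rewrite -!hadjP//; congr inner; apply: (inner_eq_span dx) => i.
by rewrite -[LHS]inner_conj -[RHS]inner_conj !hadjP// h.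
Qed.

(** [Gr] is the closure of the spanned relation. The bound [hM] makes it single-valued, since a pair
    over 0 has second component 0, and completeness of [H2] together with density puts every vector
    in its domain. *)
Lemma bounded_extension (H1 H2 : hilbert R) (I : Type) (x : I -> H1)
    (y : I -> H2) (M : R) : hdense (span_of x) -> 0 <= M ->
  (forall u v, pair_span x y u v -> hnorm v <= M * hnorm u) ->
  exists2 U : H1 -> H2, bounded_map U & forall i, U (x i) = y i.
Proof.
move=> dx M0 hM.
have hd u v u' v' : pair_span x y u v -> pair_span x y u' v' ->
    hnorm (v - v') <= M * hnorm (u - u').
  by move=> h h'; apply: hM; exact: pair_spanB.
have M1 : 0 < M + 1 by rewrite ltr_wpDl.
pose Gr (u : H1) (v : H2) := forall e : R, 0 < e -> exists u' v',
  [/\ pair_span x y u' v', hnorm (u - u') < e & hnorm (v - v') < e].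
have GrS u v : pair_span x y u v -> Gr u v.
  by move=> h e e0; exists u, v; rewrite !subrr !hnorm0.
have ex u : exists v, Gr u v.
  have /choice[s hs] : forall n, exists p : H1 * H2,
      pair_span x y p.1 p.2 /\ hnorm (u - p.1) < n.+1%:R^-1.
    move=> n; have n0 : (0 : R) < n.+1%:R^-1 by rewrite invr_gt0.
    have [u' su' hu'] := dx u _ n0.
    by have [v' hv'] := span_of_pair y su'; exists (u', v').
  have [|l hl] := @hcauchy_cvg _ _ (fun n => (s n).2).
    move=> e e0; have e2 : 0 < e / 2 / (M + 1) by rewrite !divr_gt0.
    have [k hk] := inv_succ_lt e2.
    exists k => m n km kn; rewrite (le_lt_trans (hd _ _ _ _ (hs m).1 (hs n).1))//.
    have h1 : hnorm ((s m).1 - (s n).1) < e / (M + 1).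
      rewrite (le_lt_trans (hnorm_distD u _ _))// [e]splitr mulrDl ltrD//.
        by rewrite hnorm_distC (lt_trans (hs m).2)// hk.
      by rewrite (lt_trans (hs n).2)// hk.
    rewrite (@le_lt_trans _ _ ((M + 1) * hnorm ((s m).1 - (s n).1)))//.
      by rewrite ler_wpM2r ?hnorm_ge0// lerDl.
    by rewrite mulrC -ltr_pdivlMr.
  exists l => e e0; have [k hk] := inv_succ_lt e0; have [k' hk'] := hl e e0.
  exists (s (maxn k k')).1, (s (maxn k k')).2; split.
  - exact: (hs _).1.
  - by rewrite (lt_trans (hs _).2)// hk// leq_maxl.
  - by rewrite hnorm_distC hk'// leq_maxr.
have GrD a u v u' v' : Gr u v -> Gr u' v' -> Gr (a *: u + u') (a *: v + v').
  move=> h h' e e0; have e2 : 0 < e / 2 by rewrite divr_gt0.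
  have c0 : 0 < cmod a + 1 by rewrite ltr_wpDl ?cmod_ge0.
  have [u1 [v1 [s1 a1 b1]]] := h _ (divr_gt0 e2 c0).
  have [u2 [v2 [s2 a2 b2]]] := h' _ e2.
  have aux (r : R) : 0 <= r -> r < e / 2 / (cmod a + 1) -> cmod a * r <= e / 2.
    move=> r0; rewrite ltr_pdivlMr// mulrDr mulr1 mulrC => /ltW; apply: le_trans.
    by rewrite lerDl.
  exists (a *: u1 + u2), (a *: v1 + v2); split.
  - by apply: pair_spanD => //; exact: pair_spanZ.
  - rewrite opprD addrACA -scalerBr (le_lt_trans (hnormD _ _))//.
    by rewrite [ltRHS]splitr ler_ltD// hnormZ aux ?hnorm_ge0.
  - rewrite opprD addrACA -scalerBr (le_lt_trans (hnormD _ _))//.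
    by rewrite [ltRHS]splitr ler_ltD// hnormZ aux ?hnorm_ge0.
have GrM u v : Gr u v -> hnorm v <= M * hnorm u.
  move=> h; apply: ler_eps => e e0.
  have [u1 [v1 [s1 a1 b1]]] := h _ (divr_gt0 e0 M1).
  have h1 : hnorm v <= hnorm (v - v1) + hnorm v1 by rewrite -{1}(subrK v1 v) hnormD.
  have h2 : hnorm u1 <= hnorm (u - u1) + hnorm u.
    by rewrite hnorm_distC -{1}(subrK u u1) hnormD.
  have h3 := hM _ _ s1; have h4 : M * hnorm u1 <= M * (e / (M + 1) + hnorm u).
    by rewrite ler_wpM2l// (le_trans h2)// lerD2r ltW.
  have -> : M * hnorm u + e = e / (M + 1) + M * (e / (M + 1) + hnorm u).
    by field; rewrite gt_eqF.
  apply: (le_trans h1); apply: lerD; [exact: ltW b1|exact: le_trans h3 h4].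
have Gr1 u v v' : Gr u v -> Gr u v' -> v = v'.
  move=> h h'; have hdd := GrD (-1) _ _ _ _ h h'.
  move: hdd; rewrite !scaleN1r addNr => /GrM; rewrite hnorm0 mulr0 => h0.
  apply/eqP; rewrite eq_sym -subr_eq0 addrC; apply/eqP/hnorm_eq0/eqP.
  by rewrite eq_le h0 hnorm_ge0.
have [U hU] := choice ex.
exists U => [|i]; last exact/(Gr1 (x i))/GrS/pair_span_gen.
split; last by exists M => u; exact: GrM.
by move=> a u v; exact/(Gr1 (a *: u + v))/GrD.
Qed.

Lemma isometric_extension (H1 H2 : hilbert R) (I : Type) (x : I -> H1)
    (y : I -> H2) : hdense (span_of x) ->
  (forall i j, ⟨y i, y j⟩ = ⟨x i, x j⟩) ->
  exists U : H1 -> H2, [/\ linear U, forall u v, ⟨U u, U v⟩ = ⟨u, v⟩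
    & forall i, U (x i) = y i].
Proof.
move=> dx hxy; have [||U bU hU] := @bounded_extension _ _ _ x y 1 dx.
- by [].
- move=> u v h; rewrite mul1r; apply: hnorm_le_sqr; rewrite ?hnorm_ge0//.
  by rewrite !hnorm_sqr (pair_span_inner hxy h h).
exists U; split=> [||//]; first exact: bU.1.
suff h : hadj U \o U = id by move=> u v; rewrite -hadjP// -[hadj U _]/((hadj U \o U) u) h.
apply: (bounded_map_eq dx).
- by apply: bounded_map_comp => //; exact: hadj_bounded.
- by split=> //; exists 1 => u; rewrite mul1r.
- by move=> i; apply: (inner_eq_span dx) => j /=; rewrite hadjPr// !hU.
Qed.

End BoundedMaps.

(** * Positive operators and suprema of directed families *)

Section PositiveOperators.
Variables (R : realType) (H : hilbert R).
Implicit Types (P X Y : H -> H) (D : set (H -> H)).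

(** Positivity at [v + t u] for [t = 1] and [t = i] forces [<u, P v>] to be the conjugate of
    [<v, P u>]. The values [t = - s conj <v, P u>] with [s] real then give a nonnegative real
    quadratic in [s], whose discriminant is the claim. *)
Lemma positive_cauchy_schwarz P : linear P -> (forall u, 0 <= ⟨u, P u⟩) ->
  forall u v, cmod ⟨v, P u⟩ ^+ 2 <= complex.Re ⟨v, P v⟩ * complex.Re ⟨u, P u⟩.
Proof.
move=> lP pP u v.
have pos t : 0 <= ⟨v, P v⟩ + t * ⟨v, P u⟩ + Num.conj t * ⟨u, P v⟩
    + Num.conj t * t * ⟨u, P u⟩.
  suff <- : ⟨v + t *: u, P (v + t *: u)⟩ = ⟨v, P v⟩ + t * ⟨v, P u⟩
    + Num.conj t * ⟨u, P v⟩ + Num.conj t * t * ⟨u, P u⟩ by exact: pP.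
  by rewrite (linearmapD lP) (linearmapZ lP) !innerE; ring.
have := pP u; have := pP v; have h1 := pos 1; have hi := pos 'i%C.
move: h1 hi (pos) => {pos}.
move: ⟨v, P v⟩ ⟨u, P v⟩ ⟨v, P u⟩ ⟨u, P u⟩ => [p p'] [b b'] [a a'] [q q'].
rewrite !complex_ge0 !(ReD, ImD, ReM, ImM, ReJ, ImJ) /=.
move=> /andP[/eqP h1 _] /andP[/eqP hi _] pos /andP[/eqP p0 pp] /andP[/eqP q0 qp].
have {h1} eb' : b' = - a' by lra.
have {hi} eb : b = a by lra.
subst b b' p' q'.
have {}pos (s : R) : 0 <= p - 2 * s * (a ^+ 2 + a' ^+ 2) + s ^+ 2 * (a ^+ 2 + a' ^+ 2) * q.
  have := pos (Complex (- s * a) (s * a')).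
  rewrite complex_ge0 !(ReD, ImD, ReM, ImM, ReJ, ImJ) /= => /andP[_]; nra.
rewrite cmod_sqr /=; set c := a ^+ 2 + a' ^+ 2 in pos *.
have c0 : 0 <= c by rewrite addr_ge0 ?sqr_ge0.
have [q0|q0] := eqVneq q 0.
  rewrite q0 mulr0; have := pos ((p + 1) / 2 / (c + 1)); rewrite q0 mulr0 addr0.
  have c1 : 0 < c + 1 by rewrite ltr_wpDl.
  have -> : p - 2 * ((p + 1) / 2 / (c + 1)) * c = (p - c) / (c + 1).
    by field; rewrite gt_eqF.
  rewrite pmulr_lge0 ?invr_gt0// subr_ge0 => cp.
  have := pos ((p + 1) / c); rewrite q0 mulr0 addr0.
  have [->//|cn] := eqVneq c 0.
  by rewrite -mulrA divfK// => h; exfalso; lra.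
have q1 : 0 < q by rewrite lt_neqAle eq_sym q0.
have := pos q^-1.
have -> : p - 2 * q^-1 * c + q^-1 ^+ 2 * c * q = (p * q - c) / q by field.
by rewrite pmulr_lge0 ?invr_gt0// subr_ge0.
Qed.

Lemma op_leP X Y : op_le X Y <-> forall u, complex.Im ⟨u, X u⟩ = complex.Im ⟨u, Y u⟩
  /\ complex.Re ⟨u, X u⟩ <= complex.Re ⟨u, Y u⟩.
Proof.
split=> h u; have := h u; rewrite innerBr complex_ge0 ImD ReD ImN ReN.
  by move=> /andP[/eqP h1 h2]; split; lra.
by move=> [h1 h2]; apply/andP; split; [apply/eqP|]; lra.
Qed.

(** Cauchy-Schwarz for the form of [P], taken at the pair [u], [P u]. It turns smallness of a
    quadratic form into smallness in norm. *)
Lemma positive_bound P (M : R) : 0 <= M -> linear P -> (forall u, 0 <= ⟨u, P u⟩) ->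
  (forall u, complex.Re ⟨u, P u⟩ <= M * hnorm u ^+ 2) ->
  forall u, hnorm (P u) ^+ 2 <= M * complex.Re ⟨u, P u⟩.
Proof.
move=> M0 lP pP hM u; have h := positive_cauchy_schwarz lP pP u (P u).
have := pP u; rewrite complex_ge0 => /andP[_ q0].
have h2 := hM (P u).
have h3 : hnorm (P u) ^+ 2 * hnorm (P u) ^+ 2 <= hnorm (P u) ^+ 2 * (M * complex.Re ⟨u, P u⟩).
  have -> : hnorm (P u) ^+ 2 * hnorm (P u) ^+ 2 = cmod ⟨P u, P u⟩ ^+ 2.
    by rewrite inner_self cmod_real ger0_norm ?sqr_ge0// expr2.
  by rewrite (le_trans h)// mulrCA mulrA ler_wpM2r// mulrC.
have [->|n0] := eqVneq (hnorm (P u)) 0.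
  by rewrite expr0n /= mulr_ge0.
have n1 : 0 < hnorm (P u) ^+ 2 by rewrite exprn_even_gt0.
by rewrite ler_pM2l in h3.
Qed.

(** A least upper bound is attained by the quadratic forms. Members [s n] whose forms at [u]
    approach their supremum give a Cauchy sequence [s n u], by directedness and [positive_bound]. If
    its limit [l] differed from [X u], subtracting from [X] a multiple of the projection on
    [w = X u - l] would leave an upper bound smaller than [X]. *)
Lemma directed_sup D X : D !=set0 ->
  (forall Y, D Y -> bounded_op Y /\ op_le (fun=> 0) Y) ->
  (forall Y Z, D Y -> D Z -> exists V, [/\ D V, op_le Y V & op_le Z V]) ->
  op_lub D X -> forall u (e : R), 0 < e ->
  exists2 Y, D Y & complex.Re ⟨u, X u - Y u⟩ <= e.
Proof.
move=> [Y0 DY0] bD dD [bX uX lX] u d d0; apply: contrapT => /forall2NP hn.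
have {}hn Y : D Y -> d < complex.Re ⟨u, X u - Y u⟩.
  by move=> DY; case: (hn Y) => // /negP; rewrite -ltNge.
have [M M0 hM] := bounded_map_nneg bX.
have lin Y : D Y -> linear Y by move=> /bD[[]].
have pos Y : D Y -> forall v, 0 <= ⟨v, Y v⟩.
  by move=> /bD[_ h] v; have := h v; rewrite subr0.
have lB Y Z : linear Y -> linear Z -> linear (fun v => Y v - Z v).
  by move=> lY lZ a v w; rewrite lY lZ opprD addrACA scalerBr.
have XM v : complex.Re ⟨v, X v⟩ <= M * hnorm v ^+ 2.
  by rewrite (le_trans (Re_inner_le _ _))// mulrC expr2 mulrA ler_wpM2r ?hnorm_ge0.
have DB Y V : D Y -> D V -> op_le Y V -> forall v,
    hnorm (V v - Y v) ^+ 2 <= M * complex.Re ⟨v, V v - Y v⟩.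
  move=> DY DV YV v.
  apply: (@positive_bound (fun v => V v - Y v)) => //; first exact: lB (lin _ DV) (lin _ DY).
  move=> w; apply: (le_trans _ (XM w)); rewrite innerBr ReD ReN.
  have := (op_leP _ _).1 (uX _ DV) w => -[_ h].
  have := pos _ DY w; rewrite complex_ge0 => /andP[_]; lra.
pose E := [set complex.Re ⟨u, Y u⟩ | Y in D].
have hE : has_sup E.
  split; first by exists (complex.Re ⟨u, Y0 u⟩), Y0.
  exists (complex.Re ⟨u, X u⟩) => _ [Y DY <-].
  by have [_ ] := (op_leP _ _).1 (uX _ DY) u.
have ubE Y : D Y -> complex.Re ⟨u, Y u⟩ <= sup E.
  by move=> DY; apply: ub_le_sup; [exact: hE.2 | exists Y].
have /choice[s hs] : forall n, exists Y, D Y /\ sup E - n.+1%:R^-1 < complex.Re ⟨u, Y u⟩.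
  move=> n; have n0 : (0 : R) < n.+1%:R^-1 by rewrite invr_gt0.
  by have [_ [Y DY <-] hu] := sup_adherent n0 hE; exists Y.
have near_top Y V (e : R) : D Y -> D V -> op_le Y V -> sup E - e <= complex.Re ⟨u, Y u⟩ ->
    hnorm (V u - Y u) ^+ 2 <= M * e.
  move=> DY DV YV h; rewrite (le_trans (DB _ _ DY DV YV u))// ler_wpM2l//.
  rewrite innerBr ReD ReN; have := ubE _ DV; lra.
have small (e : R) : 0 < e -> exists k, forall n, (k <= n)%N ->
    forall Y V, D Y -> D V -> op_le Y V -> sup E - n.+1%:R^-1 <= complex.Re ⟨u, Y u⟩ ->
    hnorm (V u - Y u) < e.
  move=> e0; have M1 : 0 < M + 1 by rewrite ltr_wpDl.
  have e1 : 0 < (e / 2) ^+ 2 / (M + 1) by rewrite divr_gt0// exprn_gt0// divr_gt0.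
  have [k hk] := inv_succ_lt e1; exists k => n /hk kn Y V DY DV YV h.
  apply: (@le_lt_trans _ _ (e / 2)); last by lra.
  apply: hnorm_le_sqr; first lra.
  apply: (le_trans (near_top _ _ _ DY DV YV h)).
  move: kn; rewrite ltr_pdivlMr// => /ltW; apply: le_trans.
  by rewrite mulrC ler_wpM2l ?invr_ge0// lerDl.
have [|l hl] := @hcauchy_cvg _ _ (fun n => s n u).
  move=> e e0; have e2 : 0 < e / 2 by rewrite divr_gt0.
  have [k hk] := small _ e2; exists k => m n km kn.
  have [V [DV mV nV]] := dD _ _ (hs m).1 (hs n).1.
  rewrite (le_lt_trans (hnorm_distD (V u) _ _))// [e]splitr ltrD//.
    by rewrite hnorm_distC; apply: (hk m) => //; [exact: (hs m).1|exact/ltW/(hs m).2].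
  by apply: (hk n) => //; [exact: (hs n).1|exact/ltW/(hs n).2].
pose w := X u - l.
pose A := complex.Re ⟨u, X u⟩.
have A0 : 0 <= A.
  have [_ h] := (op_leP _ _).1 (uX _ DY0) u.
  by have := pos _ DY0 u; rewrite complex_ge0 => /andP[_ /le_trans]; exact.
(* Take a member [V] above both [Y] and a late [s n]. Then [V u] is near [l], and Cauchy-Schwarz for
   [X - V] bounds the rest: its form at [u] is at most [A] because [V] is positive, its form at [v]
   at most that of [X - Y] because [V] is above [Y]. *)
have key Y v : D Y -> cmod ⟨v, w⟩ ^+ 2 <= A * complex.Re ⟨v, X v - Y v⟩.
  move=> DY; set B := A * _.
  have gap Z z : D Z -> 0 <= ⟨z, X z - Z z⟩ by move=> DZ; exact: uX.
  have B0 : 0 <= B.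
    by rewrite mulr_ge0//; have := gap _ v DY; rewrite complex_ge0 => /andP[].
  suff : cmod ⟨v, w⟩ <= Num.sqrt B.
    by move=> h; rewrite -(sqr_sqrtr B0) ler_pXn2r ?nnegrE ?cmod_ge0 ?sqrtr_ge0.
  apply: ler_eps => e e0.
  have v1 : 0 < hnorm v + 1 by rewrite ltr_wpDl ?hnorm_ge0.
  have e2 : 0 < e / (hnorm v + 1) / 2 by rewrite !divr_gt0.
  have [k hk] := small _ e2; have [k' hk'] := hl _ e2.
  pose n := maxn k k'.
  have [V [DV YV nV]] := dD _ _ DY (hs n).1.
  have h1 : hnorm (V u - s n u) < e / (hnorm v + 1) / 2.
    by apply: (hk n) => //; [exact: leq_maxl | exact: (hs n).1 | exact/ltW/(hs n).2].
  have h2 : hnorm (s n u - l) < e / (hnorm v + 1) / 2 by apply: hk'; exact: leq_maxr.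
  have h3 : hnorm (V u - l) <= e / (hnorm v + 1).
    by rewrite (le_trans (hnorm_distD (s n u) _ _))// [leRHS]splitr lerD ?ltW.
  have -> : w = (X u - V u) + (V u - l) by rewrite addrA subrK.
  rewrite innerDr (le_trans (cmodD _ _))// lerD//; last first.
    rewrite (le_trans (inner_le _ _))// (@le_trans _ _ ((hnorm v + 1) * hnorm (V u - l)))//.
      by rewrite ler_wpM2r ?hnorm_ge0// lerDl.
    by rewrite mulrC -ler_pdivlMr.
  rewrite -[leLHS]ger0_norm ?cmod_ge0// -sqrtr_sqr ler_sqrt//.
  have lP := lB _ _ bX.1 (lin _ DV).
  rewrite (le_trans (positive_cauchy_schwarz lP (fun z => gap _ z DV) u v))// mulrC.
  have [_ hYV] := (op_leP _ _).1 YV v.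
  have := gap _ v DV; have := gap _ u DV; have := pos _ DV u.
  rewrite !complex_ge0 !innerBr !ReD !ReN => /andP[_ p1] /andP[_ p2] /andP[_ p3].
  rewrite /B innerBr ReD ReN; apply: ler_pM => //; rewrite /A; lra.
pose a := ((A + 1)^-1)%:C : R[i].
(* A rank-one perturbation that [key] keeps above all of [D]; dividing by [A + 1] instead of [A]
   covers [A = 0]. *)
pose Z v := X v - (a * ⟨w, v⟩) *: w.
have A1 : 0 < A + 1 by rewrite ltr_wpDl.
have ZE v : ⟨v, Z v⟩ = ⟨v, X v⟩ - ((A + 1)^-1 * cmod ⟨v, w⟩ ^+ 2)%:C.
  rewrite /Z innerBr innerZr -(inner_conj v) -mulrA mul_conj_cmod.
  by rewrite /a -rmorphM.
have bZ : bounded_op Z.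
  split=> [b v z|].
    rewrite /Z bX.1 innerDr innerZr mulrDr scalerDl opprD [b *: (X v - _)]scalerBr scalerA.
    by rewrite addrACA mulrCA.
  exists (M + (A + 1)^-1 * hnorm w * hnorm w) => v.
  rewrite (le_trans (hnormB _ _))// mulrDl lerD// hnormZ cmodM cmod_real.
  rewrite ger0_norm ?invr_ge0 ?(ltW A1)// -!mulrA ler_wpM2l ?invr_ge0 ?(ltW A1)//.
  by rewrite mulrC ler_wpM2l ?hnorm_ge0// inner_le.
have XZ : op_le X Z.
  apply: lX => // Y DY v; rewrite innerBr ZE.
  have := uX _ DY v; have := key _ v DY.
  rewrite complex_ge0 innerBr !ReD !ImD !ReN !ImN /= => h1 /andP[/eqP h2 h3].
  rewrite complex_ge0 !ReD !ImD !ReN !ImN /=; apply/andP; split; first by apply/eqP; lra.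
  have h4 : (A + 1)^-1 * cmod ⟨v, w⟩ ^+ 2 <= (A + 1)^-1 * (A * (complex.Re ⟨v, X v⟩ - complex.Re ⟨v, Y v⟩)).
    by rewrite ler_wpM2l// invr_ge0 ltW.
  have h5 : (A + 1)^-1 * (A * (complex.Re ⟨v, X v⟩ - complex.Re ⟨v, Y v⟩))
      <= complex.Re ⟨v, X v⟩ - complex.Re ⟨v, Y v⟩.
    by rewrite mulrA ler_piMl// ler_pdivrMl// mulr1 lerDl.
  lra.
have w0 : hnorm w = 0.
  have := XZ w; rewrite innerBr ZE complex_ge0 !ReD !ReN => /andP[_].
  rewrite addrAC subrr add0r /= oppr_ge0 pmulr_rle0 ?invr_gt0// => h.
  have : cmod ⟨w, w⟩ ^+ 2 == 0 by rewrite eq_le h sqr_ge0.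
  rewrite sqrf_eq0 inner_self cmod_real normr_eq0 sqrf_eq0 => /eqP //.
have [k hk] := hl (d / (hnorm u + 1)) (divr_gt0 d0 (ltr_wpDl (hnorm_ge0 u) ltr01)).
have := hn _ (hs k).1.
have -> : X u - s k u = w + (l - s k u) by rewrite addrA subrK.
rewrite (hnorm_eq0 w0) add0r ltNge => /negP; apply.
rewrite (le_trans (Re_inner_le _ _))// hnorm_distC.
rewrite (@le_trans _ _ ((hnorm u + 1) * hnorm (s k u - l)))//.
  by rewrite ler_wpM2r ?hnorm_ge0// lerDl.
rewrite mulrC -ler_pdivlMr ?ltr_wpDl ?hnorm_ge0//.
by apply/ltW/hk.
Qed.

End PositiveOperators.

(** * Hilbert tensor products and ampliations *)

Section Frames.
Variables (R : realType) (F : hilbert R).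
Implicit Types (es : seq F) (x : F).

Definition orthonormal es := forall i j, (i < size es)%N -> (j < size es)%N ->
  ⟨es`_i, es`_j⟩ = (i == j)%:R.

Definition in_frame es x :=
  exists c : nat -> R[i], x = \sum_(k < size es) c k *: es`_k.

Lemma in_frame_rcons es e x : in_frame es x -> in_frame (rcons es e) x.
Proof.
move=> [c ->]; exists (fun k => if (k < size es)%N then c k else 0).
rewrite size_rcons big_ord_recr /= ltnn scale0r addr0.
by apply: eq_bigr => i _; rewrite nth_rcons ltn_ord.
Qed.

(** Orthonormalizes the finitely many second components of a sum of simple tensors. Over such a
    frame scalar products in the tensor product split into sums of scalar products in the first
    factor, on which [X (x) I] acts componentwise. *)
Lemma gram_schmidt (xs : seq F) :
  exists es, orthonormal es /\ forall x, x \in xs -> in_frame es x.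
Proof.
elim: xs => [|x xs [es [oes hes]]]; first by exists [::].
pose y := x - \sum_(k < size es) ⟨es`_k, x⟩ *: es`_k.
have yo k : (k < size es)%N -> ⟨es`_k, y⟩ = 0.
  move=> ks; rewrite innerBr inner_sumr (bigD1 (Ordinal ks))//= innerZr oes// eqxx mulr1.
  rewrite big1 ?addr0 ?subrr// => i ik; rewrite innerZr oes//.
  suff -> : (k == i :> nat) = false by rewrite mulr0.
  by apply/eqP => ki; move/eqP: ik; apply; apply/val_inj.
have xE : x = \sum_(k < size es) ⟨es`_k, x⟩ *: es`_k + y by rewrite addrC subrK.
have [y0|y0] := eqVneq y 0.
  exists es; split=> // z; rewrite inE => /orP[/eqP->|/hes//].
  by exists (fun k => ⟨es`_k, x⟩); rewrite {1}xE y0 addr0.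
have n0 : hnorm y != 0 by apply: contra_neq y0; exact: hnorm_eq0.
pose e := ((hnorm y)^-1)%:C *: y.
exists (rcons es e); split=> [i j|z].
  rewrite size_rcons ltnS leq_eqVlt ltnS (leq_eqVlt j) !nth_rcons.
  have ee : ⟨e, e⟩ = 1.
    rewrite /e innerZl innerZr conj_real inner_self -!rmorphM /=.
    by apply: complex_eq => //=; field.
  have oe k : (k < size es)%N -> ⟨es`_k, e⟩ = 0 by move=> /yo h; rewrite innerZr h mulr0.
  move=> /orP[/eqP->|ik] /orP[/eqP->|jk].
  - by rewrite ltnn !eqxx ee.
  - by rewrite ltnn jk eqxx -inner_conj oe// rmorph0 eq_sym ltn_eqF.
  - by rewrite ltnn ik eqxx oe// ltn_eqF.
  - by rewrite ik jk oes.
rewrite inE => /orP[/eqP->|/hes h]; last exact: in_frame_rcons.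
exists (fun k => if (k < size es)%N then ⟨es`_k, x⟩ else (hnorm y)%:C).
rewrite size_rcons big_ord_recr /= ltnn nth_rcons ltnn eqxx.
rewrite /e scalerA -rmorphM /= divff// scale1r {1}xE; congr (_ + _).
by apply: eq_bigr => i _; rewrite nth_rcons ltn_ord.
Qed.

End Frames.

Section HilbertTensor.
Variables (R : realType) (H F : hilbert R) (K : hilbert_tensor H F).
Implicit Types (X Y : H -> H).
Local Notation tn := (tensor K).

Definition tpair (p : H * F) : K := tn p.1 p.2.

Lemma tensor_dense : hdense (span_of tpair).
Proof.
by apply: (htotal_span (@tensor_total _ _ _ K)) => _ [u [x ->]]; exists (u, x).
Qed.

Lemma tensor_eq (w w' : K) : (forall u x, ⟨tn u x, w⟩ = ⟨tn u x, w'⟩) -> w = w'.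
Proof. by move=> h; apply: (inner_eq_span tensor_dense) => -[u x]; exact: h. Qed.

Lemma tensorDl u v x : tn (u + v) x = tn u x + tn v x.
Proof. by apply: tensor_eq => w y; rewrite innerDr !tensor_inner innerDr mulrDl. Qed.

Lemma tensorZl a u x : tn (a *: u) x = a *: tn u x.
Proof. by apply: tensor_eq => w y; rewrite innerZr !tensor_inner innerZr mulrA. Qed.

Lemma tensorDr u x y : tn u (x + y) = tn u x + tn u y.
Proof. by apply: tensor_eq => w z; rewrite innerDr !tensor_inner innerDr mulrDr. Qed.

Lemma tensorZr a u x : tn u (a *: x) = a *: tn u x.
Proof. by apply: tensor_eq => w z; rewrite innerZr !tensor_inner innerZr mulrCA. Qed.

Lemma tensorBl u v x : tn (u - v) x = tn u x - tn v x.
Proof. by rewrite -scaleN1r tensorDl tensorZl scaleN1r. Qed.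

Lemma tensorBr u x y : tn u (x - y) = tn u x - tn u y.
Proof. by rewrite -scaleN1r tensorDr tensorZr scaleN1r. Qed.

Lemma tensor0l x : tn 0 x = 0.
Proof. by rewrite -(scale0r 0) tensorZl scale0r. Qed.

Lemma tensor0r u : tn u 0 = 0.
Proof. by rewrite -(scale0r 0) tensorZr scale0r. Qed.

Lemma tensor_sumr (I : Type) (r : seq I) (P : pred I) (f : I -> F) u :
  tn u (\sum_(i <- r | P i) f i) = \sum_(i <- r | P i) tn u (f i).
Proof. exact: (big_morph (tn u) (tensorDr u) (tensor0r u)). Qed.

Lemma hnorm_tensor u x : hnorm (tn u x) = hnorm u * hnorm x.
Proof.
apply/eqP; rewrite -(@eqrXn2 _ 2) ?mulr_ge0 ?hnorm_ge0// hnorm_sqr tensor_inner.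
by rewrite !inner_self -rmorphM exprMn.
Qed.

Definition frame_sum es (u : nat -> H) : K := \sum_(k < size es) tn (u k) es`_k.

Lemma frame_inner es u v : orthonormal es ->
  ⟨frame_sum es u, frame_sum es v⟩ = \sum_(k < size es) ⟨u k, v k⟩.
Proof.
move=> oes; rewrite inner_suml; apply: eq_bigr => i _.
rewrite inner_sumr (bigD1 i)//= tensor_inner oes// eqxx mulr1.
rewrite big1 ?addr0// => j ji; rewrite tensor_inner oes//.
by rewrite eq_sym; move/negPf: ji; rewrite -val_eqE /= => ->; rewrite mulr0.
Qed.

Lemma pair_span_frame X w v : linear X ->
  pair_span tpair (fun p => tn (X p.1) p.2) w v ->
  exists xs : seq F, forall es, (forall x, x \in xs -> in_frame es x) ->
    exists u : nat -> H, w = frame_sum es u /\ v = frame_sum es (fun k => X (u k)).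
Proof.
move=> lX; elim=> [|a [u0 x0] w1 v1 _ [xs IH]].
  exists [::] => es _; exists (fun=> 0); rewrite (linearmap0 lX).
  by split; rewrite /frame_sum big1// => i _; rewrite tensor0l.
exists (x0 :: xs) => es hes.
have [|u [-> ->]] := IH es; first by move=> x xx; apply: hes; rewrite inE xx orbT.
have [|c ->] := hes x0; first by rewrite inE eqxx.
exists (fun k => (a * c k) *: u0 + u k); rewrite /tpair /= !tensor_sumr !scaler_sumr.
by split; rewrite -big_split; apply: eq_bigr => i _;
  rewrite /= ?lX tensorDl tensorZl tensorZr scalerA.
Qed.

Lemma frame_approx n (w : 'I_n -> K) (e : R) : 0 < e ->
  exists es (u : 'I_n -> nat -> H), orthonormal es /\
    forall i, hnorm (w i - frame_sum es (u i)) < e.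
Proof.
move=> e0.
have /choice[xs hxs] : forall i : 'I_n, exists xs : seq F, forall es,
    (forall x, x \in xs -> in_frame es x) ->
    exists u : nat -> H, hnorm (w i - frame_sum es u) < e.
  move=> i; have [w' sw' hw'] := tensor_dense (w i) e0.
  have [v' sv'] := span_of_pair (fun p => tn (id p.1) p.2) sw'.
  have [//|xs hxs] := pair_span_frame (X := id) _ sv'.
  by exists xs => es /hxs[u [ew _]]; exists u; rewrite -ew.
have [es [oes hes]] := gram_schmidt (flatten [seq xs i | i <- enum 'I_n]).
have /choice[u hu] : forall i, exists u, hnorm (w i - frame_sum es u) < e.
  move=> i; apply: hxs => x xx; apply: hes; apply/flattenP; exists (xs i) => //.
  by apply: map_f; rewrite mem_enum.
by exists es, u.
Qed.

(** Over an orthonormal frame the squared norm is a sum over components, so the bound of [X] holds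
    unchanged on the span of simple tensors; this gives both well-definedness and extension. *)
Lemma ampliation_exists X : bounded_op X -> exists2 Y : K -> K,
  bounded_op Y & forall u x, Y (tn u x) = tn (X u) x.
Proof.
move=> bX; have [M M0 hM] := bounded_map_nneg bX.
have [|Y bY hY] := bounded_extension (y := fun p => tn (X p.1) p.2) tensor_dense M0.
  move=> w v /(pair_span_frame bX.1)[xs hxs].
  have [es [oes hes]] := gram_schmidt xs; have [u [-> ->]] := hxs _ hes.
  apply: hnorm_le_sqr; first by rewrite mulr_ge0 ?hnorm_ge0.
  rewrite exprMn !hnorm_sqr !frame_inner// !(big_morph _ (@ReD R) (erefl : complex.Re 0 = 0)).
  rewrite mulr_sumr; apply: ler_sum => i _; rewrite -!hnorm_sqr -exprMn.
  by rewrite ler_pXn2r ?nnegrE ?hnorm_ge0 ?mulr_ge0 ?hnorm_ge0.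
by exists Y => // u x; exact: (hY (u, x)).
Qed.

Local Notation ampl := (@ampliation R H F K).

Lemma ampliationP X : bounded_op X ->
  bounded_op (ampl X) /\ forall u x, ampl X (tn u x) = tn (X u) x.
Proof.
move=> /ampliation_exists[Y bY hY]; rewrite /ampliation.
by case: xgetP => [Z _ //|/(_ Y)]; case.
Qed.

Lemma ampliation_bounded X : bounded_op X -> bounded_op (ampl X).
Proof. by case/ampliationP. Qed.

Lemma ampliationE X u x : bounded_op X -> ampl X (tn u x) = tn (X u) x.
Proof. by case/ampliationP. Qed.

Lemma ampliation_unique X (Y : K -> K) : bounded_op X -> bounded_op Y ->
  (forall u x, Y (tn u x) = tn (X u) x) -> ampl X = Y.
Proof.
move=> bX bY hY; apply: (bounded_map_eq tensor_dense) => //.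
  exact: ampliation_bounded.
by move=> [u x] /=; rewrite /tpair /= ampliationE// hY.
Qed.

Lemma bounded_op_id (H' : hilbert R) : bounded_op (id : H' -> H').
Proof. by split=> //; exists 1 => u; rewrite mul1r. Qed.

Lemma ampliation_id : ampl id = id.
Proof. by apply: ampliation_unique => //; exact: bounded_op_id. Qed.

Lemma ampliation_lin a X Y : bounded_op X -> bounded_op Y ->
  ampl (fun u => a *: X u + Y u) = (fun w => a *: ampl X w + ampl Y w).
Proof.
move=> bX bY; apply: ampliation_unique.
- exact: bounded_map_lin.
- by apply: bounded_map_lin; exact: ampliation_bounded.
- by move=> u x; rewrite !ampliationE// tensorDl tensorZl.
Qed.

Lemma ampliation_comp X Y : bounded_op X -> bounded_op Y ->
  ampl (X \o Y) = ampl X \o ampl Y.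
Proof.
move=> bX bY; apply: ampliation_unique.
- exact: bounded_map_comp.
- by apply: bounded_map_comp; exact: ampliation_bounded.
- by move=> u x; rewrite /= !ampliationE.
Qed.

Lemma op_adjoint_bounded (H' : hilbert R) (X : H' -> H') :
  bounded_op X -> bounded_op (op_adjoint X).
Proof. exact: hadj_bounded. Qed.

Lemma ampliation_adjoint X : bounded_op X ->
  ampl (op_adjoint X) = op_adjoint (ampl X).
Proof.
move=> bX; apply: ampliation_unique.
- exact: op_adjoint_bounded.
- exact/op_adjoint_bounded/ampliation_bounded.
- move=> u x; apply: tensor_eq => v y.
  rewrite hadjPr ?ampliationE//; last exact: ampliation_bounded.
  by rewrite !tensor_inner hadjPr.
Qed.

Lemma ampliation_frame X es u : bounded_op X ->
  ampl X (frame_sum es u) = frame_sum es (fun k => X (u k)).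
Proof.
move=> bX; rewrite /frame_sum (linearmap_sum (ampliation_bounded bX).1).
by apply: eq_bigr => i _; rewrite ampliationE.
Qed.

(** If all [w i] are written over one common frame, the double sum is a sum over the frame of
    instances of the hypothesis. General vectors are approximated, nonnegative numbers being a
    closed set. *)
Lemma ampliation_positive n (X : 'I_n -> 'I_n -> H -> H) :
  (forall i j, bounded_op (X i j)) ->
  (forall u : 'I_n -> H, 0 <= \sum_i \sum_j ⟨u i, X i j (u j)⟩) ->
  forall w : 'I_n -> K, 0 <= \sum_i \sum_j ⟨w i, ampl (X i j) (w j)⟩.
Proof.
move=> bX pX w; apply: complex_ge0_closed => e e0.
have bA i j := ampliation_bounded (bX i j).
have /choice[M' hM'] : forall p : 'I_n * 'I_n, exists M : R, 0 <= M /\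
    forall z, hnorm (ampl (X p.1 p.2) z) <= M * hnorm z.
  by move=> p; have [M ? ?] := bounded_map_nneg (bA p.1 p.2); exists M.
pose B := \sum_i \sum_j M' (i, j) * (hnorm (w i) + hnorm (w j) + 1).
have B0 : 0 <= B.
  by do 2 (apply: sumr_ge0 => ? _); rewrite mulr_ge0 ?(hM' _).1// !addr_ge0 ?hnorm_ge0.
have B1 : 0 < B + 1 by rewrite ltr_wpDl.
pose d := Num.min 1 (e / (B + 1)).
have d0 : 0 < d by rewrite lt_min ltr01 divr_gt0.
have [es [u [oes hu]]] := frame_approx w d0.
pose w' i := frame_sum es (u i).
exists (\sum_i \sum_j ⟨w' i, ampl (X i j) (w' j)⟩).
  under eq_bigr => i _ do under eq_bigr => j _ do rewrite ampliation_frame// frame_inner//.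
  under eq_bigr => i _ do rewrite exchange_big.
  by rewrite exchange_big; apply: sumr_ge0 => k _; exact: pX.
rewrite cmod_distC -sumrB (le_trans (cmod_sum _ _ _))//.
apply: (@le_trans _ _ (d * B)); last first.
  apply: (@le_trans _ _ (d * (B + 1))); first by rewrite ler_pM2l// lerDl.
  by rewrite -ler_pdivlMr// ge_min lexx orbT.
rewrite /B mulr_sumr; apply: ler_sum => i _.
rewrite -sumrB (le_trans (cmod_sum _ _ _))// mulr_sumr; apply: ler_sum => j _.
rewrite (le_trans (inner_diff _ _ _ _))//.
have [m0 hm] := hM' (i, j); move: hm => /= hm.
rewrite -(linearmapB (bA i j).1).
have h1 : hnorm (w' i) <= hnorm (w i) + 1.
  rewrite -[w' i](subKr (w i)) (le_trans (hnormB _ _))// lerD2l (le_trans (ltW (hu i)))//.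
  by rewrite ge_min lexx.
have h2 : hnorm (w i - w' i) <= d by exact/ltW/hu.
have h3 : hnorm (w j - w' j) <= d by exact/ltW/hu.
have -> : d * (M' (i, j) * (hnorm (w i) + hnorm (w j) + 1)) =
  d * (M' (i, j) * hnorm (w j)) + (hnorm (w i) + 1) * (M' (i, j) * d) by ring.
rewrite lerD// ler_pM ?hnorm_ge0//.
by rewrite (le_trans (hm _))// ler_wpM2l.
Qed.

(** Normality of [X |-> X (x) I]. Over a frame the gap is a finite sum of gaps in [H]:
    [directed_sup] makes each one small and directedness finds one [Y] for all. Replacing [w] by a
    frame vector is harmless because the forms [p Y] are bounded by [N] uniformly in [Y]. *)
Lemma ampliation_sup (D : set (H -> H)) X : D !=set0 ->
  (forall Y, D Y -> bounded_op Y /\ op_le (fun=> 0) Y) ->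
  (forall Y Z, D Y -> D Z -> exists V, [/\ D V, op_le Y V & op_le Z V]) ->
  op_lub D X -> forall (w : K) (e : R), 0 < e ->
  exists2 Y, D Y & complex.Re ⟨w, ampl X w - ampl Y w⟩ <= e.
Proof.
move=> D0 bD dD lubX w e e0; have [bX uX lX] := lubX.
have [N N0 hN] := bounded_map_nneg (ampliation_bounded bX).
have amplB Y : bounded_op Y -> forall z,
    ampl X z - ampl Y z = ampl (fun u => (-1) *: Y u + X u) z.
  by move=> bY z; rewrite ampliation_lin// scaleN1r addrC.
have posZ Z : bounded_op Z -> (forall u, 0 <= ⟨u, Z u⟩) -> forall z : K, 0 <= ⟨z, ampl Z z⟩.
  move=> bZ pZ z; have := @ampliation_positive 1 (fun _ _ => Z) (fun _ _ => bZ).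
  move=> /(_ _ (fun=> z)); rewrite !big_ord1; apply.
  by move=> u; rewrite !big_ord1.
have bZ Y : D Y -> bounded_op (fun u => (-1) *: Y u + X u).
  by move=> /bD[bY _]; exact: bounded_map_lin.
pose p Y (z : K) := complex.Re ⟨z, ampl X z - ampl Y z⟩.
have p0 Y z : D Y -> 0 <= p Y z.
  move=> DY; have [bY _] := bD _ DY.
  have := posZ _ (bZ _ DY) _ z; rewrite -amplB// complex_ge0 => h.
  suff /h/andP[] : forall u : H, 0 <= ⟨u, -1 *: Y u + X u⟩ by [].
  by move=> u; rewrite scaleN1r addrC; exact: uX.
have pN Y z : D Y -> p Y z <= N * hnorm z ^+ 2.
  move=> DY; have [bY pY] := bD _ DY.
  rewrite /p innerBr ReD ReN.
  have := posZ _ bY _ z; rewrite complex_ge0 => h.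
  have /h/andP[_ h1] : forall u : H, 0 <= ⟨u, Y u⟩.
    by move=> u; have := pY u; rewrite subr0.
  have h2 : complex.Re ⟨z, ampl X z⟩ <= N * hnorm z ^+ 2.
    by rewrite (le_trans (Re_inner_le _ _))// mulrC expr2 mulrA ler_wpM2r ?hnorm_ge0.
  lra.
have p2 Y y z : D Y -> p Y (y + z) <= 2 * p Y y + 2 * p Y z.
  move=> DY; have [bY _] := bD _ DY.
  have lp : linear (fun z => ampl X z - ampl Y z).
    by move=> a u v; rewrite !(ampliation_bounded _).1// opprD addrACA scalerBr.
  suff : p Y (y + z) + p Y (y - z) = 2 * p Y y + 2 * p Y z.
    by have := p0 Y (y - z) DY; lra.
  rewrite /p (linearmapD lp) (linearmapB lp).
  move: (ampl X y - ampl Y y) (ampl X z - ampl Y z) => a b.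
  by rewrite !innerE !(ReD, ReN); ring.
have N1 : 0 < N + 1 by rewrite ltr_wpDl.
pose d := Num.min 1 (e / 4 / (N + 1)).
have d0 : 0 < d by rewrite lt_min ltr01 !divr_gt0.
have [es [u [oes hu]]] := frame_approx (fun _ : 'I_1 => w) d0.
have {}hu := hu ord0; pose w' := frame_sum es (u ord0); pose v := u ord0.
suff [Y DY hY] : exists2 Y, D Y & p Y w' <= e / 4.
  exists Y => //; rewrite -/(p Y w) -(subrK w' w) (le_trans (p2 _ _ _ DY))//.
  have h1 : p Y (w - w') <= e / 4.
    rewrite (le_trans (pN _ _ DY))// (@le_trans _ _ ((N + 1) * d))//.
      rewrite ler_pM ?sqr_ge0 ?lerDl// (@le_trans _ _ (d ^+ 2))//.
        by rewrite ler_pXn2r ?nnegrE ?hnorm_ge0 ?(ltW d0)// ltW.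
      by rewrite expr2 ler_piMr ?(ltW d0)// ge_min lexx.
    by rewrite mulrC -ler_pdivlMr// ge_min lexx orbT.
  lra.
have pE Y : D Y -> p Y w' = \sum_(k < size es) complex.Re ⟨v k, X (v k) - Y (v k)⟩.
  move=> DY; have [bY _] := bD _ DY.
  rewrite /p /w' innerBr !ampliation_frame// !frame_inner// -sumrB.
  by rewrite (big_morph _ (@ReD R) (erefl : complex.Re 0 = 0));
    apply: eq_bigr => i _; rewrite innerBr.
have s1 : 0 < (size es).+1%:R :> R by [].
have e1 : 0 < e / 4 / (size es).+1%:R by rewrite !divr_gt0.
pose d' := e / 4 / (size es).+1%:R.
have [Y DY hY] : exists2 Y, D Y & forall k, (k < size es)%N ->
    complex.Re ⟨v k, X (v k) - Y (v k)⟩ <= d'.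
  elim: (size es) => [|m [Y DY hY]]; first by have [Y DY] := D0; exists Y.
  have [Y' DY' hY'] := directed_sup D0 bD dD lubX (v m) e1.
  have [V [DV YV Y'V]] := dD _ _ DY DY'.
  have mono A B z : op_le A B -> complex.Re ⟨z, X z - B z⟩ <= complex.Re ⟨z, X z - A z⟩.
    by move=> /op_leP/(_ z)[_]; rewrite !innerBr !ReD !ReN; lra.
  exists V => // k; rewrite ltnS leq_eqVlt => /orP[/eqP->|/hY].
    by apply: le_trans hY'; exact: mono.
  by apply: le_trans; exact: mono.
exists Y => //; rewrite pE//.
apply: (@le_trans _ _ (\sum_(k < size es) e / 4 / (size es).+1%:R)).
  by apply: ler_sum => i _; exact: hY.
have q0 : 0 <= e / 4 by lra.
rewrite sumr_const card_ord -[_ *+ size es]mulr_natr; move: (e / 4) q0 => q q0.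
rewrite -mulrA ler_piMr// mulrC.
by rewrite ler_pdivrMr// mul1r ler_nat.
Qed.

End HilbertTensor.

(** * Complex integrals and the exponential *)

Lemma poly2_ge0_discr (R : realType) (a b c : R) : 0 <= c ->
  (forall x, 0 <= a - 2 * x * b + x ^+ 2 * c) -> b ^+ 2 <= a * c.
Proof.
move=> c0 h; have [c0'|cn] := eqVneq c 0.
  rewrite c0' mulr0; have [->|bn] := eqVneq b 0; first by rewrite expr0n.
  have := h ((a + 1) / b); rewrite c0' mulr0 addr0 -!mulrA mulVf// mulr1.
  have := h 0; rewrite c0' !(mulr0, mul0r) subr0 addr0 => a0 hh; exfalso; lra.
have c1 : 0 < c by rewrite lt_neqAle eq_sym cn.
have := h (b / c).
have -> : a - 2 * (b / c) * b + (b / c) ^+ 2 * c = (a * c - b ^+ 2) / c by field.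
by rewrite pmulr_lge0 ?invr_gt0// subr_ge0.
Qed.

Section ComplexIntegration.
Variable R : realType.
Local Notation mu := (@lebesgue_measure R).
Local Notation TR := (measurableTypeR R).
Implicit Types (D E : set TR) (a b : TR -> R) (f g : TR -> R[i]).

Definition cmeas D f := measurable_fun D (fun s => complex.Re (f s)) /\
  measurable_fun D (fun s => complex.Im (f s)).

Definition rintegrable D a := mu.-integrable D (EFin \o a).

Lemma rintegrable_measurable D a : rintegrable D a -> measurable_fun D a.
Proof. by move=> /measurable_int /measurable_EFinP. Qed.

Lemma rintegrable_le D a b : measurable D -> measurable_fun D a ->
  (forall s, D s -> `|a s| <= b s) -> rintegrable D b -> rintegrable D a.
Proof.
move=> mD ma h ib; apply: (@le_integrable _ _ _ mu D mD (EFin \o a) (EFin \o b)) => //.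
  exact/measurable_EFinP.
by move=> s Ds /=; rewrite lee_fin (le_trans (h s Ds))// ler_norm.
Qed.

Lemma rintegrable_eq D (F : TR -> \bar R) a : (forall s, F s = (a s)%:E) ->
  mu.-integrable D F -> rintegrable D a.
Proof. by move=> Fa; rewrite /rintegrable (_ : EFin \o a = F)//; apply/funext => s /=. Qed.

Lemma rintegrableD D a b : measurable D -> rintegrable D a -> rintegrable D b ->
  rintegrable D (fun s => a s + b s).
Proof. by move=> mD ia ib; apply: (rintegrable_eq _ (integrableD mD ia ib)). Qed.

Lemma rintegrableZ D (c : R) a : measurable D -> rintegrable D a ->
  rintegrable D (fun s => c * a s).
Proof. by move=> mD ia; apply: (rintegrable_eq _ (integrableZl mD c ia)). Qed.

Lemma rintegrableN D a : measurable D -> rintegrable D a ->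
  rintegrable D (fun s => - a s).
Proof. by move=> mD ia; apply: (rintegrable_eq _ (integrableN ia)). Qed.

Lemma eq_rintegrable D a b : measurable D -> {in D, a =1 b} -> rintegrable D a ->
  rintegrable D b.
Proof. by move=> mD ab; apply: eq_integrable => // s sD; rewrite /= ab. Qed.

Lemma rintegrableS D E a : measurable D -> measurable E -> E `<=` D ->
  rintegrable D a -> rintegrable E a.
Proof. exact: integrableS. Qed.

Lemma measure_itv (s t : R) : s <= t -> mu (`[s, t] : set TR) = (t - s)%:E.
Proof.
move=> st; have -> := @lebesgue_measure_itv R `[s, t]; rewrite /= lte_fin EFinB.
by move: st; rewrite le_eqVlt => /orP[/eqP->|->]//; rewrite ltxx -EFinB subrr.
Qed.

Lemma rintegrable_cst (s t c : R) : rintegrable `[s, t] (fun=> c).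
Proof.
apply: measurable_bounded_integrable => //.
  suff : (mu (`[s, t] : set TR) < +oo)%E by [].
  case: (leP s t) => [st|ts]; first by rewrite measure_itv// ltry.
  by rewrite (_ : `[s, t]%classic = set0) ?measure0 ?ltry// set_itv_ge// -leNgt ltW.
by exists `|c|; split; [rewrite num_real | move=> x xc y _ /=; exact: ltW].
Qed.

Lemma Rintegral_cst_itv (s t c : R) : s <= t -> \int[mu]_(x in `[s, t]) c = c * (t - s).
Proof.
move=> st; rewrite Rintegral_cst//; congr (_ * _).
by have h := measure_itv st; transitivity (fine (t - s)%:E); [rewrite -h|].
Qed.

Lemma rintegral_cauchy_schwarz D a b : measurable D ->
  measurable_fun D a -> measurable_fun D b ->
  rintegrable D (fun s => a s ^+ 2) -> rintegrable D (fun s => b s ^+ 2) ->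
  rintegrable D (fun s => a s * b s) /\
  (\int[mu]_(s in D) (a s * b s)) ^+ 2 <=
  (\int[mu]_(s in D) (a s ^+ 2)) * (\int[mu]_(s in D) (b s ^+ 2)).
Proof.
move=> mD ma mb ia ib.
have iab : rintegrable D (fun s => a s * b s).
  apply: (rintegrable_le mD _ _ (rintegrableD mD ia ib)); first exact: measurable_funM.
  move=> s _; rewrite ler_norml; apply/andP; split.
    by have := sqr_ge0 (a s + b s); nra.
  by have := sqr_ge0 (a s - b s); nra.
split=> //; apply: poly2_ge0_discr; first by apply: Rintegral_ge0 => s _; exact: sqr_ge0.
move=> x.
have -> : \int[mu]_(s in D) (a s ^+ 2) - 2 * x * (\int[mu]_(s in D) (a s * b s)) +
    x ^+ 2 * \int[mu]_(s in D) (b s ^+ 2) =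
    \int[mu]_(s in D) ((a s - x * b s) ^+ 2); last first.
  by apply: Rintegral_ge0 => s _; exact: sqr_ge0.
rewrite -RintegralZl// -RintegralZl// -RintegralB//; last first.
  exact: rintegrableZ.
rewrite -RintegralD//; last first.
- exact: rintegrableZ.
- by apply: (@rintegrableD _ _ (fun s => - (2 * x * (a s * b s)))) => //;
    apply: rintegrableN => //; exact: rintegrableZ.
by apply: eq_Rintegral => s _; ring.
Qed.

Definition cintegrable D f := rintegrable D (fun s => complex.Re (f s)) /\
  rintegrable D (fun s => complex.Im (f s)).

Definition square_integrable D f :=
  cmeas D f /\ rintegrable D (fun s => cmod (f s) ^+ 2).

Lemma cmeasurableD D f g : cmeas D f -> cmeas D g ->
  cmeas D (fun s => f s + g s).
Proof.
move=> [? ?] [? ?]; split.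
  by under eq_fun do rewrite ReD; exact: measurable_funD.
by under eq_fun do rewrite ImD; exact: measurable_funD.
Qed.

Lemma cmeasurableN D f : cmeas D f -> cmeas D (fun s => - f s).
Proof.
move=> [? ?]; split.
  by under eq_fun do rewrite ReN; exact: measurable_funN.
by under eq_fun do rewrite ImN; exact: measurable_funN.
Qed.

Lemma cmeasurableM D f g : cmeas D f -> cmeas D g ->
  cmeas D (fun s => f s * g s).
Proof.
move=> [? ?] [? ?]; split.
  by under eq_fun do rewrite ReM; apply: measurable_funB; exact: measurable_funM.
by under eq_fun do rewrite ImM; apply: measurable_funD; exact: measurable_funM.
Qed.

Lemma cmeasurableJ D f : cmeas D f ->
  cmeas D (fun s => Num.conj (f s)).
Proof.
move=> [? ?]; split.
  by under eq_fun do rewrite ReJ.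
by under eq_fun do rewrite ImJ; exact: measurable_funN.
Qed.

Lemma cmeasurable_cst D z : cmeas D (fun=> z).
Proof. by split; exact: measurable_cst. Qed.

Lemma measurable_cmod D f : cmeas D f -> measurable_fun D (fun s => cmod (f s)).
Proof.
move=> [mr mi]; rewrite (_ : (fun _ => _) =
  Num.sqrt \o (fun s => complex.Re (f s) ^+ 2 + complex.Im (f s) ^+ 2)); last first.
  by apply/funext => s; rewrite /cmod normc_def.
apply: measurableT_comp; first by apply: continuous_measurable_fun; exact: sqrt_continuous.
by apply: measurable_funD; exact: measurable_funX.
Qed.

Lemma cintegrable_le D f b : measurable D -> cmeas D f ->
  (forall s, D s -> cmod (f s) <= b s) -> rintegrable D b -> cintegrable D f.
Proof.
move=> mD [mr mi] h ib; split; apply: rintegrable_le ib => // s Ds.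
  exact: le_trans (norm_Re_le _) (h s Ds).
exact: le_trans (norm_Im_le _) (h s Ds).
Qed.

Lemma cintegrableD D f g : measurable D -> cintegrable D f -> cintegrable D g ->
  cintegrable D (fun s => f s + g s).
Proof.
move=> mD [? ?] [? ?]; split.
  by under eq_fun do rewrite ReD; exact: rintegrableD.
by under eq_fun do rewrite ImD; exact: rintegrableD.
Qed.

Lemma cintegrableZ D z f : measurable D -> cintegrable D f ->
  cintegrable D (fun s => z * f s).
Proof.
move=> mD [? ?]; split.
  by under eq_fun do rewrite ReM -mulNr; apply: rintegrableD => //; exact: rintegrableZ.
by under eq_fun do rewrite ImM; apply: rintegrableD => //; exact: rintegrableZ.
Qed.

Lemma cintegrableN D f : measurable D -> cintegrable D f ->
  cintegrable D (fun s => - f s).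
Proof.
move=> mD cf; under eq_fun do rewrite -mulN1r; exact: cintegrableZ.
Qed.

Lemma cintegrableS D E f : measurable D -> measurable E -> E `<=` D ->
  cintegrable D f -> cintegrable E f.
Proof. by move=> mD mE ED [? ?]; split; exact: rintegrableS ED _. Qed.

Lemma cintegrable_sum D (I : Type) (r : seq I) (F : I -> TR -> R[i]) : measurable D ->
  (forall i, cintegrable D (F i)) -> cintegrable D (fun s => \sum_(i <- r) F i s).
Proof.
move=> mD h; elim: r => [|i r IH].
  under eq_fun do rewrite big_nil; split; exact: (rintegrable_eq _ (integrable0 _ _)).
by under eq_fun do rewrite big_cons; exact: cintegrableD.
Qed.

Lemma cintegralD D f g : measurable D -> cintegrable D f -> cintegrable D g ->
  cintegral D (fun s => f s + g s) = cintegral D f + cintegral D g.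
Proof.
move=> mD [? ?] [? ?]; apply: complex_eq; rewrite /cintegral /=.
  by under eq_Rintegral do rewrite ReD; rewrite RintegralD.
by under eq_Rintegral do rewrite ImD; rewrite RintegralD.
Qed.

Lemma cintegralZ D z f : measurable D -> cintegrable D f ->
  cintegral D (fun s => z * f s) = z * cintegral D f.
Proof.
move=> mD [? ?]; apply: complex_eq; rewrite ?ReM ?ImM /cintegral /=.
  under eq_Rintegral do rewrite ReM.
  by rewrite RintegralB ?RintegralZl//; exact: rintegrableZ.
under eq_Rintegral do rewrite ImM.
by rewrite RintegralD ?RintegralZl//; exact: rintegrableZ.
Qed.

Lemma cintegralN D f : measurable D -> cintegrable D f ->
  cintegral D (fun s => - f s) = - cintegral D f.
Proof.
move=> mD cf; rewrite -[RHS]mulN1r -cintegralZ//; congr (cintegral D _).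
by apply/funext => s; rewrite mulN1r.
Qed.

Lemma cintegralB D f g : measurable D -> cintegrable D f -> cintegrable D g ->
  cintegral D (fun s => f s - g s) = cintegral D f - cintegral D g.
Proof. by move=> mD cf cg; rewrite cintegralD ?cintegralN//; exact: cintegrableN. Qed.

Lemma cintegralJ D f : measurable D -> cintegrable D f ->
  cintegral D (fun s => Num.conj (f s)) = Num.conj (cintegral D f).
Proof.
move=> mD [? ?]; apply: complex_eq; rewrite ?ReJ ?ImJ /cintegral /=.
  by apply: eq_Rintegral => s _; rewrite ReJ.
rewrite -mulN1r -RintegralZl//.
by apply: eq_Rintegral => s _; rewrite ImJ mulN1r.
Qed.

Lemma eq_cintegral D f g : {in D, f =1 g} -> cintegral D f = cintegral D g.
Proof.
by move=> fg; rewrite /cintegral; congr (_ +i* _); apply: eq_Rintegral => s sD; rewrite fg.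
Qed.

(** Real and imaginary parts are bounded separately, whence the factor 2. *)
Lemma cintegral_le D f b : measurable D -> cintegrable D f ->
  (forall s, D s -> cmod (f s) <= b s) -> rintegrable D b ->
  cmod (cintegral D f) <= 2 * \int[mu]_(s in D) b s.
Proof.
move=> mD [? ?] h ib; rewrite (le_trans (cmod_le_ReIm _))//= mulr_natl mulr2n.
have key (a : TR -> R) : rintegrable D a -> (forall s, D s -> `|a s| <= b s) ->
    `|\int[mu]_(s in D) a s| <= \int[mu]_(s in D) b s.
  move=> ia hab; rewrite (le_trans (le_normr_Rintegral _ _))//.
  apply: le_Rintegral => //.
  by apply: (rintegrable_eq _ (integrable_abse ia)).
rewrite lerD// key// => s Ds.
  exact: le_trans (norm_Re_le _) (h s Ds).
exact: le_trans (norm_Im_le _) (h s Ds).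
Qed.

Lemma cintegral_sum D (I : Type) (r : seq I) (F : I -> TR -> R[i]) : measurable D ->
  (forall i, cintegrable D (F i)) ->
  cintegral D (fun s => \sum_(i <- r) F i s) = \sum_(i <- r) cintegral D (F i).
Proof.
move=> mD h; elim: r => [|i r IH].
  rewrite big_nil; under eq_fun do rewrite big_nil.
  by apply: complex_eq; rewrite /cintegral /=; under eq_Rintegral do [];
    rewrite /Rintegral integral_cst//= mul0e.
rewrite big_cons; under eq_fun do rewrite big_cons.
by rewrite cintegralD// ?IH//; exact: cintegrable_sum.
Qed.

Lemma cutoff_in D f s : D s -> cutoff D f s = f s.
Proof. by move=> Ds; rewrite /cutoff mem_set. Qed.

Lemma cutoff_out D f s : ~ D s -> cutoff D f s = 0.
Proof. by move=> Ds; rewrite /cutoff memNset. Qed.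

Lemma Re_cutoff D f s : complex.Re (cutoff D f s) = ((fun s => complex.Re (f s)) \_ D) s.
Proof. by rewrite /cutoff patchE; case: ifP. Qed.

Lemma Im_cutoff D f s : complex.Im (cutoff D f s) = ((fun s => complex.Im (f s)) \_ D) s.
Proof. by rewrite /cutoff patchE; case: ifP. Qed.

Lemma cintegral_cutoff D E f : cintegral D (cutoff E f) = cintegral (D `&` E) f.
Proof.
rewrite /cintegral; congr (_ +i* _); rewrite Rintegral_mkcondr; apply: eq_Rintegral => s _.
  by rewrite Re_cutoff.
by rewrite Im_cutoff.
Qed.

Lemma cmeasurable_cutoff D E f : measurable D -> measurable E ->
  cmeas (D `&` E) f -> cmeas D (cutoff E f).
Proof.
move=> mD mE [mr mi]; split.
  by under eq_fun do rewrite Re_cutoff; exact/measurable_restrict.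
by under eq_fun do rewrite Im_cutoff; exact/measurable_restrict.
Qed.

Lemma cmeasurableS D E f : measurable D -> E `<=` D ->
  cmeas D f -> cmeas E f.
Proof. by move=> mD ED [? ?]; split; exact: measurable_funS ED _. Qed.

End ComplexIntegration.

Section ComplexLimits.
Variable R : realType.
Implicit Types (a b : nat -> R[i]) (l m : R[i]).

Definition ccvg a l :=
  forall e : R, 0 < e -> exists k, forall n, (k <= n)%N -> cmod (a n - l) < e.

Lemma ccvg_le a l m (c : R) : ccvg a l ->
  (exists k, forall n, (k <= n)%N -> cmod (a n - m) <= c) -> cmod (l - m) <= c.
Proof.
move=> h [k hk]; apply: ler_eps => e /h[k' hk'].
rewrite (le_trans (cmod_distD (a (maxn k k')) _ _))// addrC lerD ?hk ?leq_maxl//.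
by rewrite cmod_distC ltW// hk'// leq_maxr.
Qed.

Lemma ccvg_unique a l m : ccvg a l -> ccvg a m -> l = m.
Proof.
move=> h h'; apply: eq_by_cmod => e /h'[k hk].
by apply: (ccvg_le h); exists k => n /hk/ltW.
Qed.

Lemma ccvg_mod_le a l (c : R) : ccvg a l ->
  (exists k, forall n, (k <= n)%N -> cmod (a n) <= c) -> cmod l <= c.
Proof.
move=> h [k hk]; rewrite -[l]subr0; apply: (ccvg_le h).
by exists k => n /hk; rewrite subr0.
Qed.

Lemma ccvg_ext a b l : (forall n, a n = b n) -> ccvg a l -> ccvg b l.
Proof. by move=> /funext <-. Qed.

Lemma ccvg_cst l : ccvg (fun=> l) l.
Proof. by move=> e e0; exists 0%N => n _; rewrite subrr cmod0. Qed.

Lemma ccvgD a b l m : ccvg a l -> ccvg b m -> ccvg (fun n => a n + b n) (l + m).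
Proof.
move=> ha hb e e0; have e2 : 0 < e / 2 by rewrite divr_gt0.
have [k hk] := ha _ e2; have [k' hk'] := hb _ e2.
exists (maxn k k') => n; rewrite geq_max => /andP[kn kn'].
by rewrite opprD addrACA (le_lt_trans (cmodD _ _))// [e]splitr ltrD ?hk ?hk'.
Qed.

Lemma ccvgZ (z : R[i]) a l : ccvg a l -> ccvg (fun n => z * a n) (z * l).
Proof.
move=> ha e e0; have c0 : 0 < cmod z + 1 by rewrite ltr_wpDl ?cmod_ge0.
have [k hk] := ha _ (divr_gt0 e0 c0); exists k => n /hk.
rewrite -mulrBr cmodM ltr_pdivlMr// mulrC; apply: le_lt_trans.
by rewrite ler_wpM2r ?cmod_ge0// lerDl.
Qed.

Lemma ccvgN a l : ccvg a l -> ccvg (fun n => - a n) (- l).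
Proof. by move=> /(ccvgZ (-1)); rewrite mulN1r; apply: ccvg_ext => n; rewrite mulN1r. Qed.

Lemma ccvgJ a l : ccvg a l -> ccvg (fun n => Num.conj (a n)) (Num.conj l).
Proof. by move=> h e /h[k hk]; exists k => n /hk; rewrite -rmorphB cmodJ. Qed.

Lemma ccvg_inner (H : hilbert R) (x y : nat -> H) u v : hcvg x u -> hcvg y v ->
  ccvg (fun n => ⟨x n, y n⟩) ⟨u, v⟩.
Proof.
move=> hx hy e e0.
pose M := hnorm u + hnorm v + 1.
have M0 : 0 < M by rewrite /M ltr_wpDl ?addr_ge0 ?hnorm_ge0.
have e2 : 0 < Num.min 1 (e / 2 / M) by rewrite lt_min ltr01 !divr_gt0.
have [k hk] := hx _ e2; have [k' hk'] := hy _ e2.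
exists (maxn k k') => n; rewrite geq_max => /andP[/hk h1 /hk' h2].
move: h1 h2; rewrite !lt_min => /andP[_ h1] /andP[h21 h2].
rewrite (le_lt_trans (inner_diff _ _ _ _))// [e]splitr.
have hyn : hnorm (y n) <= hnorm v + 1.
  by rewrite -[y n](subrK v) (le_trans (hnormD _ _))// addrC lerD2l ltW.
have aux (r s : R) : 0 <= r -> 0 <= s -> s <= M -> r < e / 2 / M -> r * s < e / 2.
  move=> r0 s0 sM; rewrite ltr_pdivlMr//; apply: le_lt_trans.
  by rewrite ler_wpM2l.
rewrite ltrD//; first by apply: aux; rewrite ?hnorm_ge0//;
  apply: (le_trans hyn); rewrite /M -addrA lerDr hnorm_ge0.
rewrite mulrC; apply: aux; rewrite ?hnorm_ge0//.
by rewrite /M -addrA lerDl addr_ge0 ?hnorm_ge0.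
Qed.

Lemma ccvg_cauchy a (b : nat -> R) : cvgn b ->
  (forall n p, (n <= p)%N -> cmod (a p - a n) <= b p - b n) -> exists l, ccvg a l.
Proof.
move=> cb hab.
have key (f : R[i] -> R) : (forall z w, f (z - w) = f z - f w) ->
    (forall z, `|f z| <= cmod z) -> cvgn (fun n => f (a n)).
  move=> fB fle; apply/cauchy_cvgP/cauchy_exP => e e0.
  have [k _ hk] := (iffLR (cvgrPdist_lt _ _) cb) _ e0.
  exists (f (a k)); exists k => // n /= kn.
  rewrite /ball /= -fB (le_lt_trans (fle _))// cmod_distC (le_lt_trans (hab _ _ kn))//.
  have nb : nondecreasing_seq b.
    by move=> p q /hab h; rewrite -subr_ge0 (le_trans (cmod_ge0 _) h).
  have h1 := nondecreasing_cvgn_le nb cb n; have := hk k (leqnn k).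
  by rewrite ltr_norml => /andP[_]; apply: le_lt_trans; rewrite lerD2r.
have /cvg_ex[x hx] := key (@complex.Re R)
  (fun z w => etrans (ReD _ _) (congr1 (fun t => _ + t) (ReN w))) (@norm_Re_le R).
have /cvg_ex[y hy] := key (@complex.Im R)
  (fun z w => etrans (ImD _ _) (congr1 (fun t => _ + t) (ImN w))) (@norm_Im_le R).
exists (x +i* y) => e e0; have e2 : 0 < e / 2 by rewrite divr_gt0.
have [k _ hk] := (iffLR (cvgrPdist_lt _ _) hx) _ e2; have [k' _ hk'] := (iffLR (cvgrPdist_lt _ _) hy) _ e2.
exists (maxn k k') => n; rewrite geq_max => /andP[/hk h1 /hk' h2].
rewrite (le_lt_trans (cmod_le_ReIm _))// ReD ImD ReN ImN /= [e]splitr.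
by rewrite ltrD// distrC.
Qed.

End ComplexLimits.

Section ComplexExponential.
Variable R : realType.

Definition exp_sum (T : fieldType) (z : T) n := \sum_(k < n) z ^+ k / k`!%:R.

(** The products of degree [i + j < n] regroup by the binomial formula. The leftover terms have
    nonnegative coefficients, so at complex arguments they are dominated by the same leftover at the
    moduli, which tends to 0 by the real functional equation. The field [T] is generic to serve both
    sides of that comparison. *)
Lemma exp_sumD (T : fieldType) (z w : T) n : (forall p : nat, p != 0%N -> p%:R != 0 :> T) ->
  exp_sum z n * exp_sum w n = exp_sum (z + w) n +
  \sum_(i < n) \sum_(j < n | (n <= i + j)%N) (z ^+ i / i`!%:R) * (w ^+ j / j`!%:R).
Proof.
move=> c0.
have fn0 k : k`!%:R != 0 :> T by rewrite c0// -lt0n fact_gt0.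
pose f i j := (z ^+ i / i`!%:R) * (w ^+ j / j`!%:R).
rewrite /exp_sum mulr_suml.
have -> : \sum_(i < n) z ^+ i / i`!%:R * (\sum_(k < n) w ^+ k / k`!%:R) =
    \sum_(i < n) (\sum_(j < n | (i + j < n)%N) f i j + \sum_(j < n | (n <= i + j)%N) f i j).
  apply: eq_bigr => i _; rewrite mulr_sumr (bigID (fun j : 'I_n => (i + j < n)%N)) /=.
  by congr (_ + _); apply: eq_bigl => j; rewrite -leqNgt.
rewrite big_split /=; congr (_ + _).
have -> : \sum_(i < n) \sum_(j < n | (i + j < n)%N) f i j =
    \sum_(i < n) \sum_(k < n | (i <= k)%N) f i (k - i)%N.
  apply: eq_bigr => i _.
  rewrite -(big_mkord (fun j => i + j < n)%N (f i)).
  rewrite -(big_mkord (fun k => i <= k)%N (fun k => f i (k - i)%N)).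
  rewrite (big_cat_nat (n := (n - i)%N)) ?leq_subr//= [X in _ + X]big_nat_cond.
  rewrite [X in _ + X]big_pred0 ?addr0; last first.
    by move=> j; apply/negP => /andP[/andP[h _] h']; move: h h'; clear; lia.
  rewrite [RHS](big_cat_nat (n := i)) ?(ltnW (ltn_ord i))//= [X in _ = X + _]big_nat_cond.
  rewrite [X in _ = X + _]big_pred0 ?add0r; last first.
    by move=> j; apply/negP => /andP[/andP[_ h] h']; move: h h'; clear; lia.
  rewrite -{4}[nat_of_ord i]add0n big_addn; apply: congr_big_nat => // j /=.
    by move=> h; apply/idP/idP; move: h; clear; lia.
  by rewrite addnK.
rewrite (exchange_big_dep xpredT)//=; apply: eq_bigr => k _.
rewrite addrC exprDn mulr_suml (big_ord_widen n (fun i => (w ^+ (k - i) * z ^+ i *+ 'C(k, i)) / k`!%:R))//.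
apply: eq_big => [i|i]; first by rewrite ltnS.
rewrite /f => ik; rewrite -mulr_natr -(bin_fact ik) !natrM.
have b0 : 'C(k, i)%:R != 0 :> T by rewrite c0// -lt0n bin_gt0.
by field; rewrite b0 !fn0.
Qed.

Implicit Types (x y : R) (z w : R[i]).

Lemma exp_sum_cvg x : exp_sum x @ \oo --> expR x.
Proof.
rewrite (_ : exp_sum x = series (exp_coeff x)); first exact: is_cvg_series_exp_coeff.
by apply/funext => n; rewrite /exp_sum /series /= big_mkord.
Qed.

Lemma exp_sum_nd x : 0 <= x -> nondecreasing_seq (exp_sum x).
Proof.
move=> x0; apply/nondecreasing_seqP => n; rewrite /exp_sum big_ord_recr /= lerDl.
by rewrite mulr_ge0 ?exprn_ge0// invr_ge0 ler0n.
Qed.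

Lemma exp_sum_le x n : 0 <= x -> exp_sum x n <= expR x.
Proof.
move=> x0; rewrite -(cvg_lim _ (exp_sum_cvg (x := x)))//.
apply: nondecreasing_cvgn_le; first exact: exp_sum_nd.
by apply/cvg_ex; exists (expR x); exact: exp_sum_cvg.
Qed.

Lemma exp_sum_diff (T : fieldType) (z : T) n m : (n <= m)%N ->
  exp_sum z m - exp_sum z n = \sum_(n <= k < m) z ^+ k / k`!%:R.
Proof.
move=> nm; rewrite /exp_sum -!(big_mkord xpredT (fun k => z ^+ k / k`!%:R)).
by rewrite (big_cat_nat (n := n))//= addrAC subrr add0r.
Qed.

Lemma exp_sum_remainder x n : 0 <= x -> expR x - exp_sum x n <= x ^+ n * expR x.
Proof.
move=> x0; rewrite lerBlDl -lerBlDl; apply: ler_eps => e e0.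
have [k _ hk] := (iffLR (cvgrPdist_lt _ _) (exp_sum_cvg (x := x))) _ e0.
have := hk (maxn k n) (leq_maxl _ _); rewrite ltr_norml => /andP[_ h].
have nm : (n <= maxn k n)%N by rewrite leq_maxr.
suff : exp_sum x (maxn k n) - exp_sum x n <= x ^+ n * expR x by lra.
rewrite exp_sum_diff// -{1}[n]add0n big_addn.
rewrite (@le_trans _ _ (x ^+ n * exp_sum x (maxn k n - n)))//; last first.
  by rewrite ler_wpM2l ?exprn_ge0// exp_sum_le.
rewrite /exp_sum big_mkord mulr_sumr; apply: ler_sum => i _.
rewrite exprD [leRHS]mulrCA [leRHS]mulrA ler_wpM2l ?mulr_ge0 ?exprn_ge0//.
rewrite lef_pV2 ?posrE ?ltr0n ?fact_gt0// ler_nat.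
by apply: leq_fact; rewrite leq_addr.
Qed.

Lemma exp_sum_cmod z n m : (n <= m)%N ->
  cmod (exp_sum z m - exp_sum z n) <= exp_sum (cmod z) m - exp_sum (cmod z) n.
Proof.
move=> nm; rewrite !exp_sum_diff// (le_trans (cmod_sum _ _ _))//; apply: ler_sum => i _.
rewrite cmodM cmodX cmodV -[_%:R](rmorph_nat (real_complex R)) cmod_real.
by rewrite ger0_norm ?ler0n.
Qed.

Definition cexp z : R[i] := xget 0 [set l | ccvg (exp_sum z) l].

Lemma cexp_cvg z : ccvg (exp_sum z) (cexp z).
Proof.
have [||l hl] := @ccvg_cauchy R (exp_sum z) (exp_sum (cmod z)).
- by apply/cvg_ex; exists (expR (cmod z)); exact: exp_sum_cvg.
- exact: exp_sum_cmod.
by rewrite /cexp; case: xgetP => [y _ //|/(_ l)].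
Qed.

Global Opaque cexp.

Lemma cexp_remainder z n :
  cmod (cexp z - exp_sum z n) <= expR (cmod z) - exp_sum (cmod z) n.
Proof.
apply: (ccvg_le (cexp_cvg z)); exists n => m nm.
by rewrite (le_trans (exp_sum_cmod z nm))// lerD2r exp_sum_le ?cmod_ge0.
Qed.

Lemma exp_sum0 (T : fieldType) (z : T) : exp_sum z 0 = 0.
Proof. by rewrite /exp_sum big_ord0. Qed.

Lemma exp_sum1 (T : fieldType) (z : T) : exp_sum z 1 = 1.
Proof. by rewrite /exp_sum big_ord1 expr0 fact0 divr1. Qed.

Lemma exp_sum2 (T : fieldType) (z : T) : exp_sum z 2 = 1 + z.
Proof. by rewrite /exp_sum big_ord_recr /= big_ord1 expr0 fact0 !divr1 expr1. Qed.

Lemma cexp_bound z : cmod (cexp z) <= expR (cmod z).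
Proof. by have := cexp_remainder z 0; rewrite !exp_sum0 !subr0. Qed.

Lemma cexp_bound1 z : cmod (cexp z - 1) <= cmod z * expR (cmod z).
Proof.
have := cexp_remainder z 1; rewrite !exp_sum1 => h; apply: (le_trans h).
by have := exp_sum_remainder (x := cmod z) 1 (cmod_ge0 z); rewrite exp_sum1 expr1.
Qed.

Lemma cexp_bound2 z : cmod (cexp z - 1 - z) <= cmod z ^+ 2 * expR (cmod z).
Proof.
have := cexp_remainder z 2; rewrite !exp_sum2 opprD addrA => h; apply: (le_trans h).
by have := exp_sum_remainder (x := cmod z) 2 (cmod_ge0 z); rewrite exp_sum2.
Qed.

Lemma cexpD z w : cexp (z + w) = cexp z * cexp w.
Proof.
pose a := cmod z; pose b := cmod w.
have a0 : 0 <= a by exact: cmod_ge0.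
have b0 : 0 <= b by exact: cmod_ge0.
have nat0 (T : numFieldType) p : p != 0%N -> p%:R != 0 :> T by rewrite pnatr_eq0.
have key n : cmod (exp_sum z n * exp_sum w n - exp_sum (z + w) n) <=
    exp_sum a n * exp_sum b n - exp_sum (a + b) n.
  rewrite !exp_sumD; [|exact: nat0|exact: nat0].
  rewrite addrC addKr [leRHS]addrC addKr (le_trans (cmod_sum _ _ _))//.
  apply: ler_sum => i _; rewrite (le_trans (cmod_sum _ _ _))//; apply: ler_sum => j _.
  rewrite !cmodM !cmodX !cmodV -!(rmorph_nat (real_complex R)) !cmod_real.
  by rewrite !ger0_norm ?ler0n.
have sl (c : R[i]) : ccvg (fun n => exp_sum c n) (cexp c) by exact: cexp_cvg.
apply: eq_by_cmod => e e0.
have cv : (fun n => exp_sum a n * exp_sum b n - exp_sum (a + b) n) @ \oo --> (0 : R).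
  have -> : 0 = expR a * expR b - expR (a + b) by rewrite expRD subrr.
  by apply: cvgB; [apply: cvgM|]; exact: exp_sum_cvg.
have [k1 _ h1] := (iffLR (cvgrPdist_lt _ _) cv) (e / 2) (divr_gt0 e0 (ltr0Sn _ 1)).
have prod_cvg : ccvg (fun n => exp_sum z n * exp_sum w n) (cexp z * cexp w).
  move=> d d0.
  have [M [M0 q1 q2]] : exists M : R, [/\ 0 < M, forall n, cmod (exp_sum w n) <= M
      & cmod (cexp z) <= M].
    exists (expR a + expR b + 1); split=> [|n|].
    - by rewrite ltr_wpDl// addr_ge0 ?expR_ge0.
    - have := exp_sum_cmod w (leq0n n); rewrite !exp_sum0 !subr0 => q; apply: (le_trans q).
      rewrite (le_trans (exp_sum_le _ b0))//; have := expR_ge0 a; lra.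
    - rewrite (le_trans (cexp_bound z))//; have := expR_ge0 b; rewrite -/a; lra.
  have d1 : 0 < d / 2 / M by rewrite !divr_gt0.
  have [k hk] := cexp_cvg z d1; have [k' hk'] := cexp_cvg w d1.
  exists (maxn k k') => n; rewrite geq_max => /andP[/hk p1 /hk' p2].
  move: p1 p2 (q1 n) q2.
  move: (exp_sum z n) (exp_sum w n) (cexp z) (cexp w) => s1 s2 c1 c2 p1 p2 {}q1 q2.
  have -> : s1 * s2 - c1 * c2 = (s1 - c1) * s2 + c1 * (s2 - c2) by ring.
  have r1 : cmod (s1 - c1) * cmod s2 <= cmod (s1 - c1) * M by rewrite ler_wpM2l ?cmod_ge0.
  have r2 : cmod c1 * cmod (s2 - c2) <= cmod (s2 - c2) * M.
    by rewrite mulrC ler_wpM2l ?cmod_ge0.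
  have {}p1 : cmod (s1 - c1) * M < d / 2 by rewrite -ltr_pdivlMr.
  have {}p2 : cmod (s2 - c2) * M < d / 2 by rewrite -ltr_pdivlMr.
  rewrite (le_lt_trans (cmodD _ _))// !cmodM [ltRHS]splitr.
  exact: ltrD (le_lt_trans r1 p1) (le_lt_trans r2 p2).
rewrite cmod_distC.
have cd := ccvgD prod_cvg (ccvgN (cexp_cvg (z + w))).
apply: (ccvg_mod_le cd); exists k1 => n /h1.
rewrite sub0r normrN => h; apply: (le_trans (key n)).
by apply: (le_trans (ler_norm _)); apply: (le_trans (ltW h)); lra.
Qed.

Lemma cexp0 : cexp 0 = 1.
Proof.
apply: eq_by_cmod => e e0.
by have := cexp_bound1 0; rewrite cmod0 mul0r => /le_trans; apply; exact: ltW.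
Qed.

Lemma cexpJ z : Num.conj (cexp z) = cexp (Num.conj z).
Proof.
apply: (ccvg_unique (ccvgJ (cexp_cvg z))).
apply: ccvg_ext (cexp_cvg (Num.conj z)) => n.
rewrite /exp_sum rmorph_sum; apply: eq_bigr => i _.
by rewrite rmorphM rmorphXn fmorphV rmorph_nat.
Qed.

Lemma cexp_real x : cexp x%:C = (expR x)%:C.
Proof.
apply: (ccvg_unique (cexp_cvg x%:C)) => e e0.
have [k _ hk] := (iffLR (cvgrPdist_lt _ _) (exp_sum_cvg (x := x))) _ e0.
exists k => n /hk; rewrite distrC -cmod_real; congr (_ < _); congr cmod.
rewrite rmorphB /exp_sum rmorph_sum; congr (_ - _); apply: eq_bigr => i _.
by rewrite rmorphM rmorphXn fmorphV rmorph_nat.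
Qed.

Lemma cexp_diff z w : cmod (cexp z - cexp w) <=
  expR (cmod w) * (cmod (z - w) * expR (cmod (z - w))).
Proof.
have -> : cexp z - cexp w = cexp w * (cexp (z - w) - 1).
  by rewrite mulrBr -cexpD mulr1 [w + _]addrC subrK.
by rewrite cmodM ler_pM ?cmod_ge0 ?cexp_bound ?cexp_bound1.
Qed.

End ComplexExponential.

(** * Square-integrable functions and exponential vectors *)

Section Ryser.
Variable T : numFieldType.

(** Toggling a point outside [A] is a sign-reversing involution of the supersets of [A], so only
    [A = setT] survives. *)
Lemma sum_sign_supersets n (A : {set 'I_n}) :
  \sum_(S : {set 'I_n} | A \subset S) (-1) ^+ #|~: S| = [forall j, j \in A]%:R :> T.
Proof.
have [/forallP fA|] := boolP [forall j, j \in A].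
  rewrite (big_pred1 (~: finset.set0)); first by rewrite finset.setCK cards0.
  move=> S /=; apply/idP/eqP => [/fintype.subsetP h|->].
    by apply/finset.setP => x; rewrite !inE; apply: h; exact: fA.
  by apply/fintype.subsetP => x _; rewrite !inE.
rewrite negb_forall => /existsP[j jA].
pose f (S : {set 'I_n}) := if j \in S then S :\ j else j |: S.
have fK : involutive f.
  move=> S; rewrite /f; have [jS|jS] := boolP (j \in S).
    by rewrite finset.setD11 finset.setD1K.
  by rewrite finset.setU11 finset.setU1K.
set X := \sum_(S | _) _.
suff : X = - X by move/eqP; rewrite -addr_eq0 -mulr2n mulrn_eq0 /= => /eqP.
rewrite {1}/X (reindex_inj (inv_inj fK)) /= -sumrN.
have sub S : (A \subset f S) = (A \subset S).
  rewrite /f; have [jS|jS] := boolP (j \in S).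
    by rewrite finset.subsetD1 jA andbT.
  apply/idP/idP => [h|h]; last by rewrite (fintype.subset_trans h)// finset.subsetU1.
  apply/fintype.subsetP => x xA; have := fintype.subsetP h x xA; rewrite !inE => /orP[/eqP xj|//].
  by move: jA; rewrite -xj xA.
apply: eq_big => [S|S _]; first exact: sub.
have card (S' : {set 'I_n}) : j \in S' -> (-1) ^+ #|~: (S' :\ j)| = - (-1) ^+ #|~: S'| :> T.
  move=> jS; rewrite finset.setCD finset.setUC cardsU1 !inE jS /= exprS mulN1r.
  by [].
rewrite /f; case: ifP => [jS|jS]; first exact: card.
by rewrite -[S in RHS](finset.setU1K (negbT jS)) card ?finset.setU11// opprK.
Qed.

(** Expand the product over all maps [f] and exchange the sums: the sets [S] containing the image of
    [f] contribute the alternating sum of [sum_sign_supersets], which vanishes unless [f] is onto,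
    that is, a permutation. *)
Lemma ryser n (a : 'I_n -> 'I_n -> T) :
  \sum_(S : {set 'I_n}) (-1) ^+ #|~: S| * \prod_i \sum_(j in S) a i j =
  \sum_(p : 'S_n) \prod_i a i (p i).
Proof.
under eq_bigr => S _ do rewrite bigA_distr_big mulr_sumr big_mkcond.
rewrite exchange_big /=.
pose G (f : {ffun 'I_n -> 'I_n}) := \prod_i a i (f i).
transitivity (\sum_(f : {ffun 'I_n -> 'I_n} | injectiveb f) G f).
  rewrite [RHS]big_mkcond; apply: eq_bigr => f _ /=.
  pose A := [set f i | i : 'I_n]%SET.
  transitivity (\sum_(S : {set 'I_n} | A \subset S) (-1) ^+ #|~: S| * G f).
    rewrite [RHS]big_mkcond; apply: eq_bigr => S _; congr (if _ then _ else _).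
    apply/ffun_onP/fintype.subsetP => [h x /imsetP[i _ ->]|h i]; first exact: h.
    by apply: h; apply/imsetP; exists i.
  rewrite -mulr_suml sum_sign_supersets.
  have -> : [forall j, j \in A] = injectiveb f; last by case: injectiveb; rewrite ?mul1r ?mul0r.
  apply/forallP/injectiveP => [h|h j].
    have : #|A| == #|'I_n|.
      by rewrite eqn_leq max_card /=; apply/subset_leq_card/fintype.subsetP => x _; exact: h.
    by move=> /imset_injP hi x y; apply: hi.
  by have /injF_bij[g _ gK] := h; apply/imsetP; exists (g j); rewrite ?gK.
rewrite (reindex_onto (fun p : 'S_n => pval p) (fun f => insubd (1%g : 'S_n) f)) /=.
  apply: eq_big => [p|p _].
    by rewrite (valP p) /= -val_eqE /= insubdK ?eqxx//; exact: valP.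
  by apply: eq_bigr => i _; rewrite pvalE.
by move=> f fi; rewrite insubdK.
Qed.
End Ryser.

Section SquareIntegrable.
Variable R : realType.
Local Notation mu := (@lebesgue_measure R).
Local Notation TR := (measurableTypeR R).
Implicit Types (f g h : R -> R[i]) (D : set TR).

Definition half_line : set TR := `[0, +oo[%classic.

Lemma measurable_half_line : measurable half_line.
Proof. exact: measurable_itv. Qed.
Hint Resolve measurable_half_line : core.

Lemma Lfun2_half_line (a : TR -> R) : (a \_ half_line \in Lfun mu 2%:E) <->
  measurable_fun half_line a /\ rintegrable half_line (fun s => a s ^+ 2).
Proof.
split=> [ha|[ma ia]].
  split.
    apply/(measurable_restrictT _ measurable_half_line).
    by move: ha; rewrite inE => /andP[]; rewrite inE.
  apply/(integrable_mkcond _ measurable_half_line).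
  have h1 := Lfun2_integrable_sqr ha.
  suff <- : EFin \o (fun s => (a \_ half_line) s ^+ 2) =
    (EFin \o (fun s => a s ^+ 2)) \_ half_line by exact: h1.
  by apply/funext => s; rewrite /= !patchE; case: ifP => // _; rewrite expr0n.
rewrite inE; apply/andP; split; rewrite inE /=.
  exact/(measurable_restrictT _ measurable_half_line).
rewrite /finite_norm unlock /Lnorm /= poweR_lty//.
have /integrableP[_] := (integrable_mkcond _ measurable_half_line).1 ia.
rewrite (_ : (fun x => _) = (fun x => (`|(a \_ half_line) x| `^ 2)%:E))//.
apply/funext => s; rewrite !patchE; case: ifP => _ /=.
  by rewrite powR_mulrn// normrX.
by rewrite normr0 powR0.
Qed.

Definition L2 f := square_integrable half_line f.

Lemma square_integrable_ReIm D f : measurable D -> square_integrable D f <->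
  (measurable_fun D (fun s => complex.Re (f s)) /\
    rintegrable D (fun s => complex.Re (f s) ^+ 2)) /\
  (measurable_fun D (fun s => complex.Im (f s)) /\
    rintegrable D (fun s => complex.Im (f s) ^+ 2)).
Proof.
move=> mD; split=> [[[mr mi] sf]|[[mr sr] [mi si]]].
  split; split=> //; apply: rintegrable_le sf => //; first exact: measurable_funX.
  - by move=> s _; rewrite cmod_sqr ger0_norm ?sqr_ge0// lerDl sqr_ge0.
  - exact: measurable_funX.
  - by move=> s _; rewrite cmod_sqr ger0_norm ?sqr_ge0// lerDr sqr_ge0.
split=> //; under eq_fun do rewrite cmod_sqr; exact: rintegrableD.
Qed.

Lemma L2P f : L2_half_line f <-> L2 f.
Proof.
rewrite /L2 square_integrable_ReIm// -!Lfun2_half_line.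
by split=> [[? ?]|[? ?]]; split.
Qed.

Lemma square_integrableD D f g : measurable D -> square_integrable D f ->
  square_integrable D g -> square_integrable D (fun s => f s + g s).
Proof.
move=> mD [mf sf] [mg sg]; split; first exact: cmeasurableD.
have := rintegrableD mD (rintegrableZ 2 mD sf) (rintegrableZ 2 mD sg).
apply: rintegrable_le => //.
  by apply: measurable_funX; apply: measurable_cmod; exact: cmeasurableD.
move=> s _; rewrite ger0_norm ?sqr_ge0//.
apply: (@le_trans _ _ ((cmod (f s) + cmod (g s)) ^+ 2)).
  by rewrite ler_pXn2r ?nnegrE ?addr_ge0 ?cmod_ge0// cmodD.
by have := sqr_ge0 (cmod (f s) - cmod (g s)); nra.
Qed.

Lemma square_integrableZ D z f : measurable D -> square_integrable D f ->
  square_integrable D (fun s => z * f s).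
Proof.
move=> mD [mf sf]; split; first exact: cmeasurableM (cmeasurable_cst _ _) mf.
under eq_fun do rewrite cmodM exprMn; exact: rintegrableZ.
Qed.

Lemma square_integrableB D f g : measurable D -> square_integrable D f ->
  square_integrable D g -> square_integrable D (fun s => f s - g s).
Proof.
move=> mD sf sg; under eq_fun do rewrite -[- _]mulN1r.
by apply: square_integrableD => //; exact: square_integrableZ.
Qed.

Lemma square_integrable0 D : measurable D -> square_integrable D (fun=> 0).
Proof.
move=> mD; split; first exact: cmeasurable_cst.
by apply: rintegrable_eq (integrable0 _ D) => s; rewrite cmod0 expr0n.
Qed.

Lemma square_integrable_sum D (I : Type) (r : seq I) (P : pred I) (F : I -> R -> R[i]) :
  measurable D -> (forall i, square_integrable D (F i)) ->
  square_integrable D (fun s => \sum_(i <- r | P i) F i s).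
Proof.
move=> mD h; elim: r => [|i r IH].
  by under eq_fun do rewrite big_nil; exact: square_integrable0.
have [Pi|Pi] := boolP (P i); last by under eq_fun do rewrite big_cons (negbTE Pi).
by under eq_fun do rewrite big_cons Pi; exact: square_integrableD.
Qed.

Lemma square_integrableS D E f : measurable D -> measurable E -> E `<=` D ->
  square_integrable D f -> square_integrable E f.
Proof.
move=> mD mE ED [mf sf]; split; first exact: cmeasurableS mf.
exact: rintegrableS ED sf.
Qed.

Lemma square_integrable_cutoff D E f : measurable D -> measurable E ->
  square_integrable (D `&` E) f -> square_integrable D (cutoff E f).
Proof.
move=> mD mE [mf sf]; have mc := cmeasurable_cutoff mD mE mf; split=> //.
apply/(integrable_mkcond _ mD).
have h := (integrable_mkcond _ (measurableI _ _ mD mE)).1 sf.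
suff <- : (EFin \o (fun s => cmod (f s) ^+ 2)) \_ (D `&` E) =
  (EFin \o (fun s => cmod (cutoff E f s) ^+ 2)) \_ D by exact: h.
apply/funext => s; rewrite !patchE in_setI; case: (s \in D) => //=; rewrite /cutoff.
by case: ifP => // _; rewrite cmod0 expr0n.
Qed.

Lemma inner_integrable D f g : measurable D -> square_integrable D f ->
  square_integrable D g -> cintegrable D (fun s => Num.conj (f s) * g s).
Proof.
move=> mD [mf sf] [mg sg].
apply: (cintegrable_le mD _ _ (rintegrableD mD sf sg)).
  by apply: cmeasurableM => //; exact: cmeasurableJ.
move=> s _; rewrite cmodM cmodJ.
by have := sqr_ge0 (cmod (f s) - cmod (g s)); have := sqr_ge0 (cmod (f s)); nra.
Qed.

Lemma L2_innerDr f g h : L2 f -> L2 g -> L2 h ->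
  L2_inner f (fun s => g s + h s) = L2_inner f g + L2_inner f h.
Proof.
move=> Lf Lg Lh; rewrite /L2_inner -cintegralD//; try exact: inner_integrable.
by apply: eq_cintegral => s _; rewrite mulrDr.
Qed.

Lemma L2_innerZr z f g : L2 f -> L2 g -> L2_inner f (fun s => z * g s) = z * L2_inner f g.
Proof.
move=> Lf Lg; rewrite /L2_inner -cintegralZ//; try exact: inner_integrable.
by apply: eq_cintegral => s _; rewrite mulrCA.
Qed.

Lemma L2_inner_conj f g : L2 f -> L2 g -> Num.conj (L2_inner f g) = L2_inner g f.
Proof.
move=> Lf Lg; rewrite /L2_inner -cintegralJ//; try exact: inner_integrable.
by apply: eq_cintegral => s _; apply: complex_eq; rewrite !(ReM, ImM, ReJ, ImJ); ring.
Qed.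

Lemma L2_inner_suml (I : Type) (r : seq I) (P : pred I) (F : I -> R -> R[i]) g :
  L2 g -> (forall i, L2 (F i)) ->
  L2_inner (fun s => \sum_(i <- r | P i) F i s) g = \sum_(i <- r | P i) L2_inner (F i) g.
Proof.
move=> Lg LF; rewrite [RHS]big_mkcond /L2_inner.
have -> : cintegral `[0, +oo[ (fun s => Num.conj (\sum_(i <- r | P i) F i s) * g s) =
    cintegral half_line (fun s => \sum_(i <- r)
      (if P i then Num.conj (F i s) * g s else 0)).
  apply: eq_cintegral => s _.
  rewrite rmorph_sum mulr_suml big_mkcond; apply: eq_bigr => i _.
  by case: (P i).
rewrite cintegral_sum//; last first.
  move=> i; case: (P i); first by apply: inner_integrable => //; exact: LF.
  by split; exact: rintegrable_eq (integrable0 _ half_line).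
apply: eq_bigr => i _; case: (P i) => //.
by rewrite /cintegral /Rintegral integral_cst//= mul0e.
Qed.

Lemma L2_inner_self f : L2 f -> L2_inner f f = (\int[mu]_(s in half_line) cmod (f s) ^+ 2)%:C.
Proof.
move=> _; apply: complex_eq; rewrite /L2_inner /cintegral /=.
  by apply: eq_Rintegral => s _; rewrite mul_conj_cmod.
transitivity (\int[mu]_(s in half_line) (0 : R)).
  by apply: eq_Rintegral => s _; rewrite mul_conj_cmod.
by rewrite /Rintegral integral_cst//= mul0e.
Qed.

End SquareIntegrable.

#[global] Hint Resolve measurable_half_line : core.
Arguments half_line {R}.

Section ExponentialVectors.
Variables (R : realType) (F : fock R).
Local Notation mu := (@lebesgue_measure R).
Implicit Types (f g : R -> R[i]).

Definition tpow n f : F := fock_tensor F (fun _ : 'I_n => f).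

Lemma tpow_inner m n f g : L2 f -> L2 g ->
  ⟨tpow m f, tpow n g⟩ = if m == n then L2_inner f g ^+ m else 0.
Proof.
move=> /L2P Lf /L2P Lg; case: eqVneq => [<-|mn]; last exact: fock_orthogonal.
rewrite fock_inner//.
under eq_bigr do rewrite prodr_const card_ord.
rewrite sumr_const -[#|_|]/#|'S_m| card_Sn -[X in _ * X]mulr_natl mulrA mulVf ?mul1r//.
Qed.

Definition exp_partial f k : F := \sum_(n < k)
  ((Num.sqrt (n`!%:R : R))^-1)%:C *: tpow n f.

Lemma exp_partial_inner f g k l : L2 f -> L2 g ->
  ⟨exp_partial f k, exp_partial g l⟩ = exp_sum (L2_inner f g) (minn k l).
Proof.
move=> Lf Lg; rewrite inner_suml.
pose a := L2_inner f g.
transitivity (\sum_(i < k) if (i < l)%N then a ^+ i / i`!%:R else 0).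
  apply: eq_bigr => i _; rewrite innerZl conj_real inner_sumr.
  have term (j : 'I_l) : ⟨tpow i f, ((Num.sqrt (j`!%:R : R))^-1)%:C *: tpow j g⟩ =
      if i == j :> nat then ((Num.sqrt (i`!%:R : R))^-1)%:C * a ^+ i else 0.
    by rewrite innerZr tpow_inner//; case: eqP => [->//|_]; rewrite mulr0.
  under eq_bigr do rewrite term.
  case: ifP => [il|il]; last first.
    rewrite big1 ?mulr0// => j _; case: eqP => // ij.
    by move: il; rewrite ij ltn_ord.
  rewrite (bigD1 (Ordinal il))//= eqxx big1 ?addr0; last first.
    move=> j jn; case: eqP => // ij; move/eqP: jn; case.
    exact/val_inj.
  rewrite mulrA -rmorphM -expr2 exprVn sqr_sqrtr ?ler0n// mulrC.
  by rewrite fmorphV rmorph_nat.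
rewrite -big_mkcond /= /exp_sum.
have -> : \sum_(i < k | (i < l)%N) a ^+ i / i`!%:R =
    \sum_(i < k | (i < minn k l)%N) a ^+ i / i`!%:R.
  by apply: eq_bigl => i; rewrite ltn_min ltn_ord.
by rewrite -(big_ord_widen _ (fun i => a ^+ i / i`!%:R)) ?geq_minl.
Qed.

Lemma L2_sqnorm_ge0 f : 0 <= \int[mu]_(s in @half_line R) cmod (f s) ^+ 2.
Proof. by apply: Rintegral_ge0 => s _; exact: sqr_ge0. Qed.

Lemma exp_sum_realE (x : R) n : exp_sum x%:C n = (exp_sum x n)%:C.
Proof.
rewrite /exp_sum rmorph_sum; apply: eq_bigr => i _.
by rewrite rmorphM rmorphXn fmorphV rmorph_nat.
Qed.

Lemma exp_vec_cvg f : L2 f -> hcvg (exp_partial f) (exp_vec F f).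
Proof.
move=> Lf.
have [|l hl] := @hcauchy_cvg R F (exp_partial f); last first.
  by rewrite /exp_vec (hlim_eq hl).
move=> e e0; pose a := \int[mu]_(s in @half_line R) cmod (f s) ^+ 2.
have a0 : 0 <= a by exact: L2_sqnorm_ge0.
have e2 : 0 < (e / 2) ^+ 2 by rewrite exprn_gt0// divr_gt0.
have [k _ hk] := (iffLR (cvgrPdist_lt _ _) (exp_sum_cvg (x := a))) _ e2.
exists k; suff key m n : (k <= m)%N -> (m <= n)%N -> hnorm (exp_partial f m - exp_partial f n) < e.
  move=> m n km kn; case: (leqP m n) => [mn|/ltnW nm]; first exact: key.
  by rewrite hnorm_distC; exact: key.
move=> km mn; apply: (@le_lt_trans _ _ (e / 2)); last lra.
apply: hnorm_le_sqr; first lra.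
rewrite hnormB_sqr !hnorm_sqr !exp_partial_inner// !minnn (minn_idPl mn).
rewrite L2_inner_self// !exp_sum_realE /=.
have := hk m km; rewrite ltr_norml => /andP[_].
have := exp_sum_le n a0; rewrite -/a; lra.
Qed.

Lemma exp_vec_inner f g : L2 f -> L2 g ->
  ⟨exp_vec F f, exp_vec F g⟩ = cexp (L2_inner f g).
Proof.
move=> Lf Lg; apply: (ccvg_unique (ccvg_inner (exp_vec_cvg Lf) (exp_vec_cvg Lg))).
by apply: ccvg_ext (cexp_cvg _) => n; rewrite exp_partial_inner// minnn.
Qed.

Lemma exp_vec_partial f k : L2 f -> hnorm (exp_vec F f - exp_partial f k) ^+ 2 =
  expR (\int[mu]_(s in @half_line R) cmod (f s) ^+ 2) -
  exp_sum (\int[mu]_(s in @half_line R) cmod (f s) ^+ 2) k.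
Proof.
move=> Lf; set a := \int[mu]_(s in _) _.
have h : ⟨exp_vec F f, exp_partial f k⟩ = (exp_sum a k)%:C.
  have hc : hcvg (fun=> exp_partial f k) (exp_partial f k).
    by move=> e e0; exists 0%N => n _; rewrite subrr hnorm0.
  apply: (ccvg_unique (ccvg_inner (exp_vec_cvg Lf) hc)) => e e0.
  exists k => n kn; rewrite exp_partial_inner// (minn_idPr kn) L2_inner_self//.
  by rewrite exp_sum_realE subrr cmod0.
rewrite hnormB_sqr h !hnorm_sqr exp_vec_inner// exp_partial_inner// minnn.
by rewrite L2_inner_self// cexp_real exp_sum_realE /= -/a; ring.
Qed.

Definition one_particle f : F := tpow 1 f.

Lemma one_particle_inner f g : L2 f -> L2 g ->
  ⟨one_particle f, one_particle g⟩ = L2_inner f g.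
Proof. by move=> Lf Lg; rewrite tpow_inner// eqxx expr1. Qed.

Lemma one_particle_sqnorm f : L2 f ->
  hnorm (one_particle f) ^+ 2 = \int[mu]_(s in @half_line R) cmod (f s) ^+ 2.
Proof. by move=> Lf; rewrite hnorm_sqr one_particle_inner// L2_inner_self. Qed.

Lemma L2_innerBr f g h : L2 f -> L2 g -> L2 h ->
  L2_inner f (fun s => g s - h s) = L2_inner f g - L2_inner f h.
Proof.
move=> Lf Lg Lh.
have -> : (fun s => g s - h s) = (fun s => g s + (-1) * h s).
  by apply/funext => s; rewrite mulN1r.
by rewrite L2_innerDr// ?L2_innerZr// ?mulN1r//; exact: square_integrableZ.
Qed.

Lemma L2_innerBl f g h : L2 f -> L2 g -> L2 h ->
  L2_inner (fun s => g s - h s) f = L2_inner g f - L2_inner h f.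
Proof.
move=> Lf Lg Lh; have LB := square_integrableB (@measurable_half_line R) Lg Lh.
by rewrite -L2_inner_conj// L2_innerBr// rmorphB /= !L2_inner_conj.
Qed.

(** [fock_tensor] is known only through its scalar products, so even linearity is obtained by
    computing the norm of the difference; [tpowZ] uses the same device. *)
Lemma one_particleB f g : L2 f -> L2 g ->
  one_particle (fun s => f s - g s) = one_particle f - one_particle g.
Proof.
move=> Lf Lg; have LB := square_integrableB (@measurable_half_line R) Lf Lg.
apply/eqP; rewrite -subr_eq0; apply/eqP/hnorm_eq0/eqP.
rewrite -sqrf_eq0 hnorm_sqr !(innerDr, innerDl, innerNr, innerNl) !one_particle_inner//.
by rewrite !(L2_innerBr, L2_innerBl)//; apply/eqP; rewrite !ReD !ReN !ReD !ReN; ring.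
Qed.

(* Quantitative continuity of [f |-> e(f)], from [<e(f), e(g)> = exp <f, g>]. *)
Lemma exp_vec_close f g (N : R) : L2 f -> L2 g ->
  hnorm (one_particle f) <= N -> hnorm (one_particle g) <= N ->
  hnorm (exp_vec F f - exp_vec F g) ^+ 2 <=
  2 * (N * hnorm (one_particle f - one_particle g) * expR (3 * N ^+ 2)).
Proof.
move=> Lf Lg fN gN; set d := hnorm (one_particle f - one_particle g).
have N0 : 0 <= N by apply: le_trans fN; exact: hnorm_ge0.
have d0 : 0 <= d by exact: hnorm_ge0.
have dN : d <= 2 * N.
  by rewrite (le_trans (hnormB _ _))// mulr_natl mulr2n lerD.
have key f' g' : L2 f' -> L2 g' -> hnorm (one_particle f') <= N ->
    hnorm (one_particle g') <= N -> hnorm (one_particle f' - one_particle g') = d ->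
    cmod (cexp (L2_inner f' f') - cexp (L2_inner f' g')) <= N * d * expR (3 * N ^+ 2).
  move=> Lf' Lg' f'N g'N hd.
  have wN : cmod (L2_inner f' g') <= N ^+ 2.
    by rewrite -one_particle_inner// (le_trans (inner_le _ _))// expr2 ler_pM ?hnorm_ge0.
  have zw : cmod (L2_inner f' f' - L2_inner f' g') <= N * d.
    rewrite -!one_particle_inner// -innerBr (le_trans (inner_le _ _))// hd.
    by rewrite ler_wpM2r.
  rewrite (le_trans (cexp_diff _ _))//.
  have -> : N * d * expR (3 * N ^+ 2) = expR (N ^+ 2) * (N * d * expR (2 * N ^+ 2)).
    by rewrite [RHS]mulrCA -expRD; congr (_ * expR _); ring.
  rewrite ler_pM ?expR_ge0 ?mulr_ge0 ?cmod_ge0 ?expR_ge0 ?ler_expR//.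
  rewrite ler_pM ?cmod_ge0 ?expR_ge0 ?ler_expR// (le_trans zw)//.
  by rewrite expr2 mulrCA ler_wpM2l.
have k1 := key f g Lf Lg fN gN erefl.
have k2 := key g f Lg Lf gN fN (hnorm_distC _ _).
have -> : hnorm (exp_vec F f - exp_vec F g) ^+ 2 =
    complex.Re ((cexp (L2_inner f f) - cexp (L2_inner f g)) +
      (cexp (L2_inner g g) - cexp (L2_inner g f))).
  rewrite hnorm_sqr !(innerDr, innerDl, innerNr, innerNl) !exp_vec_inner//.
  move: (cexp (L2_inner f f)) (cexp (L2_inner f g)) (cexp (L2_inner g f))
    (cexp (L2_inner g g)) => c1 c2 c3 c4.
  by congr complex.Re; ring.
apply: (le_trans (Re_le_cmod _)); apply: (le_trans (cmodD _ _)).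
by rewrite mulr_natl mulr2n; exact: lerD k1 k2.
Qed.

Lemma tpowZ n f z : L2 f -> tpow n (fun s => z * f s) = z ^+ n *: tpow n f.
Proof.
move=> Lf; have LZ := square_integrableZ z (@measurable_half_line R) Lf.
have Zl : L2_inner (fun s => z * f s) f = Num.conj z * L2_inner f f.
  by rewrite -L2_inner_conj// L2_innerZr// rmorphM /= L2_inner_conj.
apply/eqP; rewrite -subr_eq0; apply/eqP/hnorm_eq0/eqP.
rewrite -sqrf_eq0 hnorm_sqr !innerE !tpow_inner// eqxx.
rewrite !L2_innerZr// Zl !exprMn -!rmorphXn.
set a := L2_inner f f ^+ n; set b := z ^+ n; set c := Num.conj b.
by apply/eqP; rewrite (_ : _ + _ = 0)//; ring.
Qed.

Definition L2_fun := {f : R -> R[i] | L2 f}.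

Definition exp_family (p : L2_fun) : F := exp_vec F (sval p).

Definition exp_closure (x : F) :=
  forall e : R, 0 < e -> exists2 u, span_of exp_family u & hnorm (x - u) < e.

Lemma exp_closure_lin (I : Type) (r : seq I) (c : I -> R[i]) (x : I -> F) :
  (forall i, exp_closure (x i)) -> exp_closure (\sum_(i <- r) c i *: x i).
Proof.
move=> h; elim: r => [|i r IH] e e0.
  by exists 0; [constructor | rewrite big_nil subrr hnorm0].
have e2 : 0 < e / 2 by rewrite divr_gt0.
have c0 : 0 < cmod (c i) + 1 by rewrite ltr_wpDl ?cmod_ge0.
have [u su hu] := h i _ (divr_gt0 e2 c0); have [v sv hv] := IH _ e2.
exists (c i *: u + v); first by apply: pair_spanD => //; exact: pair_spanZ.
rewrite big_cons opprD addrACA -scalerBr (le_lt_trans (hnormD _ _))//.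
rewrite [ltRHS]splitr ler_ltD// hnormZ.
rewrite (@le_trans _ _ ((cmod (c i) + 1) * hnorm (x i - u)))//.
  by rewrite ler_wpM2r ?hnorm_ge0// lerDl.
by rewrite mulrC -ler_pdivlMr// ltW.
Qed.

Lemma exp_closure_exp f : L2 f -> exp_closure (exp_vec F f).
Proof.
move=> Lf e e0; exists (exp_vec F f); last by rewrite subrr hnorm0.
exact: (pair_span_gen exp_family exp_family (exist _ f Lf)).
Qed.

Lemma exp_closure_lim x :
  (forall e : R, 0 < e -> exists2 y, exp_closure y & hnorm (x - y) < e) -> exp_closure x.
Proof.
move=> h e e0; have e2 : 0 < e / 2 by rewrite divr_gt0.
have [y cy hy] := h _ e2; have [u su hu] := cy _ e2.
by exists u => //; rewrite (le_lt_trans (hnorm_distD y _ _))// [e]splitr ltrD.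
Qed.

(* [f^{(x) n}] is the limit, as [z -> 0], of [sqrt(n!) z^-n] times the exponential
   vector [e(z f)] minus its first [n] terms. *)
Lemma exp_closure_tpow n f : L2 f -> exp_closure (tpow n f).
Proof.
move=> Lf; elim/ltn_ind: n => n IH; apply: exp_closure_lim => e e0.
pose a := \int[mu]_(s in @half_line R) cmod (f s) ^+ 2.
have a0 : 0 <= a by exact: L2_sqnorm_ge0.
(* After rescaling by [b], the part of [e(z f)] of degree above [n] has norm at most [C z], by
   [exp_sum_remainder]; [z <= 1] allows [expR a] to bound [expR (z ^+ 2 * a)]. *)
pose C := Num.sqrt (n`!%:R * (a ^+ n.+1 * expR a)).
have C0 : 0 <= C by exact: sqrtr_ge0.
have C1 : 0 < C + 1 by rewrite ltr_wpDl.
pose z := Num.min 1 (e / 2 / (C + 1)).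
have z0 : 0 < z by rewrite lt_min ltr01 !divr_gt0.
have z1 : z <= 1 by rewrite ge_min lexx.
have zf := square_integrableZ z%:C (@measurable_half_line R) Lf.
pose g s := z%:C * f s.
have az : \int[mu]_(s in @half_line R) cmod (g s) ^+ 2 = z ^+ 2 * a.
  rewrite /a -RintegralZl//; last by case: Lf.
  by apply: eq_Rintegral => s _; rewrite cmodM cmod_real (gtr0_norm z0) exprMn.
pose b : R := Num.sqrt n`!%:R / z ^+ n.
have fn0 : 0 < n`!%:R :> R by rewrite ltr0n fact_gt0.
have sn0 : Num.sqrt (n`!%:R : R) != 0 by rewrite gt_eqF// sqrtr_gt0.
have zn0 : z ^+ n != 0 by rewrite expf_neq0// gt_eqF.
have b0 : 0 <= b by rewrite divr_ge0 ?sqrtr_ge0// exprn_ge0// ltW.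
exists (b%:C *: (exp_vec F g - exp_partial g n)).
  have -> : b%:C *: (exp_vec F g - exp_partial g n) =
    \sum_(i <- [:: true; false]) (if i then b%:C else - b%:C) *:
      (if i then exp_vec F g else exp_partial g n).
    by rewrite !big_cons big_nil addr0 /= scaleNr scalerBr.
  apply: exp_closure_lin => -[]; first exact: exp_closure_exp.
  rewrite /exp_partial; have -> : \sum_(m < n) ((Num.sqrt (m`!%:R : R))^-1)%:C *: tpow m g =
    \sum_(m < n) (((Num.sqrt (m`!%:R : R))^-1)%:C * z%:C ^+ m) *: tpow m f.
    by apply: eq_bigr => i _; rewrite tpowZ// scalerA.
  by apply: exp_closure_lin => m; exact: IH.
have -> : tpow n f - b%:C *: (exp_vec F g - exp_partial g n) =
    - (b%:C *: (exp_vec F g - exp_partial g n.+1)).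
  rewrite /exp_partial big_ord_recr /= -/(exp_partial g n) tpowZ// opprD addrA.
  rewrite [in RHS]scalerBr opprB 2!scalerA (_ : _ * _ * _ = 1) ?scale1r//.
  rewrite -rmorphXn -!rmorphM -(rmorph1 (real_complex R)) /b; congr (_ %:C).
  by field; rewrite zn0 sn0.
rewrite hnormN hnormZ cmod_real (ger0_norm b0).
apply: (@le_lt_trans _ _ (C * z)); last first.
  apply: (@le_lt_trans _ _ (e / 2)); last lra.
  rewrite (@le_trans _ _ ((C + 1) * z))//; first by rewrite ler_wpM2r ?ltW// ltrDl.
  by rewrite mulrC -ler_pdivlMr// ge_min lexx orbT.
rewrite -(@ler_pXn2r _ 2) ?nnegrE ?mulr_ge0 ?hnorm_ge0 ?(ltW z0)//.
have eC : C ^+ 2 = n`!%:R * (a ^+ n.+1 * expR a).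
  by rewrite sqr_sqrtr// !mulr_ge0 ?expR_ge0 ?exprn_ge0 ?(ltW fn0).
have eb : b ^+ 2 = n`!%:R / z ^+ n ^+ 2.
  by rewrite /b exprMn exprVn sqr_sqrtr ?(ltW fn0).
rewrite [(b * _) ^+ 2]exprMn [(C * z) ^+ 2]exprMn eC eb exp_vec_partial// az.
have za0 : 0 <= z ^+ 2 * a by rewrite mulr_ge0 ?sqr_ge0.
have := exp_sum_remainder n.+1 za0.
have ez : expR (z ^+ 2 * a) <= expR a.
  by rewrite ler_expR ler_piMl// exprn_ile1// ltW.
set r := expR _ - _ => h.
have {}h : r <= (z ^+ 2 * a) ^+ n.+1 * expR a.
  by rewrite (le_trans h)// ler_wpM2l ?exprn_ge0.
apply: (@le_trans _ _ (n`!%:R / z ^+ n ^+ 2 * ((z ^+ 2 * a) ^+ n.+1 * expR a))).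
  by rewrite ler_wpM2l// divr_ge0 ?(ltW fn0)// sqr_ge0.
have -> : (z ^+ 2 * a) ^+ n.+1 = z ^+ n ^+ 2 * z ^+ 2 * a ^+ n.+1.
  by rewrite exprMn exprS -!exprM [in RHS]mulnC mulrC; ring.
rewrite le_eqVlt; apply/orP; left; apply/eqP; field.
  by rewrite zn0.
by rewrite invr_ge0 exprn_ge0// ltW.
Qed.

(** Polarization of symmetric tensors. Against a tensor of the [g i], both sides are [1 / n!] times
    the permanent of the matrix [<g i, f j>]: directly on the left, in Ryser's expansion on the
    right. *)
Lemma fock_tensor_polarization n (f : 'I_n -> R -> R[i]) : (forall i, L2 (f i)) ->
  fock_tensor F f = \sum_(S <- enum {set 'I_n})
    ((n`!%:R)^-1 * (-1) ^+ #|~: S|) *: tpow n (fun s => \sum_(j in S) f j s).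
Proof.
move=> Lf.
pose tens (q : {m & {h : 'I_m -> R -> R[i] | forall i, L2_half_line (h i)}}) : F :=
  fock_tensor F (sval (projT2 q)).
have dt : hdense (span_of tens).
  apply: (htotal_span (@fock_total _ F)) => _ [m [h [Lh ->]]].
  by exists (existT _ m (exist _ h Lh)).
have LS (S : {set 'I_n}) : L2 (fun s => \sum_(j in S) f j s).
  exact: square_integrable_sum.
apply: (inner_eq_span dt) => -[m [g Lg]]; rewrite /tens /=.
rewrite inner_sumr; have [mn|mn] := eqVneq m n; last first.
  rewrite fock_orthogonal// => [|i]; last exact/L2P/Lf.
  rewrite big1// => S _; rewrite innerZr fock_orthogonal ?mulr0// => i.
  exact/L2P/LS.
subst m; rewrite fock_inner// => [|i]; last exact/L2P/Lf.
have Lg' i : L2 (g i) by exact/L2P.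
transitivity ((n`!%:R)^-1 * \sum_(S : {set 'I_n}) (-1) ^+ #|~: S| *
    \prod_i \sum_(j in S) L2_inner (g i) (f j)).
  by rewrite ryser.
rewrite mulr_sumr big_enum /=; apply: eq_bigr => S _; rewrite innerZr -mulrA.
congr (_ * (_ * _)); rewrite fock_inner//; last by move=> i; exact/L2P/LS.
rewrite sumr_const -[#|_|]/#|'S_n| card_Sn -[X in _ * X]mulr_natl mulrA mulVf ?mul1r; last first.
  by rewrite pnatr_eq0 -lt0n fact_gt0.
apply: eq_bigr => i _; rewrite -L2_inner_conj// L2_inner_suml// rmorph_sum.
by apply: eq_bigr => j _; rewrite /= L2_inner_conj.
Qed.

Lemma exp_vec_total : hdense (span_of exp_family).
Proof.
pose tens (q : {m & {h : 'I_m -> R -> R[i] | forall i, L2_half_line (h i)}}) : F :=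
  fock_tensor F (sval (projT2 q)).
have dt : hdense (span_of tens).
  apply: (htotal_span (@fock_total _ F)) => _ [m [h [Lh ->]]].
  by exists (existT _ m (exist _ h Lh)).
apply: (span_of_trans dt) => -[m [h Lh]]; rewrite /tens /=.
have Lh' i : L2 (h i) by exact/L2P.
rewrite fock_tensor_polarization//; apply: exp_closure_lin => S.
by apply: exp_closure_tpow; exact: square_integrable_sum.
Qed.

End ExponentialVectors.

(** * Dyadic step functions *)

Section StepFunctions.
Variable R : realType.
Local Notation mu := (@lebesgue_measure R).
Local Notation TR := (measurableTypeR R).
Implicit Types (f g : R -> R[i]) (c : nat -> R[i]) (s : R) (k n j : nat).

Definition mesh k : R := (2 ^+ k)^-1.

Lemma mesh_gt0 k : 0 < mesh k.
Proof. by rewrite invr_gt0 exprn_gt0. Qed.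

Lemma mesh_le1 k : mesh k <= 1.
Proof. by rewrite invf_le1 ?exprn_gt0// exprn_ege1// ler1n. Qed.

Lemma meshS k m : mesh k = (2 ^ m)%:R * mesh (k + m).
Proof. by rewrite /mesh natrX exprD; field; rewrite !expf_neq0. Qed.

Lemma mesh_small (e : R) : 0 < e -> exists k0, forall k, (k0 <= k)%N -> mesh k < e.
Proof.
move=> e0; have [k0 hk] := inv_succ_lt e0; exists k0 => k /hk; apply: le_lt_trans.
rewrite lef_pV2 ?posrE ?exprn_gt0// -natrX ler_nat.
by elim: k => // k IH; rewrite expnS mul2n -addnn -addn1 leq_add// expn_gt0.
Qed.

Definition dint k j : set TR := `[j%:R * mesh k, j.+1%:R * mesh k[%classic.

Lemma measurable_dint k j : measurable (dint k j).
Proof. exact: measurable_itv. Qed.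

Lemma dintP k j s : dint k j s <-> j%:R * mesh k <= s < j.+1%:R * mesh k.
Proof. by rewrite /dint /= in_itv /=. Qed.

Lemma dint_lt k j i s : dint k j s -> s < i%:R * mesh k <-> (j < i)%N.
Proof.
move=> /dintP/andP[h1 h2]; split=> [h|h].
  have : j%:R * mesh k < i%:R * mesh k by apply: le_lt_trans h.
  by rewrite ltr_pM2r ?mesh_gt0// ltr_nat.
by apply: lt_le_trans h2 _; rewrite ler_pM2r ?mesh_gt0// ler_nat.
Qed.

Lemma dint_uniq k j i s : dint k j s -> dint k i s -> j = i.
Proof.
move=> hj hi; apply/eqP; rewrite eqn_leq; apply/andP; split; rewrite -ltnS.
  by apply/(dint_lt i.+1 hj); have /dintP/andP[] := hi.
by apply/(dint_lt j.+1 hi); have /dintP/andP[] := hj.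
Qed.

Lemma dint_exists k s : 0 <= s -> exists j, dint k j s.
Proof.
move=> s0; exists (Num.truncn (s / mesh k)); apply/dintP.
have h : 0 <= s / mesh k by rewrite divr_ge0// ltW// mesh_gt0.
by rewrite -ler_pdivlMr ?mesh_gt0// -ltr_pdivrMr ?mesh_gt0// truncn_itv.
Qed.

Lemma dint_half_line k j : dint k j `<=` half_line.
Proof.
move=> s /dintP/andP[h _]; rewrite /half_line /= in_itv /= andbT (le_trans _ h)//.
by rewrite mulr_ge0// ltW// mesh_gt0.
Qed.

Lemma dint_refine k m j s : dint (k + m) j s -> dint k (j %/ 2 ^ m) s.
Proof.
move=> /dintP/andP[h1 h2]; apply/dintP; rewrite (meshS k m) !mulrA -!natrM.
apply/andP; split.
  by apply: le_trans h1; rewrite ler_pM2r ?mesh_gt0// ler_nat leq_trunc_div.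
apply: (lt_le_trans h2); rewrite ler_pM2r ?mesh_gt0// ler_nat.
by rewrite mulSn addnC -ltn_subLR ?leq_trunc_div// {1}(divn_eq j (2 ^ m)) addKn ltn_mod expn_gt0.
Qed.

Lemma cintegrable_cutoff (D E : set TR) f : measurable D -> measurable E ->
  cintegrable (D `&` E) f -> cintegrable D (cutoff E f).
Proof.
move=> mD mE [ir ii].
have key (a : TR -> R) : rintegrable (D `&` E) a -> rintegrable D (a \_ E).
  by move=> /(integrable_restrict mu mE mD); apply: rintegrable_eq => s; rewrite !patchE; case: ifP.
split.
  by under eq_fun do rewrite Re_cutoff; exact: key.
by under eq_fun do rewrite Im_cutoff; exact: key.
Qed.

Definition step k n c : R -> R[i] := fun s => \sum_(j < n) cutoff (dint k j) (fun=> c j) s.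

Lemma step_in k n c j s : (j < n)%N -> dint k j s -> step k n c s = c j.
Proof.
move=> jn js; rewrite /step (bigD1 (Ordinal jn))//= cutoff_in// big1 ?addr0// => i ij.
rewrite cutoff_out// => /(dint_uniq js) e; move/eqP: ij; apply; exact/val_inj.
Qed.

Lemma step_out k n c j s : (n <= j)%N -> dint k j s -> step k n c s = 0.
Proof.
move=> jn js; rewrite /step big1// => i _; rewrite cutoff_out// => /(dint_uniq js) e.
by move: (ltn_ord i); rewrite -e ltnNge jn.
Qed.

Lemma square_integrable_cst_itv D z (i : interval R) : measurable D ->
  (exists a b : R, i = Interval (BLeft a) (BLeft b) \/ i = Interval (BLeft a) (BRight b)) ->
  square_integrable D (cutoff [set` i] (fun=> z)).
Proof.
move=> mD [a [b hi]].
have mi : measurable ([set` i] : set TR) by exact: measurable_itv.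
apply: square_integrable_cutoff => //; split; first exact: cmeasurable_cst.
apply: (rintegrableS (D := `[a, b]%classic)) => //.
- exact: measurableI.
- move=> s [_]; case: hi => ->; rewrite /= !in_itv /= => /andP[-> //].
  by move=> /ltW.
- exact: rintegrable_cst.
Qed.

Lemma square_integrable_step D k n c : measurable D -> square_integrable D (step k n c).
Proof.
move=> mD; apply: square_integrable_sum => // j.
by apply: (@square_integrable_cst_itv _ _ `[j%:R * mesh k, j.+1%:R * mesh k[) => //;
    exists (j%:R * mesh k), (j.+1%:R * mesh k); left.
Qed.

Lemma L2_step k n c : L2 (step k n c).
Proof. exact: square_integrable_step. Qed.

Lemma cintegral_cst_dint z k j : cintegral (dint k j) (fun=> z) = z * (mesh k)%:C.
Proof.
have hm : mu (dint k j) = (mesh k)%:E.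
  have h := @lebesgue_measure_itv R `[j%:R * mesh k, j.+1%:R * mesh k[.
  rewrite [LHS]h /= lte_fin ltr_pM2r ?mesh_gt0// ltr_nat ltnSn -EFinB -mulrBl -natr1.
  by rewrite addrAC subrr add0r mul1r.
apply: complex_eq; rewrite /cintegral /= ?ReM ?ImM /= mulr0 ?subr0 ?add0r ?addr0;
  rewrite Rintegral_cst; try exact: measurable_dint;
  by congr (_ * _); transitivity (fine (mesh k)%:E); [rewrite -hm|].
Qed.

(** Prescribed cell values followed by an untouched tail. With the tails fixed, scalar products of
    the exponential vectors depend on the words only through [seq_inner]. *)
Definition splice k (A : seq R[i]) g : R -> R[i] := fun s =>
  step k (size A) (nth 0 A) s + cutoff `[(size A)%:R * mesh k, +oo[ g s.

Lemma L2_splice k A g : L2 g -> L2 (splice k A g).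
Proof.
move=> Lg; apply: square_integrableD => //; first exact: L2_step.
have mT : measurable (`[(size A)%:R * mesh k, +oo[%classic : set TR) by exact: measurable_itv.
apply: (square_integrable_cutoff _ mT) => //.
by apply: (square_integrableS _ _ _ Lg) => //; exact: measurableI.
Qed.

Lemma splice_in k A g j s : (j < size A)%N -> dint k j s -> splice k A g s = nth 0 A j.
Proof.
move=> jA js; rewrite /splice (step_in _ jA js) cutoff_out ?addr0//.
rewrite /= in_itv /= andbT leNgt; apply/negP; rewrite negbK.
exact/(dint_lt _ js).
Qed.

Lemma splice_out k A g j s : (size A <= j)%N -> dint k j s -> splice k A g s = g s.
Proof.
move=> jA js; rewrite /splice (step_out _ jA js) add0r cutoff_in//= in_itv /= andbT.
by rewrite leNgt; apply/negP => /(dint_lt _ js); rewrite ltnNge jA.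
Qed.

Definition seq_inner (A B : seq R[i]) := \sum_(p <- zip A B) Num.conj p.1 * p.2.

Lemma seq_inner_cat A B A' B' : size A = size A' ->
  seq_inner (A ++ B) (A' ++ B') = seq_inner A A' + seq_inner B B'.
Proof. by move=> h; rewrite /seq_inner zip_cat// big_cat. Qed.

Lemma seq_innerE A B : size A = size B ->
  seq_inner A B = \sum_(j < size A) Num.conj (nth 0 A j) * nth 0 B j.
Proof.
move=> h; rewrite /seq_inner (big_nth (0, 0)) size_zip -h minnn big_mkord.
by apply: eq_bigr => i _; rewrite nth_zip.
Qed.

Lemma L2_inner_splice k A B f g : size A = size B -> L2 f -> L2 g ->
  L2_inner (splice k A f) (splice k B g) = seq_inner A B * (mesh k)%:C +
  cintegral `[(size A)%:R * mesh k, +oo[ (fun s => Num.conj (f s) * g s).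
Proof.
move=> AB Lf Lg; rewrite /L2_inner.
pose T : set TR := `[(size A)%:R * mesh k, +oo[%classic.
have mT : measurable T by exact: measurable_itv.
have sT : half_line `&` T = T.
  apply/seteqP; split=> [s []//|s sT]; split=> //; move: sT.
  rewrite /T /half_line /= !in_itv /= !andbT; apply: le_trans.
  by rewrite mulr_ge0// ltW// mesh_gt0.
have LT h : L2 h -> square_integrable T h.
  by move=> Lh; apply: square_integrableS Lh => //; rewrite -sT; exact: subIsetl.
transitivity (cintegral half_line (fun s =>
  step k (size A) (fun j => Num.conj (nth 0 A j) * nth 0 B j) s +
  cutoff T (fun s => Num.conj (f s) * g s) s)).
  apply: eq_cintegral => s; rewrite inE /= in_itv /= andbT => /(dint_exists k)[j js].
  have [jA|jA] := ltnP j (size A).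
    rewrite !(@splice_in _ _ _ j)// -?AB// (step_in _ jA js) cutoff_out ?addr0//.
    rewrite /T /= in_itv /= andbT leNgt; apply/negP; rewrite negbK.
    exact/(dint_lt _ js).
  rewrite !(@splice_out _ _ _ j)// -?AB// (step_out _ jA js) add0r cutoff_in//.
  rewrite /T /= in_itv /= andbT leNgt; apply/negP => /(dint_lt _ js).
  by rewrite ltnNge jA.
have ci : cintegrable half_line (cutoff T (fun s => Num.conj (f s) * g s)).
  by apply: cintegrable_cutoff => //; rewrite sT; exact: inner_integrable (LT _ Lf) (LT _ Lg).
have cstep j (z : R[i]) : cintegrable half_line (cutoff (dint k j) (fun=> z)).
  apply: cintegrable_cutoff => //; first exact: measurable_dint.
  rewrite setIidr; last exact: dint_half_line.
  have sub : dint k j `<=` `[j%:R * mesh k, j.+1%:R * mesh k].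
    by move=> s /dintP/andP[h1 h2]; rewrite /= in_itv /= h1 ltW.
  by split; apply: (rintegrableS _ _ sub (rintegrable_cst _ _ _)) => //; exact: measurable_dint.
rewrite cintegralD//; last by apply: cintegrable_sum => // i; exact: cstep.
rewrite cintegral_cutoff [_ `&` _]sT; congr (_ + _).
rewrite cintegral_sum//.
rewrite seq_innerE// mulr_suml; apply: eq_bigr => j _.
rewrite cintegral_cutoff setIidr ?cintegral_cst_dint//; exact: dint_half_line.
Qed.

End StepFunctions.

(** * Density of dyadic step functions *)

Section StepDensity.
Variables (R : realType) (F : fock R).
Local Notation mu := (@lebesgue_measure R).
Local Notation TR := (measurableTypeR R).
Local Notation ι := (@one_particle R F).
Implicit Types (f g : R -> R[i]) (D E : set TR).

Lemma small_Rintegral D (u : nat -> TR -> R) (b : TR -> R) (e : R) : measurable D ->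
  (forall n, measurable_fun D (u n)) -> (forall n s, D s -> `|u n s| <= b s) ->
  rintegrable D b -> (forall s, D s -> u ^~ s @ \oo --> (0 : R)) -> 0 < e ->
  exists N, forall n, (N <= n)%N -> \int[mu]_(s in D) u n s < e.
Proof.
move=> mD mu_ ub ib u0 e0.
have [|||||_ _ h] := @dominated_convergence _ _ R mu D mD (fun n => EFin \o u n)
    (fun=> 0%E) (EFin \o b).
- by move=> n; exact/measurable_EFinP.
- exact: measurable_cst.
- by apply: aeW => s Ds; apply: cvg_EFin; [near=> n | exact: u0].
- exact: ib.
- by apply: aeW => s n Ds /=; rewrite lee_fin ub.
rewrite integral0 in h.
move/fine_cvg : h => /cvgrPdist_lt /(_ _ e0)[N _ hN].
exists N => n /hN; rewrite sub0r normrN; apply: le_lt_trans.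
exact: ler_norm.
Unshelve. all: by end_near. Qed.

Lemma one_particle_dist f g : L2 f -> L2 g ->
  hnorm (ι f - ι g) ^+ 2 = \int[mu]_(s in half_line) cmod (f s - g s) ^+ 2.
Proof.
by move=> Lf Lg; rewrite -one_particleB// one_particle_sqnorm//; exact: square_integrableB.
Qed.

Lemma L2_measurable_cmod2 f : L2 f -> measurable_fun half_line (fun s => cmod (f s) ^+ 2).
Proof. by move=> [mf _]; apply: measurable_funX; exact: measurable_cmod. Qed.

Lemma small_L2_dist f (g : nat -> R -> R[i]) (b : TR -> R) (e : R) : L2 f ->
  (forall n, L2 (g n)) -> rintegrable half_line b ->
  (forall n s, half_line s -> cmod (f s - g n s) ^+ 2 <= b s) ->
  (forall s, half_line s -> (fun n => cmod (f s - g n s)) @ \oo --> (0 : R)) -> 0 < e ->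
  exists N, forall n, (N <= n)%N -> hnorm (ι f - ι (g n)) < e.
Proof.
move=> Lf Lg ib hb h0 e0; have e2 : 0 < e ^+ 2 by rewrite exprn_gt0.
have LB n : L2 (fun s => f s - g n s) by apply: square_integrableB => //; exact: Lg.
have [|||N hN] := @small_Rintegral half_line (fun n s => cmod (f s - g n s) ^+ 2) b
    (e ^+ 2) (@measurable_half_line R) _ _ ib _ e2.
- by move=> n; exact: L2_measurable_cmod2.
- by move=> n s Ds; rewrite ger0_norm ?sqr_ge0// hb.
- move=> s Ds; rewrite -[X in _ --> X](expr0n _ 2).
  by under eq_fun do rewrite expr2; rewrite expr2; apply: cvgM; exact: h0.
exists N => n /hN h; rewrite -(@ltr_pXn2r _ 2) ?nnegrE ?hnorm_ge0 ?(ltW e0)//.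
by rewrite one_particle_dist.
Qed.

Definition trunc_set f (m : nat) : set TR :=
  half_line `&` [set s | cmod (f s) <= m%:R] `&` `[0, m%:R[.

Lemma measurable_trunc_set f m : L2 f -> measurable (trunc_set f m).
Proof.
move=> [mf _]; apply: measurableI; last exact: measurable_itv.
have := measurable_cmod mf (@measurable_half_line R) (measurable_itv `]-oo, m%:R]).
by congr measurable; apply/seteqP; split=> s []; rewrite /= in_itv /=.
Qed.

Lemma L2_cutoff f E : L2 f -> measurable E -> L2 (cutoff E f).
Proof.
move=> Lf mE; apply: square_integrable_cutoff => //.
by apply: (square_integrableS _ _ _ Lf) => //; exact: measurableI.
Qed.

Lemma truncation_dense f (e : R) : L2 f -> 0 < e ->
  exists m, hnorm (ι f - ι (cutoff (trunc_set f m) f)) < e.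
Proof.
move=> Lf e0.
have [||||N hN] := @small_L2_dist f (fun m => cutoff (trunc_set f m) f)
    (fun s => cmod (f s) ^+ 2) e Lf _ _ _ _ e0.
- by move=> m; apply: L2_cutoff => //; exact: measurable_trunc_set.
- by case: Lf.
- move=> n s _; rewrite /cutoff; case: ifP => _; last by rewrite subr0.
  by rewrite subrr cmod0 expr0n sqr_ge0.
- move=> s Ds; apply/cvgrPdist_lt => d d0.
  pose M := (Num.truncn (cmod (f s)) + Num.truncn s).+1.
  exists M => // n /= Mn; rewrite sub0r normrN cutoff_in ?subrr ?cmod0 ?normr0//.
  have tl (x : R) : (Num.truncn x <= M.-1)%N -> x < n%:R.
    move=> h; apply: (lt_le_trans (truncnS_gt x)); rewrite ler_nat.
    by apply: leq_trans Mn; rewrite /M ltnS.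
  split; [split=> //|]; first by apply/ltW/tl; rewrite leq_addr.
  move: Ds; rewrite /half_line /= !in_itv /= andbT => ->.
  by rewrite tl// leq_addl.
by exists N; exact: hN.
Qed.

(** An [L^1] approximation by a continuous function is clipped to [[-M, M]]. Clipping does not
    increase the distance to [a], and then [(a - h)^2 <= 2 M |a - h|] upgrades [L^1] to [L^2]. *)
Lemma continuous_dense_real (m : nat) (a : TR -> R) (M e : R) :
  measurable_fun (`[0%R, m%:R[%classic : set TR) a -> 0 < e -> 0 <= M ->
  (forall s, `[0, m%:R[%classic s -> `|a s| <= M) ->
  exists h : R -> R, [/\ continuous h, forall s, `|h s| <= M &
    \int[mu]_(s in `[0, m%:R[) ((a s - h s) ^+ 2) < e].
Proof.
move=> ma e0 M0 aM; set E : set TR := `[0, m%:R[%classic in ma aM *.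
have mE : measurable E by exact: measurable_itv.
have cE (z : R) : rintegrable E (fun=> z).
  apply: (rintegrableS (D := `[0, m%:R]%classic)) => //; last exact: rintegrable_cst.
  by move=> s; rewrite /E /= !in_itv /= => /andP[-> /ltW].
have ia : rintegrable E a by exact: rintegrable_le (cE M).
have fE : (mu E < +oo)%E.
  have h := @lebesgue_measure_itv R `[0, m%:R[.
  by rewrite [X in (X < _)%E]h /=; case: ifP; rewrite ?ltry// -EFinB ltry.
have [g [cg ig g0]] := approximation_continuous_integrable mE fE ia.
pose clip x := Num.max (- M) (Num.min M x).
have clipM x : `|clip x| <= M.
  rewrite /clip; case: (leP M x) => h1; case: (leP (- M)) => h2; rewrite ler_norml;
    by apply/andP; split; lra.
have clip_dist x y : `|x| <= M -> `|x - clip y| <= `|x - y|.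
  rewrite ler_norml => /andP[x1 x2]; rewrite /clip.
  have := ler_norm (x - y); have := ler_norm (- (x - y)); rewrite normrN => n1 n2.
  by case: (leP M y) => My; case: (leP (- M)) => h; rewrite ler_norml; apply/andP; split; lra.
have ih n : rintegrable E (fun s => (a s - clip (g n s)) ^+ 2).
  apply: (rintegrable_le mE _ _ (cE ((M + M) ^+ 2))).
    apply: measurable_funX; apply: measurable_funB => //.
    apply: measurable_maxr; first exact: measurable_cst.
    apply: measurable_minr; first exact: measurable_cst.
    exact: rintegrable_measurable (ig n).
  move=> s Es; rewrite normrX ler_pXn2r ?nnegrE ?addr_ge0//.
  by rewrite (le_trans (ler_normB _ _))// lerD ?aM ?clipM.
have M1 : 0 < 2 * M + 1 by rewrite ltr_wpDl// mulr_ge0.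
move/fine_cvg : g0 => /cvgrPdist_lt /(_ _ (divr_gt0 e0 M1))[N _ hN].
have {}hN := hN N (leqnn N); rewrite sub0r normrN in hN.
exists (fun s => clip (g N s)); split=> // [|].
  have cst_c (z : R) : continuous (fun _ : R => z) by move=> s; exact: cvg_cst.
  exact: (max_fun_continuous (cst_c (- M)) (min_fun_continuous (cst_c M) (cg N))).
have iN : rintegrable E (fun s => `|a s - g N s|).
  apply: rintegrable_eq (integrable_abse (integrableB mE ia (ig N))) => s /=.
  by [].
apply: (@le_lt_trans _ _ ((2 * M) * \int[mu]_(s in E) `|a s - g N s|)).
  rewrite -RintegralZl//; apply: le_Rintegral => //; [exact: ih|exact: rintegrableZ|].
  move=> s Es; rewrite -[leLHS]ger0_norm ?sqr_ge0// normrX expr2 ler_pM//.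
    by rewrite (le_trans (ler_normB _ _))// mulr_natl mulr2n lerD ?aM ?clipM.
  exact/clip_dist/aM.
have i0 : 0 <= \int[mu]_(s in E) `|a s - g N s| by apply: Rintegral_ge0 => s _.
apply: (@le_lt_trans _ _ ((2 * M + 1) * \int[mu]_(s in E) `|a s - g N s|)).
  by rewrite ler_wpM2r// lerDl.
rewrite mulrC -ltr_pdivlMr//; apply: le_lt_trans hN.
exact: ler_norm.
Qed.

(** Three approximations: truncation of support and range, continuity on [[0, m[], sampling at the
    left ends of the cells. The last converges pointwise by continuity, and is dominated since
    samples and function are both at most [2 m] in modulus. *)
Lemma step_dense f (e : R) : L2 f -> 0 < e ->
  exists k n c, hnorm (ι f - ι (step k n c)) < e.
Proof.
move=> Lf e0; have e3 : 0 < e / 3 by rewrite divr_gt0.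
have [m hm] := truncation_dense Lf e3.
set f1 := cutoff (trunc_set f m) f in hm.
have mT := measurable_trunc_set m Lf.
have L1 : L2 f1 by exact: L2_cutoff.
pose E : set TR := `[0, m%:R[%classic.
have mE : measurable E by exact: measurable_itv.
have EH : E `<=` half_line.
  by move=> s; rewrite /E /half_line /= !in_itv /= andbT => /andP[].
have f1M s : cmod (f1 s) <= m%:R.
  rewrite /f1 /cutoff; case: ifPn => [|_]; last by rewrite cmod0.
  by rewrite inE => -[[]].
have f1E s : half_line s -> ~ E s -> f1 s = 0.
  by move=> Ds nE; rewrite /f1 cutoff_out// => -[_].
have e4 : 0 < (e / 3) ^+ 2 / 2 by rewrite divr_gt0// exprn_gt0.
have [|||hr [cr rM hr2]] := @continuous_dense_real m (fun s => complex.Re (f1 s)) m%:R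
    ((e / 3) ^+ 2 / 2) _ e4.
- by have [[mr _] _] := L1; exact: measurable_funS (@measurable_half_line R) EH mr.
- exact: ler0n.
- by move=> s _; exact: le_trans (norm_Re_le _) (f1M s).
have [|||hi [ci iM hi2]] := @continuous_dense_real m (fun s => complex.Im (f1 s)) m%:R
    ((e / 3) ^+ 2 / 2) _ e4.
- by have [[_ mi] _] := L1; exact: measurable_funS (@measurable_half_line R) EH mi.
- exact: ler0n.
- by move=> s _; exact: le_trans (norm_Im_le _) (f1M s).
pose h s := Complex (hr s) (hi s).
have hM s : cmod (h s) <= m%:R + m%:R.
  by apply: (le_trans (cmod_le_ReIm _)); apply: lerD; [exact: rM|exact: iM].
have cE (z : R) : rintegrable E (fun=> z).
  apply: (rintegrableS (D := `[0, m%:R]%classic)) => //; last exact: rintegrable_cst.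
  by move=> s; rewrite /E /= !in_itv /= => /andP[-> /ltW].
have mh : cmeas E h.
  by split; apply: measurable_funTS; exact: continuous_measurable_fun.
have sqh : square_integrable E h.
  split=> //; apply: (rintegrable_le mE _ _ (cE ((m%:R + m%:R) ^+ 2))).
    by apply: measurable_funX; exact: measurable_cmod.
  by move=> s _; rewrite normrX ler_pXn2r ?nnegrE ?addr_ge0// ger0_norm ?cmod_ge0.
pose f2 := cutoff E h.
have L22 : L2 f2.
  by apply: square_integrable_cutoff => //; rewrite setIidr.
have d12 : hnorm (ι f1 - ι f2) < e / 3.
  rewrite -(@ltr_pXn2r _ 2) ?nnegrE ?hnorm_ge0 ?(ltW e3)// one_particle_dist//.
  have -> : \int[mu]_(s in half_line) cmod (f1 s - f2 s) ^+ 2 =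
      \int[mu]_(s in E) (cmod (f1 s - h s) ^+ 2).
    rewrite -[in RHS](setIidr EH) Rintegral_mkcondr; apply: eq_Rintegral => s.
    rewrite inE patchE => Ds; case: ifPn => sE.
      by rewrite /f2 cutoff_in//; move: sE; rewrite inE.
    have nE : ~ E s by move=> Es; move: sE; rewrite mem_set.
    by rewrite /f2 cutoff_out// (f1E s Ds nE) subrr cmod0 expr0n.
  have LE1 := square_integrableS (@measurable_half_line R) mE EH L1.
  have [[mr ir] [mi ii]] := (square_integrable_ReIm _ mE).1 (square_integrableB mE LE1 sqh).
  have -> : \int[mu]_(s in E) (cmod (f1 s - h s) ^+ 2) =
      \int[mu]_(s in E) ((complex.Re (f1 s) - hr s) ^+ 2) +
      \int[mu]_(s in E) ((complex.Im (f1 s) - hi s) ^+ 2).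
    rewrite -RintegralD//; last first.
    - by apply: eq_rintegrable ii => // s _; rewrite ImD ImN.
    - by apply: eq_rintegrable ir => // s _; rewrite ReD ReN.
    by apply: eq_Rintegral => s _; rewrite cmod_sqr ReD ImD ReN ImN.
  by rewrite [ltRHS]splitr ltrD.
pose c k j := h (j%:R * mesh R k).
have LS k : L2 (step k (m * 2 ^ k) (c k)) by exact: L2_step.
have hE k s j : dint k j s -> (j < m * 2 ^ k)%N <-> E s.
  move=> js; rewrite -(dint_lt _ js) natrM natrX /mesh mulfK ?expf_neq0//.
  rewrite /E /= in_itv /=; split=> [->|/andP[]//].
  by have := dint_half_line js; rewrite /half_line /= in_itv /= andbT => ->.
have sval k s j : dint k j s -> E s -> step k (m * 2 ^ k) (c k) s = c k j.
  by move=> js Es; rewrite (step_in _ _ js)//; apply/(hE k s j js).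
have sval0 k s j : dint k j s -> ~ E s -> step k (m * 2 ^ k) (c k) s = 0.
  move=> js Es; rewrite (step_out _ _ js)// leqNgt; apply/negP => /(hE k s j js) //.
have [|||N hN] := @small_L2_dist f2 (fun k => step k (m * 2 ^ k) (c k))
    (fun s => if s \in E then (4 * m%:R) ^+ 2 else 0) (e / 3) L22 LS _ _ _ e3.
- have := (integrable_restrict mu mE (@measurable_half_line R)
    (EFin \o (fun=> (4 * m%:R) ^+ 2))).1.
  rewrite setIidr// => /(_ (cE _)); apply: rintegrable_eq => s.
  by rewrite patchE; case: ifP.
- move=> k s; rewrite {1}/half_line /= in_itv /= andbT => /(dint_exists k)[j js].
  case: ifPn => [|sE].
    rewrite inE => Es; rewrite /f2 cutoff_in// (sval k s j)//.
    rewrite ler_pXn2r ?nnegrE ?cmod_ge0 ?mulr_ge0// (le_trans (cmodB _ _))//.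
    have := hM s; have := hM (j%:R * mesh R k); rewrite /c; lra.
  have nE : ~ E s by move=> Es; move: sE; rewrite mem_set.
  by rewrite /f2 cutoff_out// (sval0 k s j)// subrr cmod0 expr0n.
- move=> s Ds; have [Es|nE] := pselect (E s); last first.
    apply/cvgrPdist_lt => d d0; exists 0%N => // k _ /=.
    have := Ds; rewrite {1}/half_line /= in_itv /= andbT => /(dint_exists k)[j js].
    by rewrite /f2 cutoff_out// (sval0 k s j)// subrr cmod0 subr0 normr0.
  apply/cvgrPdist_lt => d d0; have d2 : 0 < d / 2 by rewrite divr_gt0.
  have [r1 /= r10 hr1] := (iffLR (cvgrPdist_lt _ _) (cr s)) _ d2.
  have [r2 /= r20 hr3] := (iffLR (cvgrPdist_lt _ _) (ci s)) _ d2.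
  have r0 : 0 < Num.min r1 r2 by rewrite lt_min r10.
  have [k0 hk0] := mesh_small r0.
  exists k0 => // k /= kk; rewrite sub0r normrN ger0_norm ?cmod_ge0//.
  have := Ds; rewrite {1}/half_line /= in_itv /= andbT => /(dint_exists k)[j js].
  rewrite /f2 cutoff_in// (sval k s j)// (le_lt_trans (cmod_le_ReIm _))//.
  rewrite /c /h /= [ltRHS]splitr.
  have cl : `|s - j%:R * mesh R k| < Num.min r1 r2.
    apply: le_lt_trans (hk0 k kk); have /dintP/andP[j1 j2] := js.
    rewrite ger0_norm ?subr_ge0// lerBlDl (le_trans (ltW j2))// -natr1 mulrDl mul1r//.
  by move: cl; rewrite lt_min => /andP[? ?]; rewrite ltrD// ?hr1 ?hr3.
exists N, (m * 2 ^ N)%N, (c N).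
have -> : ι f - ι (step N (m * 2 ^ N) (c N)) =
   (ι f - ι f1) + (ι f1 - ι f2) + (ι f2 - ι (step N (m * 2 ^ N) (c N))).
  by rewrite !addrA !subrK.
apply: (le_lt_trans (hnormD _ _)).
have := hnormD (ι f - ι f1) (ι f1 - ι f2); move: hm d12 (hN N (leqnn N)); clear.
move: (hnorm _) (hnorm _) (hnorm _) (hnorm _) => x y z w; lra.
Qed.

End StepDensity.

(** * Euler steps on sesquilinear forms *)

Section LocalOperators.
Variables (R : realType) (H : hilbert R) (W : set H).
Hypothesis W_lin : forall a u v, W u -> W v -> W (a *: u + v).
Implicit Types (A B : H -> H) (u v : H) (a b : R).

(** Linearity and boundedness are required on [W] only. The operators to which this is applied are
    values of graphs, set to 0 outside the domain, and in general are not linear on [H]. *)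
Definition local_op a A := [/\ 0 <= a, forall u, W u -> W (A u),
  forall z u v, W u -> W v -> A (z *: u + v) = z *: A u + A v
  & forall u, W u -> hnorm (A u) <= a * hnorm u].

Lemma local_op_id : local_op 1 id.
Proof. by split=> // u _; rewrite mul1r. Qed.

Lemma local_op_comb z a b A B : local_op a A -> local_op b B ->
  local_op (cmod z * a + b) (fun u => z *: A u + B u).
Proof.
move=> [a0 WA lA nA] [b0 WB lB nB]; split.
- by rewrite addr_ge0// mulr_ge0// cmod_ge0.
- by move=> u Wu; apply: W_lin; [exact: WA | exact: WB].
- move=> y u v Wu Wv; rewrite lA// lB// !scalerDr !scalerA addrACA.
  by rewrite [z * y]mulrC.
- move=> u Wu; rewrite (le_trans (hnormD _ _))// hnormZ mulrDl lerD ?nB//.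
  by rewrite -mulrA ler_wpM2l ?cmod_ge0 ?nA.
Qed.

Lemma local_op_comp a b A B : local_op a A -> local_op b B -> local_op (a * b) (A \o B).
Proof.
move=> [a0 WA lA nA] [b0 WB lB nB]; split=> /=.
- exact: mulr_ge0.
- by move=> u Wu; exact/WA/WB.
- by move=> z u v Wu Wv; rewrite lB// lA//; exact: WB.
- by move=> u Wu; rewrite (le_trans (nA _ (WB _ Wu)))// -mulrA ler_wpM2l ?nB.
Qed.

Lemma local_op_le a b A : a <= b -> local_op a A -> local_op b A.
Proof.
move=> ab [a0 WA lA nA]; split=> //; first exact: le_trans ab.
by move=> u Wu; rewrite (le_trans (nA _ Wu))// ler_wpM2r ?hnorm_ge0.
Qed.

Lemma local_op_iter a A p : local_op a A -> local_op (a ^+ p) (iter p A).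
Proof.
move=> hA; elim: p => [|p IH]; first exact: local_op_id.
by rewrite exprS; exact: local_op_comp.
Qed.

Lemma local_opZ a A z u : local_op a A -> W u -> A (z *: u) = z *: A u.
Proof.
move=> [_ _ lA _] Wu; have W0 : W 0 by have := W_lin (-1) Wu Wu; rewrite scaleN1r addNr.
have A0 : A 0 = 0 by have := lA (-1) 0 0 W0 W0; rewrite !scaleN1r oppr0 addr0 addNr.
by have := lA z u 0 Wu W0; rewrite !addr0 A0 addr0.
Qed.

Lemma local_opD a A u v : local_op a A -> W u -> W v -> A (u + v) = A u + A v.
Proof. by move=> [_ _ lA _] Wu Wv; have := lA 1 u v Wu Wv; rewrite !scale1r. Qed.

Lemma W_scale z u : W u -> W (z *: u).
Proof.
move=> Wu; have W0 : W 0 by have := W_lin (-1) Wu Wu; rewrite scaleN1r addNr.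
by have := W_lin z Wu W0; rewrite addr0.
Qed.

Lemma W_add u v : W u -> W v -> W (u + v).
Proof. by move=> Wu /(W_lin 1 Wu); rewrite scale1r. Qed.

Definition form := H -> H -> R[i].
Implicit Types (phi psi : form) (S L : form -> form).

Definition sesquilinear_on phi :=
  (forall z u u' v, W u -> W u' -> W v ->
     phi (z *: u + u') v = Num.conj z * phi u v + phi u' v) /\
  (forall z u v v', W u -> W v -> W v' ->
     phi u (z *: v + v') = z * phi u v + phi u v').

Definition form_bound (M : R) phi := 0 <= M /\
  forall u v, W u -> W v -> cmod (phi u v) <= M * (hnorm u * hnorm v).

Definition form_comb z phi psi : form := fun u v => z * phi u v + psi u v.

Lemma sesquilinear_comb z phi psi : sesquilinear_on phi -> sesquilinear_on psi ->
  sesquilinear_on (form_comb z phi psi).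
Proof.
move=> [l1 r1] [l2 r2]; rewrite /form_comb; split=> y u u' v Wu Wu' Wv.
  by rewrite l1// l2//; ring.
by rewrite r1// r2//; ring.
Qed.

Lemma sesquilinear_comp phi a b A B : local_op a A -> local_op b B ->
  sesquilinear_on phi -> sesquilinear_on (fun u v => phi (A u) (B v)).
Proof.
move=> [a0 WA lA nA] [b0 WB lB nB] [l1 r1]; split=> z u u' v Wu Wu' Wv.
  by rewrite lA// l1//; [exact: WA|exact: WA|exact: WB].
by rewrite lB// r1//; [exact: WA|exact: WB|exact: WB].
Qed.

Lemma form_bound_comb z M N phi psi : form_bound M phi -> form_bound N psi ->
  form_bound (cmod z * M + N) (form_comb z phi psi).
Proof.
move=> [M0 hM] [N0 hN]; split; first by rewrite addr_ge0// mulr_ge0// cmod_ge0.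
move=> u v Wu Wv; rewrite (le_trans (cmodD _ _))// cmodM mulrDl lerD ?hN//.
by rewrite -mulrA ler_wpM2l ?cmod_ge0 ?hM.
Qed.

Lemma form_bound_comp M phi a b A B : local_op a A -> local_op b B ->
  form_bound M phi -> form_bound (M * (a * b)) (fun u v => phi (A u) (B v)).
Proof.
move=> [a0 WA lA nA] [b0 WB lB nB] [M0 hM]; split; first by rewrite !mulr_ge0.
move=> u v Wu Wv; rewrite (le_trans (hM _ _ (WA _ Wu) (WB _ Wv)))//.
rewrite -mulrA ler_wpM2l// mulrACA ler_pM ?hnorm_ge0 ?nA ?nB//.
Qed.

Lemma form_bound_le M N phi : M <= N -> form_bound M phi -> form_bound N phi.
Proof.
move=> MN [M0 hM]; split=> [|u v Wu Wv]; first exact: le_trans MN.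
by rewrite (le_trans (hM _ _ Wu Wv))// ler_wpM2r// mulr_ge0 ?hnorm_ge0.
Qed.

Lemma form_bound_ext M phi psi : (forall u v, W u -> W v -> phi u v = psi u v) ->
  form_bound M phi -> form_bound M psi.
Proof. by move=> e [M0 hM]; split=> // u v Wu Wv; rewrite -e// hM. Qed.

(* One time step [S] of length [h] agrees with [1 + h L] up to [c h^2]. *)
Definition euler_step (h c b : R) S L :=
  [/\ forall phi, sesquilinear_on phi -> sesquilinear_on (S phi),
      forall phi, sesquilinear_on phi -> sesquilinear_on (L phi),
      forall z phi psi u v, S (form_comb z phi psi) u v = z * S phi u v + S psi u v,
      forall z phi psi u v, L (form_comb z phi psi) u v = z * L phi u v + L psi u v
    & forall phi M, sesquilinear_on phi -> form_bound M phi ->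
      form_bound (M * b) (L phi) /\
      form_bound (M * (c * h ^+ 2)) (fun u v => S phi u v - phi u v - h%:C * L phi u v)].

Lemma euler_step_bound h c b S L phi M : 0 <= h <= 1 -> 0 <= b -> 0 <= c ->
  euler_step h c b S L -> sesquilinear_on phi -> form_bound M phi ->
  form_bound (M * (h * (b + c))) (form_comb (-1) phi (S phi)).
Proof.
move=> /andP[h0 h1] b0 c0 [sS sL lS lL eS] sp bp; have [bL bE] := eS _ _ sp bp.
have M0 : 0 <= M by case: bp.
have := form_bound_comb h%:C bL bE.
rewrite cmod_real (ger0_norm h0) => hh.
apply: form_bound_ext (form_bound_le _ hh) => [u v _ _|]; first by rewrite /form_comb; ring.
rewrite mulrCA -mulrDr ler_wpM2l// mulrDr lerD2l mulrC ler_wpM2r// expr2.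
by rewrite ler_piMr.
Qed.

Lemma euler_step_bound1 h c b S L phi M : 0 <= h <= 1 -> 0 <= b -> 0 <= c ->
  euler_step h c b S L -> sesquilinear_on phi -> form_bound M phi ->
  form_bound (M * (1 + h * (b + c))) (S phi).
Proof.
move=> h01 b0 c0 eS sp bp; have h2 := euler_step_bound h01 b0 c0 eS sp bp.
have := form_bound_comb 1 bp h2; rewrite cmod1 mul1r => hh.
apply: form_bound_ext (form_bound_le _ hh) => [u v _ _|]; first by rewrite /form_comb; ring.
by rewrite [leRHS]mulrDr mulr1.
Qed.

(** [c] is the error of single steps, [b * (b + c)] that of keeping the initial form inside [L], and
    [expR (b + c)] bounds the growth [(1 + h (b + c))^p] for [p h <= 1]. *)
Definition power_const (c b : R) := (c + b * (b + c)) * expR (b + c).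

Lemma power_const_ge0 c b : 0 <= c -> 0 <= b -> 0 <= power_const c b.
Proof. by move=> c0 b0; rewrite mulr_ge0 ?expR_ge0// addr_ge0// mulr_ge0// addr_ge0. Qed.

Lemma exp_step_bound (x : R) p : 0 <= x -> (1 + x) ^+ p <= expR (p%:R * x).
Proof.
move=> x0; rewrite mulrC expRM_natr.
by apply: lerXn2r; rewrite ?nnegrE ?expR_ge0 ?addr_ge0 ?expR_ge1Dx.
Qed.

Lemma euler_step_power h c b S L p phi M : 0 <= h -> p%:R * h <= 1 -> 0 <= b -> 0 <= c ->
  euler_step h c b S L -> sesquilinear_on phi -> form_bound M phi ->
  form_bound (M * (power_const c b * (p%:R * h) ^+ 2))
    (fun u v => iter p S phi u v - phi u v - (p%:R * h)%:C * L phi u v).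
Proof.
move=> h0 ph1 b0 c0 eS.
have [->|p0] := posnP p.
  move=> _ [M0 _]; rewrite mul0r; apply: form_bound_le (conj (lexx 0) _).
    by rewrite expr0n /= !mulr0.
  by move=> u v _ _; rewrite subrr mul0r subr0 cmod0 mul0r.
have h1 : h <= 1 by rewrite (le_trans _ ph1)// ler_peMl// ler1n.
have h01 : 0 <= h <= 1 by rewrite h0.
have [sS sL lS lL eS'] := eS.
pose q := 1 + h * (b + c).
have q1 : 1 <= q by rewrite lerDl mulr_ge0// addr_ge0.
(* The induction peels off the step applied first: the error of [n + 1] steps on [psi] is the error
   of [n] steps on [S psi], plus [n h L (S psi - psi)], plus the one-step error at [psi]. The power
   of [q] absorbs the larger bound of [S psi]. *)
suff key n psi N : sesquilinear_on psi -> form_bound N psi ->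
    form_bound (N * ((c + b * (b + c)) * (n%:R * h) ^+ 2 * q ^+ n))
    (fun u v => iter n S psi u v - psi u v - (n%:R * h)%:C * L psi u v).
  move=> sp bp; have M0 : 0 <= M by case: bp.
  apply: form_bound_le (key p _ _ sp bp); rewrite ler_wpM2l// /power_const mulrAC.
  rewrite ler_wpM2r ?sqr_ge0// ler_wpM2l; [|by rewrite addr_ge0// mulr_ge0// addr_ge0|].
    by [].
  apply: (le_trans (exp_step_bound p _)); first by rewrite mulr_ge0// addr_ge0.
  by rewrite ler_expR mulrA ler_piMl// addr_ge0.
elim: n psi N => [|n IH] psi N sp bp.
  have N0 : 0 <= N by case: bp.
  rewrite mul0r; apply: form_bound_le (conj (lexx 0) _).
    by rewrite expr0n /= mulr0 mul0r mulr0.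
  by move=> u v _ _; rewrite subrr mul0r subr0 cmod0 mul0r.
have N0 : 0 <= N by case: bp.
have sSp := sS _ sp; have bSp := euler_step_bound1 h01 b0 c0 eS sp bp.
have bd := euler_step_bound h01 b0 c0 eS sp bp.
have sd : sesquilinear_on (form_comb (-1) psi (S psi)) by exact: sesquilinear_comb.
have [bLd _] := eS' _ _ sd bd.
have [bLp bE] := eS' _ _ sp bp.
have b1 := IH _ _ sSp bSp.
have b2 := form_bound_comb (n%:R * h)%:C bLd bE.
have := form_bound_comb 1 b1 b2.
apply: (fun e l h => form_bound_ext e (form_bound_le l h)) => [u v Wu Wv|].
  rewrite /form_comb iterSr lL -natr1 mulrDl mul1r.
  rewrite rmorphD /=; ring.
rewrite cmod1 mul1r cmod_real ger0_norm ?mulr_ge0//.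
set g := c + b * (b + c).
have g0 : 0 <= g by rewrite /g addr_ge0// mulr_ge0// addr_ge0.
have -> : N * (1 + h * (b + c)) * (g * (n%:R * h) ^+ 2 * q ^+ n) =
   N * (g * (n%:R * h) ^+ 2 * q ^+ n.+1).
  by rewrite [q ^+ n.+1]exprS; move: (q ^+ n) => Q; rewrite /q; ring.
have -> : n%:R * h * (N * (h * (b + c)) * b) + N * (c * h ^+ 2) =
   N * (h ^+ 2 * (c + n%:R * (b * (b + c)))) by ring.
rewrite -mulrDr ler_wpM2l// -natr1.
have qn : 1 <= q ^+ n.+1 by rewrite exprn_ege1.
have bound : c + n%:R * (b * (b + c)) <= (n%:R *+ 2 + 1) * g.
  rewrite /g; have n0 : 0 <= n%:R :> R by [].
  have bb : 0 <= b * (b + c) by rewrite mulr_ge0// addr_ge0.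
  rewrite mulr2n; nra.
apply: (@le_trans _ _ (g * (n%:R * h) ^+ 2 * q ^+ n.+1 +
    h ^+ 2 * ((n%:R *+ 2 + 1) * g) * q ^+ n.+1)).
  rewrite lerD2l (@le_trans _ _ (h ^+ 2 * ((n%:R *+ 2 + 1) * g)))//.
    by rewrite ler_wpM2l ?sqr_ge0.
  by rewrite ler_peMr// !mulr_ge0 ?sqr_ge0// addr_ge0// mulrn_wge0.
by rewrite le_eqVlt; apply/orP; left; apply/eqP; ring.
Qed.

End LocalOperators.

(** * The discretized evolution *)

Section Toy.
Variables (R : realType) (H : hilbert R) (F : fock R) (K : hilbert_tensor H F).
Variables C Cd : H -> H.
Implicit Types (h w : R) (c g z : R[i]) (u v : H) (A B s l : seq R[i]) (X : H -> H).

Definition gen_op v : H := (- 2^-1 : R[i]) *: Cd (C v).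
(** Annihilation acts on [v (x) e(g)] as multiplication by [g], so the annihilation integral
    contributes to the time drift. *)
Definition drift g v := (- g) *: Cd v + gen_op v.
(** The coefficient of one particle in the cell: [g v] comes from expanding [e(g)] itself, [C v]
    from the creation integral. *)
Definition jump g v := g *: v + C v.
(** The one-cell vector paired with an exponential vector of cell value [conj c]: the branch of
    value 1 has weight [exp(h c)], the branch of value 0 has weight 1. To first order this is
    [1 + h (drift + c jump)], the Hudson-Parthasarathy differential with the factor [exp(h c g)] of
    the exponential vectors included. *)
Definition toy_step h c g v :=
  (cexp (h%:C * c) - 1) *: jump g v + (h%:C *: drift g v + v).
(** Fixed by requiring that [jump g v (x) e(1) + toy0 h g v (x) e(0)] be
    [(v + h drift g v) (x) e(0)] plus [jump g v (x) (e(1) - e(0))]. *)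
Definition toy0 h g v := (-1) *: jump g v + (h%:C *: drift g v + v).

Lemma toy_stepE h c g v : toy_step h c g v = cexp (h%:C * c) *: jump g v + toy0 h g v.
Proof. by rewrite /toy_step /toy0 scalerDl -addrA. Qed.

(** The word [A] collects the value 1 or 0 chosen on each cell, repeated [p] times when the cell is
    viewed on a mesh [p] times finer; [E] turns the final word into a Fock vector. Collecting at the
    head reverses the order of [l]. *)
Fixpoint toy h p l v A (E : seq R[i] -> F) : K :=
  if l is g :: l' then toy h p l' (jump g v) (nseq p 1 ++ A) E +
                       toy h p l' (toy0 h g v) (nseq p 0 ++ A) E
  else tensor K v (E A).

(* The last time step is listed first and acts first on the vector. *)
Fixpoint toy_word h s l v : H :=
  match s, l with c :: s', g :: l' => toy_word h s' l' (toy_step h c g v) | _, _ => v end.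

(** A coarse cell on the left against [p] fine cells on the right: the branch chosen on the left
    becomes the parameter 1 or 0 of the [p] fine steps. *)
Definition toy_form h h' p g g' (phi : form H) : form H := fun u v =>
  phi (jump g u) (iter p (toy_step h' 1 g') v) +
  phi (toy0 h g u) (iter p (toy_step h' 0 g') v).

Fixpoint toy_gram h h' p l l' (phi : form H) : form H :=
  match l, l' with
  | g :: l1, g' :: l1' => toy_form h h' p g g' (toy_gram h h' p l1 l1' phi)
  | _, _ => phi end.

Lemma toy_word_cat h s1 l1 s2 l2 v : size s1 = size l1 ->
  toy_word h (s1 ++ s2) (l1 ++ l2) v = toy_word h s2 l2 (toy_word h s1 l1 v).
Proof. by elim: s1 l1 v => [|c s1 IH] [|g l1] v //= [] /IH. Qed.

Lemma toy_word_nseq h p c g v :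
  toy_word h (nseq p c) (nseq p g) v = iter p (toy_step h c g) v.
Proof. by elim: p v => //= p IH v; rewrite IH -iterSr. Qed.

(** The Gram matrix of exponential vectors with prescribed values on [n] cells; [z] is the
    contribution of the time after these cells. *)
Definition gram_pair h (z : R[i]) n (E0 E1 : seq R[i] -> F) :=
  forall A B, size A = n -> size B = n ->
    ⟨E0 A, E1 B⟩ = z * cexp (h%:C * seq_inner A B).

Variables (W : set H) (k : R).
Hypothesis W_lin : forall a u v, W u -> W v -> W (a *: u + v).
Hypothesis C_local : local_op W k C.
Hypothesis Cd_local : local_op W k Cd.

Lemma local_op_scale z a (f : H -> H) : local_op W a f ->
  local_op W (cmod z * a) (fun u => z *: f u).
Proof.
move=> hA; have [a0 WA lA nA] := hA; split.
- by rewrite mulr_ge0// cmod_ge0.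
- by move=> u Wu; apply: W_scale => //; exact: WA.
- by move=> y u v Wu Wv; rewrite lA// scalerDr !scalerA [z * y]mulrC.
- by move=> u Wu; rewrite hnormZ -mulrA ler_wpM2l ?cmod_ge0 ?nA.
Qed.

Let k0 : 0 <= k. Proof. by case: C_local. Qed.

Lemma gen_op_local : local_op W (k * k) gen_op.
Proof.
apply: local_op_le (local_op_scale _ (local_op_comp Cd_local C_local)).
rewrite ler_piMl ?mulr_ge0// cmodN cmodV.
have -> : (2 : R[i]) = (2 : R)%:C by rewrite rmorph_nat.
by rewrite cmod_real ger0_norm// invf_le1// ler1n.
Qed.

Variable b : R.

(** Dominates at once the bound [b k + k^2] of [drift g] and the bound [b + k] of [jump g] for
    [|g| <= b]. *)
Definition step_const : R := (b + k) ^+ 2 + k + b.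

Lemma drift_local g : cmod g <= b -> local_op W step_const (drift g).
Proof.
move=> gb; have g0 := cmod_ge0 g; have b0 : 0 <= b := le_trans g0 gb.
apply: local_op_le (local_op_comb W_lin (- g) Cd_local gen_op_local).
rewrite cmodN /step_const.
have : cmod g * k <= b * k by rewrite ler_wpM2r.
have := mulr_ge0 b0 k0; have := sqr_ge0 b; move: b0 k0.
rewrite sqrrD mulr2n [k ^+ 2]expr2.
by move: (cmod g * k) (b * k) (b ^+ 2) (k * k); clear; move=> *; lra.
Qed.

Lemma jump_local g : cmod g <= b -> local_op W step_const (jump g).
Proof.
move=> gb; have g0 := cmod_ge0 g; have b0 : 0 <= b := le_trans g0 gb.
apply: local_op_le (local_op_comb W_lin g (local_op_id W) C_local).
by rewrite mulr1 addrC lerD// lerDr sqr_ge0.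
Qed.

Lemma step_const_ge0 g : cmod g <= b -> 0 <= step_const.
Proof. by case/drift_local. Qed.

Lemma near_id_local z h g : cmod g <= b -> 0 <= h ->
  local_op W (cmod z * step_const + (h * step_const + 1))
    (fun v => z *: jump g v + (h%:C *: drift g v + v)).
Proof.
move=> gb h0; apply: local_op_comb => //; first exact: jump_local.
apply: local_op_le (local_op_comb W_lin h%:C (drift_local gb) (local_op_id W)).
by rewrite cmod_real ger0_norm.
Qed.

Lemma toy0_local h g : cmod g <= b -> 0 <= h ->
  local_op W (step_const + (h * step_const + 1)) (toy0 h g).
Proof.
move=> gb h0; apply: local_op_le (near_id_local (-1) gb h0).
by rewrite cmodN cmod1 mul1r.
Qed.

Lemma toy_step_local h c g : cmod g <= b -> cmod c <= b -> 0 <= h <= 1 ->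
  local_op W (1 + h * (step_const * (b * expR b + 1))) (toy_step h c g).
Proof.
move=> gb cb /andP[h0 h1]; have s0 := step_const_ge0 gb.
have b0 : 0 <= b := le_trans (cmod_ge0 _) gb.
apply: local_op_le (near_id_local (cexp (h%:C * c) - 1) gb h0).
have hc : cmod (h%:C * c) <= h * b by rewrite cmodM cmod_real ger0_norm// ler_wpM2l.
have : cmod (cexp (h%:C * c) - 1) <= h * (b * expR b).
  rewrite (le_trans (cexp_bound1 _))// mulrA ler_pM ?cmod_ge0 ?expR_ge0//.
  by rewrite ler_expR (le_trans hc)// ler_piMl.
move=> /(ler_wpM2r s0); move: (cmod _ * _) (expR b) => x y; nra.
Qed.

End Toy.

Section ToyGram.
Variables (R : realType) (H : hilbert R) (F : fock R) (K : hilbert_tensor H F).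
Variables C Cd : H -> H.
Implicit Types (h w : R) (c g z : R[i]) (u v : H) (A B s l : seq R[i]) (X : H -> H).
Variables (W : set H) (k : R).
Hypothesis W_lin : forall a u v, W u -> W v -> W (a *: u + v).
Hypothesis C_local : local_op W k C.
Hypothesis Cd_local : local_op W k Cd.
Variable X : H -> H.
Hypothesis bX : bounded_op X.
Variables (h' : R) (z : R[i]) (n : nat) (E0 E1 : seq R[i] -> F).
Hypothesis h'01 : 0 <= h' <= 1.
Hypothesis gE : gram_pair h' z n E0 E1.
Local Notation word := (toy_word C Cd h').
Local Notation Y := (ampliation (K := K) X).

Let h'0 : 0 <= h'. Proof. by case/andP: h'01. Qed.

Lemma toy0_W h g v : 0 <= h -> W v -> W (toy0 C Cd h g v).
Proof. by move=> h0; have [_ + _ _] := toy0_local W_lin C_local Cd_local (lexx (cmod g)) h0; apply. Qed.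

Lemma jump_W g v : W v -> W (jump C g v).
Proof. by have [_ + _ _] := jump_local W_lin C_local (lexx (cmod g)); apply. Qed.

Lemma toy_word_loc s l : exists a, local_op W a (word s l).
Proof.
elim: s l => [|c s IH] [|g l] /=; try by exists 1; exact: local_op_id.
have [a ha] := IH l; eexists; apply: local_op_comp ha _.
exact: (near_id_local W_lin C_local Cd_local _ (lexx (cmod g)) h'0).
Qed.

(** Against a cell value [c], the branch 1 acquires [exp(h conj c)] and the branch 0 acquires 1, so
    the two branches recombine into one [toy_step]; induction over the cells builds the word. *)
Lemma toy_inner s l A B u v : W v -> size s = size l -> (size A + size l = n)%N ->
  size A = size B ->
  ⟨tensor K u (E0 (rev s ++ A)), Y (toy K C Cd h' 1 l v B E1)⟩ =
  z * cexp (h'%:C * seq_inner A B) * ⟨u, X (word (map Num.conj s) l v)⟩.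
Proof.
elim: l s A B v => [|g l IH] [|c s] A B v //= Wv; rewrite ?addn0 ?rev_cons.
  by move=> _ nA AB; rewrite ampliationE// tensor_inner gE -?AB// mulrC.
move=> [sl] nA AB.
have [bY _] := ampliationP K bX.
have [a la] := toy_word_loc (map Num.conj s) l.
rewrite (linearmapD bY.1) innerDr -cats1 -catA /=.
have nA' : (size (c :: A) + size l)%N = n by rewrite -nA /= addSnnS.
rewrite (IH s (c :: A) (1 :: B) (jump C g v))//; [|exact: jump_W|by rewrite /= AB].
rewrite (IH s (c :: A) (0 :: B) (toy0 C Cd h' g v))//; [|exact: toy0_W|by rewrite /= AB].
rewrite /seq_inner !big_cons /= -/(seq_inner A B) mulr0 mulr1 add0r.
rewrite mulrDr cexpD toy_stepE.
move: (jump_W g Wv) (toy0_W g h'0 Wv); move: (jump C g v) (toy0 _ _ _ _ _) => y t Wy Wt.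
rewrite (local_opD la)//; last exact: W_scale.
rewrite (local_opZ W_lin _ la)// (linearmapD bX.1) (linearmapZ bX.1) innerDr innerZr.
by move: (cexp _) (cexp _) => p q; ring.
Qed.

Definition scale_word p l : seq R[i] := flatten [seq nseq p g | g <- l].

Lemma size_scale_word p l : size (scale_word p l) = (p * size l)%N.
Proof.
by elim: l => [|g l IH]; rewrite ?muln0//= size_cat size_nseq mulnS -/(scale_word p l) IH.
Qed.

(** The left vector is expanded cell by cell until [toy_inner] applies; the value of each branch,
    repeated [p] times, feeds [p] fine steps on the right, which is [toy_form]. The words [s1] and
    [s2] are the values of the left function on fine cells not covered by coarse ones, [L1] and [L2]
    those of the right function. *)
Lemma toy_toy_inner h p l l' s1 L1 s2 L2 A B u v : 0 <= h -> W u -> W v ->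
  size l = size l' -> size s1 = size L1 -> size s2 = size L2 ->
  (size A + p * size l + size L1 + size L2 = n)%N -> size A = size B ->
  ⟨toy K C Cd h p l u (rev s1 ++ A) (fun A0 => E0 (rev s2 ++ A0)),
   Y (toy K C Cd h' 1 (L1 ++ (scale_word p l' ++ L2)) v B E1)⟩ =
  z * cexp (h'%:C * seq_inner A B) *
  toy_gram C Cd h h' p l l'
    (fun u v => ⟨u, X (word (map Num.conj s2) L2 v)⟩) u (word (map Num.conj s1) L1 v).
Proof.
move=> h0; elim: l l' s1 L1 u v => [|g l IH] [|g' l'] s1 L1 u v //= Wu Wv.
  rewrite muln0 addn0 => _ s1L s2L nA AB.
  rewrite catA -rev_cat toy_inner ?size_cat ?s1L ?s2L ?addnA//.
  by rewrite map_cat toy_word_cat// size_map.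
move=> [ll'] s1L s2L nA AB; have [bY _] := ampliationP K bX.
have key x : nseq p (x : R[i]) ++ rev s1 ++ A = rev (s1 ++ nseq p x) ++ A.
  by rewrite rev_cat rev_nseq catA.
rewrite innerDl !key// -catA [L1 ++ _]catA.
have nA' : (size A + p * size l + size (L1 ++ nseq p g') + size L2)%N = n.
  by rewrite size_cat size_nseq -nA mulnS; lia.
have sL x : size (s1 ++ nseq p (x : R[i])) = size (L1 ++ nseq p g').
  by rewrite !size_cat !size_nseq s1L.
rewrite (IH l' (s1 ++ nseq p 1) (L1 ++ nseq p g') (jump C g u) v (jump_W _ Wu) Wv ll' (sL _) s2L nA' AB).
rewrite (IH l' (s1 ++ nseq p 0) (L1 ++ nseq p g') _ v (toy0_W _ h0 Wu) Wv ll' (sL _) s2L nA' AB).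
rewrite -mulrDr; congr (_ * _); rewrite /toy_form !map_cat !map_nseq !toy_word_cat ?size_map//.
by rewrite !toy_word_nseq /= rmorph0 rmorph1.
Qed.

End ToyGram.

Ltac nonneg := repeat first [assumption | exact: ler01 | exact: expR_ge0 | exact: cmod_ge0 |
  exact: hnorm_ge0 | exact: ler0n | exact: sqr_ge0 | exact: exprn_ge0 | apply: mulr_ge0 | apply: addr_ge0].

(** * Second-order accuracy of the one-cell maps *)

Section Steps.
Variables (R : realType) (H : hilbert R) (C Cd : H -> H) (W : set H) (k : R).
Hypothesis W_lin : forall a u v, W u -> W v -> W (a *: u + v).
Hypothesis C_local : local_op W k C.
Hypothesis Cd_local : local_op W k Cd.
Variable b : R.
Hypothesis b0 : 0 <= b.
Implicit Types (h : R) (c g w z : R[i]) (u v : H) (phi psi : form H).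
Local Notation s := (step_const k b).
Local Notation drift := (drift C Cd).
Local Notation jump := (jump C).
Local Notation tstep := (toy_step C Cd).

Lemma sesqD phi u v v' : sesquilinear_on W phi -> W u -> W v -> W v' ->
  phi u (v + v') = phi u v + phi u v'.
Proof. by move=> [_ h] Wu Wv Wv'; have := h 1 u v v' Wu Wv Wv'; rewrite scale1r mul1r. Qed.

Lemma drift_W g v : W v -> W (drift g v).
Proof. by have [_ + _ _] := drift_local W_lin C_local Cd_local (lexx (cmod g)); apply. Qed.

Lemma toy_step_W h c g v : 0 <= h -> W v -> W (tstep h c g v).
Proof.
move=> h0; have [_ + _ _] := near_id_local W_lin C_local Cd_local (cexp (h%:C * c) - 1) (lexx (cmod g)) h0.
exact.
Qed.

Lemma small_exp1 h z : 0 <= h <= 1 -> cmod z <= b -> cmod (cexp (h%:C * z) - 1) <= h * (b * expR b).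
Proof.
move=> /andP[h0 h1] zb; have hz : cmod (h%:C * z) <= h * b by rewrite cmodM cmod_real ger0_norm// ler_wpM2l.
rewrite (le_trans (cexp_bound1 _))// mulrA ler_pM ?cmod_ge0 ?expR_ge0//.
by rewrite ler_expR (le_trans hz)// ler_piMl.
Qed.

Lemma small_exp2 h z : 0 <= h <= 1 -> cmod z <= b ->
  cmod (cexp (h%:C * z) - 1 - h%:C * z) <= h ^+ 2 * (b ^+ 2 * expR b).
Proof.
move=> /andP[h0 h1] zb; have hz : cmod (h%:C * z) <= h * b by rewrite cmodM cmod_real ger0_norm// ler_wpM2l.
rewrite (le_trans (cexp_bound2 _))// mulrA -exprMn ler_pM ?exprn_ge0 ?cmod_ge0 ?expR_ge0//.
  by rewrite lerXn2r ?nnegrE ?cmod_ge0// mulr_ge0.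
by rewrite ler_expR (le_trans hz)// ler_piMl.
Qed.

Lemma form_bound_le_ext (M N : R) phi psi : form_bound W N phi ->
  (forall u v, W u -> W v -> phi u v = psi u v) -> N <= M -> form_bound W M psi.
Proof. by move=> h e l; apply: form_bound_ext e _; exact: form_bound_le h. Qed.

(** The weight [w] is 0 for bare words. With [w = - conj f g] it accounts for the cell that leaves
    the tail of the exponential vectors when time advances. *)
Definition word_form h c g w phi : form H := fun u v => cexp (h%:C * w) * phi u (tstep h c g v).

Definition word_generator c g w phi : form H := fun u v =>
  phi u (drift g v) + c * phi u (jump g v) + w * phi u v.

(** The three summands bound, in this order, the remainder of [exp(h w)] on the full step, the
    product of [h w] with the first-order move of the step, and the remainder of [exp(h c)] on
    [jump]. *)
Definition word_err : R := b ^+ 2 * expR b * (1 + s * (b * expR b + 1)) +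
  b * (s * (b * expR b + 1)) + b ^+ 2 * expR b * s.

Lemma step_const_ge0' : 0 <= s.
Proof. by apply: (step_const_ge0 W_lin C_local Cd_local (g := 0)); rewrite cmod0. Qed.

Lemma word_err_ge0 : 0 <= word_err.
Proof.
have s0 := step_const_ge0'; have e0 := expR_ge0 b.
by rewrite /word_err !addr_ge0// ?mulr_ge0// ?addr_ge0// ?mulr_ge0// ?addr_ge0 ?mulr_ge0 ?sqr_ge0.
Qed.

Lemma word_step h c g w : 0 <= h <= 1 -> cmod c <= b -> cmod g <= b -> cmod w <= b ->
  euler_step W h word_err (s + b * s + b) (word_form h c g w) (word_generator c g w).
Proof.
move=> h01 cb gb wb; have /andP[h0 h1] := h01; have s0 := step_const_ge0'.
have ld := drift_local W_lin C_local Cd_local gb.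
have lj := jump_local W_lin C_local gb.
have lt := toy_step_local W_lin C_local Cd_local gb cb h01.
have li := local_op_id W.
have cm phi z u v : z * phi u v = form_comb z phi (fun _ _ => 0) u v by rewrite /form_comb addr0.
have s00 : sesquilinear_on W (fun _ _ => 0) by split=> *; rewrite mulr0 addr0.
split=> [phi sp|phi sp|z phi psi u v|z phi psi u v|phi M sp bp].
- rewrite (_ : word_form _ _ _ _ _ =
    form_comb (cexp (h%:C * w)) (fun u v => phi u (tstep h c g v)) (fun _ _ => 0)).
    by apply: sesquilinear_comb => //; exact: (sesquilinear_comp li lt sp).
  by apply/funext => u; apply/funext => v; rewrite /form_comb addr0.
- rewrite (_ : word_generator _ _ _ _ = form_comb w phi
    (form_comb c (fun u v => phi u (jump g v)) (fun u v => phi u (drift g v)))).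
    by do 2!apply: sesquilinear_comb => //; [exact: (sesquilinear_comp li lj sp)|exact: (sesquilinear_comp li ld sp)].
  by apply/funext => u; apply/funext => v; rewrite /form_comb /word_generator; ring.
- by rewrite /word_form /form_comb; move: (cexp _) => e; ring.
- by rewrite /word_generator /form_comb; ring.
have M0 : 0 <= M by case: bp.
have bd := form_bound_comp li ld bp; have bj := form_bound_comp li lj bp.
have bt := form_bound_comp li lt bp.
split.
  have := form_bound_comb w bp (form_bound_comb c bj bd).
  move=> hh; apply: (form_bound_le_ext hh) => [u v _ _|].
    by rewrite /form_comb /word_generator; ring.
  rewrite !mul1r; have := ler_wpM2r M0 wb; have := ler_wpM2r (mulr_ge0 M0 s0) cb.
  by move: (cmod w * M) (cmod c * _) => x y hy hx; lra.
have e1 := small_exp1 h01 cb; have e2 := small_exp2 h01 cb; have e3 := small_exp2 h01 wb.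
have ln : local_op W (h * (s * (b * expR b + 1)))
    (fun v => (cexp (h%:C * c) - 1) *: jump g v + h%:C *: drift g v).
  apply: local_op_le (local_op_comb W_lin _ lj (local_op_scale W_lin h%:C ld)).
  rewrite cmod_real ger0_norm//; have := ler_wpM2r s0 e1.
  by move: (cmod _ * _) (b * expR b) => x y hx; lra.
have bn := form_bound_comp li ln bp.
have b00 : form_bound W 0 (fun _ _ => 0) by split=> // *; rewrite cmod0 mul0r.
have := form_bound_comb (cexp (h%:C * c) - 1 - h%:C * c) bj
  (form_bound_comb (h%:C * w) bn (form_bound_comb (cexp (h%:C * w) - 1 - h%:C * w) bt b00)).
move=> hh; apply: (form_bound_le_ext hh) => [u v Wu Wv|].
  have [Wd Wj] : W (drift g v) /\ W (jump g v) by split; [exact: drift_W | case: lj => _ + _ _; apply].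
  rewrite /form_comb /word_form /word_generator /toy_step.
  move: (drift g v) (jump g v) Wd Wj => dv jv Wd Wj.
  move: (cexp (h%:C * w)) (cexp (h%:C * c)) => e e'.
  have Z z y : W y -> phi u (z *: y) = z * phi u y.
    move=> Wy; have W0 : W 0 by have := W_lin (-1) Wv Wv; rewrite scaleN1r addNr.
    have p0 : phi u 0 = 0.
      by have := sp.2 (-1) u 0 0 Wu W0 W0; rewrite scaleN1r oppr0 addr0 mulN1r addNr.
    by have := sp.2 z u y 0 Wu Wy W0; rewrite !addr0 p0 addr0.
  have Ws z y : W y -> W (z *: y) by exact: W_scale.
  rewrite !(sesqD sp)// ?Z//; do ?by [exact: Ws | apply: W_add => //; exact: Ws].
  ring.
rewrite !mul1r addr0 cmodM cmod_real ger0_norm//.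
have -> : M * (word_err * h ^+ 2) = h ^+ 2 * (b ^+ 2 * expR b) * (M * s) +
   (h * b * (M * (h * (s * (b * expR b + 1)))) +
    h ^+ 2 * (b ^+ 2 * expR b) * (M * (1 + s * (b * expR b + 1)))).
  by rewrite /word_err; move: (expR b) => e; ring.
have n0 : 0 <= b * expR b by rewrite mulr_ge0 ?expR_ge0.
apply: lerD; first by rewrite ler_wpM2r ?mulr_ge0.
apply: lerD.
  apply: ler_wpM2r; [by rewrite !mulr_ge0// addr_ge0|exact: ler_wpM2l].
apply: (le_trans (ler_wpM2r _ e3)); first by nonneg.
apply: ler_wpM2l; first by nonneg.
by rewrite ler_wpM2l// lerD2l ler_piMl//; nonneg.
Qed.

Lemma jump_W' g v : W v -> W (jump g v).
Proof. by have [_ + _ _] := jump_local W_lin C_local (lexx (cmod g)); apply. Qed.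

(* The Lindbladian form of the pair of exponential vectors with values g, g'. *)
Definition gram_generator g g' phi : form H := fun u v =>
  phi (drift g u) v + phi u (drift g' v) + phi (jump g u) (jump g' v).

(** [power_const] is the error of the [p] fine steps, multiplied by the bounds of [jump] and [toy0]
    on the left; [s * s] bounds the product of the two drifts. *)
Definition gram_err : R := power_const word_err (s + b * s + b) * (s + (s + (s + 1))) + s * s.

Lemma iter_word_form h c g p phi u v :
  iter p (word_form h c g 0) phi u v = phi u (iter p (tstep h c g) v).
Proof.
elim: p phi u v => // p IH phi u v.
by rewrite iterSr IH /word_form mulr0 cexp0 mul1r iterS.
Qed.

Lemma iter_toy_step_local h c g p : 0 <= h -> exists a, local_op W a (iter p (tstep h c g)).
Proof.
move=> h0; eexists; apply: local_op_iter.
exact: (near_id_local W_lin C_local Cd_local _ (lexx (cmod g)) h0).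
Qed.

Lemma toy_step_power h c g p phi M : 0 <= h -> p%:R * h <= 1 -> cmod c <= b -> cmod g <= b ->
  sesquilinear_on W phi -> form_bound W M phi ->
  form_bound W (M * (power_const word_err (s + b * s + b) * (p%:R * h) ^+ 2))
    (fun u v => phi u (iter p (tstep h c g) v) - phi u v -
      (p%:R * h)%:C * (phi u (drift g v) + c * phi u (jump g v))).
Proof.
move=> h0 ph cb gb sp bp; have s0 := step_const_ge0'.
have M0 : 0 <= M by case: bp.
have [->|p0] := posnP p.
  rewrite mul0r; apply: (@form_bound_le_ext _ 0 (fun _ _ => 0)) => [|u v _ _|].
  - by split=> // *; rewrite cmod0 mul0r.
  - by rewrite mul0r subrr subrr.
  by rewrite expr0n /= !mulr0.
have h1 : h <= 1 by rewrite (le_trans _ ph)// ler_peMl// ler1n.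
have sb : 0 <= s + b * s + b by do 2!apply: addr_ge0 => //; exact: mulr_ge0.
have h01 : 0 <= h <= 1 by rewrite h0.
have w0 : cmod (0 : R[i]) <= b by rewrite cmod0.
have hh := euler_step_power h0 ph sb word_err_ge0 (word_step h01 cb gb w0) sp bp.
apply: (form_bound_le_ext hh) => // u v _ _.
by rewrite iter_word_form /word_generator mul0r addr0.
Qed.

(** By [toy_step_power] the fine steps are [v + h (drift + c jump)] for [c = 1] and [c = 0]. Writing
    [d], [j] and [d'], [j'] for drift and jump on the two sides, [phi j (v + h d' + h j') + phi (u +
    h d - j) (v + h d')] equals [phi u v] plus [h] times the generator plus [h^2 phi d d']: the
    zeroth-order terms in [j] cancel. *)
Lemma toy_form_step h h' p g g' : 0 <= h' -> h = p%:R * h' -> h <= 1 -> 1 <= b ->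
  cmod g <= b -> cmod g' <= b ->
  euler_step W h gram_err (s + s + s * s) (toy_form C Cd h h' p g g') (gram_generator g g').
Proof.
move=> h'0 hE h1 b1 gb gb'; have s0 := step_const_ge0'.
have h0 : 0 <= h by rewrite hE mulr_ge0.
have ld := drift_local W_lin C_local Cd_local gb.
have lj := jump_local W_lin C_local gb.
have ld' := drift_local W_lin C_local Cd_local gb'.
have lj' := jump_local W_lin C_local gb'.
have l0 := toy0_local W_lin C_local Cd_local gb h0.
have li := local_op_id W.
have [a1 l1] := iter_toy_step_local 1 g' p h'0.
have [a2 l2] := iter_toy_step_local 0 g' p h'0.
split=> [phi sp|phi sp|z phi psi u v|z phi psi u v|phi M sp bp].
- rewrite (_ : toy_form _ _ _ _ _ _ _ _ = form_comb 1
    (fun u v => phi (jump g u) (iter p (tstep h' 1 g') v))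
    (fun u v => phi (toy0 C Cd h g u) (iter p (tstep h' 0 g') v))).
    by apply: sesquilinear_comb; [exact: (sesquilinear_comp lj l1)|exact: (sesquilinear_comp l0 l2)].
  by apply/funext => u; apply/funext => v; rewrite /form_comb mul1r.
- rewrite (_ : gram_generator _ _ _ = form_comb 1 (fun u v => phi (jump g u) (jump g' v))
    (form_comb 1 (fun u v => phi (drift g u) v) (fun u v => phi u (drift g' v)))).
    apply: sesquilinear_comb; first exact: (sesquilinear_comp lj lj').
    by apply: sesquilinear_comb; [exact: (sesquilinear_comp ld li)|exact: (sesquilinear_comp li ld')].
  by apply/funext => u; apply/funext => v; rewrite /form_comb /gram_generator; ring.
- by rewrite /toy_form /form_comb mulrDr addrACA.
- by rewrite /gram_generator /form_comb; ring.
have M0 : 0 <= M by case: bp.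
have bj := form_bound_comp lj lj' bp.
split.
  have := form_bound_comb 1 bj (form_bound_comb 1 (form_bound_comp ld li bp) (form_bound_comp li ld' bp)).
  move=> hh; apply: (form_bound_le_ext hh) => [u v _ _|].
    by rewrite /form_comb /gram_generator; ring.
  rewrite !cmod1 !mul1r mulr1 le_eqVlt; apply/orP; left; apply/eqP; ring.
have ph1 : p%:R * h' <= 1 by rewrite -hE.
have cb1 : cmod (1 : R[i]) <= b by rewrite cmod1.
have cb0 : cmod (0 : R[i]) <= b by rewrite cmod0.
have e1 := form_bound_comp lj li (toy_step_power h'0 ph1 cb1 gb' sp bp).
have e0 := form_bound_comp l0 li (toy_step_power h'0 ph1 cb0 gb' sp bp).
have := form_bound_comb (h ^+ 2)%:C (form_bound_comp ld ld' bp) (form_bound_comb 1 e1 e0).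
move=> hh; apply: (form_bound_le_ext hh) => [u v Wu Wv|].
  have W2 : W (iter p (tstep h' 0 g') v) by case: l2 => _ + _ _; apply.
  have W0 : W 0 by have := W_lin (-1) Wv Wv; rewrite scaleN1r addNr.
  suff gen d j d' j' y1 y2 : W d -> W j -> W d' -> W y2 ->
      form_comb (h ^+ 2)%:C (fun u0 v0 => phi d d') (form_comb 1
        (fun u0 v0 => phi j y1 - phi j v - h%:C * (phi j d' + 1 * phi j j'))
        (fun u0 v0 => phi (-1 *: j + (h%:C *: d + u)) y2 - phi (-1 *: j + (h%:C *: d + u)) v
          - h%:C * (phi (-1 *: j + (h%:C *: d + u)) d' + 0 * phi (-1 *: j + (h%:C *: d + u)) j'))) u v =
      phi j y1 + phi (-1 *: j + (h%:C *: d + u)) y2 - phi u v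
        - h%:C * (phi d v + phi u d' + phi j j').
    rewrite -hE; apply: (gen (drift g u) (jump g u) (drift g' v) (jump g' v)
      (iter p (tstep h' 1 g') v) (iter p (tstep h' 0 g') v)) => //; [exact: drift_W|exact: jump_W'|exact: drift_W].
  move=> Wd Wj Wd' Wy2.
  have key y : W y -> phi (-1 *: j + (h%:C *: d + u)) y = - phi j y + (h%:C * phi d y + phi u y).
    move=> Wy; rewrite sp.1 ?rmorphN ?rmorph1 ?mulN1r//; last by apply: W_lin.
    by rewrite sp.1//; congr (_ + (_ * _ + _)); rewrite conj_real.
  rewrite /form_comb mul0r !key// addr0 !mul1r rmorphXn /=.
  move: (phi j y1) (phi j y2) (phi d y2) (phi u y2) (phi j v) (phi d v) (phi u v) => a3 a4 a5 a6 a7 a8 a9.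
  move: (phi j d') (phi d d') (phi u d') (phi j j') => *; ring.
rewrite cmod_real ger0_norm ?sqr_ge0// cmod1 -hE !mulr1 mul1r /gram_err.
have sb : 0 <= s + b * s + b by do 2!apply: addr_ge0 => //; exact: mulr_ge0.
have p0 := power_const_ge0 word_err_ge0 sb.
have e00 : h * s <= s by rewrite ler_piMl.
move: (power_const _ _) p0 => P P0.
have -> : M * ((P * (s + (s + (s + 1))) + s * s) * h ^+ 2) =
  h ^+ 2 * (M * (s * s)) + (M * (P * h ^+ 2) * s + M * (P * h ^+ 2) * (s + (s + 1))) by ring.
rewrite lerD2l lerD2l ler_wpM2l ?mulr_ge0 ?sqr_ge0//.
by rewrite lerD2l lerD2r.
Qed.

(** The infinitesimal unitarity condition [G + G^* + C^* C = 0]: all terms with [C] cancel, and what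
    remains is the logarithmic derivative of [<e(g), e(g')>]. *)
Lemma gram_generator_inner g g' u v : (forall u v, W u -> W v -> ⟨C u, v⟩ = ⟨u, Cd v⟩) ->
  W u -> W v -> gram_generator g g' (@inner R H) u v = Num.conj g * g' * ⟨u, v⟩.
Proof.
move=> adj Wu Wv.
have [WC WCd] : (forall u, W u -> W (C u)) /\ (forall u, W u -> W (Cd u)).
  by split; [case: C_local | case: Cd_local].
have adj' x y : W x -> W y -> ⟨Cd x, y⟩ = ⟨x, C y⟩.
  by move=> Wx Wy; rewrite -inner_conj -adj// inner_conj.
rewrite /gram_generator /drift /jump /gen_op.
rewrite !(innerDl, innerDr, innerZl, innerZr, innerNl, innerNr).
have [WCu WCv] : W (C u) /\ W (C v) by split; exact: WC.
rewrite !adj'// !adj// [Num.conj (- g)]rmorphN [Num.conj (- 2^-1)]rmorphN /=.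
have -> : Num.conj (2^-1 : R[i]) = 2^-1 by rewrite fmorphV rmorph_nat.
by move: (Num.conj g) => gc; field.
Qed.
End Steps.

(** * The Gram matrix over many cells *)

Section Products.
Variables (R : realType) (H : hilbert R) (C Cd : H -> H) (W : set H) (k : R).
Hypothesis W_lin : forall a u v, W u -> W v -> W (a *: u + v).
Hypothesis C_local : local_op W k C.
Hypothesis Cd_local : local_op W k Cd.
Hypothesis C_adj : forall u v, W u -> W v -> ⟨C u, v⟩ = ⟨u, Cd v⟩.
Variable b : R.
Hypothesis b1 : 1 <= b.
Implicit Types (h : R) (c g w z : R[i]) (u v : H) (phi psi : form H) (l s : seq R[i]).
Local Notation sc := (step_const k b).
Local Notation ip := (@inner R H : form H).
Local Notation bounded_by := (all (fun c : R[i] => cmod c <= b)).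

Let b0 : 0 <= b. Proof. exact: le_trans b1. Qed.

Lemma inner_sesq : sesquilinear_on W ip.
Proof. by split=> *; rewrite !innerE. Qed.

Lemma inner_form_bound : form_bound W 1 ip.
Proof. by split=> // u v _ _; rewrite mul1r inner_le. Qed.

Lemma form_bound0 : form_bound W 0 (fun _ _ => 0).
Proof. by split=> // *; rewrite cmod0 mul0r. Qed.

Lemma toy_gram_sesq h h' p l l' phi : 0 <= h' -> h = p%:R * h' -> h <= 1 ->
  bounded_by l -> bounded_by l' ->
  sesquilinear_on W phi -> sesquilinear_on W (toy_gram C Cd h h' p l l' phi).
Proof.
move=> h'0 hE h1; elim: l l' => [|g l IH] [|g' l'] //= /andP[gb lb] /andP[gb' lb'] sp.
by have [+ _ _ _ _] := toy_form_step W_lin C_local Cd_local b0 h'0 hE h1 b1 gb gb'; apply; exact: IH.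
Qed.

Definition gram_rate := sc + sc + sc * sc + gram_err k b + b ^+ 2.
(** The one-cell defect of the inner product: the Euler error, plus the remainder in replacing
    [1 + h conj g g'] by the exponential. *)
Definition gram_defect := gram_err k b + (b ^+ 2) ^+ 2 * expR (b ^+ 2).

Lemma gram_err_ge0 : 0 <= gram_err k b.
Proof.
have s0 := step_const_ge0' W_lin C_local Cd_local b0.
have e0 := word_err_ge0 W_lin C_local Cd_local b0.
by rewrite /gram_err; nonneg.
Qed.

Lemma gram_rate_ge : [/\ 0 <= gram_rate, b ^+ 2 <= gram_rate &
  sc + sc + sc * sc + gram_err k b <= gram_rate].
Proof.
have s0 := step_const_ge0' W_lin C_local Cd_local b0; have e0 := gram_err_ge0.
have ss : 0 <= sc * sc by rewrite mulr_ge0.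
have b2 := sqr_ge0 b; rewrite /gram_rate; move: (gram_err k b) (sc * sc) sc (b ^+ 2) e0 ss s0 b2.
by move=> *; split; lra.
Qed.

Lemma seq_inner_bound l l' : bounded_by l -> bounded_by l' -> size l = size l' ->
  cmod (seq_inner l l') <= (size l)%:R * b ^+ 2.
Proof.
elim: l l' => [|g l IH] [|g' l'] //=; first by rewrite /seq_inner big_nil cmod0 mul0r.
move=> /andP[gb lb] /andP[gb' lb'] [ll']; rewrite /seq_inner /= big_cons /= -/(seq_inner l l').
rewrite (le_trans (cmodD _ _))// -natr1 mulrDl mul1r addrC lerD ?IH//.
by rewrite cmodM cmodJ expr2 ler_pM ?cmod_ge0.
Qed.

(** The inner product is almost an eigenform: each cell multiplies it by [exp(h conj g g')] up to
    [gram_defect h^2], and a discrete Gronwall argument sums the defects. The initial form is only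
    near a multiple [a] of the inner product, which leaves room for fine cells outside the coarse
    mesh. *)
Lemma toy_gram_inner h h' p l l' phi (a : R[i]) M N : 0 <= h' -> h = p%:R * h' -> h <= 1 ->
  bounded_by l -> bounded_by l' -> size l = size l' -> sesquilinear_on W phi ->
  cmod a <= M -> form_bound W N (form_comb (- a) ip phi) ->
  form_bound W (expR ((size l)%:R * h * gram_rate) *
      (N + (size l)%:R * h * (M * gram_defect * h)))
    (form_comb (- (a * cexp (h%:C * seq_inner l l'))) ip (toy_gram C Cd h h' p l l' phi)).
Proof.
move=> h'0 hE h1 lb lb' ll' sp aM bN.
have h0 : 0 <= h by rewrite hE mulr_ge0.
have M0 : 0 <= M := le_trans (cmod_ge0 a) aM.
have [r0 rb rs] := gram_rate_ge.
have ge0 := gram_err_ge0.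
have s0 := step_const_ge0' W_lin C_local Cd_local b0.
have s30 : 0 <= sc + sc + sc * sc by do 2?apply: addr_ge0 => //; exact: mulr_ge0.
have d0 : 0 <= gram_defect by rewrite addr_ge0// mulr_ge0 ?expR_ge0 ?sqr_ge0.
elim: l l' ll' lb lb' => [|g l IH] [|g' l'] //=.
  move=> _ _ _; rewrite !mul0r addr0 expR0 mul1r /seq_inner big_nil mulr0 cexp0 mulr1.
  exact: bN.
move=> [ll'] /andP[gb lb] /andP[gb' lb'].
have st := toy_form_step W_lin C_local Cd_local b0 h'0 hE h1 b1 gb gb'.
have {}IH := IH _ ll' lb lb'.
have sT := toy_gram_sesq h'0 hE h1 lb lb' sp.
set T := toy_gram _ _ _ _ _ l l' phi in IH sT *.
pose e := cexp (h%:C * seq_inner l l').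
have sD : sesquilinear_on W (form_comb (- (a * e)) ip T).
  by apply: sesquilinear_comb => //; exact: inner_sesq.
have h01 : 0 <= h <= 1 by rewrite h0.
have bSD := euler_step_bound1 h01 s30 ge0 st sD IH.
have [_ _ lS _ eS] := st.
have [_ bI] := eS _ _ inner_sesq inner_form_bound.
have zb : cmod (Num.conj g * g') <= b ^+ 2 by rewrite cmodM cmodJ expr2 ler_pM ?cmod_ge0.
have e2 := small_exp2 (sqr_ge0 b) h01 zb.
have bE : form_bound W (h ^+ 2 * ((b ^+ 2) ^+ 2 * expR (b ^+ 2)))
    (fun u v => (cexp (h%:C * (Num.conj g * g')) - 1 - h%:C * (Num.conj g * g')) * ⟨u, v⟩).
  split; first by rewrite mulr_ge0 ?sqr_ge0// mulr_ge0 ?sqr_ge0 ?expR_ge0.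
  by move=> u v _ _; rewrite cmodM ler_pM ?cmod_ge0 ?inner_le.
have := form_bound_comb 1 bSD (form_bound_comb (a * e) bI (form_bound_comb (- (a * e)) bE
  form_bound0)).
move=> hh; apply: (form_bound_le_ext hh) => [u v Wu Wv|].
  rewrite {hh bSD bI bE} /form_comb lS (gram_generator_inner C_local Cd_local g g' C_adj Wu Wv).
  have -> : cexp (h%:C * seq_inner (g :: l) (g' :: l')) = cexp (h%:C * (Num.conj g * g')) * e.
    by rewrite /e -cexpD -mulrDr /seq_inner /= big_cons.
  move: (cexp (h%:C * (Num.conj g * g'))) (Num.conj g * g') (toy_form _ _ _ _ _ _ _ T u v) (toy_form _ _ _ _ _ _ _ _ u v) (⟨u, v⟩).
  by move=> e1 z x y i; ring.
have N0 : 0 <= N by case: bN.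
rewrite cmod1 mul1r cmodN addr0 mul1r -natr1.
set X := expR (_ * h * _).
have -> : expR (((size l)%:R + 1) * h * gram_rate) = X * expR (h * gram_rate).
  by rewrite -expRD; congr expR; ring.
have Ebound : 1 + h * (sc + sc + sc * sc + gram_err k b) <= expR (h * gram_rate).
  by rewrite (le_trans _ (expR_ge1Dx _))// lerD2l ler_wpM2l.
have E1 : 1 <= expR (h * gram_rate) by rewrite (le_trans _ (expR_ge1Dx _))// lerDl mulr_ge0.
have Z : cmod (a * e) <= M * X.
  rewrite cmodM ler_pM ?cmod_ge0// (le_trans (cexp_bound _))// ler_expR cmodM cmod_real ger0_norm//.
  rewrite [_%:R * h]mulrC -mulrA ler_wpM2l// (le_trans (seq_inner_bound lb lb' ll'))// ler_wpM2l//.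
have X0 : 0 <= X by exact: expR_ge0.
have Y0 : 0 <= N + (size l)%:R * h * (M * gram_defect * h) by nonneg.
rewrite -mulrDr (_ : gram_err k b * h ^+ 2 + _ = h ^+ 2 * gram_defect); last first.
  by rewrite /gram_defect; move: (expR (b ^+ 2)) => x; ring.
have Z2 := ler_wpM2r (mulr_ge0 (sqr_ge0 h) d0) Z.
apply: (le_trans (lerD (ler_wpM2l (mulr_ge0 X0 Y0) Ebound) Z2)) {Z2}.
have := ler_wpM2l (mulr_ge0 (mulr_ge0 M0 X0) (mulr_ge0 (sqr_ge0 h) d0)) E1.
clearbody X; move: X (expR (h * gram_rate)) gram_defect (size l)%:R X0 {Z Y0} => Y E D n X0 hy.
rewrite (_ : Y * E * (N + (n + 1) * h * (M * D * h)) =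
  Y * (N + n * h * (M * D * h)) * E + M * Y * (h ^+ 2 * D) * E); last by ring.
by rewrite lerD2l (le_trans _ hy)// mulr1.
Qed.
End Products.

(** * Dyadic cells, their refinement and orientation *)

Section Cells.
Variable R : realType.
Implicit Types (f g : R -> R[i]) (A B : seq R[i]) (k m n i j p : nat) (t : R).

Definition cell_const k g := forall j s, dint k j s -> g s = g (j%:R * mesh R k).

Lemma dint_left k j : dint k j (j%:R * mesh R k).
Proof. by apply/dintP; rewrite lexx /= ltr_pM2r ?mesh_gt0// ltr_nat. Qed.

Lemma cell_const_refine k m g : cell_const k g -> cell_const (k + m) g.
Proof.
move=> cg j s hs; rewrite (cg _ _ (dint_refine hs)).
by rewrite -(cg _ _ (dint_refine (dint_left (k + m) j))).
Qed.

Lemma cell_const_step k n c : cell_const k (@step R k n c).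
Proof.
move=> j s hs; case: (ltnP j n) => jn.
  by rewrite (step_in _ jn hs) (step_in _ jn (dint_left _ _)).
by rewrite (step_out _ jn hs) (step_out _ jn (dint_left _ _)).
Qed.

Definition samples k i n g : seq R[i] := [seq g (j%:R * mesh R k) | j <- iota i n].

Lemma size_samples k i n g : size (samples k i n g) = n.
Proof. by rewrite size_map size_iota. Qed.

Lemma samples_cat k i n n' g :
  samples k i (n + n') g = samples k i n g ++ samples k (i + n) n' g.
Proof. by rewrite /samples iotaD map_cat. Qed.

Lemma nth_samples k i n g j : (j < n)%N -> nth 0 (samples k i n g) j = g ((i + j)%:R * mesh R k).
Proof. by move=> jn; rewrite (nth_map 0%N) ?size_iota// nth_iota. Qed.

Lemma nth_scale_word p A i : (0 < p)%N -> nth 0 (scale_word p A) i = nth 0 A (i %/ p).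
Proof.
move=> p0; elim: A i => [|a A IH] i; first by rewrite /= !nth_nil.
rewrite /scale_word /= nth_cat size_nseq nth_nseq; case: ltnP => ip.
  by rewrite divn_small.
rewrite -/(scale_word p A) IH -[in RHS](subnKC ip) divnDl// divnn p0 add1n.
by [].
Qed.

Lemma scale_word_cat p A B : scale_word p (A ++ B) = scale_word p A ++ scale_word p B.
Proof. by rewrite /scale_word map_cat flatten_cat. Qed.

Lemma scale_word_rev p A : scale_word p (rev A) = rev (scale_word p A).
Proof.
elim: A => [//|a A IH]; rewrite rev_cons -cats1 scale_word_cat IH.
by rewrite [in RHS]/scale_word /= rev_cat rev_nseq -/(scale_word p A) /scale_word /= cats0.
Qed.

Lemma samples_refine k m n g : cell_const k g ->
  samples (k + m) 0 (2 ^ m * n) g = scale_word (2 ^ m) (samples k 0 n g).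
Proof.
move=> cg; have p0 : (0 < 2 ^ m)%N by rewrite expn_gt0.
apply: (@eq_from_nth _ 0) => [|i]; rewrite size_samples ?size_scale_word ?size_samples// => ip.
have ip' : (i %/ 2 ^ m < n)%N by rewrite ltn_divLR// mulnC.
rewrite nth_scale_word// (nth_samples _ _ _ ip) (nth_samples _ _ _ ip').
by rewrite !add0n (cg _ _ (dint_refine (dint_left (k + m) i))).
Qed.

Lemma splice_refine k m A r f : cell_const k f ->
  splice k A f = splice (k + m) (scale_word (2 ^ m) A ++ samples (k + m) (2 ^ m * size A) r f) f.
Proof.
move=> cf; have p0 : (0 < 2 ^ m)%N by rewrite expn_gt0.
apply/funext => s; case: (leP 0 s) => s0; last first.
  have out k' A' : splice k' A' f s = 0.
    rewrite /splice /step big1 ?add0r => [|i _].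
      rewrite cutoff_out//= in_itv /= andbT leNgt (lt_le_trans s0)//.
      by rewrite mulr_ge0// ltW// mesh_gt0.
    rewrite cutoff_out// => /dint_half_line; rewrite /half_line /= in_itv /= andbT.
    by rewrite leNgt s0.
  by rewrite !out.
have [i hi] := dint_exists (k + m) s0; have hi' := dint_refine hi.
case: (ltnP (i %/ 2 ^ m) (size A)) => iA.
  have iA' : (i < size (scale_word (2 ^ m) A))%N by rewrite size_scale_word mulnC -ltn_divLR.
  rewrite (splice_in _ iA hi') (splice_in _ _ hi) ?size_cat ?ltn_addr//.
  by rewrite nth_cat iA' nth_scale_word.
have iA' : (size (scale_word (2 ^ m) A) <= i)%N by rewrite size_scale_word mulnC -leq_divRL.
rewrite (splice_out _ iA hi').
case: (ltnP i (size (scale_word (2 ^ m) A ++ samples (k + m) (2 ^ m * size A) r f))) => ir.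
  have jr : (i - size (scale_word (2 ^ m) A) < r)%N by move: ir; rewrite size_cat size_samples; lia.
  rewrite (splice_in _ ir hi) nth_cat ltnNge iA' /= (nth_samples _ _ _ jr).
  rewrite -size_scale_word subnKC//; exact: (cell_const_refine cf hi).
by rewrite (splice_out _ ir hi).
Qed.

(** Only cells completed by time [t] enter the discretization; the rest, shorter than one mesh,
    vanishes in the limit. *)
Definition cells t k := Num.truncn (t / mesh R k).

Lemma cells_bounds t k : 0 <= t -> (cells t k)%:R * mesh R k <= t < (cells t k).+1%:R * mesh R k.
Proof.
move=> t0; have h : 0 <= t / mesh R k by rewrite divr_ge0// ltW// mesh_gt0.
by rewrite -ler_pdivlMr ?mesh_gt0// -ltr_pdivrMr ?mesh_gt0// truncn_itv.
Qed.

Lemma cells_refine t k m : 0 <= t ->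
  exists r, cells t (k + m) = (2 ^ m * cells t k + r)%N /\ (r <= 2 ^ m)%N.
Proof.
move=> t0; have /andP[a1 a2] := cells_bounds k t0.
have /andP[b1 b2] := cells_bounds (k + m) t0.
have mm := mesh_gt0 R (k + m); rewrite (meshS R k m) !mulrA in a1 a2.
have c1 : (2 ^ m * cells t k <= cells t (k + m))%N.
  rewrite -ltnS -(ltr_nat R) -(ltr_pM2r mm) mulnC natrM; exact: le_lt_trans b2.
have c2 : (cells t (k + m) < 2 ^ m * (cells t k).+1)%N.
  rewrite -(ltr_nat R) -(ltr_pM2r mm) mulnC natrM; exact: le_lt_trans a2.
by exists (cells t (k + m) - 2 ^ m * cells t k)%N; lia.
Qed.

(** [o = false] serves the solution, which reads the cells from the last to the first; [o = true]
    serves its adjoint, which reads them chronologically. *)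
Definition orient (o : bool) (T : Type) (l : seq T) := if o then rev l else l.

Lemma size_orient o (T : Type) (l : seq T) : size (orient o l) = size l.
Proof. by case: o; rewrite //= size_rev. Qed.

Lemma seq_inner_rev A B : size A = size B -> seq_inner (rev A) (rev B) = seq_inner A B.
Proof.
elim: A B => [|a A IH] [|b B] //= [AB]; rewrite !rev_cons -!cats1.
rewrite seq_inner_cat ?size_rev// IH// /seq_inner /= !big_cons big_nil /= addr0.
by rewrite addrC.
Qed.

Lemma seq_inner_orient o A B : size A = size B -> seq_inner (orient o A) (orient o B) = seq_inner A B.
Proof. by case: o => //; exact: seq_inner_rev. Qed.

Lemma seq_inner_scale p A B : size A = size B ->
  seq_inner (scale_word p A) (scale_word p B) = p%:R * seq_inner A B.
Proof.
have key a b : seq_inner (nseq p a) (nseq p b) = p%:R * (Num.conj a * b).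
  elim: p => [|p IH]; first by rewrite /seq_inner big_nil mul0r.
  by rewrite /seq_inner /= big_cons /= -/(seq_inner _ _) IH -natr1 mulrDl mul1r addrC.
elim: A B => [|a A IH] [|b B] //=; first by rewrite /seq_inner !big_nil mulr0.
move=> [AB]; rewrite /scale_word /= seq_inner_cat ?size_nseq// -!/(scale_word _ _) IH// key.
by rewrite /seq_inner /= big_cons mulrDr.
Qed.
End Cells.

Section WordNear.
Variables (R : realType) (H : hilbert R) (C Cd : H -> H) (W : set H) (k : R).
Hypothesis W_lin : forall a u v, W u -> W v -> W (a *: u + v).
Hypothesis C_local : local_op W k C.
Hypothesis Cd_local : local_op W k Cd.
Variable b : R.
Hypothesis b0 : 0 <= b.
Implicit Types (h : R) (u v : H) (l s : seq R[i]).
Local Notation bounded_by := (all (fun c : R[i] => cmod c <= b)).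
Local Notation sc := (step_const k b).

Definition word_rate := sc * (b * expR b + 1) + b ^+ 2.

Lemma word_rate_ge0 : 0 <= word_rate.
Proof. by have := step_const_ge0' W_lin C_local Cd_local b0; rewrite /word_rate => s0; nonneg. Qed.

Lemma toy_word_close h s l v : 0 <= h <= 1 -> bounded_by s -> bounded_by l -> W v ->
  hnorm (toy_word C Cd h s l v - v) <= (expR ((size l)%:R * h * word_rate) - 1) * hnorm v.
Proof.
move=> h01; have /andP[h0 h1] := h01; have r0 := word_rate_ge0.
have s0 := step_const_ge0' W_lin C_local Cd_local b0.
elim: s l v => [|c s IH] [|g l] v /= sb lb Wv.
- by rewrite subrr hnorm0 mul0r mul0r expR0 subrr mul0r.
- rewrite subrr hnorm0 mulr_ge0 ?hnorm_ge0// subr_ge0 -[leLHS]expR0 ler_expR; nonneg.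
- by rewrite subrr hnorm0 mul0r mul0r expR0 subrr mul0r.
move: sb lb => /andP[cb sb] /andP[gb lb].
have WQ := toy_step_W W_lin C_local Cd_local c g h0 Wv.
have lj := jump_local W_lin C_local gb.
have ld := drift_local W_lin C_local Cd_local gb.
have [_ _ _ ln] := local_op_comb W_lin (cexp (h%:C * c) - 1) lj (local_op_scale W_lin h%:C ld).
have {ln} d1 : hnorm (toy_step C Cd h c g v - v) <= h * word_rate * hnorm v.
  rewrite /toy_step addrA addrK (le_trans (ln _ Wv))// ler_wpM2r ?hnorm_ge0//.
  rewrite cmod_real ger0_norm// /word_rate.
  have := ler_wpM2r s0 (small_exp1 b0 h01 cb); have := mulr_ge0 h0 (sqr_ge0 b).
  by move: (cmod _ * _) (b ^+ 2) (b * expR b) => x y z hx; lra.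
rewrite (le_trans (hnorm_distD (toy_step C Cd h c g v) _ _))//.
apply: (le_trans (lerD (IH _ _ sb lb WQ) d1)).
set X := expR ((size l)%:R * h * word_rate).
have X1 : 1 <= X by rewrite -[leLHS]expR0 ler_expR; nonneg.
have d2 : hnorm (toy_step C Cd h c g v) <= (1 + h * word_rate) * hnorm v.
  rewrite mulrDl mul1r -[toy_step _ _ _ _ _ _](subrK v) addrC (le_trans (hnormD _ _))//.
  by rewrite lerD2l.
have -> : expR ((size l).+1%:R * h * word_rate) = X * expR (h * word_rate).
  by rewrite -expRD; congr expR; rewrite -natr1; ring.
have x1 : 0 <= X - 1 by rewrite subr_ge0.
apply: (le_trans (lerD (ler_wpM2l x1 d2) (lexx _))).
have := ler_wpM2l (le_trans ler01 X1) (ler_wpM2r (hnorm_ge0 v) (expR_ge1Dx (h * word_rate))).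
clearbody X.
by move: (expR (h * word_rate)) (h * word_rate) (hnorm v) => e x y; lra.
Qed.

Lemma expR_sub1 (x : R) : 0 <= x -> expR x - 1 <= x * expR x.
Proof.
move=> x0; have := cexp_bound1 x%:C; rewrite cexp_real -rmorphB /= !cmod_real !ger0_norm//.
by rewrite subr_ge0 -[leLHS]expR0 ler_expR.
Qed.

(** Meant for leftover fine cells of total length at most [d]: word and exponential both differ from
    1 by a multiple of [d], so that no cancellation between them is exploited. *)
Lemma toy_word_inner h s l u v d : 0 <= h <= 1 -> bounded_by s -> bounded_by l -> W v ->
  size s = size l -> (size l)%:R * h <= d -> d <= 1 ->
  cmod (⟨u, toy_word C Cd h (map Num.conj s) l v⟩ - cexp (h%:C * seq_inner s l) * ⟨u, v⟩) <=
  d * (2 * (word_rate * expR word_rate)) * (hnorm u * hnorm v).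
Proof.
move=> h01 sb lb Wv sl ld d1; have /andP[h0 h1] := h01; have r0 := word_rate_ge0.
have s0 := step_const_ge0' W_lin C_local Cd_local b0.
have sb' : bounded_by (map Num.conj s).
  by rewrite all_map; apply: sub_all sb => c; rewrite /= cmodJ.
have x0 : 0 <= (size l)%:R * h * word_rate by nonneg.
have d0 : 0 <= d by apply: le_trans ld; nonneg.
have bnd x : 0 <= x -> x <= d * word_rate -> x * expR x <= d * (word_rate * expR word_rate).
  move=> x0' xd; rewrite mulrA ler_pM ?expR_ge0// ler_expR (le_trans xd)// ler_piMl//.
have e1 : hnorm (toy_word C Cd h (map Num.conj s) l v - v) <= d * (word_rate * expR word_rate) * hnorm v.
  apply: (le_trans (toy_word_close h01 sb' lb Wv)); rewrite ler_wpM2r ?hnorm_ge0//.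
  by rewrite (le_trans (expR_sub1 x0))// bnd// ler_wpM2r.
have e2 : cmod (cexp (h%:C * seq_inner s l) - 1) <= d * (word_rate * expR word_rate).
  rewrite (le_trans (cexp_bound1 _))// bnd ?cmod_ge0// cmodM cmod_real ger0_norm//.
  rewrite (le_trans (ler_wpM2l h0 (seq_inner_bound sb lb sl)))// sl mulrA [h * _]mulrC.
  rewrite ler_pM ?mulr_ge0 ?sqr_ge0// /word_rate lerDr; nonneg.
rewrite (_ : _ - _ = ⟨u, toy_word C Cd h (map Num.conj s) l v - v⟩ -
   (cexp (h%:C * seq_inner s l) - 1) * ⟨u, v⟩); last by rewrite innerBr; move: (cexp _) => e; ring.
rewrite (le_trans (cmodB _ _))//.
rewrite (_ : d * _ * _ = d * (word_rate * expR word_rate) * (hnorm u * hnorm v) +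
  d * (word_rate * expR word_rate) * (hnorm u * hnorm v)); last by ring.
apply: lerD.
  by rewrite (le_trans (inner_le _ _))// mulrCA ler_wpM2l ?hnorm_ge0.
by rewrite cmodM ler_pM ?cmod_ge0 ?inner_le.
Qed.
End WordNear.

(** * Convergence and unitarity *)

Lemma cexp_seq_inner_nil (R : realType) (x : R[i]) : cexp (x * seq_inner [::] [::]) = 1.
Proof. by rewrite /seq_inner big_nil mulr0 cexp0. Qed.

Section ToyGramNil.
Variables (R : realType) (H : hilbert R) (F : fock R) (K : hilbert_tensor H F).
Variables C Cd : H -> H.
Implicit Types (h : R) (u v : H) (s l : seq R[i]).
Variables (W : set H) (k : R).
Hypothesis W_lin : forall a u v, W u -> W v -> W (a *: u + v).
Hypothesis C_local : local_op W k C.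
Hypothesis Cd_local : local_op W k Cd.
Variables (h' : R) (z : R[i]) (n : nat) (E0 E1 : seq R[i] -> F).
Hypothesis h'01 : 0 <= h' <= 1.
Hypothesis gE : gram_pair h' z n E0 E1.

Lemma toy_inner_nil s l u v : W v -> size s = size l -> size l = n ->
  ⟨tensor K u (E0 (rev s)), toy K C Cd h' 1 l v [::] E1⟩ =
  z * ⟨u, toy_word C Cd h' (map Num.conj s) l v⟩.
Proof.
move=> Wv sl ln; have := toy_inner K W_lin C_local Cd_local (bounded_op_id H) h'01 gE u Wv sl
  (ln : (size ([::] : seq R[i]) + size l = n)%N) (erefl _).
by rewrite ampliation_id cats0 => ->; congr (_ * _); rewrite cexp_seq_inner_nil mulr1.
Qed.

Lemma toy_toy_inner_nil h p l l' s1 L1 s2 L2 u v : 0 <= h -> W u -> W v ->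
  size l = size l' -> size s1 = size L1 -> size s2 = size L2 ->
  (p * size l + size L1 + size L2 = n)%N ->
  ⟨toy K C Cd h p l u (rev s1 ++ [::]) (fun A0 => E0 (rev s2 ++ A0)),
   toy K C Cd h' 1 (L1 ++ (scale_word p l' ++ L2)) v [::] E1⟩ =
  z * toy_gram C Cd h h' p l l'
    (fun u v => ⟨u, toy_word C Cd h' (map Num.conj s2) L2 v⟩) u
    (toy_word C Cd h' (map Num.conj s1) L1 v).
Proof.
move=> h0 Wu Wv ll' sl1 sl2 nn.
have := toy_toy_inner K W_lin C_local Cd_local (bounded_op_id H) h'01 gE h0 Wu Wv ll' sl1 sl2
  (nn : (size ([::] : seq R[i]) + p * size l + size L1 + size L2 = n)%N) (erefl _).
by rewrite ampliation_id => ->; congr (_ * _); rewrite cexp_seq_inner_nil mulr1.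
Qed.
End ToyGramNil.

Section ExpSplice.
Variables (R : realType) (F : fock R).
Implicit Types (f g : R -> R[i]) (A B : seq R[i]) (k m n : nat) (t : R).

Lemma exp_vec_half_line f g : L2 f -> L2 g -> (forall s, 0 <= s -> f s = g s) ->
  exp_vec F f = exp_vec F g.
Proof.
move=> Lf Lg fg; apply/eqP; rewrite -subr_eq0; apply/eqP/hnorm_eq0/eqP.
rewrite -(@eqrXn2 _ 2) ?hnorm_ge0// hnorm_sqr expr0n /=; apply/eqP.
have key a c : (a = f \/ a = g) -> (c = f \/ c = g) -> L2_inner a c = L2_inner f f.
  move=> ha hc; apply: eq_cintegral => s; rewrite ?inE /= ?in_itv /= ?andbT => s0.
  by case: ha => ->; case: hc => ->; rewrite -?fg.
rewrite innerBr !innerBl !exp_vec_inner// !key; [|by auto ..].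
by rewrite !subrr.
Qed.

Definition ovec o k g A : F := exp_vec F (splice k (orient o A) g).

Lemma ovec_gram o k n f g : L2 f -> L2 g ->
  gram_pair (mesh R k) (cexp (cintegral `[n%:R * mesh R k, +oo[
    (fun s => Num.conj (f s) * g s))) n (ovec o k f) (ovec o k g).
Proof.
move=> Lf Lg A B An Bn; have sz : size (orient o A) = size (orient o B) by rewrite !size_orient An Bn.
rewrite exp_vec_inner; try exact: L2_splice.
rewrite (L2_inner_splice k sz Lf Lg) size_orient An.
rewrite (seq_inner_orient o (etrans An (esym Bn))) addrC cexpD [seq_inner A B * _]mulrC.
by [].
Qed.

Lemma splice_samples k n g s : cell_const k g -> 0 <= s -> splice k (samples k 0 n g) g s = g s.
Proof.
move=> cg s0; have [i hi] := dint_exists k s0.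
case: (ltnP i n) => ni; last by rewrite (splice_out _ _ hi) ?size_samples.
by rewrite (splice_in _ _ hi) ?size_samples// nth_samples// add0n -(cg _ _ hi).
Qed.

Lemma exp_vec_splice k n g : L2 g -> cell_const k g ->
  exp_vec F (splice k (samples k 0 n g) g) = exp_vec F g.
Proof.
by move=> Lg cg; apply: exp_vec_half_line => //; [exact: L2_splice | move=> s; exact: splice_samples].
Qed.

Lemma cexp_split k n f g : L2 f -> L2 g -> cell_const k f -> cell_const k g ->
  cexp (L2_inner f g) = cexp (cintegral `[n%:R * mesh R k, +oo[ (fun s => Num.conj (f s) * g s)) *
   cexp ((mesh R k)%:C * seq_inner (samples k 0 n f) (samples k 0 n g)).
Proof.
move=> Lf Lg cf cg; have h := @ovec_gram false k n f g Lf Lg.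
rewrite -(h (samples k 0 n f) (samples k 0 n g)) ?size_samples//.
by rewrite /ovec /= !exp_vec_splice// exp_vec_inner.
Qed.
End ExpSplice.

(** * Approximations of the solution and comparison of two meshes *)

Section ToyVectors.
Variables (R : realType) (H : hilbert R) (F : fock R) (K : hilbert_tensor H F).
Variables C Cd : H -> H.
Variables (W : set H) (kappa : R).
Hypothesis W_lin : forall a u v, W u -> W v -> W (a *: u + v).
Hypothesis C_local : local_op W kappa C.
Hypothesis Cd_local : local_op W kappa Cd.
Hypothesis C_adj : forall u v, W u -> W v -> ⟨C u, v⟩ = ⟨u, Cd v⟩.
Variable b : R.
Hypothesis b1 : 1 <= b.
Implicit Types (f g : R -> R[i]) (A B : seq R[i]) (k m n : nat) (t : R) (o : bool) (u v : H).
Local Notation bounded_by := (all (fun c : R[i] => cmod c <= b)).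
Local Notation ovec := (@ovec R F).

Definition word_list o k t g := orient o (rev (samples k 0 (cells t k) g)).

Definition toy_vec o k t g v : K :=
  toy K C Cd (mesh R k) 1 (word_list o k t g) v [::] (ovec o k g).

Definition value_bound g := forall s, cmod (g s) <= b.

Lemma all_samples k i n g : value_bound g -> bounded_by (samples k i n g).
Proof. by move=> bg; apply/allP => c /mapP[j _ ->]. Qed.

Lemma all_orient o A : bounded_by (orient o A) = bounded_by A.
Proof. by case: o; rewrite //= all_rev. Qed.

(** Describes a coarse vector by words over the fine cells, each value repeated [p] times and the
    uncovered cells [B] appended. Vectors of two meshes thereby share one index set. *)
Lemma toy_rescale h p l v A0 B (E E' : seq R[i] -> F) :
  (forall A, size A = (size l + size A0)%N -> E A = E' (scale_word p A ++ B)) ->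
  toy K C Cd h 1 l v A0 E = toy K C Cd h p l v (scale_word p A0 ++ B) E'.
Proof.
elim: l v A0 => [|g l IH] v A0 EE /=; first by rewrite EE.
have sc1 x : scale_word p ((x : R[i]) :: A0) ++ B = nseq p x ++ scale_word p A0 ++ B.
  by rewrite /scale_word /= -catA.
by rewrite -!sc1 -!IH// => A /= sA; rewrite EE//= sA addnS addSn.
Qed.

Lemma size_word_list o k t g : size (word_list o k t g) = cells t k.
Proof. by rewrite size_orient size_rev size_samples. Qed.

(* The fine cells beyond the last coarse one are read before the refined coarse cells in the
   forward orientation, after them in the backward one. *)
Lemma word_list_refine o k m t : 0 <= t -> exists r, [/\ (r <= 2 ^ m)%N,
    cells t (k + m) = (2 ^ m * cells t k + r)%N &
    forall g, cell_const k g ->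
    let s := samples (k + m) (2 ^ m * cells t k) r g in
    let s1 := if o then [::] else rev s in let s2 := if o then s else [::] in
    word_list o (k + m) t g = s1 ++ scale_word (2 ^ m) (word_list o k t g) ++ s2 /\
    forall v, toy_vec o k t g v = toy K C Cd (mesh R k) (2 ^ m) (word_list o k t g) v (rev s1 ++ [::])
      (fun A0 => ovec o (k + m) g (rev s2 ++ A0))].
Proof.
move=> t0; have [r [re r2]] := cells_refine k m t0; exists r; split=> // g cg s s1 s2.
split.
  rewrite /word_list re samples_cat add0n -/s samples_refine//.
  rewrite /s1 /s2; case: (o) => /=; first by rewrite !revK.
  by rewrite rev_cat cats0 scale_word_rev.
move=> v; rewrite /toy_vec cats0 -[rev s1]/(scale_word (2 ^ m) [::] ++ rev s1).
apply: toy_rescale => A; rewrite size_word_list addn0 => sA.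
rewrite /ovec; congr (exp_vec F _); rewrite /s1 /s2; case: (o) => /=.
  by rewrite cats0 rev_cat revK -scale_word_rev (splice_refine m (rev A) r cg) size_rev sA.
by rewrite revK (splice_refine m A r cg) sA.
Qed.

(** The first exponential bounds the tail factor. In the bracket, the first term is the error of the
    later-read leftover cells together with the accumulated cell defects, propagated through the
    coarse cells; the second is the error of the leftover cells read first. *)
Definition gram_const (t x : R) : R :=
  expR (x + t * b ^+ 2) *
  (expR (t * gram_rate kappa b) * (2 * (word_rate kappa b * expR (word_rate kappa b)) +
     t * (expR (b ^+ 2) * gram_defect kappa b)) * expR (word_rate kappa b) +
   expR (b ^+ 2) * expR (t * b ^+ 2) * (2 * (word_rate kappa b * expR (word_rate kappa b)))).

(** The scalar product factors into tail, leftover cells on either side and coarse cells, and each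
    factor is compared with the matching factor of [exp <f, g>]. The bound involves the coarse mesh
    [k] but not [m]; this uniformity yields convergence as well as isometry of the limit. *)
Lemma toy_vec_gram o k m t f g u v : 0 <= t -> L2 f -> L2 g -> cell_const k f -> cell_const k g ->
  value_bound f -> value_bound g -> W u -> W v ->
  cmod (⟨toy_vec o k t f u, toy_vec o (k + m) t g v⟩ - cexp (L2_inner f g) * ⟨u, v⟩) <=
  mesh R k * (gram_const t (cmod (L2_inner f g)) * (hnorm u * hnorm v)).
Proof.
move=> t0 Lf Lg cf cg bf bg Wu Wv.
have b0 : 0 <= b := le_trans ler01 b1.
have [r [r2 re hw]] := word_list_refine o k m t0.
have [_ hf] := hw f cf; have [hg _] := hw g cg; rewrite hf {1}/toy_vec hg {hw hf}.
set p := (2 ^ m)%N in r2 re hg *; set h' := mesh R (k + m); set h := mesh R k.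
have hE : h = p%:R * h' by exact: meshS.
have [h'0 h0] : 0 <= h' /\ 0 <= h by split; exact/ltW/mesh_gt0.
have [h'1 h1] : h' <= 1 /\ h <= 1 by split; exact: mesh_le1.
have h'01 : 0 <= h' <= 1 by rewrite h'0.
set sf := samples (k + m) _ r f; set sg := samples (k + m) _ r g.
set s1 := if o then [::] else rev sf; set s2 := if o then sf else [::].
set L1 := if o then [::] else rev sg; set L2' := if o then sg else [::].
set l := word_list o k t f; set l' := word_list o k t g.
have ll' : size l = size l' by rewrite !size_word_list.
have sfg : size sf = size sg by rewrite !size_samples.
have [sz1 sz2] : size s1 = size L1 /\ size s2 = size L2'.
  by rewrite /s1 /s2 /L1 /L2'; case: (o) => /=; rewrite ?size_rev.
have [bsf bsg] : bounded_by sf /\ bounded_by sg by split; exact: all_samples.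
have [[bs1 bs2] [bL1 bL2]] : (bounded_by s1 /\ bounded_by s2) /\ (bounded_by L1 /\ bounded_by L2').
  by rewrite /s1 /s2 /L1 /L2'; case: (o); rewrite ?all_rev.
have [bl bl'] : bounded_by l /\ bounded_by l'.
  by split; rewrite all_orient all_rev all_samples.
have nsum : (p * size l + size L1 + size L2' = cells t (k + m))%N.
  by rewrite re size_word_list /L1 /L2' -addnA; case: (o); rewrite /= ?size_rev size_samples ?addn0.
have E := toy_toy_inner_nil K W_lin C_local Cd_local h'01
  (@ovec_gram R F o (k + m) (cells t (k + m)) f g Lf Lg) h0 Wu Wv ll' sz1 sz2 nsum.
set z := cexp (cintegral _ _) in E; rewrite E {E}.
pose a := cexp (h'%:C * seq_inner s2 L2'); pose e1 := cexp (h'%:C * seq_inner s1 L1).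
pose e := cexp (h%:C * seq_inner l l').
have S0 : cexp (L2_inner f g) = z * cexp (h'%:C * seq_inner (samples (k + m) 0 (cells t (k + m)) f)
    (samples (k + m) 0 (cells t (k + m)) g)).
  exact: (cexp_split F (cells t (k + m)) Lf Lg (cell_const_refine (m := m) cf) (cell_const_refine (m := m) cg)).
clearbody z.
have split_e : cexp (L2_inner f g) = z * (a * e * e1).
  have -> : a * e * e1 = cexp (h'%:C * seq_inner s2 L2' + h%:C * seq_inner l l' + h'%:C * seq_inner s1 L1).
    by rewrite [RHS]cexpD; congr (_ * _); exact/esym/cexpD.
  rewrite S0; congr (z * cexp _).
  rewrite re !samples_cat !add0n seq_inner_cat ?size_samples// !samples_refine//.
  rewrite seq_inner_scale ?size_samples// -/sf -/sg.
  have -> : seq_inner l l' = seq_inner (samples k 0 (cells t k) f) (samples k 0 (cells t k) g).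
    by rewrite seq_inner_orient ?size_rev ?size_samples// seq_inner_rev ?size_samples.
  have -> : h%:C = p%:R * h'%:C by rewrite hE rmorphM /= rmorph_nat.
  have -> : seq_inner sf sg = seq_inner s2 L2' + seq_inner s1 L1.
    rewrite /s1 /s2 /L1 /L2'; case: (o); first by rewrite {3}/seq_inner big_nil addr0.
    by rewrite {2}/seq_inner big_nil add0r seq_inner_rev.
  by rewrite -/p; ring.
have nh : (size l)%:R * h <= t by rewrite size_word_list; have /andP[] := cells_bounds k t0.
have nh' : (cells t (k + m))%:R * h' <= t by have /andP[] := cells_bounds (k + m) t0.
have zb : cmod z <= expR (cmod (L2_inner f g) + t * b ^+ 2).
  have hs : cmod (h'%:C * seq_inner (samples (k + m) 0 (cells t (k + m)) f)
      (samples (k + m) 0 (cells t (k + m)) g)) <= t * b ^+ 2.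
    rewrite cmodM cmod_real ger0_norm//.
    rewrite (le_trans (ler_wpM2l h'0 (seq_inner_bound (all_samples _ _ _ bf) (all_samples _ _ _ bg) _))) ?size_samples//.
    by rewrite mulrCA mulrA ler_wpM2r ?sqr_ge0.
  have -> : z = cexp (L2_inner f g - h'%:C * seq_inner (samples (k + m) 0 (cells t (k + m)) f)
      (samples (k + m) 0 (cells t (k + m)) g)).
    by rewrite cexpD S0 -mulrA -cexpD subrr cexp0 mulr1.
  by rewrite (le_trans (cexp_bound _))// ler_expR (le_trans (cmodB _ _))// lerD2l.
have rh : r%:R * h' <= h by rewrite hE ler_wpM2r// ler_nat.
have [szL1 szL2] : (size L1)%:R * h' <= h /\ (size L2')%:R * h' <= h.
  by rewrite /L1 /L2'; case: (o); rewrite /= ?size_rev size_samples mul0r.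
pose phi0 : form H := fun u v => ⟨u, toy_word C Cd h' (map Num.conj s2) L2' v⟩.
pose rho := word_rate kappa b; pose dl := 2 * (rho * expR rho).
have rho0 : 0 <= rho := word_rate_ge0 W_lin C_local Cd_local b0.
have dl0 : 0 <= dl by rewrite /dl; nonneg.
have bN : form_bound W (h * dl) (form_comb (- a) (@inner R H) phi0).
  split=> [|u' v' Wu' Wv']; first exact: mulr_ge0.
  have := toy_word_inner W_lin C_local Cd_local b0 u' h'01 bs2 bL2 Wv' sz2 szL2 h1.
  by rewrite /form_comb mulNr addrC.
have sp0 : sesquilinear_on W phi0.
  have [x lx] := toy_word_loc W_lin C_local Cd_local h'01 (map Num.conj s2) L2'.
  exact: (sesquilinear_comp (local_op_id W) lx (inner_sesq W)).
have ab : cmod a <= expR (b ^+ 2).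
  rewrite (le_trans (cexp_bound _))// ler_expR cmodM cmod_real ger0_norm//.
  rewrite (le_trans (ler_wpM2l h'0 (seq_inner_bound bs2 bL2 sz2)))// sz2 mulrCA mulrA.
  by rewrite -[leRHS]mul1r ler_wpM2r ?sqr_ge0// (le_trans szL2).
have eb : cmod e <= expR (t * b ^+ 2).
  rewrite (le_trans (cexp_bound _))// ler_expR cmodM cmod_real ger0_norm//.
  rewrite (le_trans (ler_wpM2l h0 (seq_inner_bound bl bl' ll')))// mulrCA mulrA.
  by rewrite ler_wpM2r ?sqr_ge0.
have [N0 hN] := toy_gram_inner W_lin C_local Cd_local C_adj b1 h'0 hE h1 bl bl' ll' sp0 ab bN.
set T := toy_gram _ _ _ _ _ _ _ _ in hN *.
set w := toy_word _ _ _ (map Num.conj s1) L1 v.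
have bs1' : bounded_by (map Num.conj s1).
  by rewrite all_map; apply: sub_all bs1 => c; rewrite /= cmodJ.
have [Ww wb] : W w /\ hnorm w <= expR rho * hnorm v.
  have [x [_ Wx _ _]] := toy_word_loc W_lin C_local Cd_local h'01 (map Num.conj s1) L1.
  split; first exact: Wx.
  have := toy_word_close W_lin C_local Cd_local b0 h'01 bs1' bL1 Wv; rewrite -/w => cl.
  rewrite -[w](subrK v) (le_trans (hnormD _ _))// (le_trans (lerD cl (lexx _)))//.
  rewrite mulrBl mul1r subrK ler_wpM2r ?hnorm_ge0// ler_expR -/rho.
  by rewrite -[leRHS]mul1r ler_wpM2r// (le_trans szL1).
have d1 := hN _ _ Wu Ww.
have d2 := toy_word_inner W_lin C_local Cd_local b0 u h'01 bs1 bL1 Wv sz1 szL1 h1.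
rewrite -/w -/e1 -/rho -/dl in d2.
(* Telescopes the comparison: first [T] with [a e] times the inner product at [w], then [<u, w>]
   with [e1 <u, v>]. *)
have alg (x1 x2 x3 x4 x5 x6 x7 : R[i]) :
  x1 * x5 - x1 * (x2 * x3 * x4) * x7 = x1 * (- (x2 * x3) * x6 + x5 + x2 * x3 * (x6 - x4 * x7)).
  by ring.
rewrite split_e (alg z a e e1 (T u w) ⟨u, w⟩ ⟨u, v⟩) {alg split_e}.
have gr0 : 0 <= gram_rate kappa b by have [] := gram_rate_ge W_lin C_local Cd_local b1.
have gd0 : 0 <= gram_defect kappa b.
  by have := gram_err_ge0 W_lin C_local Cd_local b1; rewrite /gram_defect => ?; nonneg.
have hu := hnorm_ge0 u; have hv := hnorm_ge0 v; have hw := hnorm_ge0 w.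
rewrite cmodM /gram_const -/rho -/dl.
rewrite [leRHS](_ : _ = expR (cmod (L2_inner f g) + t * b ^+ 2) *
  (expR (t * gram_rate kappa b) * (h * dl + t * (expR (b ^+ 2) * gram_defect kappa b * h)) *
     (hnorm u * (expR rho * hnorm v)) +
   expR (b ^+ 2) * expR (t * b ^+ 2) * (h * dl * (hnorm u * hnorm v)))); last first.
  have alg2 (x1 x2 x3 x4 x5 x6 x7 x8 x9 y1 y2 : R) :
    x1 * (x2 * (x3 * (x4 + x5 * (x6 * x7)) * x8 + x6 * x9 * x4) * (y1 * y2)) =
    x2 * (x3 * (x1 * x4 + x5 * (x6 * x7 * x1)) * (y1 * (x8 * y2)) + x6 * x9 * (x1 * x4 * (y1 * y2))).
    by ring.
  exact: alg2.
apply: ler_pM; rewrite ?cmod_ge0//; apply: (le_trans (cmodD _ _)); apply: lerD.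
  apply: (le_trans d1); apply: ler_pM; [exact: N0|nonneg| |by rewrite ler_wpM2l].
  apply: ler_pM; [nonneg|nonneg|by rewrite ler_expR ler_wpM2r|].
  by rewrite lerD2l; apply: ler_wpM2r => //; nonneg.
rewrite !cmodM; apply: ler_pM; rewrite ?mulr_ge0 ?cmod_ge0//.
by apply: ler_pM; rewrite ?cmod_ge0.
Qed.

Lemma toy_vec_inner o k t f g u v : 0 <= t -> L2 f -> L2 g -> cell_const k f -> cell_const k g ->
  W v ->
  ⟨tensor K u (exp_vec F f), toy_vec o k t g v⟩ =
  cexp (cintegral `[(cells t k)%:R * mesh R k, +oo[ (fun s => Num.conj (f s) * g s)) *
  ⟨u, toy_word C Cd (mesh R k) (map Num.conj (word_list o k t f)) (word_list o k t g) v⟩.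
Proof.
move=> t0 Lf Lg cf cg Wv; have h0 := ltW (mesh_gt0 R k); have h1 := mesh_le1 R k.
have h01 : 0 <= mesh R k <= 1 by rewrite h0.
have E := toy_inner_nil K W_lin C_local Cd_local h01 (@ovec_gram R F o k (cells t k) f g Lf Lg)
  (s := word_list o k t f) (l := word_list o k t g) u Wv.
rewrite !size_word_list in E; rewrite -(E (erefl _) (erefl _)) {E}.
congr (⟨tensor K u _, _⟩); rewrite -(exp_vec_splice F (cells t k) Lf cf) /ovec /word_list.
congr (exp_vec F (splice k _ f)).
by case: (o); rewrite /= !revK.
Qed.

End ToyVectors.

(** What the construction of the evolution takes from [[r, .]]: an increasing chain of invariant
    subspaces with dense union, on each of which the operator and its formal adjoint are bounded, at
    a rate that may grow along the chain. *)
Record coupling (R : realType) (H : hilbert R) := Coupling {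
  cdom : nat -> set H;
  cop : H -> H;
  cadj : H -> H;
  crate : nat -> R;
  cdom_lin : forall m a u v, cdom m u -> cdom m v -> cdom m (a *: u + v);
  cdom_mono : forall m n, (m <= n)%N -> cdom m `<=` cdom n;
  cop_local : forall m, local_op (cdom m) (crate m) cop;
  cadj_local : forall m, local_op (cdom m) (crate m) cadj;
  cop_adj : forall m u v, cdom m u -> cdom m v -> ⟨cop u, v⟩ = ⟨u, cadj v⟩;
  cdom_dense : hdense [set v | exists m, cdom m v] }.

Section NegCoupling.
Variables (R : realType) (H : hilbert R) (Q : coupling H).

Lemma neg_local m X : local_op (cdom Q m) (crate Q m) X ->
  local_op (cdom Q m) (crate Q m) (fun u => (-1) *: X u).
Proof.
move=> h; have := local_op_scale (@cdom_lin _ _ Q m) (-1) h.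
by rewrite cmodN cmod1 mul1r.
Qed.

Lemma neg_adj m u v : cdom Q m u -> cdom Q m v -> ⟨(-1) *: cop Q u, v⟩ = ⟨u, (-1) *: cadj Q v⟩.
Proof.
by move=> Wu Wv; rewrite innerZl innerZr (cop_adj Wu Wv) [Num.conj (-1)]rmorphN rmorph1.
Qed.

(** Passing from [r] to [-r] leaves [gen_op] unchanged on the core and flips both noise terms, just
    as taking adjoints of the steps does. *)
Definition neg_coupling : coupling H :=
  @Coupling R H (cdom Q) (fun u => (-1) *: cop Q u) (fun u => (-1) *: cadj Q u) (crate Q)
    (@cdom_lin _ _ Q) (@cdom_mono _ _ Q) (fun m => neg_local (cop_local Q m))
    (fun m => neg_local (cadj_local Q m)) neg_adj (@cdom_dense _ _ Q).
End NegCoupling.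

Section StepFunctions.
Variables (R : realType) (F : fock R).
Implicit Types (f g : R -> R[i]).

Definition is_step f := exists k n c, f = @step R k n c.

Lemma step_bounded k n c s :
  cmod (@step R k n c s) <= 1 + \sum_(j < n) cmod (c j).
Proof.
have S0 : 0 <= \sum_(j < n) cmod (c j) by apply: sumr_ge0 => j _; exact: cmod_ge0.
have [s0|s0] := leP 0 s; last first.
  rewrite /step big1 ?cmod0 ?addr_ge0// => i _.
  rewrite cutoff_out// => /dint_half_line; rewrite /half_line /= in_itv /= andbT.
  by rewrite leNgt s0.
have [j hj] := dint_exists k s0; case: (ltnP j n) => jn.
  rewrite (step_in _ jn hj) (bigD1 (Ordinal jn))//= addrCA lerDl addr_ge0//.
  by apply: sumr_ge0 => i _; exact: cmod_ge0.
by rewrite (step_out _ jn hj) cmod0 addr_ge0.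
Qed.

(** Step functions on meshes [k] and [k'] are both constant on the cells of mesh [k + k']. *)
Lemma step_data f g : is_step f -> is_step g -> exists k b,
  [/\ L2 f /\ L2 g, cell_const k f /\ cell_const k g, 1 <= b & value_bound b f /\ value_bound b g].
Proof.
move=> [k [n [c ->]]] [k' [n' [c' ->]]].
exists (k + k')%N, ((1 + \sum_(j < n) cmod (c j)) + (1 + \sum_(j < n') cmod (c' j))).
have S0 p (d : nat -> R[i]) : 0 <= \sum_(j < p) cmod (d j) by apply: sumr_ge0 => j _; exact: cmod_ge0.
split.
- by split; exact: L2_step.
- split; first exact/cell_const_refine/cell_const_step.
  by rewrite addnC; exact/cell_const_refine/cell_const_step.
- by rewrite -addrA lerDl !addr_ge0.
split=> s; rewrite (le_trans (step_bounded _ _ _ _))//; first by rewrite lerDl !addr_ge0.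
by rewrite lerDr !addr_ge0.
Qed.

Lemma is_step_L2 f : is_step f -> L2 f.
Proof. by move=> [k [n [c ->]]]; exact: L2_step. Qed.

Lemma exp_step_close f (e : R) : L2 f -> 0 < e -> exists g, [/\ is_step g,
  hnorm (one_particle F f - one_particle F g) < e & hnorm (exp_vec F f - exp_vec F g) < e].
Proof.
move=> Lf e0; pose N := hnorm (one_particle F f) + 1.
have N1 : 1 <= N by rewrite lerDr hnorm_ge0.
have N0 : 0 < N by exact: lt_le_trans N1.
pose A := 2 * (N * expR (3 * N ^+ 2)); have A0 : 0 < A by rewrite !mulr_gt0// expR_gt0.
pose d := Num.min 1 (Num.min e (e ^+ 2 / A)).
have d0 : 0 < d by rewrite !lt_min ltr01 e0 divr_gt0// exprn_gt0.
have [k [n [c hd]]] := step_dense F Lf d0; set g := step _ _ _ in hd.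
move: hd; rewrite !lt_min => /and3P[d1 d2 d3].
exists g; split=> //; first by exists k, n, c.
have Lg : L2 g by exact: L2_step.
have gN : hnorm (one_particle F g) <= N.
  rewrite -[one_particle F g](subrK (one_particle F f)) addrC (le_trans (hnormD _ _))//.
  by rewrite lerD2l hnorm_distC ltW.
have := exp_vec_close Lf Lg (_ : hnorm (one_particle F f) <= N) gN.
rewrite lerDl ler01 => /(_ isT) h.
rewrite -(@ltr_pXn2r _ 2) ?nnegrE ?hnorm_ge0 ?(ltW e0)//; apply: (le_lt_trans h).
move: d3; rewrite ltr_pdivlMr// /A; move: (hnorm _) (expR _) => x y.
by rewrite (_ : 2 * (N * x * y) = x * (2 * (N * y))); last by ring.
Qed.

Definition step_fun := {f : R -> R[i] | is_step f}.

Lemma exp_step_total : hdense (span_of (fun f : step_fun => exp_vec F (sval f))).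
Proof.
apply: (span_of_trans (@exp_vec_total _ F)) => -[f Lf] e e0.
have [g [sg _ hg]] := exp_step_close Lf e0.
exists (exp_vec F g) => //.
have := span_of_sum (fun f : step_fun => exp_vec F (sval f)) (fun _ : 'I_1 => 1) (fun=> exist _ g sg).
by rewrite big_ord1 scale1r.
Qed.
End StepFunctions.

Lemma tensor_span_dense (R : realType) (H F : hilbert R) (K : hilbert_tensor H F) (D : set H)
  (J : Type) (y : J -> F) : hdense D -> hdense (span_of y) ->
  hdense (span_of (fun p : {v : H | D v} * J => tensor K (sval p.1) (y p.2))).
Proof.
move=> dD dy; apply: (span_of_trans (@tensor_dense _ _ _ K)) => -[u x] e e0 /=.
have e2 : 0 < e / 2 by rewrite divr_gt0.
have a0 : 0 < hnorm x + 1 by rewrite ltr_wpDl ?hnorm_ge0.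
have [v Dv hv] := dD u _ (divr_gt0 e2 a0).
have c0 : 0 < hnorm v + 1 by rewrite ltr_wpDl ?hnorm_ge0.
have [x' sx' hx] := dy x _ (divr_gt0 e2 c0).
exists (tensor K v x').
  move: sx'; rewrite /span_of; elim=> [|a i u1 v1 _ IH]; first by rewrite tensor0r; constructor.
  by rewrite tensorDr tensorZr; exact: (pair_spanS a (exist _ v Dv, i)).
rewrite (le_lt_trans (hnorm_distD (tensor K v x) _ _))//.
rewrite -tensorBl -tensorBr !hnorm_tensor [e]splitr ltrD//.
  rewrite (le_lt_trans (ler_wpM2l (hnorm_ge0 _) (_ : hnorm x <= hnorm x + 1))) ?lerDl//.
  by rewrite -ltr_pdivlMr.
rewrite (le_lt_trans (ler_wpM2r (hnorm_ge0 _) (_ : hnorm v <= hnorm v + 1))) ?lerDl//.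
by rewrite mulrC -ltr_pdivlMr.
Qed.

Section Evolution.
Variables (R : realType) (H : hilbert R) (F : fock R) (K : hilbert_tensor H F).
Implicit Types (f g : R -> R[i]) (Q : coupling H) (k m n : nat) (t : R) (o : bool) (u v : H).

Definition core Q : set H := [set v | exists m, cdom Q m v].

Definition tvec Q o k t g v := toy_vec K (cop Q) (cadj Q) o k t g v.
Definition toy_lim Q o t g v : K := hlim (fun k => tvec Q o k t g v).

Lemma core2 Q u v : core Q u -> core Q v -> exists m, cdom Q m u /\ cdom Q m v.
Proof.
move=> [m hu] [m' hv]; exists (maxn m m'); split.
  exact: (cdom_mono (leq_maxl m m') hu).
exact: (cdom_mono (leq_maxr m m') hv).
Qed.

Lemma polarization_bound (A B D E M : R) :
  A - E <= M -> E - D <= M -> B - E <= M -> A - 2 * D + B <= 4 * M.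
Proof. by lra. Qed.

(* Two toy vectors at levels k0 <= k <= k' are within c * mesh k of the Gram matrix of the limit. *)
Lemma tvec_gram Q o t f g u v : 0 <= t -> is_step f -> is_step g -> core Q u -> core Q v ->
  exists c k0, 0 <= c /\ forall k m, (k0 <= k)%N ->
    cmod (⟨tvec Q o k t f u, tvec Q o (k + m) t g v⟩ - cexp (L2_inner f g) * ⟨u, v⟩) <= mesh R k * c.
Proof.
move=> t0 sf sg cu cv.
have [k0 [b [[Lf Lg] [cf cg] b1 [bf bg]]]] := step_data sf sg.
have [m [Wu Wv]] := core2 cu cv.
have lin := @cdom_lin _ _ Q m; have lC := cop_local Q m; have lCd := cadj_local Q m.
pose c := gram_const (crate Q m) b t (cmod (L2_inner f g)) * (hnorm u * hnorm v).
have main k p : (k0 <= k)%N ->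
    cmod (⟨tvec Q o k t f u, tvec Q o (k + p) t g v⟩ - cexp (L2_inner f g) * ⟨u, v⟩) <= mesh R k * c.
  move=> /subnKC <-; apply: (toy_vec_gram K lin lC lCd (@cop_adj _ _ Q m)) => //;
    exact: cell_const_refine.
exists c, k0; split=> //.
have := le_trans (cmod_ge0 _) (main k0 0 (leqnn _)).
by rewrite pmulr_rge0 ?mesh_gt0.
Qed.

(** In the expansion of the squared distance of two approximations, all three scalar products lie
    within a multiple of the coarser mesh of one number [a], so they cancel. *)
Lemma tvec_cvg Q o t g v : 0 <= t -> is_step g -> core Q v ->
  hcvg (fun k => tvec Q o k t g v) (toy_lim Q o t g v).
Proof.
move=> t0 sg cv; have [c [k0 [c0 hc]]] := tvec_gram o t0 sg sg cv cv.
pose a := cexp (L2_inner g g) * ⟨v, v⟩.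
have hd k m : (k0 <= k)%N ->
    hnorm (tvec Q o k t g v - tvec Q o (k + m) t g v) ^+ 2 <= mesh R k * (4 * c).
  move=> kk; set x := tvec _ _ _ _ _ _; set y := tvec _ _ _ _ _ _.
  have h1 := hc k 0 kk; have h2 := hc k m kk; have h3 := hc (k + m) 0 (leq_trans kk (leq_addr _ _)).
  rewrite !addn0 in h1 h3; rewrite -/x -/y in h1 h2 h3.
  have mm : mesh R (k + m) * c <= mesh R k * c.
    by rewrite ler_wpM2r// [leRHS](meshS R k m) ler_peMl ?ler1n ?expn_gt0// ltW// mesh_gt0.
  have re (z w : R[i]) : complex.Re z - complex.Re w <= cmod (z - w) by rewrite -ReN -ReD Re_le_cmod.
  rewrite hnormB_sqr !hnorm_sqr.
  have r1 := le_trans (re _ _) h1; have r3 := le_trans (le_trans (re _ _) h3) mm.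
  rewrite cmod_distC in h2; have r2 := le_trans (re _ _) h2.
  by rewrite mulrCA; exact: polarization_bound r1 r2 r3.
suff [l hl] : exists l, hcvg (fun k => tvec Q o k t g v) l by rewrite /toy_lim (hlim_eq hl).
apply: hcauchy_cvg => e e0.
have c1 : 0 < 4 * c + 1 by rewrite ltr_wpDl// mulr_ge0.
have e2 : 0 < (e / 2) ^+ 2 / (4 * c + 1) by rewrite divr_gt0// exprn_gt0// divr_gt0.
have [k1 hk1] := mesh_small e2; pose k := maxn k0 k1.
have close n : (k <= n)%N -> hnorm (tvec Q o k t g v - tvec Q o n t g v) < e / 2.
  move=> /subnKC <-; rewrite -(@ltr_pXn2r _ 2) ?nnegrE ?hnorm_ge0 ?divr_ge0 ?(ltW e0)//.
  apply: (le_lt_trans (hd _ _ (leq_maxl _ _))).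
  have := hk1 k (leq_maxr _ _); rewrite ltr_pdivlMr//; apply: le_lt_trans.
  by rewrite ler_wpM2l ?lerDl// ltW// mesh_gt0.
exists k => m n km kn; rewrite (le_lt_trans (hnorm_distD (tvec Q o k t g v) _ _))//.
rewrite [e]splitr; apply: ltrD; last exact: close.
by rewrite hnorm_distC; exact: close.
Qed.

Lemma toy_lim_inner Q o t f g u v : 0 <= t -> is_step f -> is_step g -> core Q u -> core Q v ->
  ⟨toy_lim Q o t f u, toy_lim Q o t g v⟩ =
  ⟨tensor K u (exp_vec F f), tensor K v (exp_vec F g)⟩.
Proof.
move=> t0 sf sg cu cv; have [c [k0 [c0 hc]]] := tvec_gram o t0 sf sg cu cv.
rewrite tensor_inner exp_vec_inner; [|exact: is_step_L2 ..].
apply: (ccvg_unique (ccvg_inner (tvec_cvg o t0 sf cu) (tvec_cvg o t0 sg cv))).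
move=> e e0; have c1 : 0 < c + 1 by rewrite ltr_wpDl.
have [k1 hk1] := mesh_small (divr_gt0 e0 c1); exists (maxn k0 k1) => n.
rewrite geq_max => /andP[n0 n1]; have := hc n 0 n0; rewrite addn0 mulrC => /le_lt_trans; apply.
have := hk1 n n1; rewrite ltr_pdivlMr//; apply: le_lt_trans.
by rewrite ler_wpM2l ?lerDl// ltW// mesh_gt0.
Qed.

Definition core_step Q := ({v : H | core Q v} * step_fun R)%type.
Definition core_exp Q (p : core_step Q) : K := tensor K (sval p.1) (exp_vec F (sval p.2)).

Lemma core_exp_dense Q : hdense (span_of (@core_exp Q)).
Proof.
have := @tensor_span_dense R H F K (core Q) (step_fun R) (fun f : step_fun R => exp_vec F (sval f)).
by apply; [exact: cdom_dense | exact: exp_step_total].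
Qed.

Lemma evolution_exists Q o t : exists U : K -> K, 0 <= t -> [/\ linear U,
  forall x y, ⟨U x, U y⟩ = ⟨x, y⟩ &
  forall g v, is_step g -> core Q v -> U (tensor K v (exp_vec F g)) = toy_lim Q o t g v].
Proof.
have [t0|t0] := leP 0 t; last by exists id.
have [|U [lU iU hU]] := @isometric_extension _ K K _ (@core_exp Q)
    (fun p => toy_lim Q o t (sval p.2) (sval p.1)) (@core_exp_dense Q).
  by move=> [[u cu] [f sf]] [[v cv] [g sg]] /=; exact: toy_lim_inner.
by exists U => _; split=> // g v sg cv; exact: (hU (exist _ v cv, exist _ g sg)).
Qed.

Definition evolution Q o t : K -> K := projT1 (cid (evolution_exists Q o t)).

Lemma evolutionP Q o t : 0 <= t -> [/\ linear (evolution Q o t),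
  forall x y, ⟨evolution Q o t x, evolution Q o t y⟩ = ⟨x, y⟩ &
  forall g v, is_step g -> core Q v ->
    evolution Q o t (tensor K v (exp_vec F g)) = toy_lim Q o t g v].
Proof. by rewrite /evolution; case: cid => U /= h /h. Qed.

End Evolution.

(** * The time-reversed scheme for [-r] as the adjoint *)

Section Duality.
Variables (R : realType) (H : hilbert R) (Q : coupling H) (m : nat) (b : R).
Hypothesis b1 : 1 <= b.
Implicit Types (h : R) (c g z : R[i]) (u v : H) (s l : seq R[i]).
Local Notation W := (cdom Q m).
Local Notation C := (cop Q).
Local Notation Cd := (cadj Q).
Local Notation C' := (cop (neg_coupling Q)).
Local Notation Cd' := (cadj (neg_coupling Q)).
Local Notation bounded_by := (all (fun c : R[i] => cmod c <= b)).
Let kap := crate Q m.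
Let lin := @cdom_lin _ _ Q m.
Let lC := cop_local Q m.
Let lCd := cadj_local Q m.
Let lC' := cop_local (neg_coupling Q) m.
Let lCd' := cadj_local (neg_coupling Q) m.

Definition dual_err := 2 * word_err kap b.

(** Both steps agree to first order with [1 + h Z] and its adjoint, where [Z] is
    [G - g Cd + conj f (g + C)] on vectors. Its formal adjoint [G - conj g C + f (conj g + Cd)] is
    the same expression for [-C], with [f] and [g] exchanged. *)
Lemma toy_step_dual h f g u v : 0 <= h <= 1 -> cmod f <= b -> cmod g <= b -> W u -> W v ->
  cmod (⟨u, toy_step C Cd h (Num.conj f) g v⟩ - ⟨toy_step C' Cd' h (Num.conj g) f u, v⟩) <=
  h ^+ 2 * (dual_err * (hnorm u * hnorm v)).
Proof.
move=> h01 fb gb Wu Wv; have b0 : 0 <= b := le_trans ler01 b1.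
have w0 : cmod (0 : R[i]) <= b by rewrite cmod0.
have fb' : cmod (Num.conj f) <= b by rewrite cmodJ.
have gb' : cmod (Num.conj g) <= b by rewrite cmodJ.
have [_ _ _ _ e1] := word_step lin lC lCd b0 h01 fb' gb w0.
have [_ _ _ _ e2] := word_step lin lC' lCd' b0 h01 gb' fb w0.
have [_ [_ {}e1]] := e1 _ _ (inner_sesq W) (inner_form_bound W).
have [_ [_ {}e2]] := e2 _ _ (inner_sesq W) (inner_form_bound W).
have {}e1 := e1 _ _ Wu Wv; have {}e2 := e2 _ _ Wv Wu.
rewrite -cmodJ in e2.
have [WC WCd] : (forall u, W u -> W (C u)) /\ (forall u, W u -> W (Cd u)).
  by split; [case: lC | case: lCd].
have adj' x y : W x -> W y -> ⟨Cd x, y⟩ = ⟨x, C y⟩.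
  by move=> Wx Wy; rewrite -inner_conj -(cop_adj Wy Wx) inner_conj.
have [WCu WCv] : W (C u) /\ W (C v) by split; exact: WC.
have e12 : word_generator C Cd (Num.conj f) g 0 (@inner R H) u v =
    Num.conj (word_generator C' Cd' (Num.conj g) f 0 (@inner R H) v u).
  rewrite /word_generator !mul0r !addr0 /drift /jump /gen_op /=.
  have -> : (-1) *: Cd ((-1) *: C u) = Cd (C u).
    by rewrite (local_opZ lin _ lCd)// scalerA mulrNN mulr1 scale1r.
  rewrite rmorphD rmorphM /= conjCK !inner_conj !(innerDl, innerDr, innerZl, innerZr).
  rewrite !adj'// (cop_adj Wu WCv) (cop_adj Wu Wv).
  have cN (x : R[i]) : Num.conj (- x) = - Num.conj x by rewrite rmorphN.
  rewrite !cN rmorph1 fmorphV rmorph_nat /=.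
  by move: (Num.conj f) => fc; ring.
move: e1 e2; rewrite /word_form !mulr0 !cexp0 !mul1r e12.
move: (word_generator _ _ _ _ _ _ _ _) => z.
rewrite !(rmorphB, rmorphM) /= !inner_conj conj_real => e1 e2.
have := le_trans (cmodB _ _) (lerD e1 e2).
rewrite (_ : _ - _ - _ - (_ - _ - _) = ⟨u, toy_step C Cd h (Num.conj f) g v⟩ -
   ⟨toy_step C' Cd' h (Num.conj g) f u, v⟩); last by ring.
move=> /le_trans; apply; rewrite /dual_err.
by rewrite le_eqVlt; apply/orP; left; apply/eqP; ring.
Qed.

Lemma toy_word_growth h s l v : 0 <= h <= 1 -> bounded_by s -> bounded_by l -> W v ->
  hnorm (toy_word C Cd h s l v) <= expR ((size l)%:R * h * word_rate kap b) * hnorm v.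
Proof.
move=> h01 bs bl Wv; have b0 : 0 <= b := le_trans ler01 b1.
have := toy_word_close lin lC lCd b0 h01 bs bl Wv.
set w := toy_word _ _ _ _ _ _ => hcl.
rewrite -[w](subrK v) (le_trans (hnormD _ _))// (le_trans (lerD hcl (lexx _)))//.
by rewrite mulrBl mul1r subrK.
Qed.
End Duality.

(** Steps cross the scalar product one at a time, each at cost [h^2]; there are about [t / h] of
    them, so the total is of order [h]. Crossing reverses the order of the word. *)
Lemma toy_word_dual (R : realType) (H : hilbert R) (Q : coupling H) m (b h : R)
    (s l : seq R[i]) (u v : H) : 1 <= b -> 0 <= h <= 1 ->
  all (fun c : R[i] => cmod c <= b) s -> all (fun c : R[i] => cmod c <= b) l ->
  size s = size l -> cdom Q m u -> cdom Q m v ->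
  cmod (⟨u, toy_word (cop Q) (cadj Q) h (map Num.conj (rev s)) (rev l) v⟩ -
    ⟨toy_word (cop (neg_coupling Q)) (cadj (neg_coupling Q)) h (map Num.conj l) s u, v⟩) <=
  (size l)%:R * h ^+ 2 * dual_err Q m b * expR ((size l)%:R * h * word_rate (crate Q m) b) *
   (hnorm u * hnorm v).
Proof.
move=> b1 h01; have b0 : 0 <= b := le_trans ler01 b1; have /andP[h0 h1] := h01.
have lin := @cdom_lin _ _ Q m; have lC := cop_local Q m; have lCd := cadj_local Q m.
have r0 := word_rate_ge0 lin lC lCd b0.
have de0 : 0 <= dual_err Q m b by rewrite mulr_ge0// (word_err_ge0 lin lC lCd b0).
have conj_bounded (s0 : seq R[i]) : all (fun c : R[i] => cmod c <= b) s0 ->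
    all (fun c : R[i] => cmod c <= b) (map Num.conj s0).
  by move=> h2; rewrite all_map; apply: sub_all h2 => c; rewrite /= cmodJ.
elim: s l u => [|f s IH] [|g l] u //=.
  by move=> _ _ _ Wu Wv; rewrite subrr cmod0 !mul0r.
move=> /andP[fb sb] /andP[gb lb] [sl] Wu Wv.
rewrite !rev_cons -!cats1 map_cat toy_word_cat ?size_map ?size_rev//=.
set z := toy_word _ _ _ _ _ v; set u' := toy_step _ _ _ _ _ u.
have bz : hnorm z <= expR ((size l)%:R * h * word_rate (crate Q m) b) * hnorm v.
  have := toy_word_growth b1 h01 (_ : all (fun c : R[i] => cmod c <= b) (map Num.conj (rev s)))
    (_ : all (fun c : R[i] => cmod c <= b) (rev l)) Wv.
  by rewrite size_rev; apply; rewrite ?conj_bounded ?all_rev.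
have Wz : cdom Q m z.
  by have [x [_ + _ _]] := toy_word_loc lin lC lCd h01 (map Num.conj (rev s)) (rev l); apply.
have Wu' : cdom Q m u'.
  by apply: (toy_step_W lin (cop_local (neg_coupling Q) m) (cadj_local (neg_coupling Q) m)).
have bu' : hnorm u' <= expR (h * word_rate (crate Q m) b) * hnorm u.
  have gb' : cmod (Num.conj g) <= b by rewrite cmodJ.
  have := @toy_word_growth _ _ (neg_coupling Q) m b b1 h [:: Num.conj g] [:: f] u h01.
  by rewrite /= gb' fb mul1r; apply.
have d1 := toy_step_dual b1 h01 fb gb Wu Wz.
have d2 := IH l u' sb lb sl Wu' Wv.
apply: (le_trans (cmod_distD _ _ _)); apply: (le_trans (lerD d1 d2)) => {d1 d2}.
rewrite -[in leRHS]natr1; set X := expR _ in bz *; set Y := expR _ in bu'.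
have -> : expR (((size l)%:R + 1) * h * word_rate (crate Q m) b) = X * Y.
  by rewrite /X /Y -expRD; congr expR; ring.
have [X0 Y1] : 0 <= X /\ 1 <= Y by rewrite expR_ge0 -[leLHS]expR0 ler_expR mulr_ge0.
have b2 : hnorm u * hnorm z <= X * Y * (hnorm u * hnorm v).
  rewrite (le_trans (ler_wpM2l (hnorm_ge0 u) bz))// mulrCA -mulrA ler_wpM2l//.
  by rewrite ler_peMl// mulr_ge0 ?hnorm_ge0.
have b3 : X * (hnorm u' * hnorm v) <= X * Y * (hnorm u * hnorm v).
  by rewrite -mulrA ler_wpM2l// mulrA ler_wpM2r ?hnorm_ge0.
have c0 : 0 <= h ^+ 2 * dual_err Q m b by rewrite mulr_ge0 ?sqr_ge0.
have i1 := ler_wpM2l c0 b2; have i2 := ler_wpM2l (mulr_ge0 (ler0n R (size l)) c0) b3.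
have alg1 (y1 y2 y3 y4 y5 y6 : R) :
  y1 * (y2 * y3) + y4 * y1 * y2 * y5 * y6 = y1 * y2 * y3 + y4 * (y1 * y2) * (y5 * y6) by ring.
have alg2 (y1 y2 y4 y5 y6 : R) :
  (y4 + 1) * y1 * y2 * y5 * y6 = y1 * y2 * (y5 * y6) + y4 * (y1 * y2) * (y5 * y6) by ring.
by rewrite alg1 alg2; exact: lerD.
Qed.

Arguments tvec {R H F} K Q o k t g v.
Arguments toy_lim {R H F} K Q o t g v.
Arguments core_exp {R H F} K Q p.
Arguments core_exp_dense {R H F} K Q.
Arguments evolution {R H F} K Q o t.
Arguments evolutionP {R H F} K Q o {t}.
Arguments tvec_cvg {R H F} K {Q} o {t g v}.
Arguments toy_lim_inner {R H F} K {Q} o {t f g u v}.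

Lemma cexp_cancel (R : realType) (z X Y : R[i]) : cexp X = z * cexp Y -> z = cexp (X - Y).
Proof. by move=> e; rewrite cexpD e -mulrA -cexpD subrr cexp0 mulr1. Qed.

Section Tail.
Variables (R : realType) (F : fock R).
Implicit Types (f g : R -> R[i]) (k m n : nat) (t : R).

Definition tail_factor k t f g : R[i] :=
  cexp (cintegral `[(cells t k)%:R * mesh R k, +oo[ (fun s => Num.conj (f s) * g s)).

Lemma tail_factorE k t f g : L2 f -> L2 g -> cell_const k f -> cell_const k g ->
  tail_factor k t f g = cexp (L2_inner f g -
    (mesh R k)%:C * seq_inner (samples k 0 (cells t k) f) (samples k 0 (cells t k) g)).
Proof.
move=> Lf Lg cf cg; exact: cexp_cancel (cexp_split F (cells t k) Lf Lg cf cg).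
Qed.

Lemma tail_factor_bound k t f g b : 0 <= t -> L2 f -> L2 g -> cell_const k f -> cell_const k g ->
  value_bound b f -> value_bound b g ->
  cmod (tail_factor k t f g) <= expR (cmod (L2_inner f g) + t * b ^+ 2).
Proof.
move=> t0 Lf Lg cf cg bf bg; rewrite tail_factorE// (le_trans (cexp_bound _))// ler_expR.
rewrite (le_trans (cmodB _ _))// lerD2l cmodM cmod_real ger0_norm ?(ltW (mesh_gt0 R k))//.
rewrite (le_trans (ler_wpM2l (ltW (mesh_gt0 R k))
  (seq_inner_bound (all_samples _ _ _ bf) (all_samples _ _ _ bg) _))) ?size_samples//.
by rewrite mulrCA mulrA ler_wpM2r ?sqr_ge0//; have /andP[] := cells_bounds k t0.
Qed.

Lemma tail_factorJ k t f g : L2 f -> L2 g -> cell_const k f -> cell_const k g ->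
  Num.conj (tail_factor k t f g) = tail_factor k t g f.
Proof.
move=> Lf Lg cf cg; rewrite !tail_factorE// cexpJ; congr cexp.
have e : Num.conj (L2_inner f g) = L2_inner g f by rewrite L2_inner_conj.
rewrite rmorphB rmorphM /= e conj_real; congr (_ - _ * _).
rewrite /seq_inner rmorph_sum /=.
rewrite (eq_bigr (fun p => Num.conj p.2 * p.1)) => [|p _]; last by rewrite rmorphM /= conjCK mulrC.
move: (samples _ _ _ f) (samples _ _ _ g); elim=> [|a A IH] [|b B] //=; rewrite ?big_nil//.
by rewrite !big_cons IH.
Qed.
End Tail.

Section Unitary.
Variables (R : realType) (H : hilbert R) (F : fock R) (K : hilbert_tensor H F).
Implicit Types (f g : R -> R[i]) (Q : coupling H) (k m n : nat) (t : R) (o : bool) (u v : H).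

Lemma tvec_inner Q o k t f g u v : 0 <= t -> L2 f -> L2 g -> cell_const k f -> cell_const k g ->
  core Q v ->
  ⟨tensor K u (exp_vec F f), tvec K Q o k t g v⟩ = tail_factor k t f g *
  ⟨u, toy_word (cop Q) (cadj Q) (mesh R k) (map Num.conj (word_list o k t f)) (word_list o k t g) v⟩.
Proof.
move=> t0 Lf Lg cf cg [m Wv].
exact: (toy_vec_inner K (@cdom_lin _ _ Q m) (cop_local Q m) (cadj_local Q m)).
Qed.

Lemma ccvg_mesh (a : nat -> R[i]) l c k0 : 0 <= c ->
  (forall k, (k0 <= k)%N -> cmod (a k - l) <= mesh R k * c) -> ccvg a l.
Proof.
move=> c0 h e e0; have c1 : 0 < c + 1 by rewrite ltr_wpDl.
have [k1 hk1] := mesh_small (divr_gt0 e0 c1); exists (maxn k0 k1) => n.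
rewrite geq_max => /andP[n0 n1]; apply: (le_lt_trans (h n n0)).
have := hk1 n n1; rewrite ltr_pdivlMr//; apply: le_lt_trans.
by rewrite ler_wpM2l ?lerDl// ltW// mesh_gt0.
Qed.

Lemma hcvg_cst (G : hilbert R) (x : G) : hcvg (fun=> x) x.
Proof. by move=> e e0; exists 0 => n _; rewrite subrr hnorm0. Qed.

Lemma toy_lim_dual Q t f g u v : 0 <= t -> is_step f -> is_step g -> core Q u -> core Q v ->
  ⟨tensor K u (exp_vec F f), toy_lim K Q false t g v⟩ =
  ⟨toy_lim K (neg_coupling Q) true t f u, tensor K v (exp_vec F g)⟩.
Proof.
move=> t0 sf sg cu cv; have [k0 [b [[Lf Lg] [cf cg] b1 [bf bg]]]] := step_data sf sg.
have [m [Wu Wv]] := core2 cu cv.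
have h1 := ccvg_inner (hcvg_cst (tensor K u (exp_vec F f))) (tvec_cvg K false t0 sg cv).
have h2 := ccvg_inner (tvec_cvg K (Q := neg_coupling Q) true t0 sf cu) (hcvg_cst (tensor K v (exp_vec F g))).
apply/eqP; rewrite -subr_eq0; apply/eqP.
apply: (ccvg_unique (ccvgD h1 (ccvgN h2))).
pose Z := expR (cmod (L2_inner f g) + t * b ^+ 2).
pose w := word_rate (crate Q m) b.
have lin := @cdom_lin _ _ Q m; have lC := cop_local Q m; have lCd := cadj_local Q m.
have b0 : 0 <= b := le_trans ler01 b1.
have w0 : 0 <= w := word_rate_ge0 lin lC lCd b0.
have de0 : 0 <= dual_err Q m b by rewrite mulr_ge0// (word_err_ge0 lin lC lCd b0).
pose c := Z * (t * dual_err Q m b * expR (t * w) * (hnorm u * hnorm v)).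
have c0 : 0 <= c by rewrite /c /Z; nonneg.
apply: (@ccvg_mesh _ _ c k0 c0) => k kk.
have [cf' cg'] : cell_const k f /\ cell_const k g.
  by split; rewrite -(subnKC kk); exact: cell_const_refine.
have h01 : 0 <= mesh R k <= 1 by rewrite (ltW (mesh_gt0 R k)) mesh_le1.
rewrite subr0 tvec_inner// -[⟨tvec _ _ true _ _ _ _, _⟩]inner_conj (tvec_inner (Q := neg_coupling Q))//.
rewrite rmorphM /= inner_conj (tail_factorJ F)// -mulrBr cmodM /c mulrCA.
apply: ler_pM; rewrite ?cmod_ge0//; first exact: (tail_factor_bound F).
rewrite /word_list /= !revK.
have sz := size_samples k 0 (cells t k).
have := toy_word_dual b1 h01 (all_samples k 0 (cells t k) bf) (all_samples k 0 (cells t k) bg) _ Wu Wv.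
rewrite !sz => /(_ (erefl _)) /le_trans; apply.
have nh : (cells t k)%:R * mesh R k <= t by have /andP[] := cells_bounds k t0.
have nh0 : 0 <= (cells t k)%:R * mesh R k by rewrite mulr_ge0// ltW// mesh_gt0.
have alg (x1 x2 x3 x4 x5 : R) : x1 * x2 ^+ 2 * x3 * x4 * x5 = x2 * (x1 * x2 * x3 * x4 * x5) by ring.
rewrite alg; apply: ler_wpM2l; first by case/andP: h01.
apply: ler_wpM2r; first by rewrite mulr_ge0 ?hnorm_ge0.
apply: ler_pM; [exact: mulr_ge0|exact: expR_ge0|exact: ler_wpM2r|].
by rewrite ler_expR; exact: ler_wpM2r.
Qed.

Lemma evolution_dual Q t x y : 0 <= t ->
  ⟨x, evolution K Q false t y⟩ = ⟨evolution K (neg_coupling Q) true t x, y⟩.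
Proof.
move=> t0; have [lU iU hU] := evolutionP K Q false t0.
have [lV iV hV] := evolutionP K (neg_coupling Q) true t0.
have bU := isometry_bounded lU iU; have bV := isometry_bounded lV iV.
suff -> : evolution K Q false t = hadj (evolution K (neg_coupling Q) true t) by rewrite hadjPr.
apply: (bounded_map_eq (core_exp_dense K Q)) => //.
  exact: hadj_bounded.
move=> [[v cv] [g sg]]; apply: (inner_eq_span (core_exp_dense K Q)) => -[[u cu] [f sf]].
by rewrite (hadjPr bV) /core_exp /= hU// hV// toy_lim_dual.
Qed.

(** The adjoint [V] of the isometry [U] is itself an isometry, hence [|U V w - w|^2 = |w|^2 - 2 |V
    w|^2 + |w|^2 = 0] and [U] is onto. *)
Lemma evolution_unitary Q t : 0 <= t -> unitary_op (evolution K Q false t).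
Proof.
move=> t0; have [lU iU hU] := evolutionP K Q false t0; split=> // w.
have [lV iV hV] := evolutionP K (neg_coupling Q) true t0.
set U := evolution _ _ false _ in lU iU *; set V := evolution _ _ true _ in lV iV.
exists (V w); apply/eqP; rewrite -subr_eq0; apply/eqP/hnorm_eq0/eqP.
rewrite -(@eqrXn2 _ 2) ?hnorm_ge0// hnormB_sqr expr0n /= !hnorm_sqr iU iV.
rewrite -[⟨U (V w), w⟩]inner_conj evolution_dual// -/V iV ReJ.
by rewrite mulr2n mulrDl mul1r opprD addrA subrr sub0r addNr.
Qed.

End Unitary.

Section EulerLimit.
Variables (R : realType) (H : hilbert R) (W : set H).
Implicit Types (u v : H) (k p : nat) (phi psi : form H).

Lemma ccvg_real (x : nat -> R) (d : R) : x @ \oo --> d -> ccvg (fun k => (x k)%:C) d%:C.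
Proof.
move=> xd e e0; have [n _ hn] := iffLR (cvgrPdist_lt _ _) xd e e0.
exists n => k /hn; rewrite -rmorphB cmod_real distrC.
by [].
Qed.

Lemma ccvgM (a c : nat -> R[i]) l m : ccvg a l -> ccvg c m -> ccvg (fun k => a k * c k) (l * m).
Proof.
move=> ha hc; apply: (@ccvg_ext _ (fun k => (a k - l) * (c k - m) + (l * c k + (m * a k - l * m)))).
  by move=> k; ring.
rewrite [X in ccvg _ X](_ : _ = 0 + (l * m + (m * l - l * m))); last by ring.
apply: ccvgD; last first.
  by apply: ccvgD; [exact: ccvgZ|apply: ccvgD; [exact: ccvgZ|exact: ccvg_cst]].
move=> e e0; have [n1 h1] := ha _ ltr01; have [n2 h2] := hc _ e0.
exists (maxn n1 n2) => k; rewrite geq_max => /andP[k1 k2]; rewrite subr0 cmodM.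
rewrite (le_lt_trans (ler_wpM2r (cmod_ge0 _) (ltW (h1 k k1))))// mul1r.
exact: h2.
Qed.

(** The estimate of [euler_step_power] for [r k] steps of length [mesh k], passed to the limit. The
    generator evaluates its form at finitely many vectors, so pointwise convergence of the forms is
    enough. *)
Lemma euler_limit (S : nat -> form H -> form H) (L : form H -> form H) (c b M d : R)
    (r : nat -> nat) (phik psik : nat -> form H) phi psi k0 u v :
  0 <= c -> 0 <= b -> W u -> W v ->
  (forall k, (k0 <= k)%N -> euler_step W (mesh R k) c b (S k) L) ->
  (forall k, (k0 <= k)%N -> sesquilinear_on W (phik k) /\ form_bound W M (phik k)) ->
  (forall k, (k0 <= k)%N -> psik k u v = iter (r k) (S k) (phik k) u v) ->
  (forall k, (k0 <= k)%N -> (r k)%:R * mesh R k <= 1) ->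
  (fun k => (r k)%:R * mesh R k) @ \oo --> d ->
  ccvg (fun k => phik k u v) (phi u v) -> ccvg (fun k => psik k u v) (psi u v) ->
  ccvg (fun k => L (phik k) u v) (L phi u v) ->
  cmod (psi u v - phi u v - d%:C * L phi u v) <=
  M * (power_const c b * d ^+ 2) * (hnorm u * hnorm v).
Proof.
move=> c0 b0 Wu Wv eS hphi hpsi hr rd cphi cpsi cL.
have lim : ccvg (fun k => psik k u v - phik k u v - ((r k)%:R * mesh R k)%:C * L (phik k) u v)
    (psi u v - phi u v - d%:C * L phi u v).
  apply: ccvgD; first by apply: ccvgD => //; exact: ccvgN.
  by apply: ccvgN; apply: ccvgM => //; exact: ccvg_real.
have P0 := power_const_ge0 c0 b0.
have M0 : 0 <= M by have [_ []] := hphi k0 (leqnn _).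
have bnd k : (k0 <= k)%N ->
    cmod (psik k u v - phik k u v - ((r k)%:R * mesh R k)%:C * L (phik k) u v) <=
    M * (power_const c b * ((r k)%:R * mesh R k) ^+ 2) * (hnorm u * hnorm v).
  move=> kk; rewrite hpsi//; have [sp bp] := hphi k kk.
  have [_] := euler_step_power (ltW (mesh_gt0 R k)) (hr k kk) b0 c0 (eS k kk) sp bp.
  by apply.
have cb : (fun k => M * (power_const c b * ((r k)%:R * mesh R k) ^+ 2) * (hnorm u * hnorm v))
    @ \oo --> M * (power_const c b * d ^+ 2) * (hnorm u * hnorm v).
  apply: cvgM; last exact: cvg_cst.
  apply: cvgM; first exact: cvg_cst.
  by apply: cvgM; [exact: cvg_cst | rewrite expr2; under eq_fun do rewrite expr2; exact: cvgM].
apply: ler_eps => e e0.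
have [n _ hn] := iffLR (cvgrPdist_lt _ _) cb e e0.
apply: (ccvg_mod_le lim); exists (maxn k0 n) => k; rewrite geq_max => /andP[kk nk].
apply: (le_trans (bnd k kk)); have := hn k nk; rewrite ltr_norml => /andP[h _].
by rewrite -lerBlDr; move: h; rewrite ltrBrDr addrC => /ltW.
Qed.
End EulerLimit.

Section LocalEstimate.
Variables (R : realType) (H : hilbert R) (F : fock R) (K : hilbert_tensor H F) (Q : coupling H).
Implicit Types (f g : R -> R[i]) (k m n : nat) (t : R) (o : bool) (u v : H).
Local Notation U := (evolution K Q false).

Definition matrix_element f g t : form H := fun u v =>
  ⟨tensor K u (exp_vec F f), U t (tensor K v (exp_vec F g))⟩.

Lemma cells_le s t k : 0 <= s -> s <= t -> (cells s k <= cells t k)%N.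
Proof.
move=> s0 st; have /andP[h1 _] := cells_bounds k s0; have /andP[_ h2] := cells_bounds k (le_trans s0 st).
rewrite -ltnS -(ltr_nat R) -(ltr_pM2r (mesh_gt0 R k)).
exact: le_lt_trans (le_trans h1 st) h2.
Qed.

Lemma cells_cvg s t : 0 <= s -> s <= t ->
  (fun k => (cells t k - cells s k)%N%:R * mesh R k) @ \oo --> t - s.
Proof.
move=> s0 st; have t0 := le_trans s0 st; apply/cvgrPdist_lt => e e0.
have [k1 hk1] := mesh_small e0; exists k1 => // k /= /hk1.
apply: le_lt_trans; rewrite natrB ?cells_le// mulrBl ler_norml.
have /andP[a1 a2] := cells_bounds k s0; have /andP[b1 b2] := cells_bounds k t0.
move: a2 b2; rewrite -!natr1 !mulrDl mul1r => a2 b2.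
by apply/andP; split; lra.
Qed.

(** Supplies the bound uniform in [k] that finite-mesh vectors do not owe to isometry: it is the
    Gram estimate of a level with itself, once the mesh makes its error at most 1. *)
Lemma tvec_norm o t g m : 0 <= t -> is_step g -> exists k0, forall k v, (k0 <= k)%N ->
  cdom Q m v -> hnorm (tvec K Q o k t g v) ^+ 2 <= (cmod (cexp (L2_inner g g)) + 1) * hnorm v ^+ 2.
Proof.
move=> t0 sg; have [k0 [b [[Lg _] [cg _] b1 [bg _]]]] := step_data sg sg.
pose c := gram_const (crate Q m) b t (cmod (L2_inner g g)).
have a0 : 0 < (`|c| + 1)^-1 by rewrite invr_gt0 ltr_wpDl.
have [k1 hk1] := mesh_small a0; exists (maxn k0 k1) => k v.
rewrite geq_max => /andP[kk0 kk1] Wv.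
have cg' : cell_const k g by rewrite -(subnKC kk0); exact: cell_const_refine.
have := toy_vec_gram K (@cdom_lin _ _ Q m) (cop_local Q m) (cadj_local Q m) (@cop_adj _ _ Q m)
  b1 o 0 t0 Lg Lg cg' cg' bg bg Wv Wv.
rewrite addn0 -/(tvec K Q o k t g v) -/c !inner_self -expr2 => h.
have := le_trans (lerD h (lexx (cmod (cexp (L2_inner g g) * (hnorm v ^+ 2)%:C)))).
move=> /(_ _ (lexx _)); have := cmodD ((hnorm (tvec K Q o k t g v) ^+ 2)%:C -
  cexp (L2_inner g g) * (hnorm v ^+ 2)%:C) (cexp (L2_inner g g) * (hnorm v ^+ 2)%:C).
rewrite subrK cmod_real ger0_norm ?sqr_ge0// => h1 h2.
apply: (le_trans (le_trans h1 h2)).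
rewrite cmodM cmod_real ger0_norm ?sqr_ge0// mulrDl mul1r addrC lerD2l mulrA ler_piMl ?sqr_ge0//.
have hc := hk1 k kk1; have m0 := ltW (mesh_gt0 R k).
rewrite (le_trans (ler_wpM2l m0 (ler_norm c)))// (le_trans (ler_wpM2l m0 (_ : _ <= `|c| + 1))) ?lerDl//.
by rewrite -ler_pdivlMr ?mul1r ?(ltW hc)// ltr_wpDl.
Qed.

Lemma matrix_elementE f g t u v : 0 <= t -> is_step g -> core Q v ->
  ccvg (fun k => ⟨tensor K u (exp_vec F f), tvec K Q false k t g v⟩) (matrix_element f g t u v).
Proof.
move=> t0 sg cv; have [_ _ hU] := evolutionP K Q false t0; rewrite /matrix_element hU//.
by apply: ccvg_inner; [exact: hcvg_cst | exact: tvec_cvg].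
Qed.

End LocalEstimate.

(** * Local estimates *)

Section LocalEstimates.
Variables (R : realType) (H : hilbert R) (F : fock R) (K : hilbert_tensor H F) (Q : coupling H).
Implicit Types (f g : R -> R[i]) (k m n : nat) (s t : R) (o : bool) (u v : H).
Local Notation U := (evolution K Q false).
Local Notation C := (cop Q).
Local Notation Cd := (cadj Q).

Lemma iter_word_formE h (c g w : R[i]) p (phi : form H) u v :
  iter p (word_form C Cd h c g w) phi u v =
  cexp (p%:R * (h%:C * w)) * phi u (iter p (toy_step C Cd h c g) v).
Proof.
elim: p phi u v => [|p IH] phi u v; first by rewrite mul0r cexp0 mul1r.
have -> : p.+1%:R * (h%:C * w) = p%:R * (h%:C * w) + h%:C * w by rewrite -natr1; ring.
by rewrite iterSr IH (cexpD (p%:R * (h%:C * w)) (h%:C * w)) -mulrA.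
Qed.

(* The indices of the fine cells between the times s and t of a coarse cell j. *)
Lemma samples_cell k0 k j s t g : (k0 <= k)%N -> cell_const k0 g -> 0 <= s ->
  j%:R * mesh R k0 <= s -> s <= t -> t <= j.+1%:R * mesh R k0 ->
  let r := (cells t k - cells s k)%N in
  samples k 0 (cells t k) g = samples k 0 (cells s k) g ++ nseq r (g (j%:R * mesh R k0)) /\
  r%:R * mesh R k <= 1.
Proof.
move=> kk cg s0 js st tj r; have t0 := le_trans s0 st.
have /andP[s1 s2] := cells_bounds k s0; have /andP[t1 t2] := cells_bounds k t0.
have m0 := mesh_gt0 R k; have m0' := mesh_gt0 R k0.
have rE : (cells s k + r = cells t k)%N by rewrite subnKC// cells_le.
have mE : mesh R k0 = (2 ^ (k - k0))%:R * mesh R k by rewrite [LHS](meshS R k0 (k - k0)) subnKC.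
have js' : (j * 2 ^ (k - k0) <= cells s k)%N.
  rewrite -ltnS -(ltr_nat R) -(ltr_pM2r m0) natrM -mulrA -mE.
  exact: le_lt_trans s2.
have js2 : j%:R * mesh R k0 <= (cells s k)%:R * mesh R k.
  by rewrite mE mulrA -natrM ler_pM2r// ler_nat.
split; last first.
  rewrite natrB ?cells_le// mulrBl; have := mesh_le1 R k0.
  by move: tj; rewrite -natr1 mulrDl mul1r => *; lra.
rewrite -rE samples_cat; congr (_ ++ _); rewrite add0n.
apply: (@eq_from_nth _ 0) => [|i]; rewrite size_samples ?size_nseq// => ir.
rewrite nth_samples// nth_nseq ir; apply: cg; apply/dintP; apply/andP; split.
  by apply: (le_trans js2); rewrite ler_pM2r// ler_nat leq_addr.
apply: lt_le_trans tj; apply: lt_le_trans t1.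
by rewrite ltr_pM2r// ltr_nat -rE ltn_add2l.
Qed.

Lemma tvec_form_bound m t f g : 0 <= t -> is_step f -> is_step g -> exists k1, forall k, (k1 <= k)%N ->
  sesquilinear_on (cdom Q m) (fun u v => ⟨tensor K u (exp_vec F f), tvec K Q false k t g v⟩) /\
  form_bound (cdom Q m) (hnorm (exp_vec F f) * Num.sqrt (cmod (cexp (L2_inner g g)) + 1))
    (fun u v => ⟨tensor K u (exp_vec F f), tvec K Q false k t g v⟩).
Proof.
move=> t0 sf sg; have [k0 [b [[Lf Lg] [cf cg] b1 [bf bg]]]] := step_data sf sg.
have [k1 hk1] := tvec_norm K Q false m t0 sg; exists (maxn k0 k1) => k.
rewrite geq_max => /andP[kk kk1]; set A := cmod _ + 1 in hk1 *.
have A0 : 0 <= A by rewrite addr_ge0 ?cmod_ge0.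
have [cf' cg'] : cell_const k f /\ cell_const k g.
  by split; rewrite -(subnKC kk); exact: cell_const_refine.
have lin := @cdom_lin _ _ Q m.
have h01 : 0 <= mesh R k <= 1 by rewrite (ltW (mesh_gt0 R k)) mesh_le1.
have [a la] := toy_word_loc lin (cop_local Q m) (cadj_local Q m) h01
  (map Num.conj (word_list false k t f)) (word_list false k t g).
split; last first.
  split=> [|u v Wu Wv]; first by rewrite mulr_ge0 ?hnorm_ge0 ?sqrtr_ge0.
  rewrite (le_trans (inner_le _ _))// hnorm_tensor [leRHS]mulrACA mulrC [leRHS]mulrC.
  rewrite [hnorm u * _]mulrC [_ * hnorm u]mulrC.
  have h : hnorm (tvec K Q false k t g v) <= Num.sqrt A * hnorm v.
    apply: hnorm_le_sqr; first by rewrite mulr_ge0 ?hnorm_ge0 ?sqrtr_ge0.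
    by rewrite exprMn (sqr_sqrtr A0); exact: hk1.
  by rewrite ler_wpM2r// mulr_ge0 ?hnorm_ge0.
have [sl sr] : sesquilinear_on (cdom Q m) (form_comb (tail_factor k t f g) (fun u v => ⟨u,
    toy_word C Cd (mesh R k) (map Num.conj (word_list false k t f)) (word_list false k t g) v⟩)
    (fun _ _ => 0)).
  apply: sesquilinear_comb; last by split=> *; rewrite mulr0 addr0.
  exact: (sesquilinear_comp (local_op_id _) la (inner_sesq _)).
have e x y : cdom Q m y -> ⟨tensor K x (exp_vec F f), tvec K Q false k t g y⟩ =
  form_comb (tail_factor k t f g) (fun u v => ⟨u,
    toy_word C Cd (mesh R k) (map Num.conj (word_list false k t f)) (word_list false k t g) v⟩)
    (fun _ _ => 0) x y.
  by move=> Wy; rewrite /form_comb addr0 tvec_inner//; exists m.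
by split=> z x y w Wx Wy Ww; rewrite !e//; [exact: sl | exact: sr | exact: lin].
Qed.

Definition matrix_rate m b : R := power_const (word_err (crate Q m) b)
  (step_const (crate Q m) b + b * step_const (crate Q m) b + b).

(** As long as [s] and [t] stay in one cell of constancy, passing from [s] to [t] prepends equal
    steps to the word, and the tail factor loses [exp(h conj f g)] per step: hence the third
    parameter of the generator. The bounds use [b ^+ 2], which dominates [b] as well as
    [|conj f g|]. *)
Lemma matrix_local f g : is_step f -> is_step g -> exists k0, [/\ cell_const k0 f, cell_const k0 g &
  forall m, exists c, 0 <= c /\ forall u v j s t, cdom Q m u -> cdom Q m v ->
    j%:R * mesh R k0 <= s -> s <= t -> t <= j.+1%:R * mesh R k0 ->
    cmod (matrix_element K Q f g t u v - matrix_element K Q f g s u v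
      - (t - s)%:C * word_generator C Cd (Num.conj (f (j%:R * mesh R k0))) (g (j%:R * mesh R k0))
          (- (Num.conj (f (j%:R * mesh R k0)) * g (j%:R * mesh R k0))) (matrix_element K Q f g s) u v) <=
    c * (t - s) ^+ 2 * (hnorm u * hnorm v)].
Proof.
move=> sf sg; have [k0 [b [[Lf Lg] [cf cg] b1 [bf bg]]]] := step_data sf sg.
exists k0; split=> // m; set M := hnorm (exp_vec F f) * Num.sqrt (cmod (cexp (L2_inner g g)) + 1).
have b0 : 0 <= b := le_trans ler01 b1; have bb0 : 0 <= b ^+ 2 by exact: sqr_ge0.
have lin := @cdom_lin _ _ Q m; have lC := cop_local Q m; have lCd := cadj_local Q m.
have M0 : 0 <= M by rewrite mulr_ge0 ?hnorm_ge0 ?sqrtr_ge0.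
have e0 := word_err_ge0 lin lC lCd bb0; have s00 := step_const_ge0' lin lC lCd bb0.
have r0 : 0 <= step_const (crate Q m) (b ^+ 2) + b ^+ 2 * step_const (crate Q m) (b ^+ 2) + b ^+ 2.
  by do 2?[apply: addr_ge0 => //]; exact: mulr_ge0.
exists (M * matrix_rate m (b ^+ 2)); split; first by rewrite mulr_ge0// power_const_ge0.
move=> u v j s t Wu Wv js st tj; rewrite -[M * _ * _]mulrA.
set fj := Num.conj (f _); set gj := g _.
have s0 : 0 <= s by apply: le_trans js; rewrite mulr_ge0// ltW// mesh_gt0.
have t0 := le_trans s0 st.
have bb : b <= b ^+ 2 by rewrite expr2 ler_peMl.
have fb : cmod fj <= b ^+ 2 by rewrite cmodJ (le_trans (bf _)).
have gb : cmod gj <= b ^+ 2 by rewrite (le_trans (bg _)).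
have wb : cmod (- (fj * gj)) <= b ^+ 2.
  by rewrite cmodN cmodM cmodJ expr2 ler_pM ?cmod_ge0 ?bf ?bg.
have [k1 hk1] := tvec_form_bound m s0 sf sg.
pose phik k : form H := fun u v => ⟨tensor K u (exp_vec F f), tvec K Q false k s g v⟩.
pose psik k : form H := fun u v => ⟨tensor K u (exp_vec F f), tvec K Q false k t g v⟩.
have cphi x y : cdom Q m y -> ccvg (fun k => phik k x y) (matrix_element K Q f g s x y).
  by move=> Wy; apply: matrix_elementE => //; exists m.
have cpsi : ccvg (fun k => psik k u v) (matrix_element K Q f g t u v).
  by apply: matrix_elementE => //; exists m.
have Wd : cdom Q m (drift C Cd gj v) by exact: (drift_W lin lC lCd).
have Wj : cdom Q m (jump C gj v) by exact: (jump_W' lin lC).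
apply: (@euler_limit R H (cdom Q m) (fun k => word_form C Cd (mesh R k) fj gj (- (fj * gj)))
  (word_generator C Cd fj gj (- (fj * gj))) _ _ _ (t - s) (fun k => (cells t k - cells s k)%N)
  phik psik _ _ (maxn k0 k1) u v e0 r0 Wu Wv) => // [k|k|k|k|||].
- move=> _; apply: (word_step lin lC lCd bb0) => //.
  by rewrite (ltW (mesh_gt0 R k)) mesh_le1.
- by rewrite geq_max => /andP[_ /hk1].
- rewrite geq_max => /andP[kk _]; have [ef _] := samples_cell kk cf s0 js st tj.
  have [eg _] := samples_cell kk cg s0 js st tj.
  have [cf' cg'] : cell_const k f /\ cell_const k g.
    by split; rewrite -(subnKC kk); exact: cell_const_refine.
  set r := (cells t k - cells s k)%N in ef eg *.
  rewrite iter_word_formE /psik /phik.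
  have cv : core Q v by exists m.
  have cv' : core Q (iter r (toy_step C Cd (mesh R k) fj gj) v).
    by exists m; have [x [_ + _ _]] := iter_toy_step_local lin lC lCd fj gj r (ltW (mesh_gt0 R k)); apply.
  have alg (x e i : R[i]) : x * e * i = e * (x * i) by ring.
  have ew : toy_word C Cd (mesh R k) (map Num.conj (word_list false k t f)) (word_list false k t g) v =
    toy_word C Cd (mesh R k) (map Num.conj (word_list false k s f)) (word_list false k s g)
      (iter r (toy_step C Cd (mesh R k) fj gj) v).
    rewrite /word_list /= ef eg !rev_cat !rev_nseq map_cat map_nseq.
    by rewrite toy_word_cat ?size_map ?size_nseq// toy_word_nseq.
  have et : tail_factor k t f g = tail_factor k s f g * cexp (r%:R * ((mesh R k)%:C * - (fj * gj))).
    rewrite !(tail_factorE F)// -[RHS]cexpD; congr cexp; rewrite ef eg seq_inner_cat ?size_samples//.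
    have -> : seq_inner (nseq r (f (j%:R * mesh R k0))) (nseq r gj) = r%:R * (fj * gj).
      elim: (r) => [|p IH]; first by rewrite /seq_inner big_nil mul0r.
      by rewrite /seq_inner /= big_cons /= -/(seq_inner _ _) IH -natr1 mulrDl mul1r addrC.
    by ring.
  by rewrite !tvec_inner// et ew alg.
- by rewrite geq_max => /andP[kk _]; have [_] := samples_cell kk cf s0 js st tj.
- exact: cells_cvg.
- exact: cphi.
by apply: ccvgD; [apply: ccvgD; [exact: cphi|apply: ccvgZ; exact: cphi]|apply: ccvgZ; exact: cphi].
Qed.

Lemma is_step0 : is_step (fun=> 0 : R[i]).
Proof. by exists 0%N, 0%N, (fun=> 0); apply/funext => s; rewrite /step big_ord0. Qed.

Definition semigroup_form (X : H -> H) t : form H := fun u v =>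
  ⟨U t (tensor K u (exp_vec F (fun=> 0))),
   ampliation (K := K) X (U t (tensor K v (exp_vec F (fun=> 0))))⟩.

Lemma toy_gram_nseq h h' p n (g g' : R[i]) phi :
  toy_gram C Cd h h' p (nseq n g) (nseq n g') phi = iter n (toy_form C Cd h h' p g g') phi.
Proof. by elim: n => //= n ->. Qed.

Lemma samples_cst k i n (z : R[i]) : samples k i n (fun=> z) = nseq n z.
Proof. by rewrite /samples; elim: n i => //= n IH i; rewrite IH. Qed.

(** [toy_toy_inner] with equal meshes, [p = 1] and no leftover cells; at [f = g = 0] the tail factor
    is 1. The operator [X] becomes the form to which the discrete flow is applied. *)
Lemma tvec_semigroup k t X u v : bounded_op X -> 0 <= t -> core Q u -> core Q v ->
  ⟨tvec K Q false k t (fun=> 0) u, ampliation (K := K) X (tvec K Q false k t (fun=> 0) v)⟩ =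
  iter (cells t k) (toy_form C Cd (mesh R k) (mesh R k) 1 0 0) (fun u v => ⟨u, X v⟩) u v.
Proof.
move=> bX t0 cu cv; have [m [Wu Wv]] := core2 cu cv.
have L0 : L2 (fun=> 0 : R[i]) by exact: is_step_L2 is_step0.
have c0 : cell_const k (fun=> 0 : R[i]) by [].
have h01 : 0 <= mesh R k <= 1 by rewrite (ltW (mesh_gt0 R k)) mesh_le1.
have h0 := ltW (mesh_gt0 R k).
have zE : cexp (cintegral `[(cells t k)%:R * mesh R k, +oo[
    (fun s => Num.conj ((fun=> 0 : R[i]) s) * (fun=> 0) s)) = 1.
  rewrite -[LHS]/(tail_factor k t (fun=> 0) (fun=> 0)) (tail_factorE F)//.
  rewrite !samples_cst (_ : L2_inner _ _ = 0) ?sub0r.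
    rewrite (_ : seq_inner _ _ = 0) ?mulr0 ?oppr0 ?cexp0//.
    elim: (cells t k) => [|n IH]; first by rewrite /seq_inner big_nil.
    by rewrite /seq_inner /= big_cons /= mulr0 add0r; exact: IH.
  rewrite /L2_inner (_ : (fun s => _) = (fun=> 0)); last by apply/funext => s; rewrite mulr0.
  by rewrite /cintegral /= /Rintegral !integral0.
have lE : word_list false k t (fun=> 0 : R[i]) = nseq (cells t k) 0.
  by rewrite /word_list /= samples_cst rev_nseq.
have sw : scale_word 1 (nseq (cells t k) (0 : R[i])) = nseq (cells t k) 0.
  by elim: (cells t k) => //= n IH; congr (_ :: _); exact: IH.
have nn : (size ([::] : seq R[i]) + 1 * size (nseq (cells t k) (0%R : R[i])) +
   size ([::] : seq R[i]) + size ([::] : seq R[i]) = cells t k)%N.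
  by rewrite /= size_nseq mul1n !addn0.
have := toy_toy_inner K (@cdom_lin _ _ Q m) (cop_local Q m) (cadj_local Q m) bX h01
  (@ovec_gram R F false k (cells t k) _ _ L0 L0) h0 Wu Wv
  (erefl (size (nseq (cells t k) (0 : R[i])))) (s1 := [::]) (L1 := [::]) (s2 := [::]) (L2 := [::])
  (erefl _) (erefl _) (A := [::]) (B := [::]) nn (erefl _).
rewrite zE mul1r cexp_seq_inner_nil mul1r /= cats0 sw toy_gram_nseq /tvec /toy_vec lE.
by [].
Qed.

Definition semigroup_rate m : R := power_const (gram_err (crate Q m) 1)
  (step_const (crate Q m) 1 + step_const (crate Q m) 1 + step_const (crate Q m) 1 * step_const (crate Q m) 1).

Lemma semigroup_local X m : bounded_op X -> exists c, 0 <= c /\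
  forall u v s t, cdom Q m u -> cdom Q m v -> 0 <= s -> s <= t -> t <= s + 2^-1 ->
    cmod (semigroup_form X t u v - semigroup_form X s u v
      - (t - s)%:C * gram_generator C Cd 0 0 (semigroup_form X s) u v) <=
    c * (t - s) ^+ 2 * (hnorm u * hnorm v).
Proof.
move=> bX; have [B B0 hB] := bounded_map_nneg (ampliation_bounded K bX).
have lin := @cdom_lin _ _ Q m; have lC := cop_local Q m; have lCd := cadj_local Q m.
set A := cmod (cexp (L2_inner (fun=> 0 : R[i]) (fun=> 0))) + 1.
have A0 : 0 <= A by rewrite addr_ge0 ?cmod_ge0.
have e0 := gram_err_ge0 lin lC lCd (lexx 1).
have s00 := step_const_ge0' lin lC lCd ler01.
have r0 : 0 <= step_const (crate Q m) 1 + step_const (crate Q m) 1 +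
    step_const (crate Q m) 1 * step_const (crate Q m) 1.
  by do 2?[apply: addr_ge0 => //]; exact: mulr_ge0.
exists (B * A * semigroup_rate m); split.
  by rewrite /semigroup_rate; apply: mulr_ge0; [exact: mulr_ge0 | exact: power_const_ge0].
move=> u v s t Wu Wv s0 st tj; rewrite -[B * A * _ * _]mulrA.
have t0 := le_trans s0 st.
have [k1 hk1] := tvec_norm K Q false m s0 is_step0.
pose phik k : form H := iter (cells s k) (toy_form C Cd (mesh R k) (mesh R k) 1 0 0) (fun u v => ⟨u, X v⟩).
pose psik k : form H := iter (cells t k) (toy_form C Cd (mesh R k) (mesh R k) 1 0 0) (fun u v => ⟨u, X v⟩).
have cgen w x y : 0 <= w -> cdom Q m x -> cdom Q m y -> ccvg (fun k => iter (cells w k)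
    (toy_form C Cd (mesh R k) (mesh R k) 1 0 0) (fun u v => ⟨u, X v⟩) x y) (semigroup_form X w x y).
  move=> w0 Wx Wy; have [cx cy] : core Q x /\ core Q y by split; exists m.
  have [_ _ hU] := evolutionP K Q false w0.
  rewrite /semigroup_form !hU//; try exact: is_step0.
  apply: (@ccvg_ext _ _ _ _ (fun k => tvec_semigroup k bX w0 cx cy)).
  apply: ccvg_inner; first exact: (tvec_cvg K false w0 is_step0 cx).
  move=> e ee; have B1 : 0 < B + 1 by rewrite ltr_wpDl.
  have [n hn] := tvec_cvg K false w0 is_step0 cy _ (divr_gt0 ee B1).
  exists n => k /hn; rewrite ltr_pdivlMr// mulrC; apply: le_lt_trans.
  rewrite -(linearmapB (ampliation_bounded K bX).1) (le_trans (hB _))//.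
  by rewrite ler_wpM2r ?hnorm_ge0// lerDl.
have st_k k : euler_step (cdom Q m) (mesh R k) (gram_err (crate Q m) 1)
   (step_const (crate Q m) 1 + step_const (crate Q m) 1 + step_const (crate Q m) 1 * step_const (crate Q m) 1)
   (toy_form C Cd (mesh R k) (mesh R k) 1 0 0) (gram_generator C Cd 0 0).
  apply: (toy_form_step lin lC lCd) => //; rewrite ?cmod0 ?mul1r ?mesh_le1//.
  exact/ltW/mesh_gt0.
have [_ bXX] := bX; have lX := bX.1.
have s0X : sesquilinear_on (cdom Q m) (fun u v => ⟨u, X v⟩).
  by split=> z x y w _ _ _; rewrite ?innerDl ?innerZl// linearmapD// linearmapZ// innerDr innerZr.
have sphi k : sesquilinear_on (cdom Q m) (phik k).
  rewrite /phik; elim: (cells s k) => //= n IH; have [+ _ _ _ _] := st_k k; exact.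
have Wd x : cdom Q m x -> cdom Q m (drift C Cd 0 x) by move=> Wx; exact: (drift_W lin lC lCd).
have Wj x : cdom Q m x -> cdom Q m (jump C 0 x) by move=> Wx; exact: (jump_W' lin lC).
apply: (@euler_limit R H (cdom Q m) (fun k => toy_form C Cd (mesh R k) (mesh R k) 1 0 0)
  (gram_generator C Cd 0 0) _ _ _ (t - s) (fun k => (cells t k - cells s k)%N)
  phik psik _ _ (maxn 1 k1) u v e0 r0 Wu Wv) => // [k kk|k kk|k kk||||].
- have {}kk : (k1 <= k)%N by move: kk; rewrite geq_max => /andP[].
  split=> //; split=> [|x y Wx Wy]; first exact: mulr_ge0.
  rewrite /phik -tvec_semigroup//; [|by exists m ..].
  rewrite (le_trans (inner_le _ _))// (le_trans (ler_wpM2l (hnorm_ge0 _) (hB _)))//.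
  rewrite mulrCA -mulrA ler_wpM2l//.
  have h z : cdom Q m z -> hnorm (tvec K Q false k s (fun=> 0) z) <= Num.sqrt A * hnorm z.
    move=> Wz; apply: hnorm_le_sqr; first by rewrite mulr_ge0 ?hnorm_ge0 ?sqrtr_ge0.
    by rewrite exprMn (sqr_sqrtr A0); exact: hk1.
  rewrite (le_trans (ler_pM (hnorm_ge0 _) (hnorm_ge0 _) (h _ Wx) (h _ Wy)))//.
  by rewrite mulrACA -expr2 (sqr_sqrtr A0).
- by rewrite /psik /phik -iterD subnK// cells_le.
(* The number of steps times the mesh may exceed [t - s] by almost one mesh. The restriction
   [t - s <= 1/2] together with a mesh of at most 1/2 keeps it within the limit 1 of
   [euler_step_power]. *)
- have k_ge1 : (1 <= k)%N by move: kk; rewrite geq_max => /andP[].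
  have mk : mesh R k <= 2^-1.
    rewrite /mesh lef_pV2 ?posrE ?exprn_gt0//; case: (k) k_ge1 => // k' _.
    by rewrite exprS ler_peMr// exprn_ege1// ler1n.
  have /andP[s1 s2] := cells_bounds k s0; have /andP[t1 t2] := cells_bounds k t0.
  rewrite natrB ?cells_le// mulrBl; move: s2; rewrite -natr1 mulrDl mul1r => s2.
  move: mk s2 t1 tj; move: ((cells t k)%:R * mesh R k) ((cells s k)%:R * mesh R k) (mesh R k) => *; lra.
- exact: cells_cvg.
- exact: cgen.
- exact: cgen.
apply: ccvgD; last by apply: cgen => //; exact: Wj.
by apply: ccvgD; apply: cgen => //; exact: Wd.
Qed.

End LocalEstimates.

(** * From local second-order estimates to integral equations *)

Section LocalToIntegral.
Variable R : realType.
Implicit Types (Phi Psi lam : R -> R[i]) (s t c : R).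
Local Notation mu := (@lebesgue_measure R).
Local Notation TR := (measurableTypeR R).

Lemma quadratic_constant Phi a b c : a <= b ->
  (forall s t, a <= s -> s <= t -> t <= b -> cmod (Phi t - Phi s) <= c * (t - s) ^+ 2) ->
  Phi b = Phi a.
Proof.
move=> ab h.
have key n i : (i <= n.+1)%N -> cmod (Phi (a + i%:R * ((b - a) / n.+1%:R)) - Phi a) <=
    i%:R * (c * ((b - a) / n.+1%:R) ^+ 2).
  have d0 : 0 <= (b - a) / n.+1%:R by rewrite divr_ge0 ?subr_ge0.
  elim: i => [|i IH] ilt; first by rewrite !mul0r addr0 subrr cmod0.
  have hs : a + i.+1%:R * ((b - a) / n.+1%:R) - (a + i%:R * ((b - a) / n.+1%:R)) = (b - a) / n.+1%:R.
    by rewrite -natr1; ring.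
  have := h (a + i%:R * ((b - a) / n.+1%:R)) (a + i.+1%:R * ((b - a) / n.+1%:R)).
  rewrite hs => /(_ _ _ _) step.
  rewrite (le_trans (cmod_distD (Phi (a + i%:R * ((b - a) / n.+1%:R))) _ _))//.
  rewrite -[i.+1%:R in leRHS]natr1 [leRHS]mulrDl mul1r [leRHS]addrC; apply: lerD; last exact/IH/ltnW.
  apply: step.
  - by rewrite lerDl mulr_ge0.
  - by rewrite -subr_ge0 hs.
  rewrite -lerBrDl -[leRHS](@divfK _ n.+1%:R) ?pnatr_eq0// mulrC ler_wpM2l// ler_nat.
  by [].
apply: eq_by_cmod => e e0; pose A := `|c| * (b - a) ^+ 2 + 1.
have A0 : 0 < A by rewrite ltr_wpDl// mulr_ge0 ?sqr_ge0.
have [n hn] := inv_succ_lt (divr_gt0 e0 A0).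
have {key} := key n n.+1 (leqnn _); rewrite mulrC divfK ?pnatr_eq0// subrKC => /le_trans; apply.
rewrite ltW// (le_lt_trans _ (_ : A * n.+1%:R^-1 < e))//; last first.
  by have := hn n (leqnn _); rewrite ltr_pdivlMr// mulrC.
have -> : n.+1%:R * (c * ((b - a) / n.+1%:R) ^+ 2) = c * (b - a) ^+ 2 / n.+1%:R.
  have nz : (n.+1%:R : R) != 0 by rewrite pnatr_eq0.
  by move: (n.+1%:R : R) nz => x nz; field.
rewrite ler_pM2r ?invr_gt0//.
by rewrite /A -[leLHS]addr0 lerD// ler_wpM2r ?sqr_ge0 ?ler_norm.
Qed.

(** Only nonnegative times are compared, because the evolution is unspecified at negative ones;
    composition with [Num.max 0] recovers a function continuous on the whole line. *)
Definition wcont Phi := forall t (e : R), 0 <= t -> 0 < e ->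
  exists2 d : R, 0 < d & forall s, 0 <= s -> `|s - t| < d -> cmod (Phi s - Phi t) < e.

Lemma wcont_lipschitz Phi c : (forall s t, 0 <= s -> s <= t -> cmod (Phi t - Phi s) <= c * (t - s)) ->
  wcont Phi.
Proof.
move=> h t e t0 e0; have c1 : 0 < `|c| + 1 by rewrite ltr_wpDl.
exists (e / (`|c| + 1)) => [|s s0]; first exact: divr_gt0.
rewrite ltr_pdivlMr// => hs; apply: le_lt_trans hs.
have key x y : 0 <= x -> x <= y -> cmod (Phi y - Phi x) <= `|x - y| * (`|c| + 1).
  move=> x0 xy; rewrite (le_trans (h _ _ x0 xy))// distrC ger0_norm ?subr_ge0// mulrC.
  by rewrite ler_wpM2l ?subr_ge0// (le_trans (ler_norm c))// lerDl.
by have [st|/ltW ts] := leP s t; [rewrite cmod_distC key | rewrite distrC key].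
Qed.

Lemma wcont_approx Phi : (forall e : R, 0 < e -> exists2 Psi, wcont Psi &
    forall t, 0 <= t -> cmod (Phi t - Psi t) <= e) -> wcont Phi.
Proof.
move=> h t e t0 e0; have e4 : 0 < e / 4 by rewrite divr_gt0.
have [Psi cP hP] := h _ e4; have e2 : 0 < e / 2 by rewrite divr_gt0.
have [d d0 hd] := cP t _ t0 e2; exists d => // s s0 hs.
have h1 := hP s s0; have h2 := hP t t0; have h3 := hd s s0 hs.
have := cmod_distD (Psi s) (Phi s) (Phi t); have := cmod_distD (Psi t) (Psi s) (Phi t).
rewrite [cmod (Psi t - Phi t)]cmod_distC.
move: (cmod _) (cmod _) (cmod _) (cmod _) (cmod _) h1 h2 h3 => *; lra.
Qed.

Lemma lipschitz_cells Phi m c : 0 < m -> (forall j s t, j%:R * m <= s -> s <= t -> t <= j.+1%:R * m ->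
    cmod (Phi t - Phi s) <= c * (t - s)) ->
  forall s t, 0 <= s -> s <= t -> cmod (Phi t - Phi s) <= c * (t - s).
Proof.
move=> m0 h s t s0 st.
have grid n s' t' : 0 <= s' -> s' <= t' -> t' <= n%:R * m -> cmod (Phi t' - Phi s') <= c * (t' - s').
  elim: n s' t' => [|n IH] x y x0 xy yn.
    have -> : y = x by apply/eqP; rewrite eq_le xy andbT (le_trans yn)// mul0r.
    by rewrite !subrr cmod0 mulr0.
  have [yn'|ny] := leP y (n%:R * m); first exact: IH.
  have [nx|xn] := leP (n%:R * m) x; first exact: (h n).
  rewrite (le_trans (cmod_distD (Phi (n%:R * m)) _ _))//.
  rewrite (_ : c * (y - x) = c * (y - n%:R * m) + c * (n%:R * m - x)); last by ring.
  by apply: lerD; [apply: (h n) => //; exact: ltW | apply: IH => //; exact: ltW].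
apply: (grid (Num.truncn (t / m)).+1) => //.
by rewrite -ler_pdivrMr// ltW// truncnS_gt.
Qed.

Lemma wcontD Phi Psi : wcont Phi -> wcont Psi -> wcont (fun t => Phi t + Psi t).
Proof.
move=> h1 h2 t e t0 e0; have e2 : 0 < e / 2 by rewrite divr_gt0.
have [d1 d10 hd1] := h1 t _ t0 e2; have [d2 d20 hd2] := h2 t _ t0 e2.
exists (Num.min d1 d2) => [|s s0]; first by rewrite lt_min d10.
rewrite lt_min => /andP[s1 s2]; rewrite opprD addrACA (le_lt_trans (cmodD _ _))// [e]splitr.
by rewrite ltrD ?hd1 ?hd2.
Qed.

Lemma wcontZ (z : R[i]) Phi : wcont Phi -> wcont (fun t => z * Phi t).
Proof.
move=> h t e t0 e0; have c0 : 0 < cmod z + 1 by rewrite ltr_wpDl ?cmod_ge0.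
have [d d0 hd] := h t _ t0 (divr_gt0 e0 c0); exists d => // s s0 /(hd s s0).
rewrite ltr_pdivlMr// -mulrBr cmodM mulrC; apply: le_lt_trans.
by rewrite ler_wpM2r ?cmod_ge0// lerDl.
Qed.

Lemma wcont_cst (z : R[i]) : wcont (fun=> z).
Proof. by move=> t e t0 e0; exists 1 => // s _ _; rewrite subrr cmod0. Qed.

Lemma max0_dist s t : `|Num.max 0 s - Num.max 0 t| <= `|t - s|.
Proof.
case: (leP 0 t) => t0; case: (leP 0 s) => s0.
- by rewrite distrC.
- by rewrite sub0r normrN !ger0_norm ?subr_ge0 ?(le_trans (ltW s0))// lerBrDr gerDl ltW.
- by rewrite subr0 [leRHS]distrC !ger0_norm ?subr_ge0 ?(le_trans (ltW t0))// lerBrDr gerDl ltW.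
by rewrite subrr normr0.
Qed.

Lemma wcont_continuous (p : R[i] -> R) Phi : (forall z w, p (z - w) = p z - p w) ->
  (forall z, `|p z| <= cmod z) -> wcont Phi -> continuous (fun t => p (Phi (Num.max 0 t))).
Proof.
move=> pB pn h t; apply/cvgrPdist_lt => e e0.
have m0 : 0 <= Num.max 0 t by rewrite le_max lexx.
have [d d0 hd] := h _ _ m0 e0.
near=> s; rewrite -pB (le_lt_trans (pn _))// cmod_distC hd ?le_max ?lexx//.
have hs : `|t - s| < d.
  near: s; exact: (iffLR (cvgrPdist_lt _ _) (@cvg_id _ (nbhs t)) _ d0).
exact: le_lt_trans (max0_dist s t) hs.
Unshelve. all: by end_near. Qed.

Lemma wcont_cmeas Phi : wcont Phi -> cmeas (@half_line R) Phi.
Proof.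
move=> h.
have key (p : R[i] -> R) : (forall z w, p (z - w) = p z - p w) -> (forall z, `|p z| <= cmod z) ->
    measurable_fun (@half_line R) (fun t : TR => p (Phi t)).
  move=> pB pn; have cp := wcont_continuous pB pn h.
  apply: (@eq_measurable_fun _ _ _ _ _ (fun t : TR => p (Phi (Num.max 0 t)))).
    move=> t; rewrite inE /half_line /= in_itv /= andbT => t0.
    by rewrite max_r.
  apply: (@measurable_funS _ _ _ _ setT) => //.
  exact: (continuous_measurable_fun cp).
split; apply: key => [z w|z]; rewrite ?ReD ?ReN ?ImD ?ImN//; first exact: norm_Re_le.
exact: norm_Im_le.
Qed.

Lemma itv_half_line t : `[0, t]%classic `<=` @half_line R.
Proof. by move=> s; rewrite /half_line /= !in_itv /= => /andP[->]. Qed.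

Lemma cintegral_split lam s t : 0 <= s -> s <= t -> cintegrable `[0, t]%classic lam ->
  cintegral `[0, t] lam = cintegral `[0, s] lam + cintegral `[s, t[ lam.
Proof.
move=> s0 st [ir ii].
have key (a : TR -> R) : rintegrable `[0, t]%classic a ->
    \int[mu]_(x in `[0, t]) a x = \int[mu]_(x in `[0, s]) a x + \int[mu]_(x in `[s, t[) a x.
  move=> ia; apply/eqP; rewrite addrC -subr_eq; apply/eqP.
  have i1 : rintegrable (`]s, t]%classic : set TR) a.
    apply: (rintegrableS _ _ _ ia); try exact: measurable_itv.
    by move=> x; rewrite /= !in_itv /= => /andP[sx ->]; rewrite (le_trans s0 (ltW sx)).
  have i2 : rintegrable (`[s, t[%classic : set TR) a.
    apply: (rintegrableS _ _ _ ia); try exact: measurable_itv.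
    by move=> x; rewrite /= !in_itv /= => /andP[sx /ltW->]; rewrite (le_trans s0 sx).
  rewrite (@Rintegral_itvB R a (BLeft 0) (BRight t) s)//; try by rewrite bnd_simp.
  rewrite (Rintegral_itv_obnd_cbnd i1).
  by rewrite (Rintegral_itv_bndo_bndc i2).
by rewrite /cintegral (key _ ir) (key _ ii); apply: complex_eq; rewrite ?ReD ?ImD.
Qed.

Lemma cintegral_dist lam s t z c : 0 <= s -> s <= t -> cintegrable `[s, t[%classic lam ->
  (forall r, s <= r -> r < t -> cmod (lam r - z) <= c) ->
  cmod (cintegral `[s, t[ lam - (t - s)%:C * z) <= 2 * (c * (t - s)).
Proof.
move=> s0 st il hl.
have mD : measurable (`[s, t[%classic : set TR) by exact: measurable_itv.
have icst (a : R) : rintegrable (`[s, t[%classic : set TR) (fun=> a).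
  apply: (rintegrableS _ _ _ (rintegrable_cst s t a)); try exact: measurable_itv.
  by move=> x; rewrite /= !in_itv /= => /andP[-> /ltW->].
have Icst (a : R) : \int[mu]_(x in `[s, t[) a = a * (t - s).
  by rewrite (Rintegral_itv_bndo_bndc (icst a)) Rintegral_cst_itv.
have iz : cintegrable (`[s, t[%classic : set TR) (fun=> z) by split; exact: icst.
have -> : (t - s)%:C * z = cintegral `[s, t[ (fun=> z).
  by apply: complex_eq; rewrite /cintegral /= ?ReM ?ImM /= !Icst; ring.
rewrite -cintegralB// -(Icst c); apply: cintegral_le => //.
- by apply: cintegrableD => //; exact: cintegrableN.
- by move=> r; rewrite /= in_itv /= => /andP[h1 h2]; exact: hl.
Qed.

(* The intervals of the grid of step m are the cells of constancy of [lam]. *)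
Lemma integral_of_local Phi lam m c t : 0 < m -> 0 <= t -> cintegrable `[0, t]%classic lam ->
  (forall j s r, j%:R * m <= s -> s <= r -> r <= j.+1%:R * m -> r <= t -> exists z,
    cmod (Phi r - Phi s - (r - s)%:C * z) <= c * (r - s) ^+ 2 /\
    forall x, s <= x -> x < r -> cmod (lam x - z) <= c * (r - s)) ->
  Phi t = Phi 0 + cintegral `[0, t] lam.
Proof.
move=> m0 t0 il h; pose Th r := Phi r - cintegral `[0, r] lam.
have sub r : r <= t -> cintegrable `[0, r]%classic lam.
  move=> rt; apply: (cintegrableS _ _ _ il); try exact: measurable_itv.
  by move=> x; rewrite /= !in_itv /= => /andP[-> /le_trans]; exact.
have loc j s r : j%:R * m <= s -> s <= r -> r <= j.+1%:R * m -> r <= t ->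
    cmod (Th r - Th s) <= (3 * c) * (r - s) ^+ 2.
  move=> js sr rj rt; have [z [hz hl]] := h j s r js sr rj rt.
  have s0 : 0 <= s by apply: le_trans js; rewrite mulr_ge0// ltW.
  have ir : cintegrable `[s, r[%classic lam.
    apply: (cintegrableS _ _ _ (sub r rt)); try exact: measurable_itv.
    by move=> x; rewrite /= !in_itv /= => /andP[sx /ltW->]; rewrite (le_trans s0 sx).
  have hd := cintegral_dist s0 sr ir hl.
  rewrite /Th (cintegral_split s0 sr (sub r rt)).
  rewrite (_ : _ - _ = (Phi r - Phi s - (r - s)%:C * z) - (cintegral `[s, r[ lam - (r - s)%:C * z)); last by ring.
  rewrite (le_trans (cmodB _ _))// (le_trans (lerD hz hd))//.
  by rewrite le_eqVlt; apply/orP; left; apply/eqP; ring.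
have grid n r : 0 <= r -> r <= n%:R * m -> r <= t -> Th r = Th 0.
  elim: n r => [|n IH] r r0 rn rt.
    by congr Th; apply/eqP; rewrite eq_le r0 andbT (le_trans rn)// mul0r.
  have n0 : 0 <= n%:R * m by rewrite mulr_ge0// ltW.
  have [rn'|nr] := leP r (n%:R * m); first exact: IH.
  rewrite -(IH (n%:R * m) n0 (lexx _) (le_trans (ltW nr) rt)).
  apply: (@quadratic_constant _ _ _ (3 * c) (ltW nr)) => x y nx xy yr.
  by apply: (loc n) => //; [exact: le_trans rn | exact: le_trans rt].
have [n hn] : exists n, t <= n%:R * m.
  exists (Num.truncn (t / m)).+1; rewrite -ler_pdivrMr// ltW// truncnS_gt.
  by [].
have := grid n t t0 hn (lexx _); rewrite /Th => e.
have c0 : cintegral `[0, 0] lam = 0.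
  by rewrite /cintegral set_itv1 !Rintegral_set1.
by rewrite c0 subr0 in e; rewrite -e subrK.
Qed.
End LocalToIntegral.

(** * The Hudson-Parthasarathy equation *)

Section Continuity.
Variables (R : realType) (H : hilbert R) (F : fock R) (K : hilbert_tensor H F) (Q : coupling H).
Implicit Types (f g : R -> R[i]) (k m n : nat) (s t : R) (u v : H) (x y : K).
Local Notation U := (evolution K Q false).
Local Notation C := (cop Q).
Local Notation Cd := (cadj Q).

Lemma matrix_element_sesq f g t m : 0 <= t -> sesquilinear_on (cdom Q m) (matrix_element K Q f g t) /\
  form_bound (cdom Q m) (hnorm (exp_vec F f) * hnorm (exp_vec F g)) (matrix_element K Q f g t).
Proof.
move=> t0; have [lU iU _] := evolutionP K Q false t0; rewrite /matrix_element; split.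
  split=> z u u' v _ _ _; first by rewrite tensorDl tensorZl innerDl innerZl.
  by rewrite tensorDl tensorZl (linearmapD lU) (linearmapZ lU) innerDr innerZr.
split=> [|u v _ _]; first by rewrite mulr_ge0 ?hnorm_ge0.
rewrite (le_trans (inner_le _ _))// (isometry_hnorm _ iU) !hnorm_tensor.
by rewrite le_eqVlt; apply/orP; left; apply/eqP; ring.
Qed.

Lemma matrix_lipschitz f g m : is_step f -> is_step g -> exists L, 0 <= L /\
  forall u v, cdom Q m u -> cdom Q m v -> forall s t, 0 <= s -> s <= t ->
  cmod (matrix_element K Q f g t u v - matrix_element K Q f g s u v) <=
  L * (hnorm u * hnorm v) * (t - s).
Proof.
move=> sf sg; have [k0 [cf cg hm]] := matrix_local K Q sf sg; have [c [c0 hc]] := hm m.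
have [_ [b [_ _ b1 [bf bg]]]] := step_data sf sg.
have b0 : 0 <= b := le_trans ler01 b1; have bb0 : 0 <= b ^+ 2 by exact: sqr_ge0.
have lin := @cdom_lin _ _ Q m; have lC := cop_local Q m; have lCd := cadj_local Q m.
have s00 := step_const_ge0' lin lC lCd bb0.
set r := step_const (crate Q m) (b ^+ 2) + b ^+ 2 * step_const (crate Q m) (b ^+ 2) + b ^+ 2.
have r0 : 0 <= r by do 2?[apply: addr_ge0 => //]; exact: mulr_ge0.
set M := hnorm (exp_vec F f) * hnorm (exp_vec F g).
have M0 : 0 <= M by rewrite mulr_ge0 ?hnorm_ge0.
exists (M * r + c); split; first by rewrite addr_ge0// mulr_ge0.
move=> u v Wu Wv; apply: (lipschitz_cells (mesh_gt0 R k0)) => j s t js st tj.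
have s0 : 0 <= s by apply: le_trans js; rewrite mulr_ge0// ltW// mesh_gt0.
have ts1 : t - s <= 1.
  by have := mesh_le1 R k0; move: tj; rewrite -natr1 mulrDl mul1r => *; lra.
have bb : b <= b ^+ 2 by rewrite expr2 ler_peMl.
have fb : cmod (Num.conj (f (j%:R * mesh R k0))) <= b ^+ 2 by rewrite cmodJ (le_trans (bf _)).
have gb : cmod (g (j%:R * mesh R k0)) <= b ^+ 2 by rewrite (le_trans (bg _)).
have wb : cmod (- (Num.conj (f (j%:R * mesh R k0)) * g (j%:R * mesh R k0))) <= b ^+ 2.
  by rewrite cmodN cmodM cmodJ expr2 ler_pM ?cmod_ge0 ?bf ?bg.
have z01 : 0 <= (0 : R) <= 1 by rewrite lexx ler01.
have [sp bp] := matrix_element_sesq f g m s0.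
have [_ _ _ _ eS] := word_step lin lC lCd bb0 z01 fb gb wb.
have [[_ bL] _] := eS _ _ sp bp.
have {}bL := bL u v Wu Wv; have {}hc := hc u v j s t Wu Wv js st tj.
set z := word_generator _ _ _ _ _ _ _ _ in hc bL.
rewrite -[X in cmod X](subrK ((t - s)%:C * z)) (le_trans (cmodD _ _))//.
have ts0 : 0 <= t - s by rewrite subr_ge0.
rewrite cmodM cmod_real ger0_norm//.
have N0 : 0 <= hnorm u * hnorm v by rewrite mulr_ge0 ?hnorm_ge0.
have h1 := ler_wpM2l ts0 bL; have h2 : c * (t - s) ^+ 2 * (hnorm u * hnorm v) <= c * (t - s) * (hnorm u * hnorm v).
  by rewrite ler_wpM2r// ler_wpM2l// expr2 ler_piMr.
rewrite (le_trans (lerD (le_trans hc h2) h1))//.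
by rewrite le_eqVlt; apply/orP; left; apply/eqP; rewrite -/M -/r; ring.
Qed.

(** Matrix elements between core vectors tensored with exponential vectors of step functions are
    Lipschitz in time. Isometry makes the approximation of general [x] and [y] uniform in [t], and
    uniform limits stay continuous. *)
Lemma evolution_wcont x y : wcont (fun t => ⟨x, U t y⟩).
Proof.
have nU t z : 0 <= t -> hnorm (U t z) = hnorm z.
  by move=> t0; have [_ iU _] := evolutionP K Q false t0; exact: isometry_hnorm.
have base p q : wcont (fun t => ⟨core_exp K Q p, U t (core_exp K Q q)⟩).
  case: p q => [[u cu] [f sf]] [[v cv] [g sg]]; have [m [Wu Wv]] := core2 cu cv.
  have [L [L0 hL]] := matrix_lipschitz m sf sg.
  exact: (wcont_lipschitz (hL u v Wu Wv)).
have ext p : wcont (fun t => ⟨core_exp K Q p, U t y⟩).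
  apply: wcont_approx => e e0; have N0 : 0 < hnorm (core_exp K Q p) + 1 by rewrite ltr_wpDl ?hnorm_ge0.
  have [y' sy' hy'] := core_exp_dense K Q y _ (divr_gt0 e0 N0).
  (* Linearity of [U t] is available for [0 <= t] only, so the induction over the span works with a
     function set to 0 at negative times. *)
  exists (fun t => if 0 <= t then ⟨core_exp K Q p, U t y'⟩ else 0) => [|t t0]; last first.
    have [lU _ _] := evolutionP K Q false t0.
    rewrite t0 -innerBr -(linearmapB lU) (le_trans (inner_le _ _))// nU//.
    rewrite (le_trans (ler_wpM2l (hnorm_ge0 _) (ltW hy')))// mulrCA ler_piMr ?(ltW e0)//.
    by rewrite ler_pdivrMr// mul1r lerDl.
  suff sp : wcont (fun t => ⟨core_exp K Q p, if 0 <= t then U t y' else 0⟩).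
    move=> t e' t0 e'0; have [d d0 hd] := sp t e' t0 e'0; exists d => // s s0 hs.
    by have := hd s s0 hs; rewrite s0 t0.
  have lin t : 0 <= t -> linear (U t) by move=> t0; have [] := evolutionP K Q false t0.
  move: sy'; rewrite /span_of; elim=> [|a i u1 v1 _ IH].
    move=> t e' t0 e'0; exists 1 => // s s0 _.
    by rewrite s0 t0 !(linearmap0 (lin _ _))// subrr cmod0.
  have := wcontD (wcontZ a (base p i)) IH.
  move=> h t e' t0 e'0; have [d d0 hd] := h t e' t0 e'0; exists d => // s s0 hs.
  have := hd s s0 hs; rewrite s0 t0.
  by rewrite !(linearmapD (lin _ _)) ?(linearmapZ (lin _ _)) ?innerDr ?innerZr.
apply: wcont_approx => e e0; have N0 : 0 < hnorm y + 1 by rewrite ltr_wpDl ?hnorm_ge0.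
have [x' sx' hx'] := core_exp_dense K Q x _ (divr_gt0 e0 N0).
exists (fun t => ⟨x', U t y⟩) => [|t t0]; last first.
  rewrite -innerBl (le_trans (inner_le _ _))// nU//.
  rewrite (le_trans (ler_wpM2r (hnorm_ge0 _) (ltW hx')))// -mulrA ler_piMr ?(ltW e0)//.
  by rewrite mulrC ler_pdivrMr// mul1r lerDl.
move: sx'; rewrite /span_of; elim=> [|a i u1 v1 _ IH].
  by move=> t e' t0 e'0; exists 1 => // s s0 _; rewrite !inner0l subrr cmod0.
have h := wcontD (wcontZ (Num.conj a) (ext i)) IH.
move=> t e' t0 e'0; have [d d0 hd] := h t e' t0 e'0; exists d => // s s0 hs.
by have := hd s s0 hs; rewrite !innerDl !innerZl.
Qed.

Lemma evolution_measurable x y : cmeasurable_on `[0, +oo[ (fun t => ⟨x, U t y⟩).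
Proof. exact: (wcont_cmeas (evolution_wcont x y)). Qed.
End Continuity.

Section HPEquation.
Variables (R : realType) (H : hilbert R) (F : fock R) (K : hilbert_tensor H F) (Q : coupling H).
Implicit Types (f g : R -> R[i]) (k m n : nat) (s t : R) (u v a b c : H) (x y : K).
Local Notation U := (evolution K Q false).
Local Notation C := (cop Q).
Local Notation Cd := (cadj Q).
Local Notation mu := (@lebesgue_measure R).
Local Notation TR := (measurableTypeR R).

Lemma Rintegral_subset_le (D E : set TR) (a : TR -> R) : measurable D -> measurable E -> E `<=` D ->
  (forall s, 0 <= a s) -> rintegrable D a -> \int[mu]_(s in E) a s <= \int[mu]_(s in D) a s.
Proof.
move=> mD mE ED a0 ia; have iE := rintegrableS mD mE ED ia.
have iDE : rintegrable (D `&` E) a by rewrite setIidr.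
have ip : rintegrable D (a \_ E).
  by move: iDE => /(integrable_restrict mu mE mD); apply: rintegrable_eq => s; rewrite !patchE; case: ifP.
rewrite -[in leLHS](setIidr ED) Rintegral_mkcondr; apply: le_Rintegral => // s _.
by rewrite patchE; case: ifP => // _; exact: a0.
Qed.

Lemma rintegral_addZ (D : set TR) (a b : TR -> R) (z : R) : measurable D -> rintegrable D a -> rintegrable D b ->
  rintegrable D (fun s => a s + z * b s) /\
  \int[mu]_(s in D) (a s + z * b s) = \int[mu]_(s in D) a s + z * \int[mu]_(s in D) b s.
Proof.
move=> mD ia ib; have iz := rintegrableZ z mD ib; split; first exact: rintegrableD.
by rewrite RintegralD// RintegralZl.
Qed.

Lemma L2_local f t : L2 f -> 0 <= t -> rintegrable `[0, t]%classic (fun s : TR => cmod (f s)) /\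
  \int[mu]_(s in `[0, t]) cmod (f s) <= hnorm (one_particle F f) * Num.sqrt t.
Proof.
move=> Lf t0; have [mf if2] := Lf.
have mD : measurable (`[0, t]%classic : set TR) by exact: measurable_itv.
have mf' : cmeas `[0, t]%classic f.
  by apply: (cmeasurableS _ (@itv_half_line R t) mf); exact: measurable_half_line.
have if2' : rintegrable `[0, t]%classic (fun s : TR => cmod (f s) ^+ 2).
  by apply: (rintegrableS _ _ (@itv_half_line R t) if2); [exact: measurable_half_line|].
have one2 : rintegrable `[0, t]%classic (fun s : TR => (1 : R) ^+ 2) by exact: rintegrable_cst.
have m1 : measurable_fun `[0, t]%classic (fun s : TR => (1 : R)) by exact: measurable_cst.
have [i1 h1] := rintegral_cauchy_schwarz mD (measurable_cmod mf') m1 if2' one2.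
have e1 : (fun s : TR => cmod (f s) * 1) = (fun s => cmod (f s)) by apply/funext => s; rewrite mulr1.
rewrite e1 in i1 h1; split=> //.
have I0 : 0 <= \int[mu]_(s in `[0, t]) cmod (f s) by apply: Rintegral_ge0 => s _; exact: cmod_ge0.
rewrite -(@ler_pXn2r _ 2) ?nnegrE ?mulr_ge0 ?hnorm_ge0 ?sqrtr_ge0//.
rewrite exprMn (sqr_sqrtr t0) (one_particle_sqnorm F Lf); apply: (le_trans h1).
rewrite (_ : \int[mu]_(s in `[0, t]) (1 ^+ 2) = t); last first.
  by rewrite expr1n Rintegral_cst_itv// mul1r subr0.
apply: ler_wpM2r => //; apply: Rintegral_subset_le => //.
- exact: itv_half_line.
- by move=> s; exact: sqr_ge0.
Qed.

Definition hp_integrand f g x a b c s : R[i] :=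
  ⟨x, U s (tensor K (a + Num.conj (f s) *: b - g s *: c) (exp_vec F g))⟩.

Lemma hp_integrandE f g x a b c s : 0 <= s -> hp_integrand f g x a b c s =
  ⟨x, U s (tensor K a (exp_vec F g))⟩ + Num.conj (f s) * ⟨x, U s (tensor K b (exp_vec F g))⟩
  - g s * ⟨x, U s (tensor K c (exp_vec F g))⟩.
Proof.
move=> s0; have [lU _ _] := evolutionP K Q false s0.
rewrite /hp_integrand tensorBl tensorDl !tensorZl (linearmapB lU) (linearmapD lU) !(linearmapZ lU).
by rewrite innerBr innerDr !innerZr.
Qed.

Lemma cmeas_eq (D : set TR) (p q : TR -> R[i]) : (forall s, D s -> p s = q s) -> cmeas D p -> cmeas D q.
Proof.
move=> pq [h1 h2]; split; first by apply: eq_measurable_fun h1 => s /[!inE] /pq ->.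
by apply: eq_measurable_fun h2 => s /[!inE] /pq ->.
Qed.

Lemma evolution_inner_le s x y : 0 <= s -> cmod ⟨x, U s y⟩ <= hnorm x * hnorm y.
Proof.
move=> s0; have [_ iU _] := evolutionP K Q false s0.
by rewrite (le_trans (inner_le _ _))// (isometry_hnorm _ iU).
Qed.

Lemma evolution_inner_close s x x' y y' : 0 <= s ->
  cmod (⟨x, U s y⟩ - ⟨x', U s y'⟩) <= hnorm (x - x') * hnorm y + hnorm x' * hnorm (y - y').
Proof.
move=> s0; have [lU iU _] := evolutionP K Q false s0.
rewrite (le_trans (inner_diff _ _ _ _))// -(linearmapB lU) !(isometry_hnorm _ iU).
by [].
Qed.

Lemma hp_cmeas f g x a b c : L2 f -> L2 g -> cmeas (@half_line R) (hp_integrand f g x a b c).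
Proof.
move=> [mf _] [mg _].
have m0 y : cmeas (@half_line R) (fun s => ⟨x, U s y⟩) by exact: (wcont_cmeas (@evolution_wcont R H F K Q x y)).
apply: (@cmeas_eq _ (fun s => ⟨x, U s (tensor K a (exp_vec F g))⟩ +
   Num.conj (f s) * ⟨x, U s (tensor K b (exp_vec F g))⟩ - g s * ⟨x, U s (tensor K c (exp_vec F g))⟩)).
  by move=> s; rewrite /half_line /= in_itv /= andbT => s0; rewrite hp_integrandE.
apply: cmeasurableD; last by apply: cmeasurableN; exact: cmeasurableM.
by apply: cmeasurableD => //; apply: cmeasurableM => //; exact: cmeasurableJ.
Qed.

Lemma hp_integrable f g x a b c t : L2 f -> L2 g -> 0 <= t ->
  cintegrable `[0, t]%classic (hp_integrand f g x a b c).
Proof.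
move=> Lf Lg t0; have mD : measurable (`[0, t]%classic : set TR) by exact: measurable_itv.
have [i1 _] := L2_local Lf t0; have [i2 _] := L2_local Lg t0.
pose N (z : H) : R := hnorm x * (hnorm z * hnorm (exp_vec F g)).
have [j1 _] := rintegral_addZ (N b) mD (rintegrable_cst 0 t (N a)) i1.
have [j2 _] := rintegral_addZ (N c) mD j1 i2.
apply: (cintegrable_le mD _ _ j2).
  by apply: (cmeasurableS _ (@itv_half_line R t) (hp_cmeas x a b c Lf Lg)); exact: measurable_half_line.
move=> s; rewrite /= in_itv /= => /andP[s0 _]; rewrite hp_integrandE//.
have h z : cmod ⟨x, U s (tensor K z (exp_vec F g))⟩ <= N z.
  by rewrite /N -(hnorm_tensor K); exact: evolution_inner_le.
rewrite (le_trans (cmodB _ _))// lerD//; last by rewrite cmodM mulrC ler_wpM2r ?cmod_ge0.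
rewrite (le_trans (cmodD _ _))// lerD//.
by rewrite cmodM cmodJ mulrC ler_wpM2r ?cmod_ge0.
Qed.

Definition hp_defect f g x v a b c t : R[i] :=
  ⟨x, U t (tensor K v (exp_vec F g))⟩ - ⟨x, tensor K v (exp_vec F g)⟩ -
  cintegral `[0, t] (hp_integrand f g x a b c).

(** [P] measures the change of the vectors [x] and [e(g)] when both move by [d], [P'] bounds their
    norms after the move. The functions enter through their integrals over [[0, t]], hence the
    factor [sqrt t] of Cauchy-Schwarz. *)
Definition hp_const f g x v a b c t : R :=
  let P := hnorm (exp_vec F g) + hnorm x + 1 in
  let P' := (hnorm x + 1) * (hnorm (exp_vec F g) + 1) in
  2 * (hnorm v * P) + 2 * (hnorm a * P * t +
     (hnorm b * P) * (hnorm (one_particle F f) * Num.sqrt t) + (hnorm b * P') * Num.sqrt t +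
     (hnorm c * P) * (hnorm (one_particle F g) * Num.sqrt t) + (hnorm c * P') * Num.sqrt t).

Lemma hp_defect_close f f' g g' x x' v a b c t (d : R) : L2 f -> L2 f' -> L2 g -> L2 g' -> 0 <= t ->
  0 <= d <= 1 -> hnorm (x - x') <= d -> hnorm (exp_vec F g - exp_vec F g') <= d ->
  hnorm (one_particle F f - one_particle F f') <= d ->
  hnorm (one_particle F g - one_particle F g') <= d ->
  cmod (hp_defect f g x v a b c t - hp_defect f' g' x' v a b c t) <= d * hp_const f g x v a b c t.
Proof.
move=> Lf Lf' Lg Lg' t0 /andP[d0 d1] xd ed fd gd.
have mD : measurable (`[0, t]%classic : set TR) by exact: measurable_itv.
pose G := hnorm (exp_vec F g); pose P := G + hnorm x + 1; pose P' := (hnorm x + 1) * (G + 1).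
have [G0 X0] : 0 <= G /\ 0 <= hnorm x by rewrite !hnorm_ge0.
have xb : hnorm x' <= hnorm x + 1.
  rewrite -[x'](subrK x) addrC (le_trans (hnormD _ _))// lerD2l hnorm_distC.
  exact: le_trans d1.
have gb : hnorm (exp_vec F g') <= G + 1.
  rewrite -[exp_vec F g'](subrK (exp_vec F g)) addrC (le_trans (hnormD _ _))// lerD2l hnorm_distC.
  exact: le_trans d1.
have el z s : 0 <= s -> cmod (⟨x, U s (tensor K z (exp_vec F g))⟩ - ⟨x', U s (tensor K z (exp_vec F g'))⟩)
    <= d * (hnorm z * P).
  move=> s0; rewrite (le_trans (evolution_inner_close _ _ _ _ s0))// -tensorBr !hnorm_tensor.
  have h1 := ler_wpM2r (mulr_ge0 (hnorm_ge0 z) G0) xd.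
  have h2 : hnorm x' * (hnorm z * hnorm (exp_vec F g - exp_vec F g')) <= (hnorm x + 1) * (hnorm z * d).
    by apply: ler_pM; rewrite ?mulr_ge0 ?hnorm_ge0// ler_wpM2l ?hnorm_ge0.
  rewrite (le_trans (lerD h1 h2))// /P -/G.
  by rewrite le_eqVlt; apply/orP; left; apply/eqP; ring.
have el0 z : cmod (⟨x, tensor K z (exp_vec F g)⟩ - ⟨x', tensor K z (exp_vec F g')⟩) <= d * (hnorm z * P).
  rewrite (le_trans (inner_diff _ _ _ _))// -tensorBr !hnorm_tensor.
  have h1 := ler_wpM2r (mulr_ge0 (hnorm_ge0 z) G0) xd.
  have h2 : hnorm x' * (hnorm z * hnorm (exp_vec F g - exp_vec F g')) <= (hnorm x + 1) * (hnorm z * d).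
    by apply: ler_pM; rewrite ?mulr_ge0 ?hnorm_ge0// ler_wpM2l ?hnorm_ge0.
  rewrite (le_trans (lerD h1 h2))// /P -/G.
  by rewrite le_eqVlt; apply/orP; left; apply/eqP; ring.
have bl z s : 0 <= s -> cmod ⟨x', U s (tensor K z (exp_vec F g'))⟩ <= hnorm z * P'.
  move=> s0; rewrite (le_trans (evolution_inner_le _ _ s0))// hnorm_tensor mulrCA /P'.
  by apply: ler_wpM2l; rewrite ?hnorm_ge0//; apply: ler_pM; rewrite ?hnorm_ge0.
have LBf := square_integrableB (@measurable_half_line R) Lf Lf'.
have LBg := square_integrableB (@measurable_half_line R) Lg Lg'.
have [i1 e1] := L2_local Lf t0; have [i2 e2] := L2_local LBf t0.
have [i3 e3] := L2_local Lg t0; have [i4 e4] := L2_local LBg t0.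
have [j1 E1] := rintegral_addZ (d * (hnorm b * P)) mD (rintegrable_cst 0 t (d * (hnorm a * P))) i1.
have [j2 E2] := rintegral_addZ (hnorm b * P') mD j1 i2.
have [j3 E3] := rintegral_addZ (d * (hnorm c * P)) mD j2 i3.
have [j4 E4] := rintegral_addZ (hnorm c * P') mD j3 i4.
have I := hp_integrable x a b c Lf Lg t0; have I' := hp_integrable x' a b c Lf' Lg' t0.
have S0 := sqrtr_ge0 t.
have P0 : 0 <= P by rewrite !addr_ge0.
have P'0 : 0 <= P' by rewrite mulr_ge0// addr_ge0.
have intb : cmod (cintegral `[0, t] (hp_integrand f g x a b c) -
    cintegral `[0, t] (hp_integrand f' g' x' a b c)) <=
  2 * (d * (hnorm a * P) * t + (d * (hnorm b * P)) * (hnorm (one_particle F f) * Num.sqrt t) +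
     (hnorm b * P') * (d * Num.sqrt t) +
     (d * (hnorm c * P)) * (hnorm (one_particle F g) * Num.sqrt t) + (hnorm c * P') * (d * Num.sqrt t)).
  rewrite -cintegralB//; apply: (le_trans (cintegral_le mD _ _ j4)).
  - by apply: cintegrableD => //; exact: cintegrableN.
  - move=> s; rewrite /= in_itv /= => /andP[s0 _]; rewrite !hp_integrandE//.
    have ea := el a s s0; have eb := el b s s0; have ec := el c s s0.
    have bb := bl b s s0; have bc := bl c s s0.
    move: ea eb ec bb bc.
    set A := ⟨x, U s (tensor K a _)⟩; set A' := ⟨x', U s (tensor K a _)⟩.
    set B := ⟨x, U s (tensor K b _)⟩; set B' := ⟨x', U s (tensor K b _)⟩.
    set D := ⟨x, U s (tensor K c _)⟩; set D' := ⟨x', U s (tensor K c _)⟩ => ea eb ec bb bc.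
    have alg (p1 p2 p3 p4 p5 p6 q1 q2 q3 q4 : R[i]) : p1 + q1 * p3 - q3 * p5 - (p2 + q2 * p4 - q4 * p6) =
      p1 - p2 + q1 * (p3 - p4) + (q1 - q2) * p4 - q3 * (p5 - p6) - (q3 - q4) * p6 by ring.
    rewrite (alg A A' B B' D D') -rmorphB /=.
    rewrite (le_trans (cmodB _ _))// lerD//; last by rewrite cmodM mulrC ler_wpM2r ?cmod_ge0.
    rewrite (le_trans (cmodB _ _))// lerD//; last by rewrite cmodM mulrC ler_wpM2r ?cmod_ge0.
    rewrite (le_trans (cmodD _ _))// lerD//; last by rewrite cmodM cmodJ mulrC ler_wpM2r ?cmod_ge0.
    by rewrite (le_trans (cmodD _ _))// lerD// cmodM cmodJ mulrC ler_wpM2r ?cmod_ge0.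
  rewrite ler_wpM2l// E4 E3 E2 E1 Rintegral_cst_itv// subr0.
  have e2' : \int[mu]_(s in `[0, t]) cmod (f s - f' s) <= d * Num.sqrt t.
    by rewrite (le_trans e2)// ler_wpM2r// one_particleB.
  have e4' : \int[mu]_(s in `[0, t]) cmod (g s - g' s) <= d * Num.sqrt t.
    by rewrite (le_trans e4)// ler_wpM2r// one_particleB.
  do 4![apply: lerD; last by apply: ler_wpM2l => //; nonneg].
  by [].
rewrite /hp_defect.
set A := ⟨x, U t _⟩; set B := ⟨x, tensor K v _⟩; set J := cintegral _ _.
set A' := ⟨x', U t _⟩; set B' := ⟨x', tensor K v _⟩; set J' := cintegral _ (hp_integrand f' _ _ _ _ _).
rewrite (_ : _ - _ = A - A' - (B - B') - (J - J')); last by move: A B J A' B' J' => *; ring.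
rewrite (le_trans (cmodB _ _))// (le_trans (lerD (cmodB _ _) intb))//.
rewrite (le_trans (lerD (lerD (el v t t0) (el0 v)) (lexx _)))// /hp_const -/G -/P -/P'.
by rewrite le_eqVlt; apply/orP; left; apply/eqP; ring.
Qed.

Lemma evolution0 g v : is_step g -> core Q v -> U 0 (tensor K v (exp_vec F g)) = tensor K v (exp_vec F g).
Proof.
move=> sg cv; have [_ _ hU] := evolutionP K Q false (lexx (0 : R)); rewrite hU//.
have [k0 [b [[Lg _] [cg _] _ _]]] := step_data sg sg.
apply: hlim_eq => e e0; exists k0 => k kk; rewrite (_ : tvec _ _ _ _ _ _ _ = tensor K v (exp_vec F g)).
  by rewrite subrr hnorm0.
have c0 : cells (0 : R) k = 0%N.
  have /andP[h _] := cells_bounds k (lexx (0 : R)).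
  by case: (cells 0 k) h => // n; rewrite leNgt mulr_gt0 ?mesh_gt0.
have cg' : cell_const k g by rewrite -(subnKC kk); exact: cell_const_refine.
by rewrite /tvec /toy_vec /word_list c0 /= /ovec /= (exp_vec_splice F 0 Lg cg').
Qed.

(** On each cell [matrix_local] compares the increment with the integrand frozen at the left time
    [s], and the Lipschitz bound keeps the true integrand within a multiple of the step from it;
    [integral_of_local] then sums up. *)
Lemma hp_step f g u v t : is_step f -> is_step g -> core Q u -> core Q v -> 0 <= t ->
  hp_defect f g (tensor K u (exp_vec F f)) v (gen_op C Cd v) (C v) (Cd v) t = 0.
Proof.
move=> sf sg cu cv t0; have [m [Wu Wv]] := core2 cu cv.
have [k0 [cf cg hm]] := matrix_local K Q sf sg; have [c [c0 hc]] := hm m.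
have [L [L0 hL]] := matrix_lipschitz K Q m sf sg.
have [_ [b [[Lf Lg] _ b1 [bf bg]]]] := step_data sf sg.
have b0 : 0 <= b := le_trans ler01 b1.
have lin := @cdom_lin _ _ Q m; have lC := cop_local Q m; have lCd := cadj_local Q m.
have lG := gen_op_local lin lC lCd.
have [[WG WC] WCd] : (cdom Q m (gen_op C Cd v) /\ cdom Q m (C v)) /\ cdom Q m (Cd v).
  by split; [split|]; [case: lG | case: lC | case: lCd] => _ + _ _; exact.
set x := tensor K u (exp_vec F f).
pose N := hnorm (gen_op C Cd v) + b * hnorm (C v) + b * hnorm (Cd v).
have N0 : 0 <= N by rewrite !addr_ge0 ?mulr_ge0 ?hnorm_ge0.
pose c1 := `|c * (hnorm u * hnorm v)| + L * (hnorm u * N).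
apply/eqP; rewrite /hp_defect -addrA -opprD subr_eq0; apply/eqP.
rewrite -[in RHS](evolution0 sg cv).
apply: (@integral_of_local _ (fun t => ⟨x, U t (tensor K v (exp_vec F g))⟩) _ (mesh R k0) c1 t (mesh_gt0 R k0) t0
   (hp_integrable x _ _ _ Lf Lg t0)) => j s r js sr rj rt.
have s0 : 0 <= s by apply: le_trans js; rewrite mulr_ge0// ltW// mesh_gt0.
set fj := Num.conj (f (j%:R * mesh R k0)); set gj := g (j%:R * mesh R k0).
pose w := gen_op C Cd v + fj *: C v - gj *: Cd v.
have Ww : cdom Q m w.
  rewrite /w addrC -scaleNr; apply: cdom_lin => //.
  by rewrite addrC; exact: cdom_lin.
have wN : hnorm w <= N.
  have hz (z : R[i]) (y : H) : cmod z <= b -> hnorm (z *: y) <= b * hnorm y.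
    by move=> zb; rewrite hnormZ ler_wpM2r ?hnorm_ge0.
  apply: (le_trans (hnormB _ _)); apply: lerD; last by apply: hz; exact: bg.
  by apply: (le_trans (hnormD _ _)); apply: lerD => //; apply: hz; rewrite cmodJ; exact: bf.
exists (matrix_element K Q f g s u w); split.
  have := hc u v j s r Wu Wv js sr rj; rewrite -/fj -/gj.
  have -> : word_generator C Cd fj gj (- (fj * gj)) (matrix_element K Q f g s) u v = matrix_element K Q f g s u w.
    have [[_ sr'] _] := matrix_element_sesq K Q f g m s0.
    have [lU _ _] := evolutionP K Q false s0.
    rewrite /word_generator /matrix_element /w /drift /jump !tensorDl !tensorZl.
    rewrite -[- (gj *: Cd v)]scaleNr tensorZl.
    rewrite !(linearmapD lU) !(linearmapZ lU) !innerDr !innerZr.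
    move: ⟨_, _⟩ ⟨_, _⟩ ⟨_, _⟩ ⟨_, _⟩ => *; ring.
  move=> /le_trans; apply; rewrite mulrAC ler_wpM2r ?sqr_ge0//.
  by rewrite (le_trans (ler_norm _))// lerDl mulr_ge0// mulr_ge0 ?hnorm_ge0.
move=> y sy yr; have y0 := le_trans s0 sy.
have yj : dint k0 j y by apply/dintP; rewrite (le_trans js sy) (lt_le_trans yr rj).
rewrite /hp_integrand (cf _ _ yj) (cg _ _ yj) -/fj -/gj -/w.
apply: (le_trans (hL u w Wu Ww s y s0 sy)).
have h1 : L * (hnorm u * hnorm w) <= c1.
  rewrite (le_trans (_ : _ <= L * (hnorm u * N)))//.
    by rewrite ler_wpM2l// ler_wpM2l ?hnorm_ge0.
  by rewrite lerDr.
apply: ler_pM; rewrite ?mulr_ge0 ?hnorm_ge0 ?subr_ge0// ?lerD2r//.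
exact: ltW.
Qed.

(** [u], [f] and [g] are approximated by core vectors and step functions, on which [hp_defect]
    depends continuously. Only [v] stays fixed, since [C v] and [Cd v] do not depend continuously on
    it. *)
Lemma hp_L2 f g u v t : L2 f -> L2 g -> core Q v -> 0 <= t ->
  hp_defect f g (tensor K u (exp_vec F f)) v (gen_op C Cd v) (C v) (Cd v) t = 0.
Proof.
move=> Lf Lg cv t0; apply: eq_by_cmod => e e0; rewrite subr0.
set x := tensor K u (exp_vec F f).
set A := hp_const f g x v (gen_op C Cd v) (C v) (Cd v) t.
pose M := hnorm (exp_vec F f) + hnorm u + 1.
have M0 : 1 <= M by rewrite lerDr addr_ge0 ?hnorm_ge0.
pose d := Num.min 1 (e / (`|A| + 1)).
have A1 : 0 < `|A| + 1 by rewrite ltr_wpDl.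
have d0 : 0 < d by rewrite lt_min ltr01 divr_gt0.
have d1 : d <= 1 by rewrite ge_min lexx.
have dM : 0 < d / M by rewrite divr_gt0// (lt_le_trans ltr01).
have dMd : d / M <= d by rewrite ler_pdivrMr ?(lt_le_trans ltr01)// ler_peMr// ltW.
have [f' [sf hf1 hf2]] := exp_step_close F Lf dM; have [g' [sg hg1 hg2]] := exp_step_close F Lg dM.
have [u' cu hu] := cdom_dense Q u dM.
have d01 : 0 <= d <= 1 by rewrite ltW.
have xd : hnorm (x - tensor K u' (exp_vec F f')) <= d.
  rewrite (le_trans (hnorm_distD (tensor K u' (exp_vec F f)) _ _))// -tensorBl -tensorBr !hnorm_tensor.
  have u'b : hnorm u' <= hnorm u + 1.
    rewrite -[u'](subrK u) addrC (le_trans (hnormD _ _))// lerD2l hnorm_distC.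
    exact: le_trans (ltW hu) (le_trans dMd d1).
  have h1 := ler_wpM2r (hnorm_ge0 (exp_vec F f)) (ltW hu).
  have h2 := ler_pM (hnorm_ge0 _) (hnorm_ge0 _) u'b (ltW hf2).
  rewrite (le_trans (lerD h1 h2))// [_ * (d / M)]mulrC -mulrDr /M addrA divfK//.
  by rewrite gt_eqF// (lt_le_trans ltr01)// -/M addrA.
have le1 z : z < d / M -> z <= d by move=> h; exact: le_trans (ltW h) dMd.
have := hp_defect_close v (gen_op C Cd v) (C v) (Cd v) Lf (is_step_L2 sf) Lg (is_step_L2 sg) t0 d01 xd
  (le1 _ hg2) (le1 _ hf1) (le1 _ hg1).
rewrite hp_step// subr0 -/A => /le_trans; apply.
rewrite (le_trans (ler_wpM2l (ltW d0) (_ : A <= `|A| + 1)))//.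
  by rewrite (le_trans (ler_norm _))// lerDl.
by rewrite -ler_pdivlMr// ge_min lexx orbT.
Qed.
End HPEquation.

(** * Adaptedness *)

Section Approximation.
Variables (R : realType) (F : fock R).
Implicit Types (f g : R -> R[i]) (k m n : nat) (s t : R).
Local Notation mu := (@lebesgue_measure R).
Local Notation TR := (measurableTypeR R).
Local Notation ι := (one_particle F).

Lemma exp_hcvg (fn : nat -> R -> R[i]) f : (forall n, L2 (fn n)) -> L2 f ->
  hcvg (fun n => ι (fn n)) (ι f) -> hcvg (fun n => exp_vec F (fn n)) (exp_vec F f).
Proof.
move=> Ln Lf h e e0; pose N := hnorm (ι f) + 1; pose A := 2 * (N * expR (3 * N ^+ 2)).
have N0 : 0 < N by rewrite ltr_wpDl ?hnorm_ge0.
have A0 : 0 < A by rewrite !mulr_gt0// expR_gt0.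
have d0 : 0 < Num.min 1 (e ^+ 2 / A) by rewrite lt_min ltr01 divr_gt0// exprn_gt0.
have [k hk] := h _ d0; exists k => n /hk; rewrite lt_min => /andP[n1 n2].
have gN : hnorm (ι (fn n)) <= N.
  rewrite -[ι (fn n)](subrK (ι f)) addrC (le_trans (hnormD _ _))// lerD2l ltW//.
have fN : hnorm (ι f) <= N by rewrite lerDl.
have := exp_vec_close (Ln n) Lf gN fN => hc.
rewrite -(@ltr_pXn2r _ 2) ?nnegrE ?hnorm_ge0 ?(ltW e0)//; apply: (le_lt_trans hc).
move: n2; rewrite ltr_pdivlMr// /A; move: (hnorm _) (expR _) => x y.
by rewrite (_ : 2 * (N * x * y) = x * (2 * (N * y))); last by ring.
Qed.

Lemma step_approx f : L2 f -> exists fn : nat -> R -> R[i], (forall n, is_step (fn n)) /\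
  hcvg (fun n => ι (fn n)) (ι f).
Proof.
move=> Lf; have h n : exists g, is_step g /\ hnorm (ι f - ι g) < n.+1%:R^-1.
  have n0 : 0 < n.+1%:R^-1 :> R by rewrite invr_gt0.
  by have [g [sg hg _]] := exp_step_close F Lf n0; exists g.
have [fn hfn] := boolp.choice h; exists fn; split=> [n|e e0]; first by have [] := hfn n.
have [k hk] := inv_succ_lt e0; exists k => n /hk; apply: lt_trans.
by have [_] := hfn n; rewrite hnorm_distC.
Qed.

Lemma cutoff_dist (E : set TR) f g : measurable E -> L2 f -> L2 g ->
  hnorm (ι (cutoff E f) - ι (cutoff E g)) <= hnorm (ι f - ι g).
Proof.
move=> mE Lf Lg; apply: hnorm_le_sqr; rewrite ?hnorm_ge0//.
have [Lcf Lcg] : L2 (cutoff E f) /\ L2 (cutoff E g) by split; exact: L2_cutoff.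
rewrite !(one_particle_dist F)//; apply: le_Rintegral.
- exact: measurable_half_line.
- by have [] := square_integrableB (@measurable_half_line R) Lcf Lcg.
- by have [] := square_integrableB (@measurable_half_line R) Lf Lg.
move=> s _; rewrite lerXn2r ?nnegrE ?cmod_ge0// /cutoff.
by case: ifP => // _; rewrite subrr cmod0 cmod_ge0.
Qed.

Lemma L2_inner_cut f g t : L2 f -> L2 g -> 0 <= t -> L2_inner f g =
  L2_inner (cutoff `[0, t] f) (cutoff `[0, t] g) + L2_inner (cutoff `[t, +oo[ f) (cutoff `[t, +oo[ g).
Proof.
move=> Lf Lg t0; have [ir ii] := inner_integrable (@measurable_half_line R) Lf Lg.
have key (E : set TR) : E `<=` @half_line R -> L2_inner (cutoff E f) (cutoff E g) =
    cintegral E (fun s => Num.conj (f s) * g s).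
  move=> EH; rewrite -(setIidr EH) -cintegral_cutoff; apply: eq_cintegral => s _.
  by rewrite /cutoff (setIidr EH); case: ifP => // _; rewrite mulr0.
rewrite !key; last 2 first.
- by move=> s; rewrite /half_line /= !in_itv /= !andbT => /(le_trans t0).
- exact: itv_half_line.
have main (a : TR -> R) : rintegrable (@half_line R) a ->
    \int[mu]_(x in @half_line R) a x = \int[mu]_(x in `[0, t]) a x + \int[mu]_(x in `[t, +oo[) a x.
  move=> ia; apply/eqP; rewrite addrC -subr_eq; apply/eqP.
  have i1 : rintegrable (`]t, +oo[%classic : set TR) a.
    apply: (rintegrableS _ _ _ ia); [exact: measurable_half_line|exact: measurable_itv|].
    by move=> x; rewrite /half_line /= !in_itv /= !andbT => /ltW /(le_trans t0).
  rewrite (@Rintegral_itvB R a (BLeft 0) +oo%O t)//; try by rewrite bnd_simp.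
  by rewrite (Rintegral_itv_obnd_cbnd i1).
by rewrite /L2_inner /cintegral (main _ ir) (main _ ii); apply: complex_eq; rewrite ?ReD ?ImD.
Qed.

Lemma ccvg_cexp (a : nat -> R[i]) l : ccvg a l -> ccvg (fun n => cexp (a n)) (cexp l).
Proof.
move=> h e e0; pose A := expR (cmod l) * expR 1; have A0 : 0 < A by rewrite mulr_gt0 ?expR_gt0.
have d0 : 0 < Num.min 1 (e / A) by rewrite lt_min ltr01 divr_gt0.
have [k hk] := h _ d0; exists k => n /hk; rewrite lt_min => /andP[n1 n2].
apply: (le_lt_trans (cexp_diff _ _)); move: n2; rewrite ltr_pdivlMr//; apply: le_lt_trans.
by rewrite /A [leLHS]mulrCA ler_wpM2l ?cmod_ge0// ler_wpM2l ?expR_ge0// ler_expR ltW.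
Qed.

Definition step_cut k n f : R -> R[i] := step k n (fun j => f (j%:R * mesh R k)).

Lemma step_cut_in k n f s : cell_const k f -> 0 <= s -> s < n%:R * mesh R k -> step_cut k n f s = f s.
Proof.
move=> cf s0 sn; have [j hj] := dint_exists k s0.
have jn : (j < n)%N by exact/(dint_lt n hj).
by rewrite /step_cut (step_in _ jn hj) -(cf _ _ hj).
Qed.

Lemma step_cut_out k n f s : 0 <= s -> n%:R * mesh R k <= s -> step_cut k n f s = 0.
Proof.
move=> s0 sn; have [j hj] := dint_exists k s0; rewrite /step_cut (step_out _ _ hj)//.
by rewrite leqNgt; apply/negP => /(dint_lt n hj); rewrite ltNge sn.
Qed.

(** The successor makes the cut end at the first mesh point after [t], so the cut function agrees
    with [f] on all of [[0, t]]; beyond [t] it dies out as the mesh shrinks, dominated by [f]. *)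
Lemma step_cut_cvg k0 f t : L2 f -> cell_const k0 f -> 0 <= t ->
  hcvg (fun k => ι (step_cut (k0 + k) (cells t (k0 + k)).+1 f)) (ι (cutoff `[0, t] f)).
Proof.
move=> Lf cf t0 e e0; have Lc : L2 (cutoff `[0, t] f) by apply: L2_cutoff => //; exact: measurable_itv.
have [||||n hn] := @small_L2_dist R F (cutoff `[0, t] f)
   (fun k => step_cut (k0 + k) (cells t (k0 + k)).+1 f) (fun s => cmod (f s) ^+ 2) e Lc _ _ _ _ e0.
- by move=> k; exact: L2_step.
- by case: Lf.
- move=> k s; rewrite /half_line /= in_itv /= andbT => s0.
  have cf' := cell_const_refine (m := k) cf.
  have /andP[b1 b2] := cells_bounds (k0 + k) t0.
  rewrite lerXn2r ?nnegrE ?cmod_ge0//.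
  have [st|ts] := leP s t.
    by rewrite cutoff_in ?step_cut_in ?subrr ?cmod0 ?cmod_ge0//= ?in_itv /= ?s0// (le_lt_trans st).
  rewrite cutoff_out; last by rewrite /= in_itv /= s0 leNgt ts.
  rewrite sub0r cmodN; have [sn|ns] := ltP s ((cells t (k0 + k)).+1%:R * mesh R (k0 + k)).
    by rewrite step_cut_in.
  by rewrite step_cut_out ?cmod0 ?cmod_ge0.
- move=> s; rewrite /half_line /= in_itv /= andbT => s0.
  apply/cvgrPdist_lt => d d0.
  have [st|ts] := leP s t.
    exists 0%N => // k _ /=; have /andP[b1 b2] := cells_bounds (k0 + k) t0.
    have cf' := cell_const_refine (m := k) cf.
    have e1 : cutoff `[0, t] f s = f s by rewrite cutoff_in//= in_itv /= s0.
    have e2 : step_cut (k0 + k) (cells t (k0 + k)).+1 f s = f s.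
      by rewrite step_cut_in// (le_lt_trans st).
    by rewrite e1 e2 subrr cmod0 subrr normr0.
  have ts0 : 0 < s - t by rewrite subr_gt0.
  have [k1 hk1] := mesh_small ts0; exists k1 => // k /= kk.
  have /andP[b1 b2] := cells_bounds (k0 + k) t0.
  have := hk1 (k0 + k)%N (leq_trans kk (leq_addl _ _)) => hm.
  rewrite cutoff_out; last by rewrite /= in_itv /= s0 leNgt ts.
  have sn : (cells t (k0 + k)).+1%:R * mesh R (k0 + k) <= s.
    by rewrite -natr1 mulrDl mul1r; move: b1 hm => *; lra.
  by rewrite step_cut_out// subr0 cmod0 subrr normr0.
by exists n => k /hn; rewrite hnorm_distC.
Qed.
End Approximation.

Section Adapted.
Variables (R : realType) (H : hilbert R) (F : fock R) (K : hilbert_tensor H F) (Q : coupling H).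
Implicit Types (f g : R -> R[i]) (k m n : nat) (s t : R) (u v : H) (x y : K).
Local Notation U := (evolution K Q false).
Local Notation mu := (@lebesgue_measure R).
Local Notation TR := (measurableTypeR R).
Local Notation ι := (one_particle F).

Lemma tensor_hcvg (un : nat -> H) u (an : nat -> F) (a : F) : hcvg un u -> hcvg an a ->
  hcvg (fun n => tensor K (un n) (an n)) (tensor K u a).
Proof.
move=> hu ha e e0; pose M := hnorm u + hnorm a + 1.
have M0 : 0 < M by rewrite ltr_wpDl// addr_ge0 ?hnorm_ge0.
pose d := Num.min 1 (e / (2 * M)).
have d0 : 0 < d by rewrite lt_min ltr01 divr_gt0// mulr_gt0.
have [k1 h1] := hu d d0; have [k2 h2] := ha d d0; exists (maxn k1 k2) => n.
rewrite geq_max => /andP[/h1 {}h1 /h2 {}h2].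
rewrite (le_lt_trans (hnorm_distD (tensor K (un n) a) _ _))// -tensorBl -tensorBr !hnorm_tensor.
have ub : hnorm (un n) <= M.
  rewrite -[un n](subrK u) addrC (le_trans (hnormD _ _))// /M -addrA lerD2l.
  by rewrite (le_trans (ltW h1))// (le_trans (_ : d <= 1)) ?ge_min ?lexx// lerDr hnorm_ge0.
have ab : hnorm a <= M by rewrite /M addrAC lerDr addr_ge0 ?hnorm_ge0.
have de : d <= e / (2 * M) by rewrite ge_min lexx orbT.
have s1 : hnorm (un n) * hnorm (an n - a) < e / 2.
  apply: (@le_lt_trans _ _ (M * hnorm (an n - a))); first by rewrite ler_wpM2r ?hnorm_ge0.
  rewrite mulrC -ltr_pdivlMr//; apply: (lt_le_trans h2); apply: (le_trans de).
  by rewrite invfM mulrA.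
have s2 : hnorm (un n - u) * hnorm a < e / 2.
  apply: (@le_lt_trans _ _ (hnorm (un n - u) * M)); first by rewrite ler_wpM2l ?hnorm_ge0.
  rewrite -ltr_pdivlMr//; apply: (lt_le_trans h1); apply: (le_trans de).
  by rewrite invfM mulrA.
by rewrite [e]splitr ltrD.
Qed.

(** Joint continuity: weak continuity in time is used at the limit vectors alone, while isometry
    controls the moving vectors uniformly in time. *)
Lemma evolution_ccvg (tn : nat -> R) t (xn yn : nat -> K) x y : 0 <= t -> (forall n, 0 <= tn n) ->
  (forall d : R, 0 < d -> exists n0, forall n, (n0 <= n)%N -> `|tn n - t| < d) ->
  hcvg xn x -> hcvg yn y -> ccvg (fun n => ⟨xn n, U (tn n) (yn n)⟩) ⟨x, U t y⟩.
Proof.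
move=> t0 tn0 ht hx hy e e0; pose M := hnorm x + hnorm y + 1.
have M0 : 0 < M by rewrite ltr_wpDl// addr_ge0 ?hnorm_ge0.
have e3 : 0 < e / 3 by rewrite divr_gt0.
pose d := Num.min 1 (e / 3 / M).
have d0 : 0 < d by rewrite lt_min ltr01 divr_gt0.
have [w w0 hw] := evolution_wcont Q x y t0 e3.
have [n1 h1] := ht w w0; have [n2 h2] := hx d d0; have [n3 h3] := hy d d0.
exists (maxn n1 (maxn n2 n3)) => n; rewrite !geq_max => /and3P[/h1 {}h1 /h2 {}h2 /h3 {}h3].
have c1 := hw _ (tn0 n) h1.
have c2 := evolution_inner_close Q (xn n) x (yn n) y (tn0 n).
have de : d <= e / 3 / M by rewrite ge_min lexx orbT.
have d1 : d <= 1 by rewrite ge_min lexx.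
have yb : hnorm (yn n) <= M.
  rewrite -[yn n](subrK y) addrC (le_trans (hnormD _ _))// /M addrAC.
  have := hnorm_ge0 x; have := le_trans (ltW h3) d1.
  by move: (hnorm (yn n - y)) (hnorm x) (hnorm y) => *; lra.
have xb : hnorm x <= M by rewrite /M -addrA lerDl addr_ge0 ?hnorm_ge0.
have s1 : hnorm (xn n - x) * hnorm (yn n) < e / 3.
  apply: (@le_lt_trans _ _ (hnorm (xn n - x) * M)); first by rewrite ler_wpM2l ?hnorm_ge0.
  by rewrite -ltr_pdivlMr//; exact: lt_le_trans h2 de.
have s2 : hnorm x * hnorm (yn n - y) < e / 3.
  apply: (@le_lt_trans _ _ (M * hnorm (yn n - y))); first by rewrite ler_wpM2r ?hnorm_ge0.
  by rewrite mulrC -ltr_pdivlMr//; exact: lt_le_trans h3 de.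
apply: (le_lt_trans (cmod_distD ⟨x, U (tn n) y⟩ _ _)).
have := le_lt_trans c2 (ltrD s1 s2); move: c1.
by move: (cmod _) (cmod _) => z1 z2 *; lra.
Qed.

(** At a mesh point [t] the words sample only cells before [t], where [f] and its cut coincide. Only
    the tail factors differ, and their ratio is the displayed exponential. *)
Lemma adapted_dyadic k n f g u v t : is_step f -> is_step g -> cell_const k f -> cell_const k g ->
  core Q u -> core Q v -> t = n%:R * mesh R k ->
  ⟨tensor K u (exp_vec F f), U t (tensor K v (exp_vec F g))⟩ =
  cexp (L2_inner f g - L2_inner (step_cut k n f) (step_cut k n g)) *
  ⟨tensor K u (exp_vec F (step_cut k n f)), U t (tensor K v (exp_vec F (step_cut k n g)))⟩.
Proof.
move=> sf sg cf cg cu cv tE.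
have t0 : 0 <= t by rewrite tE mulr_ge0// ltW// mesh_gt0.
have [s1 s2] : is_step (step_cut k n f) /\ is_step (step_cut k n g).
  by split; do 3!eexists.
have [[Lf Lg] [L1 L2']] : (L2 f /\ L2 g) /\ (L2 (step_cut k n f) /\ L2 (step_cut k n g)).
  by split; split; exact: is_step_L2.
apply: (ccvg_unique (matrix_elementE K f u t0 sg cv)).
have := ccvgZ (cexp (L2_inner f g - L2_inner (step_cut k n f) (step_cut k n g)))
  (matrix_elementE K (step_cut k n f) u t0 s2 cv).
move=> h e e0; have [p hp] := h e e0; exists (maxn k p) => q; rewrite geq_max => /andP[kq pq].
suff -> : ⟨tensor K u (exp_vec F f), tvec K Q false q t g v⟩ =
    cexp (L2_inner f g - L2_inner (step_cut k n f) (step_cut k n g)) *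
    ⟨tensor K u (exp_vec F (step_cut k n f)), tvec K Q false q t (step_cut k n g) v⟩ by exact: hp.
have [cf' cg'] : cell_const q f /\ cell_const q g by split; rewrite -(subnKC kq); exact: cell_const_refine.
have [d1 d2] : cell_const q (step_cut k n f) /\ cell_const q (step_cut k n g).
  by split; rewrite -(subnKC kq); apply/cell_const_refine/cell_const_step.
have same (h0 : R -> R[i]) : cell_const k h0 -> samples q 0 (cells t q) (step_cut k n h0) = samples q 0 (cells t q) h0.
  move=> ch; apply: (@eq_from_nth _ 0) => [|i]; rewrite !size_samples// => iq.
  rewrite !nth_samples// add0n step_cut_in//; first by rewrite mulr_ge0// ltW// mesh_gt0.
  have /andP[b1 _] := cells_bounds q t0; rewrite -tE; apply: lt_le_trans b1.
  by rewrite ltr_pM2r ?mesh_gt0// ltr_nat.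
have wE (h0 : R -> R[i]) : cell_const k h0 -> word_list false q t (step_cut k n h0) = word_list false q t h0.
  by move=> ch; rewrite /word_list same.
have E1 := @tvec_inner R H F K Q false q t f g u v t0 Lf Lg cf' cg' cv.
have E2 := @tvec_inner R H F K Q false q t _ _ u v t0 L1 L2' d1 d2 cv.
rewrite (wE f cf) (wE g cg) in E2.
suff ET : tail_factor q t f g = cexp (L2_inner f g - L2_inner (step_cut k n f) (step_cut k n g)) *
    tail_factor q t (step_cut k n f) (step_cut k n g).
  by rewrite E1 E2 ET; exact: (esym (mulrA _ _ _)).
rewrite (tail_factorE F t Lf Lg cf' cg') (tail_factorE F t L1 L2' d1 d2) (same f cf) (same g cg).
rewrite -[RHS]cexpD; congr cexp.
by move: ((mesh R q)%:C * _) (L2_inner f g) (L2_inner _ _) => *; ring.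
Qed.

(** The mesh points [tn] tend to [t] from the right; the dyadic identity passes to the limit by
    continuity of the evolution and of [f |-> e(f)], and the exponential prefactor becomes the
    scalar product over [[t, +oo[]. *)
Lemma adapted_step f g u v t : is_step f -> is_step g -> core Q u -> core Q v -> 0 <= t ->
  ⟨tensor K u (exp_vec F f), U t (tensor K v (exp_vec F g))⟩ =
  ⟨tensor K u (exp_vec F (cutoff `[0, t] f)), U t (tensor K v (exp_vec F (cutoff `[0, t] g)))⟩ *
  ⟨exp_vec F (cutoff `[t, +oo[ f), exp_vec F (cutoff `[t, +oo[ g)⟩.
Proof.
move=> sf sg cu cv t0; have [k0 [b [[Lf Lg] [cf cg] _ _]]] := step_data sf sg.
have mI : measurable (`[0, t]%classic : set TR) by exact: measurable_itv.
have mJ : measurable (`[t, +oo[%classic : set TR) by exact: measurable_itv.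
rewrite [X in _ * X]exp_vec_inner; try exact: L2_cutoff.
have -> : L2_inner (cutoff `[t, +oo[ f) (cutoff `[t, +oo[ g) =
    L2_inner f g - L2_inner (cutoff `[0, t] f) (cutoff `[0, t] g).
  by apply/eqP; rewrite eq_sym subr_eq addrC; apply/eqP; exact: L2_inner_cut.
rewrite [RHS]mulrC.
pose tn k := (cells t (k0 + k)).+1%:R * mesh R (k0 + k).
have tn0 k : 0 <= tn k by rewrite mulr_ge0// ltW// mesh_gt0.
have ht (d : R) : 0 < d -> exists n0, forall n, (n0 <= n)%N -> `|tn n - t| < d.
  move=> d0; have [n1 hn1] := mesh_small d0; exists n1 => n nn.
  have /andP[b1 b2] := cells_bounds (k0 + n) t0; have hm := hn1 (k0 + n)%N (leq_trans nn (leq_addl _ _)).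
  rewrite /tn in b2 *; rewrite ger0_norm ?subr_ge0 ?(ltW b2)//.
  by move: b1 hm; rewrite -natr1 mulrDl mul1r => *; lra.
have hcst (y : K) : hcvg (fun=> y) y by exact: hcvg_cst.
have cf1 := step_cut_cvg F Lf cf t0; have cg1 := step_cut_cvg F Lg cg t0.
have [Lcf Lcg] : L2 (cutoff `[0, t] f) /\ L2 (cutoff `[0, t] g) by split; exact: L2_cutoff.
have Ls h k n : L2 (@step_cut R k n h) by exact: L2_step.
have ef := exp_hcvg (fun k => Ls f _ _) Lcf cf1; have eg := exp_hcvg (fun k => Ls g _ _) Lcg cg1.
apply: (ccvg_unique (evolution_ccvg t0 tn0 ht (hcst _) (hcst _))).
apply: (ccvg_ext (fun k => esym (adapted_dyadic sf sg (cell_const_refine (m := k) cf)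
  (cell_const_refine (m := k) cg) cu cv (erefl (tn k))))).
apply: ccvgM; last by apply: (evolution_ccvg t0 tn0 ht); apply: tensor_hcvg => //; exact: hcvg_cst.
apply: ccvg_cexp; apply: ccvgD; first exact: ccvg_cst.
apply: ccvgN; rewrite -(one_particle_inner F Lcf Lcg).
apply: (ccvg_ext (fun k => one_particle_inner F (Ls f _ _) (Ls g _ _))).
exact: ccvg_inner.
Qed.

Lemma core_approx v : exists vn : nat -> H, (forall n, core Q (vn n)) /\ hcvg vn v.
Proof.
have h n : exists w, core Q w /\ hnorm (v - w) < n.+1%:R^-1.
  have n0 : 0 < n.+1%:R^-1 :> R by rewrite invr_gt0.
  by have [w cw hw] := cdom_dense Q v n0; exists w.
have [vn hvn] := boolp.choice h; exists vn; split=> [n|e e0]; first by have [] := hvn n.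
have [k hk] := inv_succ_lt e0; exists k => n /hk; apply: lt_trans.
by have [_] := hvn n; rewrite hnorm_distC.
Qed.

Lemma evolution_adapted : adapted_process U.
Proof.
split=> [t t0 u v f g /L2P Lf /L2P Lg|x y]; last exact: evolution_measurable.
have mI : measurable (`[0, t]%classic : set TR) by exact: measurable_itv.
have mJ : measurable (`[t, +oo[%classic : set TR) by exact: measurable_itv.
have [fn [sf cf]] := step_approx F Lf; have [gn [sg cg]] := step_approx F Lg.
have [un [cu hu]] := core_approx u; have [vn [cv hv]] := core_approx v.
have [Lfn Lgn] : (forall n, L2 (fn n)) /\ (forall n, L2 (gn n)) by split=> n; exact: is_step_L2.
have cut (hn : nat -> R -> R[i]) h (E : set TR) : measurable E -> (forall n, L2 (hn n)) -> L2 h ->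
    hcvg (fun n => ι (hn n)) (ι h) ->
    hcvg (fun n => exp_vec F (cutoff E (hn n))) (exp_vec F (cutoff E h)).
  move=> mE Lh Lh0 ch; apply: exp_hcvg => [n||e e0]; [exact: L2_cutoff|exact: L2_cutoff|].
  have [p hp] := ch e e0; exists p => n /hp; apply: le_lt_trans.
  exact: cutoff_dist.
have ht (d : R) : 0 < d -> exists n0, forall n : nat, (n0 <= n)%N -> `|t - t| < d.
  by move=> d0; exists 0%N => n _; rewrite subrr normr0.
have tt (n : nat) : 0 <= t by [].
apply: (ccvg_unique (evolution_ccvg (tn := fun=> t) t0 tt ht
  (tensor_hcvg hu (exp_hcvg Lfn Lf cf)) (tensor_hcvg hv (exp_hcvg Lgn Lg cg)))).
apply: (ccvg_ext (fun n => esym (adapted_step (sf n) (sg n) (cu n) (cv n) t0))).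
apply: ccvgM; last by apply: ccvg_inner; exact: cut.
by apply: (evolution_ccvg (tn := fun=> t) t0 tt ht); apply: tensor_hcvg => //; exact: cut.
Qed.

End Adapted.

(** * The Lindblad semigroup *)

Section Flow.
Variables (R : realType) (H : hilbert R) (Q : coupling H).
Implicit Types (m : nat) (s t c : R) (u v : H) (X Y Z : H -> H).
Local Notation C := (cop Q).
Local Notation Cd := (cadj Q).
Local Notation L := (gram_generator C Cd 0 0).

Definition op_form X : form H := fun u v => ⟨u, X v⟩.

Lemma op_form_sesq (W : set H) X : linear X -> sesquilinear_on W (op_form X).
Proof.
move=> lX; rewrite /op_form; split=> z u u' v _ _ _; first by rewrite innerDl innerZl.
by rewrite (linearmapD lX) (linearmapZ lX) innerDr innerZr.
Qed.

Lemma lindbladian_form X u v : L (op_form X) u v =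
  ⟨u, X (gen_op C Cd v)⟩ + ⟨gen_op C Cd u, X v⟩ + ⟨C u, X (C v)⟩.
Proof.
rewrite /gram_generator /op_form /drift /jump !oppr0 !scale0r !add0r.
by rewrite [⟨gen_op C Cd u, _⟩ + _]addrC.
Qed.

(** The local form of [d/dt <u, Y_t v> = <u, L(Y_t) v>], with a constant for each level. It is the
    common ground on which the expectation semigroup and an arbitrary solution of the integral
    equation are compared. *)
Definition lindblad_flow (Y : R -> H -> H) := forall m, exists c, 0 <= c /\
  forall u v s t, cdom Q m u -> cdom Q m v -> 0 <= s -> s <= t -> t <= s + 2^-1 ->
    cmod (⟨u, Y t v⟩ - ⟨u, Y s v⟩ - (t - s)%:C * L (op_form (Y s)) u v) <=
    c * (t - s) ^+ 2 * (hnorm u * hnorm v).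

Definition lind_rate m : R := step_const (crate Q m) 1 + step_const (crate Q m) 1 +
  step_const (crate Q m) 1 * step_const (crate Q m) 1.

(** Read at mesh 0, [toy_form_step] delivers linearity and boundedness of the Lindbladian on the
    forms of each level. *)
Lemma lind_euler m : 0 <= lind_rate m /\ euler_step (cdom Q m) 0 (gram_err (crate Q m) 1)
  (lind_rate m) (toy_form C Cd 0 0 1 0 0) L.
Proof.
have lin := @cdom_lin _ _ Q m; have lC := cop_local Q m; have lCd := cadj_local Q m.
have s00 := step_const_ge0' lin lC lCd ler01.
split; first by do 2?[apply: addr_ge0 => //]; exact: mulr_ge0.
by apply: (toy_form_step lin lC lCd) => //; rewrite ?cmod0 ?mul1r.
Qed.

Lemma lindbladian_bound m phi M : sesquilinear_on (cdom Q m) phi -> form_bound (cdom Q m) M phi ->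
  form_bound (cdom Q m) (M * lind_rate m) (L phi).
Proof. by move=> sp bp; have [_ [_ _ _ _ h]] := lind_euler m; have [] := h _ _ sp bp. Qed.

Lemma lindbladian_comb (z : R[i]) phi psi u v :
  L (form_comb z phi psi) u v = z * L phi u v + L psi u v.
Proof. by have [_ [_ _ _ + _]] := lind_euler 0; apply. Qed.

(** On level [m] the difference form [D] starts at 0 and follows the bounded generator up to second
    order. Over [n + 1] equal steps the accumulated error is at most a constant over [n + 1], so [D]
    vanishes; density of the core concludes. The constants depend on [m] and need not be uniform. *)
Lemma flow_unique (Y Z : R -> H -> H) : (forall t, 0 <= t -> bounded_op (Y t)) ->
  (forall t, 0 <= t -> bounded_op (Z t)) -> lindblad_flow Y -> lindblad_flow Z ->
  (forall v, Y 0 v = Z 0 v) -> forall t, 0 <= t -> Y t = Z t.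
Proof.
move=> bY bZ fY fZ YZ0 t t0.
suff key m u v : cdom Q m u -> cdom Q m v -> ⟨u, Y t v⟩ = ⟨u, Z t v⟩.
  have dn : hdense (span_of (fun p : {v : H | core Q v} => sval p)).
    move=> h e e0; have [h' Wh' hh'] := @cdom_dense _ _ Q h e e0; exists h' => //.
    rewrite (_ : h' = \sum_(i < 1) 1 *: sval (exist _ h' Wh')); last by rewrite big_ord1 scale1r.
    exact: (span_of_sum (fun p : {v : H | core Q v} => sval p) (fun=> 1) (fun=> exist _ h' Wh')).
  apply: (bounded_map_eq dn); [exact: bY | exact: bZ |].
  move=> [v cv] /=; apply: (inner_eq_span dn) => -[u cu] /=.
  by have [m [Wu Wv]] := core2 cu cv; exact: (key m).
move=> Wu0 Wv0.
have [c1 [c10 h1]] := fY m; have [c2 [c20 h2]] := fZ m; pose c := c1 + c2.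
have c0 : 0 <= c by rewrite addr_ge0.
pose D r : form H := form_comb (-1) (op_form (Z r)) (op_form (Y r)).
have DE r x y : D r x y = ⟨x, Y r y⟩ - ⟨x, Z r y⟩.
  by rewrite /D /form_comb mulN1r addrC.
have hD x y r s : cdom Q m x -> cdom Q m y -> 0 <= r -> r <= s -> s <= r + 2^-1 ->
    cmod (D s x y - D r x y - (s - r)%:C * L (D r) x y) <= c * (s - r) ^+ 2 * (hnorm x * hnorm y).
  move=> Wx Wy r0 rs sr; rewrite /D lindbladian_comb -!/(D _) !DE.
  have {}h1 := h1 x y r s Wx Wy r0 rs sr; have {}h2 := h2 x y r s Wx Wy r0 rs sr.
  have alg (a b p q l l' z : R[i]) : a - p - (b - q) - z * (-1 * l + l') =
    (a - b - z * l') - (p - q - z * l) by ring.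
  rewrite alg (le_trans (cmodB _ _))// /c -mulrA mulrDl lerD// mulrA//.
pose B := lind_rate m; have B0 : 0 <= B by case: (lind_euler m).
have sD r : 0 <= r -> sesquilinear_on (cdom Q m) (D r).
  move=> r0; apply: sesquilinear_comb; apply: op_form_sesq; [exact: (bZ r r0).1 | exact: (bY r r0).1].
(* Discrete Gronwall: each step multiplies the previous bound by [1 + h B] and adds a fresh
   [c h^2]. *)
have grid n i : t / n.+1%:R <= 2^-1 ->
    form_bound (cdom Q m) (i%:R * (c * (t / n.+1%:R) ^+ 2) * (1 + t / n.+1%:R * B) ^+ i)
      (D (i%:R * (t / n.+1%:R))).
  set h := t / n.+1%:R => hh; have hp : 0 <= h by rewrite divr_ge0.
  have q1 : 1 <= 1 + h * B by rewrite lerDl mulr_ge0.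
  have ch : 0 <= c * h ^+ 2 by rewrite mulr_ge0 ?sqr_ge0.
  elim: i => [|i [IH0 IH]].
    split=> [|x y _ _]; first by rewrite !mul0r.
    by rewrite !mul0r DE YZ0 subrr cmod0.
  have ih0 : 0 <= i%:R * h by rewrite mulr_ge0.
  have [_ hL] := lindbladian_bound (sD _ ih0) (conj IH0 IH).
  split=> [|x y Wx Wy]; first by rewrite !mulr_ge0// exprn_ge0// (le_trans ler01).
  have e : i.+1%:R * h - i%:R * h = h by rewrite -natr1; ring.
  have := hD x y (i%:R * h) (i.+1%:R * h) Wx Wy ih0; rewrite e -subr_ge0 e => /(_ hp).
  rewrite -[i.+1%:R * h](subrK (i%:R * h)) e addrC lerD2l => /(_ hh) hd.
  have {IH}IH := IH x y Wx Wy; have {hL}hL := hL x y Wx Wy.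
  set nn := hnorm x * hnorm y in hd IH hL *; have nn0 : 0 <= nn by rewrite mulr_ge0 ?hnorm_ge0.
  set M := i%:R * _ * _ in IH hL IH0 *.
  set a := D _ x y in hd *; set b := D _ x y in hd IH *; set l := L _ x y in hd hL.
  rewrite (_ : a = (a - b - h%:C * l) + (b + h%:C * l)); last by ring.
  rewrite (le_trans (cmodD _ _))//.
  have h3 : cmod (b + h%:C * l) <= M * nn + h * (M * B * nn).
    rewrite (le_trans (cmodD _ _))// lerD// cmodM cmod_real ger0_norm// ler_wpM2l//.
  rewrite (le_trans (lerD hd h3))//.
  have -> : c * h ^+ 2 * nn + (M * nn + h * (M * B * nn)) = (c * h ^+ 2 + M * (1 + h * B)) * nn by ring.
  rewrite ler_wpM2r// /M -mulrA -exprSr -[i.+1%:R]natr1.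
  move: (c * h ^+ 2) ch (exprn_ege1 i.+1 q1) => x0 ch0 hq.
  by rewrite [(_ + 1) * x0]mulrDl mul1r mulrDl [leLHS]addrC lerD2l ler_peMr.
apply: eq_by_cmod => e e0; rewrite -DE.
pose A := t ^+ 2 * c * expR (t * B) * (hnorm u * hnorm v) + 1.
have A0 : 0 < A by rewrite ltr_wpDl// !mulr_ge0 ?sqr_ge0 ?expR_ge0 ?hnorm_ge0.
have [n1 hn1] := inv_succ_lt (divr_gt0 e0 A0).
have t1 : 0 < 2 * t + 1 by rewrite ltr_wpDl// mulr_ge0.
have [n2 hn2] := inv_succ_lt (divr_gt0 (@ltr01 R) t1).
pose n := maxn n1 n2; have {hn1} := hn1 n (leq_maxl _ _); have {hn2} := hn2 n (leq_maxr _ _).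
rewrite !ltr_pdivlMr// => h2' h1'.
have n0 : 0 < (n.+1%:R : R) by [].
have hh : t / n.+1%:R <= 2^-1.
  rewrite mulrC; move: h2'; move: (n.+1%:R^-1 : R) (invr_gt0 (n.+1%:R : R)); rewrite n0 => x x0 h; nra.
have [_ hg] := grid n n.+1 hh.
have {hg} := hg u v Wu0 Wv0; rewrite mulrC divfK ?pnatr_eq0// => hg; apply: le_trans hg _.
have E := exp_step_bound n.+1 (mulr_ge0 (divr_ge0 t0 (ltW n0)) B0).
rewrite [_ * (_ * B)]mulrA [_ * (t / _)]mulrC divfK ?pnatr_eq0// in E.
apply: le_trans (ltW h1'); rewrite /A.
have nz : (n.+1%:R : R) != 0 by rewrite pnatr_eq0.
rewrite (_ : n.+1%:R * (c * (t / n.+1%:R) ^+ 2) = n.+1%:R^-1 * (t ^+ 2 * c)); last by move: (n.+1%:R : R) nz => x nz; field.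
set q := (1 + _) ^+ _ in E *; set EE := expR _ in E *; set nn := hnorm u * hnorm v.
have tc : 0 <= t ^+ 2 * c by rewrite mulr_ge0 ?sqr_ge0.
have hq : t ^+ 2 * c * q * nn <= t ^+ 2 * c * EE * nn + 1.
  by rewrite ler_wpDr// ler_wpM2r ?mulr_ge0 ?hnorm_ge0// ler_wpM2l.
rewrite (_ : _ * nn = n.+1%:R^-1 * (t ^+ 2 * c * q * nn)); last by rewrite !mulrA.
by apply: ler_wpM2l => //; rewrite invr_ge0.
Qed.
End Flow.

Lemma ReB' (R : realType) (z w : R[i]) : complex.Re (z - w) = complex.Re z - complex.Re w.
Proof. by rewrite ReD ReN. Qed.

Lemma ImB' (R : realType) (z w : R[i]) : complex.Im (z - w) = complex.Im z - complex.Im w.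
Proof. by rewrite ImD ImN. Qed.

Section BoundedFlow.
Variables (R : realType) (H : hilbert R) (Q : coupling H).
Implicit Types (m : nat) (s t c : R) (u v : H) (X : H -> H).
Local Notation C := (cop Q).
Local Notation Cd := (cadj Q).
Local Notation L := (gram_generator C Cd 0 0).
Local Notation TR := (measurableTypeR R).

Variables (Y : R -> H -> H) (B : R).
Hypothesis B0 : 0 <= B.
Hypothesis lY : forall t, 0 <= t -> linear (Y t).
Hypothesis bY : forall t, 0 <= t -> forall u v, cmod ⟨u, Y t v⟩ <= B * (hnorm u * hnorm v).

Lemma flow_generator_bound m s u v : 0 <= s -> cdom Q m u -> cdom Q m v ->
  cmod (L (op_form (Y s)) u v) <= B * lind_rate Q m * (hnorm u * hnorm v).
Proof.
move=> s0 Wu Wv; have sY := op_form_sesq (cdom Q m) (lY s0).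
have [|_ h] := @lindbladian_bound R H Q m _ B sY; first by split=> // x y _ _; exact: bY.
exact: h.
Qed.

Definition flow_lip m c := 0 <= c /\ forall u v, cdom Q m u -> cdom Q m v ->
  forall s t, 0 <= s -> s <= t -> cmod (⟨u, Y t v⟩ - ⟨u, Y s v⟩) <= c * (hnorm u * hnorm v) * (t - s).

Lemma flow_generator_lip m c s t u v : flow_lip m c -> 0 <= s -> s <= t -> cdom Q m u -> cdom Q m v ->
  cmod (L (op_form (Y t)) u v - L (op_form (Y s)) u v) <=
  c * lind_rate Q m * (hnorm u * hnorm v) * (t - s).
Proof.
move=> [c0 hc] s0 st Wu Wv; have t0 := le_trans s0 st.
have ts0 : 0 <= t - s by rewrite subr_ge0.
pose D := form_comb (-1) (op_form (Y s)) (op_form (Y t)).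
have sD : sesquilinear_on (cdom Q m) D by apply: sesquilinear_comb; apply: op_form_sesq; exact: lY.
have bD : form_bound (cdom Q m) (c * (t - s)) D.
  split=> [|x y Wx Wy]; first exact: mulr_ge0.
  rewrite /D /form_comb mulN1r addrC (le_trans (hc x y Wx Wy s t s0 st))//.
  by rewrite mulrAC.
have [_ h] := lindbladian_bound sD bD; have := h u v Wu Wv.
rewrite /D lindbladian_comb mulN1r addrC => /le_trans; apply.
by rewrite le_eqVlt; apply/orP; left; apply/eqP; ring.
Qed.

(** A Lipschitz flow has a Lipschitz generator term, so on [[s, t[] the integrand differs from its
    value at [s] by a multiple of [t - s], which is a second-order error after integration. *)
Lemma lipschitz_flow : (forall m, exists c, flow_lip m c) ->
  (forall u v s t, core Q u -> core Q v -> 0 <= s -> s <= t ->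
     cintegrable `[s, t[%classic (fun s => L (op_form (Y s)) u v) /\
     ⟨u, Y t v⟩ - ⟨u, Y s v⟩ = cintegral `[s, t[ (fun s => L (op_form (Y s)) u v)) ->
  lindblad_flow Q Y.
Proof.
move=> hL hI m; have [c hc] := hL m; have c0 := hc.1; have r0 := (lind_euler Q m).1.
exists (2 * (c * lind_rate Q m)); split; first by rewrite !mulr_ge0.
move=> u v s t Wu Wv s0 st _; have [||ii ->] := hI u v s t _ _ s0 st; try by exists m.
have nn : 0 <= hnorm u * hnorm v by rewrite mulr_ge0 ?hnorm_ge0.
apply: le_trans (cintegral_dist s0 st ii
  (_ : forall r, _ -> _ -> _ <= c * lind_rate Q m * (hnorm u * hnorm v) * (t - s))) _.
  move=> r sr rt; apply: le_trans (flow_generator_lip hc s0 sr Wu Wv) _.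
  by rewrite ler_wpM2l ?mulr_ge0 ?hnorm_ge0// lerD2r ltW.
by rewrite le_eqVlt; apply/orP; left; apply/eqP; ring.
Qed.

Hypothesis fY : lindblad_flow Q Y.

Lemma flow_lipschitz m : exists c, flow_lip m c.
Proof.
have [c [c0 hc]] := fY m; have r0 := (lind_euler Q m).1.
exists (c + B * lind_rate Q m); split=> [|u v Wu Wv]; first by rewrite addr_ge0// mulr_ge0.
have nn : 0 <= hnorm u * hnorm v by rewrite mulr_ge0 ?hnorm_ge0.
apply: (@lipschitz_cells R (fun t => ⟨u, Y t v⟩) 2^-1) => // j s t js st tj.
have s0 : 0 <= s by apply: le_trans js; rewrite mulr_ge0.
have ts : t <= s + 2^-1 by move: tj; rewrite -natr1 mulrDl mul1r => /le_trans; apply; rewrite lerD2r.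
have {hc}hc := hc u v s t Wu Wv s0 st ts; have hg := flow_generator_bound s0 Wu Wv.
set a := ⟨u, Y t v⟩ in hc *; set b := ⟨u, Y s v⟩ in hc *; set l := L _ u v in hc hg.
rewrite (_ : a - b = (a - b - (t - s)%:C * l) + (t - s)%:C * l); last by ring.
have ts0 : 0 <= t - s by rewrite subr_ge0.
have h2 : cmod ((t - s)%:C * l) <= (t - s) * (B * lind_rate Q m * (hnorm u * hnorm v)).
  by rewrite cmodM cmod_real ger0_norm// ler_wpM2l.
have h1 : c * (t - s) ^+ 2 * (hnorm u * hnorm v) <= c * (t - s) * (hnorm u * hnorm v).
  rewrite ler_wpM2r// ler_wpM2l// expr2 ler_piMr// lerBlDr (le_trans ts)// addrC lerD2r.
  by rewrite invf_le1// ler1n.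
rewrite (le_trans (cmodD _ _))// (le_trans (lerD (le_trans hc h1) h2))//.
by rewrite le_eqVlt; apply/orP; left; apply/eqP; ring.
Qed.

Lemma flow_wcont u v : wcont (fun t => ⟨u, Y t v⟩).
Proof.
apply: wcont_approx => e e0.
pose A : R := B * (hnorm u + hnorm v + 1) + 1.
have A1 : 0 < A by rewrite ltr_wpDl// mulr_ge0// !addr_ge0 ?hnorm_ge0.
pose d := Num.min 1 (e / A); have d0 : 0 < d by rewrite lt_min ltr01 divr_gt0.
have [u' cu' hu] := @cdom_dense _ _ Q u d d0; have [v' cv' hv] := @cdom_dense _ _ Q v d d0.
have [m [Wu Wv]] := core2 cu' cv'; exists (fun t => ⟨u', Y t v'⟩).
  have [c [c0 hc]] := flow_lipschitz m; exact: (wcont_lipschitz (hc u' v' Wu Wv)).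
move=> t t0; have [d1 de] : d <= 1 /\ d <= e / A by split; rewrite ge_min lexx ?orbT.
have dA : d * A <= e by rewrite -ler_pdivlMr.
have hv' : hnorm v' <= hnorm v + 1.
  by rewrite -[v'](subrK v) addrC (le_trans (hnormD _ _))// lerD2l hnorm_distC (le_trans (ltW hv)).
rewrite (_ : ⟨u, Y t v⟩ - ⟨u', Y t v'⟩ = ⟨u, Y t (v - v')⟩ + ⟨u - u', Y t v'⟩); last first.
  by rewrite (linearmapB (lY t0)) innerBr innerBl; ring.
rewrite (le_trans (cmodD _ _))// (le_trans (lerD (bY t0 _ _) (bY t0 _ _)))//.
apply: le_trans dA; rewrite -mulrDr /A [leRHS]mulrDr [d * 1]mulr1 mulrA -[leLHS]addr0 lerD ?(ltW d0)//.
rewrite [d * B]mulrC -mulrA ler_wpM2l// !mulrDr mulr1 -addrA lerD//.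
  by rewrite mulrC ler_wpM2r ?hnorm_ge0 ?ltW.
rewrite -[X in _ <= _ + X]mulr1 -mulrDr; apply: ler_pM; rewrite ?hnorm_ge0//; exact: ltW.
Qed.

Lemma flow_generator_integrable u v t : core Q u -> core Q v -> 0 <= t ->
  cintegrable `[0, t]%classic (fun s : TR => L (op_form (Y s)) u v).
Proof.
move=> cu cv t0; have mD : measurable (`[0, t]%classic : set TR) by exact: measurable_itv.
have [m [Wu Wv]] := core2 cu cv; have [c hc] := flow_lipschitz m.
apply: (cintegrable_le mD _ _ (rintegrable_cst 0 t (B * lind_rate Q m * (hnorm u * hnorm v)))).
  apply: (cmeasurableS _ (@itv_half_line R t) (wcont_cmeas _)); first exact: measurable_half_line.
  apply: (@wcont_lipschitz _ _ (c * lind_rate Q m * (hnorm u * hnorm v))) => x y x0 xy.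
  exact: flow_generator_lip hc x0 xy Wu Wv.
by move=> s; rewrite /= in_itv /= => /andP[s0 _]; exact: flow_generator_bound.
Qed.

Lemma flow_integral u v t : core Q u -> core Q v -> 0 <= t ->
  ⟨u, Y t v⟩ = ⟨u, Y 0 v⟩ + cintegral `[0, t] (fun s => L (op_form (Y s)) u v).
Proof.
move=> cu cv t0; have [m [Wu Wv]] := core2 cu cv; have [c hc] := flow_lipschitz m.
have [c1 [c10 h1]] := fY m.
have r0 := (lind_euler Q m).1; have c0 := hc.1.
have nn : 0 <= hnorm u * hnorm v by rewrite mulr_ge0 ?hnorm_ge0.
apply: (@integral_of_local R (fun s => ⟨u, Y s v⟩) _ 2^-1
  ((c1 + c * lind_rate Q m) * (hnorm u * hnorm v)) t) => //.
  exact: flow_generator_integrable.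
move=> j s r js sr rj _; exists (L (op_form (Y s)) u v).
have s0 : 0 <= s by apply: le_trans js; rewrite mulr_ge0.
have rs : r <= s + 2^-1 by move: rj; rewrite -natr1 mulrDl mul1r => /le_trans; apply; rewrite lerD2r.
have rs0 : 0 <= r - s by rewrite subr_ge0.
split=> [|x sx xr].
  apply: le_trans (h1 u v s r Wu Wv s0 sr rs) _; rewrite mulrAC ler_wpM2r ?sqr_ge0// ler_wpM2r//.
  by rewrite lerDl mulr_ge0.
apply: le_trans (flow_generator_lip hc s0 sx Wu Wv) _; apply: ler_pM; rewrite ?subr_ge0 ?mulr_ge0 ?hnorm_ge0//.
  by rewrite ler_wpM2r// lerDr.
by rewrite lerD2r ltW.
Qed.

(** The terms are bounded by the summable [beta k] uniformly in time, so the series is a uniform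
    limit of its partial sums, each of which is continuous by [flow_wcont]. *)
Lemma flow_ultraweak : ultraweakly_continuous Y.
Proof.
move=> u v su sv; pose a k t := ⟨u k, Y t (v k)⟩.
pose beta k := B * (hnorm (u k) ^+ 2 + hnorm (v k) ^+ 2).
have hab k t : 0 <= t -> cmod (a k t) <= beta k.
  move=> t0; apply: le_trans (bY t0 _ _) _; rewrite ler_wpM2l//.
  move: (hnorm (u k)) (hnorm (v k)) (hnorm_ge0 (u k)) (hnorm_ge0 (v k)) => x y x0 y0.
  by have := sqr_ge0 (x - y); rewrite expr2 => h; nra.
have cb : cvgn (series beta).
  rewrite (_ : series beta = (fun n => B * (series (fun k => hnorm (u k) ^+ 2) n +
      series (fun k => hnorm (v k) ^+ 2) n))).
    by apply: is_cvgMr; apply: is_cvgD.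
  by apply/funext => n; rewrite /series /= -big_split /= mulr_sumr.
have part t n p : 0 <= t -> (n <= p)%N ->
    cmod (\sum_(0 <= k < p) a k t - \sum_(0 <= k < n) a k t) <= series beta p - series beta n.
  move=> t0 np; have sp (V : zmodType) (G : nat -> V) :
      \sum_(0 <= k < p) G k - \sum_(0 <= k < n) G k = \sum_(n <= k < p) G k.
    by rewrite (@big_cat_nat _ _ _ n)//= addrAC subrr add0r.
  rewrite /series /= !sp.
  by apply: le_trans (cmod_sum _ _ _) _; apply: ler_sum => k _; exact: hab.
have lim t : 0 <= t -> ccvg (fun n => \sum_(0 <= k < n) a k t) (cseries_sum (fun k => a k t)).
  move=> t0; have [l hl] := ccvg_cauchy cb (fun n p => part t n p t0).
  suff -> : cseries_sum (fun k => a k t) = l by [].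
  have key (p : R[i] -> R) : (forall z w, p (z - w) = p z - p w) -> (forall z, `|p z| <= cmod z) ->
      limn (series (fun k => p (a k t))) = p l.
    move=> pB pn; apply/cvg_lim => //; apply/cvgrPdist_lt => e e0; have [n hn] := hl e e0.
    have p0 : p 0 = 0 by rewrite -(subrr 0) pB subrr.
    have pN z : p (- z) = - p z by rewrite -[- z]add0r pB p0 sub0r.
    have pD z w : p (z + w) = p z + p w by rewrite -{1}[w]opprK pB pN opprK.
    near=> k; rewrite /series /= -(big_morph p pD p0) -pB.
    apply: le_lt_trans (pn _) _; rewrite cmod_distC.
    by apply: hn; near: k; exists n.
  by rewrite /cseries_sum !key; [case: (l) | exact: ImB' | exact: norm_Im_le | exact: ReB' | exact: norm_Re_le].
suff wc : wcont (fun t => cseries_sum (fun k => a k t)).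
  have key (p : R[i] -> R) : (forall z w, p (z - w) = p z - p w) -> (forall z, `|p z| <= cmod z) ->
      {within `[0, +oo[, continuous (fun t => p (cseries_sum (fun k => a k t)))}.
    move=> pB pn; have cp := wcont_continuous pB pn wc.
    apply: (@subspace_eq_continuous _ _ _ (fun t => p (cseries_sum (fun k => a k (Num.max 0 t))))).
      by move=> t; rewrite inE /= in_itv /= andbT => t0; rewrite max_r.
    exact: continuous_subspaceT.
  by split; apply: key; [exact: ReB' | exact: norm_Re_le | exact: ImB' | exact: norm_Im_le].
apply: wcont_approx => e e0.
have [n hn] : exists n, forall p, (n <= p)%N -> series beta p - series beta n <= e.
  have /cvgrPdist_lt /(_ (e / 2)) := cb; rewrite divr_gt0// => /(_ isT)[n _ hn].
  exists n => p np; have h1 := hn n (leqnn _); have h2 := hn p np.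
  rewrite /= in h1 h2; move: h1 h2; rewrite !ltr_norml => /andP[h1 h1'] /andP[h2 h2'].
  by move: h1 h1' h2 h2'; move: (limn _) (series beta n) (series beta p) => *; lra.
exists (fun t => \sum_(0 <= k < n) a k t) => [|t t0].
  elim: (n) => [|k IH]; first by under eq_fun do rewrite big_geq//; exact: wcont_cst.
  by under eq_fun do rewrite big_nat_recr//=; apply: wcontD => //; exact: flow_wcont.
apply: (ccvg_le (lim t t0)); exists n => p np.
by apply: le_trans (part t n p t0 np) _; exact: hn.
Unshelve. all: by end_near.
Qed.
End BoundedFlow.

(** * Uniform bounds for completely positive contractions *)

Section PositiveMaps.
Variables (R : realType) (H : hilbert R) (Phi : (H -> H) -> H -> H).
Hypothesis linPhi : op_map_linear Phi.
Hypothesis bPhi : forall X, bounded_op X -> bounded_op (Phi X).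
Hypothesis cpPhi : completely_positive Phi.
Implicit Types (X P : H -> H) (u v : H).

Lemma cp_positive X : bounded_op X -> (forall u, 0 <= ⟨u, X u⟩) -> forall u, 0 <= ⟨u, Phi X u⟩.
Proof.
move=> bX pX u; have := cpPhi (n := 1) (fun _ _ => bX); rewrite /= => /(_ _ (fun=> u)).
rewrite !big_ord1; apply=> w; rewrite !big_ord1; exact: pX.
Qed.

Lemma op_map_zero : Phi (fun=> 0) = fun=> 0.
Proof.
have b0 : bounded_op (fun=> 0 : H).
  by split=> [a u v|]; [rewrite scaler0 addr0 | exists 0 => u; rewrite hnorm0 mul0r].
have e := linPhi (-1) b0 b0; rewrite (_ : (fun _ => _) = fun=> 0 : H) in e.
  by rewrite e; apply/funext => u; rewrite scaleN1r addNr.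
by apply/funext => u; rewrite scaler0 addr0.
Qed.

Lemma op_map_scale (a : R[i]) X : bounded_op X -> Phi (fun u => a *: X u) = fun u => a *: Phi X u.
Proof.
move=> bX; have b0 : bounded_op (fun=> 0 : H).
  by split=> [b u v|]; [rewrite scaler0 addr0 | exists 0 => u; rewrite hnorm0 mul0r].
have e := linPhi a bX b0; rewrite op_map_zero in e.
rewrite (_ : (fun u => a *: X u) = (fun u => a *: X u + 0)); last by apply/funext => u; rewrite addr0.
by rewrite e; apply/funext => u; rewrite addr0.
Qed.

Hypothesis cPhi : op_le (Phi id) id.

Lemma op_map_id_le u : complex.Re ⟨u, Phi id u⟩ <= hnorm u ^+ 2.
Proof. by have := cPhi u; rewrite innerBr complex_ge0 ReD ReN subr_ge0 -hnorm_sqr => /andP[]. Qed.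

(** Positivity of the map on [M - P], with [Phi id <= id], bounds the form of [Phi P] by [M];
    Cauchy-Schwarz for that positive form passes from the diagonal to all pairs. *)
Lemma positive_map_le P (M : R) : 0 <= M -> bounded_op P ->
  (forall u, exists2 r : R, ⟨u, P u⟩ = r%:C & 0 <= r <= M * hnorm u ^+ 2) ->
  forall u v, cmod ⟨v, Phi P u⟩ <= M * (hnorm v * hnorm u).
Proof.
move=> M0 bP hP.
have pP u : 0 <= ⟨u, Phi P u⟩.
  apply: cp_positive => // w; have [r -> /andP[r0 _]] := hP w.
  by rewrite complex_ge0 /= eqxx.
have uP u : complex.Re ⟨u, Phi P u⟩ <= M * hnorm u ^+ 2.
  have bM : bounded_op (fun u : H => M%:C *: u).
    have -> : (fun u : H => M%:C *: u) = (fun u : H => (M%:C - 1) *: u + u).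
      by apply/funext => w; rewrite scalerBl scale1r subrK.
    by apply: bounded_map_lin; exact: bounded_op_id.
  have bD := bounded_map_lin (-1) bP bM.
  have := cp_positive bD; rewrite (linPhi (-1) bP bM) (op_map_scale _ (bounded_op_id H)) => h.
  have {h} /(_ _ u) h : (forall w : H, 0 <= ⟨w, (-1) *: P w + M%:C *: w⟩) -> forall w,
      0 <= ⟨w, (-1) *: Phi P w + M%:C *: Phi id w⟩ by exact: h.
  have {h} : 0 <= ⟨u, (-1) *: Phi P u + M%:C *: Phi id u⟩.
    apply: h => w; have [r e /andP[_ rM]] := hP w.
    rewrite innerDr !innerZr e inner_self complex_ge0 ReD ImD !ReM !ImM /=.
    by rewrite !(mulr0, mul0r, oppr0, addr0, subr0) eqxx /= mulN1r addrC subr_ge0.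
  rewrite complex_ge0 => /andP[_]; rewrite innerDr !innerZr ReD !ReM /= oppr0 !mul0r !subr0 mulN1r addrC subr_ge0.
  by move=> /le_trans; apply; rewrite ler_wpM2l// op_map_id_le.
move=> u v; have h := positive_cauchy_schwarz (bPhi bP).1 pP u v.
rewrite -(ler_pXn2r (ltn0Sn 1)) ?nnegrE ?cmod_ge0 ?mulr_ge0 ?hnorm_ge0//.
apply: le_trans h _; rewrite (_ : _ ^+ 2 = (M * hnorm v ^+ 2) * (M * hnorm u ^+ 2)); last by ring.
by apply: ler_pM => //; have := pP v; have := pP u; rewrite !complex_ge0 => /andP[_ ?] /andP[_ ?].
Qed.

(** With [P1 = Re X + M] and [P2 = Im X + M], both between 0 and [2 M], one has
    [X = P1 + i P2 - (1 + i) M]. Each of the three terms contributes [2 M], which explains the 6. *)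
Lemma positive_map_bound X (M : R) : 0 <= M -> bounded_op X -> (forall u, hnorm (X u) <= M * hnorm u) ->
  forall u v, cmod ⟨v, Phi X u⟩ <= 6 * M * (hnorm v * hnorm u).
Proof.
move=> M0 bX hX u v; pose Xs := op_adjoint X; have bXs : bounded_op Xs := op_adjoint_bounded bX.
have z u' : ⟨u', Xs u'⟩ = Num.conj ⟨u', X u'⟩ by rewrite -(hadjP bX) inner_conj.
have zb u' : cmod ⟨u', X u'⟩ <= M * hnorm u' ^+ 2.
  by rewrite (le_trans (inner_le _ _))// mulrC expr2 mulrA ler_wpM2r ?hnorm_ge0.
pose j : R[i] := 0 +i* 1; pose h : R[i] := (2^-1 : R)%:C.
have jj : j * j = -1 by apply: complex_eq; rewrite ?ReM ?ImM ?ReN ?ImN /=; ring.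
have hh : h * 2 = 1.
  by rewrite mulr2n mulrDr mulr1; apply: complex_eq; rewrite ?ReD ?ImD /=; field.
have bid := bounded_op_id H.
have b0 : bounded_op (fun=> 0 : H).
  by split=> [b x y|]; [rewrite scaler0 addr0 | exists 0 => x; rewrite hnorm0 mul0r].
have bZ (a : R[i]) : bounded_op (fun u : H => a *: u).
  have e := bounded_map_lin a bid b0; rewrite (_ : (fun _ => _) = fun u : H => a *: u) in e => //.
  by apply/funext => w; rewrite addr0.
pose P1 u : H := h *: X u + (h *: Xs u + M%:C *: u).
pose P2 u : H := (- j * h) *: X u + ((j * h) *: Xs u + M%:C *: u).
have bP1 : bounded_op P1 := bounded_map_lin h bX (bounded_map_lin h bXs (bZ M%:C)).
have bP2 : bounded_op P2 := bounded_map_lin (- j * h) bX (bounded_map_lin (j * h) bXs (bZ M%:C)).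
have XE : X = (fun u => 1 *: P1 u + (j *: P2 u + (- (1 + j) * M%:C) *: u)).
  apply/funext => w; apply: inner_eq => w'; rewrite /P1 /P2 !(innerDr, innerZr).
  have alg (x y w0 k g m : R[i]) : 1 * (g * x + (g * y + m * w0)) +
    (k * (- k * g * x + (k * g * y + m * w0)) + - (1 + k) * m * w0) =
    g * (1 - k * k) * x + g * (1 + k * k) * y by ring.
  by rewrite alg jj opprK subrr mulr0 mul0r addr0 (_ : 1 + 1 = 2)// hh mul1r.
have M20 : 0 <= 2 * M by rewrite mulr_ge0.
have h1 : forall u v, cmod ⟨v, Phi P1 u⟩ <= 2 * M * (hnorm v * hnorm u).
  apply: positive_map_le => // w; exists (M * hnorm w ^+ 2 + complex.Re ⟨w, X w⟩).
    rewrite /P1 !(innerDr, innerZr) z inner_self; apply: complex_eq;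
      by rewrite !(ReD, ImD, ReM, ImM, ReJ, ImJ) /=; field.
  have := le_trans (norm_Re_le _) (zb w); rewrite ler_norml.
  rewrite -[2 * M * _]mulrA; move: (M * _) (complex.Re _) => p q /andP[p1 p2]; apply/andP; split; lra.
have h2 : forall u v, cmod ⟨v, Phi P2 u⟩ <= 2 * M * (hnorm v * hnorm u).
  apply: positive_map_le => // w; exists (M * hnorm w ^+ 2 + complex.Im ⟨w, X w⟩).
    rewrite /P2 !(innerDr, innerZr) z inner_self; apply: complex_eq;
      by rewrite !(ReD, ImD, ReM, ImM, ReN, ImN, ReJ, ImJ) /=; field.
  have := le_trans (norm_Im_le _) (zb w); rewrite ler_norml.
  rewrite -[2 * M * _]mulrA; move: (M * _) (complex.Im _) => p q /andP[p1 p2]; apply/andP; split; lra.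
have h3 : cmod ⟨v, Phi id u⟩ <= 1 * (hnorm v * hnorm u).
  apply: positive_map_le => // w; exists (hnorm w ^+ 2); first by rewrite inner_self.
  by rewrite mul1r lexx sqr_ge0.
have e3 := op_map_scale (- (1 + j) * M%:C) bid.
have e2 := linPhi j bP2 (bZ (- (1 + j) * M%:C)).
have e1 := linPhi 1 bP1 (bounded_map_lin j bP2 (bZ (- (1 + j) * M%:C))).
rewrite [X in Phi X u]XE e1 e2 e3 scale1r !innerDr !innerZr.
have cj : cmod j = 1 by rewrite /cmod normc_def /= expr0n expr1n add0r sqrtr1.
have cj2 : cmod (- (1 + j) * M%:C) <= 2 * M.
  rewrite cmodM cmodN cmod_real ger0_norm// ler_wpM2r// (le_trans (cmodD _ _))// cj cmod1.
  by [].
have h1' := h1 u v; have h2' := h2 u v.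
rewrite (le_trans (cmodD _ _))// (_ : 6 * M * _ = 2 * M * (hnorm v * hnorm u) +
  (2 * M * (hnorm v * hnorm u) + 2 * M * (1 * (hnorm v * hnorm u)))); last by ring.
rewrite lerD// (le_trans (cmodD _ _))// lerD//; first by rewrite cmodM cj mul1r.
by rewrite cmodM; apply: ler_pM; rewrite ?cmod_ge0.
Qed.
End PositiveMaps.

(** * Compressions of ampliations by an isometry *)

Section Compression.
Variables (R : realType) (H F : hilbert R) (K : hilbert_tensor H F) (V : H -> K).
Hypothesis lV : linear V.
Hypothesis iV : forall u v, ⟨V u, V v⟩ = ⟨u, v⟩.
Local Notation ampl := (ampliation (K := K)).
Implicit Types (X Y : H -> H) (u v : H).

(** The Stinespring form of a completely positive map. Positivity and normality are inherited from
    the ampliation, and the identity is preserved because [V] is isometric. *)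
Definition compression X : H -> H := hadj V \o ampl X \o V.
Local Notation Phi := compression.

Let bV : bounded_map V := isometry_bounded lV iV.

Lemma compression_inner X u v : ⟨u, Phi X v⟩ = ⟨V u, ampl X (V v)⟩.
Proof. exact: (hadjPr bV). Qed.

Lemma compression_bounded X : bounded_op X -> bounded_op (Phi X).
Proof.
move=> bX; apply: bounded_map_comp => //; apply: bounded_map_comp; last exact: ampliation_bounded.
exact: hadj_bounded.
Qed.

Lemma compression_linear : op_map_linear Phi.
Proof.
move=> a X Y bX bY; apply/funext => v; apply: inner_eq => u.
by rewrite innerDr innerZr !compression_inner (ampliation_lin K a bX bY) innerDr innerZr.
Qed.

Lemma compression_cp : completely_positive Phi.
Proof.
move=> n X bX pX u; have h := ampliation_positive (K := K) bX pX (fun i => V (u i)).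
by under eq_bigr => i _ do under eq_bigr => j _ do rewrite compression_inner.
Qed.

Lemma compression_id : Phi id = id.
Proof.
apply/funext => v; apply: inner_eq => u.
by rewrite compression_inner (ampliation_id K) iV.
Qed.

Lemma compression_normal : normal_map Phi.
Proof.
move=> D X D0 pD dD sX; have [bX uX lX] := sX.
have sub Y u : D Y -> ⟨u, Phi X u - Phi Y u⟩ = ⟨V u, ampl X (V u) - ampl Y (V u)⟩.
  by move=> DY; rewrite !innerBr !compression_inner.
have le Y : D Y -> op_le (Phi Y) (Phi X).
  move=> DY u; have bY := (pD Y DY).1; have bXY := bounded_map_lin (-1) bY bX.
  have h : 0 <= ⟨u, Phi (fun w => (-1) *: Y w + X w) u⟩.
    apply: (cp_positive compression_cp bXY) => w; rewrite scaleN1r addrC; exact: (uX Y DY w).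
  by rewrite (compression_linear (-1) bY bX) scaleN1r addrC in h.
split; first exact: compression_bounded.
  by move=> _ [Y DY <-]; exact: le.
move=> Z bZ hZ u; apply: complex_ge0_closed => e e0.
have [Y DY hY] := ampliation_sup D0 pD dD sX (V u) e0.
exists ⟨u, Z u - Phi Y u⟩; first by apply: hZ; exists Y.
have -> : ⟨u, Z u - Phi Y u⟩ - ⟨u, Z u - Phi X u⟩ = ⟨u, Phi X u - Phi Y u⟩.
  by rewrite !innerBr; ring.
have := le Y DY u; rewrite complex_ge0 => /andP[/eqP i0 r0].
rewrite (le_trans (cmod_le_ReIm _))// i0 normr0 addr0 ger0_norm// sub//.
Qed.
End Compression.

Section VacuumIsometry.
Variables (R : realType) (H : hilbert R) (F : fock R) (K : hilbert_tensor H F) (Q : coupling H).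
Implicit Types (m : nat) (s t c : R) (u v : H) (X : H -> H) (x y : K).
Local Notation U := (evolution K Q false).
Local Notation C := (cop Q).
Local Notation Cd := (cadj Q).
Local Notation L := (gram_generator C Cd 0 0).
Local Notation TR := (measurableTypeR R).

Definition vacuum_vec u : K := tensor K u (exp_vec F (fun=> 0)).

Lemma vacuum_linear : linear vacuum_vec.
Proof. by move=> a u v; rewrite /vacuum_vec tensorDl tensorZl. Qed.

Lemma vacuum_inner u v : ⟨vacuum_vec u, vacuum_vec v⟩ = ⟨u, v⟩.
Proof.
have L0 : L2 (fun=> 0 : R[i]) := is_step_L2 (is_step0 R).
rewrite /vacuum_vec tensor_inner exp_vec_inner// (_ : L2_inner _ _ = 0) ?cexp0 ?mulr1//.
rewrite /L2_inner (_ : (fun _ => _) = fun=> 0 : R[i]); last by apply/funext => s; rewrite mulr0.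
by rewrite /cintegral /Rintegral !integral0.
Qed.

Definition vacuum_evolution t := U t \o vacuum_vec.

Lemma vacuum_evolution_linear t : 0 <= t -> linear (vacuum_evolution t).
Proof.
move=> t0; have [lU _ _] := evolutionP K Q false t0 => a u v.
by rewrite /vacuum_evolution /= vacuum_linear (linearmapD lU) (linearmapZ lU).
Qed.

Lemma vacuum_evolution_inner t u v : 0 <= t ->
  ⟨vacuum_evolution t u, vacuum_evolution t v⟩ = ⟨u, v⟩.
Proof. by move=> t0; have [_ iU _] := evolutionP K Q false t0; rewrite iU vacuum_inner. Qed.

Definition semigroup t : (H -> H) -> H -> H := compression (vacuum_evolution t).

Section Fixed.
Variable t : R.
Hypothesis t0 : 0 <= t.
Let lV := vacuum_evolution_linear t0.
Let iV u v := vacuum_evolution_inner u v t0.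

Lemma semigroup_bounded X : bounded_op X -> bounded_op (semigroup t X).
Proof. exact: (compression_bounded lV iV). Qed.
Lemma semigroup_linear : op_map_linear (semigroup t).
Proof. exact: (compression_linear lV iV). Qed.
Lemma semigroup_cp : completely_positive (semigroup t).
Proof. exact: (compression_cp lV iV). Qed.
Lemma semigroup_normal : normal_map (semigroup t).
Proof. exact: (compression_normal lV iV). Qed.
Lemma semigroup_id : semigroup t id = id.
Proof. exact: (compression_id lV iV). Qed.
Lemma semigroup_inner X u v : ⟨u, semigroup t X v⟩ = semigroup_form K Q X t u v.
Proof. exact: (compression_inner lV iV). Qed.
End Fixed.

Lemma op_le_refl X : op_le X X.
Proof. by move=> u; rewrite subrr inner0r. Qed.

Lemma semigroup_flow X : bounded_op X -> lindblad_flow Q (fun t => semigroup t X).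
Proof.
move=> bX m; have [c [c0 hc]] := semigroup_local K Q m bX; exists c; split=> // u v s t Wu Wv s0 st ts.
have t0 := le_trans s0 st.
rewrite !semigroup_inner// (_ : op_form (semigroup s X) = semigroup_form K Q X s); first exact: hc.
by apply/funext => x; apply/funext => y; rewrite /op_form semigroup_inner.
Qed.

Lemma evolution_zero : U 0 = id.
Proof.
have [lU iU _] := evolutionP K Q false (lexx 0).
apply: (bounded_map_eq (core_exp_dense K Q)); [exact: isometry_bounded | exact: bounded_op_id |].
by move=> [[v cv] [g sg]] /=; exact: evolution0.
Qed.

Lemma semigroup0 X : bounded_op X -> semigroup 0 X = X.
Proof.
move=> bX; apply/funext => v; apply: inner_eq => u.
rewrite semigroup_inner// /semigroup_form evolution_zero /= ampliationE//.
exact: vacuum_inner.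
Qed.

(** For fixed [t], both sides are Lindblad flows in [s] that start from [semigroup t X], so
    [flow_unique] identifies them; no cocycle identity for the evolution is involved. *)
Lemma semigroup_law s t X : 0 <= s -> 0 <= t -> bounded_op X ->
  semigroup (s + t) X = semigroup s (semigroup t X).
Proof.
move=> s0 t0 bX; have bT := semigroup_bounded t0 bX.
apply: (@flow_unique R H Q (fun s => semigroup (s + t) X) (fun s => semigroup s (semigroup t X))) => //.
- by move=> r r0; apply: semigroup_bounded => //; rewrite addr_ge0.
- by move=> r r0; exact: semigroup_bounded.
- move=> m; have [c [c0 hc]] := semigroup_flow bX m; exists c; split=> // u v r p Wu Wv r0 rp pr.
  have := hc u v (r + t) (p + t) Wu Wv; rewrite (_ : p + t - (r + t) = p - r); last by ring.
  apply.
  - by rewrite addr_ge0.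
  - by rewrite lerD2r.
  by rewrite addrAC lerD2r.
- exact: semigroup_flow.
by move=> v; rewrite add0r semigroup0.
Qed.
End VacuumIsometry.

Section UniformBound.
Variables (R : realType) (H : hilbert R) (T : R -> (H -> H) -> H -> H).
Hypothesis linT : forall t, 0 <= t -> op_map_linear (T t).
Hypothesis bT : forall t, 0 <= t -> forall X, bounded_op X -> bounded_op (T t X).
Hypothesis cpT : forall t, 0 <= t -> completely_positive (T t).
Hypothesis cT : forall t, 0 <= t -> op_le (T t id) id.

Lemma qds_uniform X : bounded_op X -> exists2 B : R, 0 <= B &
  forall t, 0 <= t -> forall u v, cmod ⟨u, T t X v⟩ <= B * (hnorm u * hnorm v).
Proof.
move=> bX; have [M M0 hM] := bounded_map_nneg bX; exists (6 * M); first by rewrite mulr_ge0.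
move=> t t0 u v; exact: (positive_map_bound (linT t0) (bT t0) (cpT t0) (cT t0)).
Qed.
End UniformBound.

Lemma semigroup_qds (R : realType) (H : hilbert R) (F : fock R) (K : hilbert_tensor H F)
  (Q : coupling H) : qds (semigroup K Q).
Proof.
have cT t : 0 <= t -> op_le (semigroup K Q t id) id by move=> t0; rewrite semigroup_id//; exact: op_le_refl.
split=> //.
- by move=> t t0 X; exact: semigroup_bounded.
- by move=> t t0; exact: semigroup_linear.
- by move=> t t0; exact: semigroup_cp.
- by move=> t t0; exact: semigroup_normal.
- by move=> X; exact: semigroup0.
- by move=> s t s0 t0 X; exact: semigroup_law.
move=> X bX.
have [B B0 hB] := @qds_uniform R H (semigroup K Q) (@semigroup_linear R H F K Q)
  (@semigroup_bounded R H F K Q) (@semigroup_cp R H F K Q) cT X bX.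
have lT t : 0 <= t -> linear (semigroup K Q t X) by move=> t0; exact: (semigroup_bounded K Q t0 bX).1.
have fT : lindblad_flow Q (fun t => semigroup K Q t X) by exact: semigroup_flow.
by move=> u v; exact: (flow_ultraweak B0 lT hB fT).
Qed.

(** * Arbitrary solutions of the integral equation are flows *)

Section Uniqueness.
Variables (R : realType) (H : hilbert R) (Q : coupling H).
Implicit Types (m : nat) (s t c : R) (u v : H) (X : H -> H) (Y : R -> H -> H).
Local Notation C := (cop Q).
Local Notation Cd := (cadj Q).
Local Notation L := (gram_generator C Cd 0 0).
Local Notation TR := (measurableTypeR R).

Lemma single_series_cvg (a : nat -> R) : (forall k, k != 0%N -> a k = 0) -> series a @ \oo --> a 0%N.
Proof.
move=> h; apply: cvg_near_cst; near=> n; rewrite /series /=.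
have n0 : (0 < n)%N by near: n; exists 1%N.
rewrite big_ltn// big_nat big1 ?addr0// => k /andP[k0 _]; apply: h; by rewrite -lt0n.
Unshelve. all: by end_near.
Qed.

(** Ultraweak continuity applied to sequences concentrated at index 0 is continuity of a single
    matrix element, and this gives measurability. *)
Lemma ultraweak_cmeas Y u v : ultraweakly_continuous Y -> cmeas (@half_line R) (fun t : TR => ⟨u, Y t v⟩).
Proof.
move=> h; pose e (w : H) k := if k == 0%N then w else 0.
have z w k : k != 0%N -> hnorm (e w k) ^+ 2 = 0.
  by rewrite /e => /negbTE ->; rewrite hnorm0 expr0n.
have ce w : cvgn (series (fun k => hnorm (e w k) ^+ 2)).
  by apply/cvg_ex; exists (hnorm (e w 0%N) ^+ 2); apply: single_series_cvg => k; exact: z.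
have [hr hi] := h (e u) (e v) (ce u) (ce v).
have E t : cseries_sum (fun k => ⟨e u k, Y t (e v k)⟩) = ⟨u, Y t v⟩.
  have key (p : R[i] -> R) : p 0 = 0 -> limn (series (fun k => p ⟨e u k, Y t (e v k)⟩)) = p ⟨u, Y t v⟩.
    move=> p0; apply/cvg_lim => //; have := @single_series_cvg (fun k => p ⟨e u k, Y t (e v k)⟩).
    by apply=> k k0; rewrite /e (negbTE k0) inner0l.
  by rewrite /cseries_sum !key//; case: ⟨_, _⟩.
have mD := @measurable_half_line R.
split.
  apply: (@subspace_continuous_measurable_fun R) => //.
  by move: hr; rewrite (_ : (fun t => complex.Re (cseries_sum _)) = fun t => complex.Re ⟨u, Y t v⟩);
    last by apply/funext => t; rewrite E.
apply: (@subspace_continuous_measurable_fun R) => //.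
by move: hi; rewrite (_ : (fun t => complex.Im (cseries_sum _)) = fun t => complex.Im ⟨u, Y t v⟩);
  last by apply/funext => t; rewrite E.
Qed.

(** The uniform bound makes the integrand bounded on each level, so the integral equation first
    yields a Lipschitz estimate; [lipschitz_flow] then improves it to second order. *)
Lemma associated_flow Y (B : R) : 0 <= B -> (forall t, 0 <= t -> linear (Y t)) ->
  (forall t, 0 <= t -> forall u v, cmod ⟨u, Y t v⟩ <= B * (hnorm u * hnorm v)) ->
  ultraweakly_continuous Y ->
  (forall u v t, core Q u -> core Q v -> 0 <= t ->
    ⟨u, Y t v⟩ = ⟨u, Y 0 v⟩ + cintegral `[0, t] (fun s => L (op_form (Y s)) u v)) ->
  lindblad_flow Q Y.
Proof.
move=> B0 lY bY cY hY.
have int u v t : core Q u -> core Q v -> 0 <= t ->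
    cintegrable `[0, t]%classic (fun s : TR => L (op_form (Y s)) u v).
  move=> cu cv t0; have [m [Wu Wv]] := core2 cu cv.
  have mD : measurable (`[0, t]%classic : set TR) by exact: measurable_itv.
  apply: (cintegrable_le mD _ _ (rintegrable_cst 0 t (B * lind_rate Q m * (hnorm u * hnorm v)))).
    apply: (cmeasurableS _ (@itv_half_line R t) _); first exact: measurable_half_line.
    under eq_fun do rewrite lindbladian_form.
    by apply: cmeasurableD; [apply: cmeasurableD |]; exact: ultraweak_cmeas.
  by move=> s; rewrite /= in_itv /= => /andP[s0 _]; exact: (flow_generator_bound B0 lY bY s0).
have dif u v s t : core Q u -> core Q v -> 0 <= s -> s <= t ->
     cintegrable `[s, t[%classic (fun s => L (op_form (Y s)) u v) /\
     ⟨u, Y t v⟩ - ⟨u, Y s v⟩ = cintegral `[s, t[ (fun s => L (op_form (Y s)) u v).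
  move=> cu cv s0 st; have t0 := le_trans s0 st; have it := int u v t cu cv t0; split.
    apply: (cintegrableS _ _ _ it); try exact: measurable_itv.
    by move=> x; rewrite /= !in_itv /= => /andP[sx /ltW->]; rewrite (le_trans s0 sx).
  rewrite (hY u v t)// (hY u v s)// (cintegral_split s0 st it).
  by rewrite opprD addrACA subrr add0r addrC addrA addNr add0r.
apply: (lipschitz_flow lY) => // m.
have r0 := (lind_euler Q m).1.
exists (2 * (B * lind_rate Q m)); split=> [|u v Wu Wv s t s0 st]; first by rewrite !mulr_ge0.
have [||ii ->] := dif u v s t _ _ s0 st; try by exists m.
have h := @cintegral_dist R _ s t 0 (B * lind_rate Q m * (hnorm u * hnorm v)) s0 st ii.
rewrite mulr0 subr0 in h; apply: le_trans (h _) _.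
  by move=> r sr _; rewrite subr0; exact: (flow_generator_bound B0 lY bY (le_trans s0 sr)).
by rewrite !mulrA.
Qed.
End Uniqueness.

Section UnitaryConjugation.
Variables (R : realType) (H : hilbert R) (F : fock R) (K : hilbert_tensor H F) (U : R -> K -> K).
Hypothesis uU : forall t, 0 <= t -> unitary_op (U t).

Lemma conjugation_homomorphisms : star_homomorphisms (conjugation (K := K) U).
Proof.
move=> t t0; have [lU iU sU] := uU t0; have bU := isometry_bounded lU iU.
have lUs : linear (op_adjoint (U t)) := (hadj_bounded bU).1.
have UsU x : op_adjoint (U t) (U t x) = x.
  by apply: inner_eq => w; rewrite [LHS](hadjPr bU) iU.
have UUs x : U t (op_adjoint (U t) x) = x.
  by have [y <-] := sU x; rewrite UsU.
have bJ X : bounded_op X -> bounded_op (conjugation U t X).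
  move=> bX; apply: (@bounded_map_comp _ _ _ _ (op_adjoint (U t)) (ampliation X \o U t)).
    exact: hadj_bounded.
  by apply: bounded_map_comp => //; exact: ampliation_bounded.
split=> //.
- by apply/funext => x; rewrite /conjugation (ampliation_id K) UsU.
- move=> a X Y bX bY; apply/funext => x; rewrite /conjugation (ampliation_lin K a bX bY).
  by rewrite (linearmapD lUs) (linearmapZ lUs).
- move=> X Y bX bY; apply/funext => x; rewrite /conjugation /= (ampliation_comp K bX bY) /=.
  by rewrite UUs.
move=> X bX; apply/esym; apply: hadjE => x y; rewrite /conjugation (ampliation_adjoint K bX).
by rewrite (hadjP bU) [LHS](hadjP (ampliation_bounded K bX)) [RHS](hadjPr bU).
Qed.
End UnitaryConjugation.

(** * The theorem for an abstract coupling *)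

Section Solution.
Variables (R : realType) (H : hilbert R) (F : fock R) (K : hilbert_tensor H F) (Q : coupling H).
Variables (D : set H) (G Cc Ca : set (H * H)).
Hypothesis DE : forall v, D v <-> core Q v.
Hypothesis GE : forall v, core Q v -> gdom G v /\ gval G v = gen_op (cop Q) (cadj Q) v.
Hypothesis CE : forall v, core Q v -> gdom Cc v /\ gval Cc v = cop Q v.
Hypothesis CaE : forall v, core Q v -> gdom Ca v /\ gval Ca v = cadj Q v.
Local Notation U := (evolution K Q false).
Local Notation L := (lindbladian G Cc).

Lemma solution_unitary : unitary_solution D G Cc Ca U.
Proof.
split; first by move=> t t0; exact: evolution_unitary.
  exact: evolution_adapted.
split=> [v /DE cv|u v f g /DE cv /L2P Lf /L2P Lg t t0].
  by split; [split; [exact: (GE cv).1 | exact: (CE cv).1] | exact: (CaE cv).1].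
have h := hp_L2 K u Lf Lg cv t0; move: h; rewrite /hp_defect.
rewrite (_ : (fun s => _) = hp_integrand Q f g (tensor K u (exp_vec F f)) (gen_op (cop Q) (cadj Q) v)
  (cop Q v) (cadj Q v)); last first.
  by apply/funext => s; rewrite /hp_integrand (GE cv).2 (CE cv).2 (CaE cv).2.
move: (cintegral _ _) => I /eqP; rewrite subr_eq0 subr_eq addrC => /eqP.
exact.
Qed.

Lemma lindbladianE X u v : core Q u -> core Q v ->
  L X u v = gram_generator (cop Q) (cadj Q) 0 0 (op_form X) u v.
Proof.
by move=> cu cv; rewrite lindbladian_form /lindbladian !(GE _).2 ?(CE _).2.
Qed.

Lemma solution_expectation : expectation_semigroup (conjugation U) (semigroup K Q).
Proof.
move=> t t0 X bX u v; have [lU iU _] := evolutionP K Q false t0.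
by rewrite semigroup_inner// /conjugation [RHS](hadjPr (isometry_bounded lU iU)).
Qed.

Lemma solution_id_le t : 0 <= t -> op_le (semigroup K Q t id) id.
Proof. by move=> t0; rewrite semigroup_id//; exact: op_le_refl. Qed.

Lemma solution_associated : associated D L (semigroup K Q).
Proof.
move=> u v /DE cu /DE cv X bX t t0.
have [B B0 hB] := @qds_uniform R H (semigroup K Q) (@semigroup_linear R H F K Q)
  (@semigroup_bounded R H F K Q) (@semigroup_cp R H F K Q) solution_id_le X bX.
have lT s : 0 <= s -> linear (semigroup K Q s X) by move=> s0; exact: (semigroup_bounded K Q s0 bX).1.
have fT : lindblad_flow Q (fun t => semigroup K Q t X) by exact: semigroup_flow.
rewrite (flow_integral B0 lT hB fT cu cv t0).
rewrite semigroup0//; congr (_ + cintegral _ _).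
by apply/funext => s; rewrite lindbladianE.
Qed.

Lemma solution_unique : unique_semigroup D L (semigroup K Q).
Proof.
move=> T [bT linT cpT _ cT T0 _ wT] aT t t0 X bX.
have [B B0 hB] := qds_uniform linT bT cpT cT bX.
apply: (@flow_unique R H Q (fun t => T t X) (fun t => semigroup K Q t X)) => //.
- by move=> s s0; exact: bT.
- by move=> s s0; exact: semigroup_bounded.
- apply: (@associated_flow R H Q (fun t => T t X) B B0 _ hB).
  + by move=> s s0; exact: (bT s s0 X bX).1.
  + exact: wT.
  move=> u v s cu cv s0; rewrite (aT u v ((DE u).2 cu) ((DE v).2 cv) X bX s s0) T0//.
  congr (_ + cintegral _ _); apply/funext => r; exact: lindbladianE.
- exact: semigroup_flow.
by move=> v; rewrite T0// semigroup0.
Qed.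

Lemma coupling_solution : exists V : R -> K -> K,
  unitary_solution D G Cc Ca V /\ star_homomorphisms (conjugation V) /\
  exists T : R -> (H -> H) -> H -> H,
    [/\ expectation_semigroup (conjugation V) T, qds T /\ associated D L T,
        minimal_semigroup D L T, unique_semigroup D L T & conservative T].
Proof.
exists U; split; first exact: solution_unitary.
split; first by apply: conjugation_homomorphisms => t t0; exact: evolution_unitary.
exists (semigroup K Q); split.
- exact: solution_expectation.
- by split; [exact: semigroup_qds | exact: solution_associated].
- move=> T qT aT t t0 X bX _; rewrite (solution_unique qT aT t0 bX); exact: op_le_refl.
- exact: solution_unique.
by move=> t t0; exact: semigroup_id.
Qed.
End Solution.

(** * C*-algebras and the commutator derivation *)

Section CStar.
Variables (R : realType) (A : cstar_algebra R).
Implicit Types (x y h a b : A) (c : R[i]).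
Local Notation "'N x" := (cnorm x) (at level 8, x at level 7).
Local Notation st := (@star R A).

Lemma starD x y : st (x + y) = st x + st y.
Proof. by have := star_antilinear 1 x y; rewrite !scale1r rmorph1 scale1r. Qed.

Lemma star0 : st 0 = 0.
Proof. by have := starD 0 0; rewrite addr0 -{1}[st 0]addr0 => /addrI/esym. Qed.

Lemma starZ c x : st (c *: x) = Num.conj c *: st x.
Proof. by have := star_antilinear c x 0; rewrite star0 !addr0. Qed.

Lemma starN x : st (- x) = - st x.
Proof. by rewrite -scaleN1r starZ rmorphN rmorph1 scaleN1r. Qed.

Lemma star1 : st 1 = 1.
Proof. by rewrite -[RHS](@star_involutive R A) -[st 1]mul1r star_mul star_involutive mul1r. Qed.

Lemma cnorm0 : 'N (0 : A) = 0.
Proof. by rewrite -(scale0r 0) cnorm_scale cmod0 mul0r. Qed.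

Lemma cnormN x : 'N (- x) = 'N x.
Proof. by rewrite -scaleN1r cnorm_scale cmodN cmod1 mul1r. Qed.

Lemma cnorm_ge0 x : 0 <= 'N x.
Proof. by have := cnorm_triangle x (- x); rewrite subrr cnorm0 cnormN -mulr2n pmulrn_lge0. Qed.

Lemma cnorm_star x : 'N (st x) = 'N x.
Proof.
have le y : 'N y <= 'N (st y).
  have := cnorm_mul (st y) y; rewrite cnorm_cstar expr2.
  have [->|y0] := eqVneq ('N y) 0; first by rewrite cnorm_ge0.
  by rewrite ler_pM2r// lt_def y0 cnorm_ge0.
by apply/eqP; rewrite eq_le le andbT -{2}[x](@star_involutive R A) le.
Qed.

(* A square root of 1 - h is 1 - y for the fixed point y of y |-> (h + y^2) / 2,
   which contracts the ball of radius 1/2. *)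
Lemma one_minus_square h : st h = h -> 'N h <= 2^-1 ->
  exists y, st y = y /\ 1 - h = st (1 - y) * (1 - y).
Proof.
move=> sh nh; pose f y := (2^-1 : R)%:C *: (h + y * y); pose u n := iter n f 0.
have c2 : cmod ((2^-1 : R)%:C) = 2^-1 by rewrite cmod_real ger0_norm.
have nf y : 'N y <= 2^-1 -> 'N (f y) <= 2^-1.
  move=> ny; rewrite cnorm_scale c2 ler_piMr ?invr_ge0// (le_trans (cnorm_triangle _ _))//.
  have := cnorm_mul y y; have := cnorm_ge0 y; move: ('N y) ('N (y * y)) ('N h) ny nh => p q r *; nra.
have nu n : 'N (u n) <= 2^-1 by elim: n => [|n IH]; [rewrite cnorm0 invr_ge0 | exact: nf].
have df y z : 'N y <= 2^-1 -> 'N z <= 2^-1 -> 'N (f y - f z) <= 2^-1 * 'N (y - z).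
  move=> ny nz; rewrite -scalerBr cnorm_scale c2 ler_wpM2l ?invr_ge0//.
  (* [A] is not commutative, so the difference of the squares is split without exchanging
     factors. *)
  rewrite (_ : _ - _ = y * (y - z) + (y - z) * z); last first.
    by rewrite mulrBr mulrBl opprD addrACA subrr add0r addrA subrK.
  rewrite (le_trans (cnorm_triangle _ _))//.
  have := cnorm_mul y (y - z); have := cnorm_mul (y - z) z; have := cnorm_ge0 (y - z).
  move: ('N y) ('N z) ('N (y - z)) ('N (y * (y - z))) ('N ((y - z) * z)) ny nz => p q r s t *; nra.
have du n p : 'N (u (n + p)%N - u n) <= 2^-1 ^+ n.
  elim: n => [|n IH].
    by rewrite add0n subr0 expr0 (le_trans (nu _))// invf_le1 ?ler1n.
  by rewrite addSn exprS (le_trans (df _ _ (nu _) (nu _)))// ler_wpM2l ?invr_ge0.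
have small e : 0 < e -> exists k, forall n, (k <= n)%N -> 2^-1 ^+ n < e :> R.
  move=> e0; have [k hk] := inv_succ_lt e0; exists k => n kn; apply: le_lt_trans (hk n kn).
  rewrite exprVn lef_pV2 ?posrE ?exprn_gt0// -natrX ler_nat; exact: ltn_expl.
have [y hy] : exists y, (fun n => 'N (u n - y)) @ \oo --> (0 : R).
  apply: cnorm_complete => e e0; have [k hk] := small (e / 2) (divr_gt0 e0 (ltr0Sn _ 1)).
  exists k => m n km kn; rewrite -(subnKC km) -(subnKC kn).
  rewrite -[X in X - _](subrK (u k)) -addrA (le_lt_trans (cnorm_triangle _ _))//.
  rewrite -opprB cnormN -[X in 'N X + _]opprB cnormN.
  have h1 := le_lt_trans (du k (m - k)%N) (hk k (leqnn _)).
  have h2 := le_lt_trans (du k (n - k)%N) (hk k (leqnn _)).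
  by rewrite [e]splitr ltrD// -opprB cnormN.
have lim e : 0 < e -> exists n, 'N (u n - y) <= e /\ 'N (u n.+1 - y) <= e.
  move=> e0; move/cvgrPdist_lt: hy => /(_ e e0) [n _ hn]; exists n.
  have h1 := hn n (leqnn n); have h2 := hn n.+1 (leqnSn n).
  by rewrite /= !sub0r !normrN !ger0_norm ?cnorm_ge0// in h1 h2; split; exact: ltW.
have eq0 x (c : R) : 0 <= c -> (forall e : R, 0 < e -> 'N x <= c * e) -> x = 0.
  move=> c0 hx; apply: cnorm_eq0; apply/eqP; rewrite eq_le cnorm_ge0 andbT.
  apply: ler_eps => e e0; rewrite add0r; have c1 : 0 < c + 1 by rewrite ltr_wpDl.
  apply: le_trans (hx _ (divr_gt0 e0 c1)) _.
  by rewrite mulrA ler_pdivrMr// [e * _]mulrC ler_wpM2r ?(ltW e0)// lerDl.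
have su n : st (u n) = u n.
  elim: n => [|n IH]; first exact: star0.
  by rewrite /u /= -/(u n) starZ conj_real starD star_mul sh IH.
have sy : st y = y.
  apply/eqP; rewrite -subr_eq0; apply/eqP/(eq0 _ 2) => // e e0; have [n [hn _]] := lim e e0.
  rewrite (_ : st y - y = st (y - u n) + (u n - y)); last by rewrite starD starN su addrA subrK.
  rewrite (le_trans (cnorm_triangle _ _))// cnorm_star -opprB cnormN.
  by rewrite mulr_natl mulr2n lerD.
have ny : 'N y <= 2^-1.
  apply: ler_eps => e e0; have [n [hn _]] := lim e e0.
  rewrite -[y](subrK (u n)) addrC (le_trans (cnorm_triangle _ _))// lerD// -opprB cnormN//.
have fy : y = f y.
  apply/eqP; rewrite -subr_eq0; apply/eqP/(eq0 _ 2) => // e e0; have [n [hn hn']] := lim e e0.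
  rewrite -(subrKA (u n.+1)) (le_trans (cnorm_triangle _ _))// mulr_natl mulr2n lerD//.
    by rewrite -opprB cnormN.
  rewrite (le_trans (df _ _ (nu n) ny))// (le_trans _ hn)// ler_piMl ?cnorm_ge0//.
  by rewrite invf_le1 ?ler1n.
exists y; split=> //; rewrite starD star1 starN sy mulrBl mul1r mulrBr mulr1.
have e2 : y + y = h + y * y.
  have e : 2 * (2^-1 : R) = 1 by rewrite divff.
  rewrite -mulr2n -scaler_nat {1}fy /f scalerA (_ : 2%:R * _ = 1) ?scale1r//.
  by rewrite mulr2n mulrDl mul1r; apply: complex_eq; rewrite ?ReD ?ImD /=; lra.
by rewrite -[1 - y - _]addrA -opprD addrA e2 addrK.
Qed.
End CStar.

(** * Multiplication and commutators on the space of the trace *)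

Section Trace.
Variables (R : realType) (A : cstar_algebra R) (tr : A -> R[i]).
Hypothesis trP : normalized_trace tr.
Implicit Types (x y h a b : A) (c : R[i]).
Local Notation st := (@star R A).

Definition positive_functional (phi : A -> R[i]) :=
  (forall c x y, phi (c *: x + y) = c * phi x + phi y) /\ forall x, 0 <= phi (st x * x).

(** [h = x^* x / (2 |x|^2)] has norm 1/2, so [one_minus_square] writes [1 - h] as a product of the
    form [a^* a] and positivity gives [phi h <= phi 1]. The factor 2 reflects the radius 1/2 of the
    contraction. *)
Lemma positive_functional_le phi x : positive_functional phi ->
  complex.Re (phi (st x * x)) <= 2 * cnorm x ^+ 2 * complex.Re (phi 1).
Proof.
move=> [lphi pphi]; have [x0|x0] := eqVneq (cnorm x) 0.
  rewrite x0 (cnorm_eq0 x0) mulr0 expr0n /= mulr0 mul0r.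
  have := lphi (-1) 0 0; rewrite scaler0 addr0 mulN1r addNr => ->; exact: lexx.
have n0 : 0 < cnorm x by rewrite lt_def x0 cnorm_ge0.
pose s : R := (2 * cnorm x ^+ 2)^-1.
have s0 : 0 < s by rewrite invr_gt0 mulr_gt0 ?exprn_gt0.
have [||y [_ ey]] := @one_minus_square R A (s%:C *: (st x * x)).
- by rewrite starZ conj_real star_mul star_involutive.
- rewrite cnorm_scale cmod_real cnorm_cstar gtr0_norm// /s.
  by rewrite invfM -mulrA mulVf ?mulr1// expf_neq0.
have := pphi (1 - y); rewrite -ey.
rewrite (_ : 1 - _ = (- s%:C) *: (st x * x) + 1); last by rewrite scaleNr addrC.
rewrite lphi complex_ge0 => /andP[_].
rewrite ReD ReM ReN ImN /= oppr0 mul0r subr0 mulNr addrC subr_ge0.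
by rewrite /s mulrC ler_pdivrMr ?mulr_gt0 ?exprn_gt0// mulrC.
Qed.

Let ltr c x y : tr (c *: x + y) = c * tr x + tr y.
Proof. by case: trP => h _ _ _; exact: h. Qed.
Let ptr x : 0 <= tr (st x * x).
Proof. by case: trP => _ h _ _; exact: h. Qed.
Let ctr x y : tr (x * y) = tr (y * x).
Proof. by case: trP => _ _ _ h; exact: h. Qed.

Lemma trB x y : tr (x - y) = tr x - tr y.
Proof. by rewrite addrC -scaleN1r ltr mulN1r addrC. Qed.

Variable H : gns tr.
Local Notation g := (gns_vec H).

Lemma gnsD x y : g (x + y) = g x + g y.
Proof. exact: (linearmapD (@gns_linear _ _ _ H)). Qed.
Lemma gnsB x y : g (x - y) = g x - g y.
Proof. exact: (linearmapB (@gns_linear _ _ _ H)). Qed.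
Lemma gnsZ c x : g (c *: x) = c *: g x.
Proof. exact: (linearmapZ (@gns_linear _ _ _ H)). Qed.

Lemma gns_sqr x : hnorm (g x) ^+ 2 = complex.Re (tr (st x * x)).
Proof. by rewrite hnorm_sqr gns_inner. Qed.

Lemma gns_le x : hnorm (g x) <= 2 * cnorm x.
Proof.
apply: hnorm_le_sqr; first by rewrite mulr_ge0 ?cnorm_ge0.
rewrite gns_sqr (le_trans (positive_functional_le _ (_ : positive_functional tr)))//.
have -> : tr 1 = 1 by case: trP.
rewrite /= mulr1 exprMn ler_wpM2r ?sqr_ge0// expr2.
by move: (2 : R) (ler1n R 2) => t t1; rewrite ler_peMr// (le_trans ler01).
Qed.

(** [b |-> tr (x^* b x)] is a positive functional, to which [positive_functional_le] applies at
    [a]. *)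
Lemma gns_mul_le a x : hnorm (g (a * x)) <= 2 * cnorm a * hnorm (g x).
Proof.
apply: hnorm_le_sqr; first by rewrite !mulr_ge0 ?cnorm_ge0 ?hnorm_ge0.
pose phi b := tr (st x * b * x).
have pphi : positive_functional phi.
  split=> [c y z|y]; first by rewrite /phi mulrDr mulrDl -scalerAr -scalerAl ltr.
  by rewrite /phi mulrA -mulrA -star_mul ptr.
rewrite gns_sqr star_mul mulrA -[st x * st a * a]mulrA -/(phi _).
rewrite (le_trans (positive_functional_le a pphi))// /phi mulr1 -gns_sqr !exprMn.
rewrite ler_wpM2r ?sqr_ge0// ler_wpM2r ?sqr_ge0// expr2.
by move: (2 : R) (ler1n R 2) => t t1; rewrite ler_peMr// (le_trans ler01).
Qed.

Lemma gns_star x : hnorm (g (st x)) = hnorm (g x).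
Proof.
have e : hnorm (g (st x)) ^+ 2 = hnorm (g x) ^+ 2 by rewrite !gns_sqr star_involutive ctr.
by apply/eqP; rewrite -(eqrXn2 (n := 2))// ?hnorm_ge0// e.
Qed.

(** By the trace property the involution preserves the Hilbert norm, and it exchanges right
    multiplication by [a] with left multiplication by [star a]. *)
Lemma gns_mulr_le a x : hnorm (g (x * a)) <= 2 * cnorm a * hnorm (g x).
Proof.
rewrite -gns_star star_mul (le_trans (gns_mul_le _ _))//.
by rewrite cnorm_star gns_star.
Qed.

(** Left multiplication by [a] always has adjoint left multiplication by [star a]; cyclicity of the
    trace gives the same for right multiplication, so the adjoint of a commutator is again a
    commutator. *)
Lemma gns_commutator_adjoint a x y :
  ⟨g (st a * x - x * st a), g y⟩ = ⟨g x, g (a * y - y * a)⟩.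
Proof.
rewrite !gns_inner starD starN !star_mul star_involutive mulrBl mulrBr !trB.
by rewrite -[a * st x * y]mulrA [tr (a * _)]ctr !mulrA.
Qed.
End Trace.

(** * Local algebras and their commutation *)

Section Local.
Variables (R : realType) (N d : nat) (A : cstar_algebra R) (S : uhf N d A).
Implicit Types (x y : A) (c : R[i]) (Delta : set 'rV[int]_d) (m n : nat).
Local Notation st := (@star R A).
Local Notation alg := (local_algebra S).

Lemma local_algebra_sub Delta : star_subalgebra (alg Delta).
Proof.
split.
- by move=> B [[]].
- by move=> c x y hx hy B BB; case: (BB) => -[_ h _ _] _; apply: h; [exact: hx | exact: hy].
- by move=> x y hx hy B BB; case: (BB) => -[_ _ h _] _; apply: h; [exact: hx | exact: hy].
by move=> x hx B BB; case: (BB) => -[_ _ _ h] _; apply: h; exact: hx.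
Qed.

Lemma local_algebra_site Delta j a : Delta j -> alg Delta (site S j a).
Proof. by move=> Dj B [_]; apply; exists j => //; exists a. Qed.

Lemma local_algebra_ind Delta (B : set A) : star_subalgebra B ->
  (forall j a, Delta j -> B (site S j a)) -> alg Delta `<=` B.
Proof. by move=> sB hB x; apply; split=> // _ [j Dj [a ->]]; exact: hB. Qed.

Lemma local_algebra_mono Delta Delta' : Delta `<=` Delta' -> alg Delta `<=` alg Delta'.
Proof.
move=> h; apply: local_algebra_ind; first exact: local_algebra_sub.
by move=> j a /h; exact: local_algebra_site.
Qed.

(** The commutant of a star-closed set is a star-subalgebra. Applied twice, this reduces the claim
    to generators at distinct sites. *)
Lemma local_algebra_comm Delta Delta' x y : (forall j, Delta j -> ~ Delta' j) ->
  alg Delta x -> alg Delta' y -> x * y = y * x.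
Proof.
move=> dis hx hy.
have comm (P : set A) : (forall z, P z -> P (st z)) -> star_subalgebra [set z | forall w, P w -> z * w = w * z].
  move=> Ps; split=> /=.
  - by move=> w _; rewrite mul1r mulr1.
  - by move=> c u v hu hv w Pw; rewrite mulrDl mulrDr -scalerAl -scalerAr hu// hv.
  - by move=> u v hu hv w Pw; rewrite -mulrA hv// mulrA hu// mulrA.
  move=> u hu w Pw; rewrite -[w](@star_involutive R A) -!star_mul hu//; exact: Ps.
have [_ _ _ algs] := local_algebra_sub Delta'.
apply: (local_algebra_ind (comm _ algs) _ hx y hy) => j a Dj w.
pose P := [set z | exists b, z = site S j b].
have Ps z : P z -> P (st z) by move=> [b ->]; exists (map_mx Num.conj b^T); rewrite site_star.
move=> hw; apply/esym; apply: (local_algebra_ind (comm _ Ps) _ hw); last by exists a.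
move=> k b Dk _ [e ->]; apply: site_comm; apply/eqP => kj; apply: (dis j Dj); by rewrite -kj.
Qed.
End Local.

Section Derivation.
Variables (R : realType) (N d : nat) (A : cstar_algebra R) (S : uhf N d A) (tr : A -> R[i]).
Hypothesis trP : normalized_trace tr.
Variables (H : gns tr).
Implicit Types (x y : A) (c : R[i]) (m n : nat) (W : nat -> A) (u v w : H).
Local Notation st := (@star R A).
Local Notation g := (gns_vec H).
Local Notation alg m := (local_algebra S (@box d m)).

Definition boundary_local W := forall n, (1 <= n)%N -> local_algebra S (@box_boundary d n) (W n).
Definition commutator_sum W m x : A := \sum_(1 <= n < m.+1) (W n * x - x * W n).
(** Left and right multiplication by [W n] each have bound [2 |W n|] in the Hilbert norm. *)
Definition commutator_rate W m : R := \sum_(1 <= n < m.+1) 4 * cnorm (W n).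
Definition local_vec m : set H := [set g x | x in alg m].

Lemma boundary_local_star W : boundary_local W -> boundary_local (fun n => st (W n)).
Proof. by move=> h n n1; have [_ _ _ s] := local_algebra_sub S (@box_boundary d n); apply: s; exact: h. Qed.

Lemma alg_mono m n : (m <= n)%N -> alg m `<=` alg n.
Proof. by move=> mn; apply: local_algebra_mono => j /= /leq_trans; exact. Qed.

Lemma commutator_sum_alg W m x : boundary_local W -> alg m x -> alg m (commutator_sum W m x).
Proof.
move=> lW ax; have [a1 al am _] := local_algebra_sub S (@box d m).
have a0 : alg m 0 by have := al (-1) _ _ a1 a1; rewrite scaleN1r addNr.
rewrite /commutator_sum big_nat; elim/big_ind: _ => // [u v au av|n /andP[n1 nm]].
  by rewrite -[u]scale1r; exact: al.
have aW : alg m (W n) by apply: (local_algebra_mono _ (lW n n1)) => j; rewrite /box /box_boundary /= => ->.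
by rewrite addrC -scaleN1r; apply: al; exact: am.
Qed.

(** For [n > m] the boundary of the box [n] is disjoint from the box [m], so the extra commutators
    vanish. *)
Lemma commutator_sum_mono W m p x : boundary_local W -> (m <= p)%N -> alg m x ->
  commutator_sum W p x = commutator_sum W m x.
Proof.
move=> lW mp ax; rewrite /commutator_sum (big_cat_nat (n := m.+1))//= [X in _ + X](_ : _ = 0) ?addr0//.
rewrite big_nat big1// => n /andP[mn _]; apply/eqP; rewrite subr_eq0; apply/eqP/esym.
apply: (local_algebra_comm _ ax (lW n (leq_trans (ltn0Sn m) mn))) => j /= jm jn.
by move: mn; rewrite -jn ltnNge jm.
Qed.

Lemma commutator_sum_lin W m c x y :
  commutator_sum W m (c *: x + y) = c *: commutator_sum W m x + commutator_sum W m y.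
Proof.
rewrite /commutator_sum scaler_sumr -big_split; apply: eq_bigr => n _ /=.
by rewrite mulrDr mulrDl scalerBr -scalerAr -scalerAl opprD addrACA.
Qed.

Lemma commutator_rate_star W m : commutator_rate (fun n => st (W n)) m = commutator_rate W m.
Proof. by rewrite /commutator_rate; apply: eq_bigr => n _; rewrite cnorm_star. Qed.

Lemma gns_commutator_le W m x : hnorm (g (commutator_sum W m x)) <= commutator_rate W m * hnorm (g x).
Proof.
rewrite (linearmap_sum (@gns_linear _ _ _ H)) (le_trans (hnorm_sum _ _ _))// /commutator_rate mulr_suml.
apply: ler_sum => n _; rewrite gnsB (le_trans (hnormB _ _))//.
rewrite (le_trans (lerD (gns_mul_le trP H _ _) (gns_mulr_le trP H _ _)))//.
by rewrite le_eqVlt; apply/orP; left; apply/eqP; ring.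
Qed.

Lemma gns_commutator_dual W m x y :
  ⟨g (commutator_sum (fun n => st (W n)) m x), g y⟩ = ⟨g x, g (commutator_sum W m y)⟩.
Proof.
rewrite !(linearmap_sum (@gns_linear _ _ _ H)) inner_suml inner_sumr.
by apply: eq_bigr => n _; exact: (gns_commutator_adjoint trP).
Qed.

Lemma gval_eq (T : set (H * H)) u w : T (u, w) -> (forall w', T (u, w') -> w' = w) -> gval T u = w.
Proof. by move=> h1 h2; apply: xget_unique. Qed.

(** Single-valuedness has two sides: the truncation level is immaterial by [commutator_sum_mono],
    and the value depends only on the vector [g x] by the bound [gns_commutator_le], so injectivity
    of [gns_vec] is not invoked. *)
Lemma derivation_val W m x : boundary_local W -> alg m x ->
  derivation S H W (g x, g (commutator_sum W m x)) /\ gval (derivation S H W) (g x) = g (commutator_sum W m x).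
Proof.
move=> lW ax; have dx : derivation S H W (g x, g (commutator_sum W m x)) by exists m, x.
split=> //; apply: gval_eq => // w' [p [y [ay [exy ->]]]].
pose q := maxn m p; have mq : (m <= q)%N by rewrite leq_maxl.
have pq : (p <= q)%N by rewrite leq_maxr.
rewrite -(commutator_sum_mono lW mq ax) -[LHS]/(g (commutator_sum W p y)) -(commutator_sum_mono lW pq ay).
apply/eqP; rewrite -subr_eq0 -gnsB; apply/eqP/hnorm_eq0/eqP; rewrite eq_le hnorm_ge0 andbT.
have -> : commutator_sum W q y - commutator_sum W q x = commutator_sum W q (y - x).
  by rewrite addrC -scaleN1r -commutator_sum_lin scaleN1r addrC.
by rewrite (le_trans (gns_commutator_le _ _ _))// gnsB exy subrr hnorm0 mulr0.
Qed.

Lemma local_vectorsE v : local_vectors S H v <-> exists m, local_vec m v.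
Proof.
split=> [[x [m _ ax] <-]|[m [x ax <-]]]; first by exists m, x.
by exists x => //; exists m.
Qed.

Lemma local_vec_dense : hdense [set v | exists m, local_vec m v].
Proof.
move=> h e e0; have [_ [x _ <-] hx] := @gns_dense _ _ _ H h _ (divr_gt0 e0 (ltr0Sn _ 1)).
have [y [m ay] hy] := site_dense S x (divr_gt0 e0 (ltr0Sn R 3)).
exists (g y); first by exists m, y.
rewrite (le_lt_trans (hnorm_distD (g x) _ _))// [e]splitr ltrD// -gnsB (le_lt_trans (gns_le trP H _))//.
by move: hy; move: (cnorm _) => z hz; lra.
Qed.

Lemma local_vec_lin m c u v : local_vec m u -> local_vec m v -> local_vec m (c *: u + v).
Proof.
move=> [x ax <-] [y ay <-]; have [_ al _ _] := local_algebra_sub S (@box d m).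
by exists (c *: x + y); [exact: al | rewrite gnsD gnsZ].
Qed.

Lemma local_vec_mono m n : (m <= n)%N -> local_vec m `<=` local_vec n.
Proof. by move=> mn _ [x ax <-]; exists x => //; exact: (alg_mono mn). Qed.

Lemma derivation_local W m : boundary_local W ->
  local_op (local_vec m) (commutator_rate W m) (gval (derivation S H W)).
Proof.
move=> lW; split.
- by apply: sumr_ge0 => n _; rewrite mulr_ge0// cnorm_ge0.
- move=> _ [x ax <-]; rewrite (derivation_val lW ax).2.
  by exists (commutator_sum W m x) => //; exact: commutator_sum_alg.
- move=> c _ _ [x ax <-] [y ay <-]; have [_ al _ _] := local_algebra_sub S (@box d m).
  rewrite -gnsZ -gnsD (derivation_val lW ax).2 (derivation_val lW ay).2.
  by rewrite (derivation_val lW (al c x y ax ay)).2 commutator_sum_lin gnsD gnsZ.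
by move=> _ [x ax <-]; rewrite (derivation_val lW ax).2; exact: gns_commutator_le.
Qed.

Variable W : nat -> A.
Hypothesis lW : boundary_local W.
Let lWs := boundary_local_star lW.
Local Notation C := (gval (derivation S H W)).
Local Notation Cd := (gval (derivation S H (fun n => st (W n)))).

Lemma derivation_dual m u v : local_vec m u -> local_vec m v -> ⟨C u, v⟩ = ⟨u, Cd v⟩.
Proof.
move=> [x ax <-] [y ay <-]; rewrite (derivation_val lW ax).2 (derivation_val lWs ay).2.
rewrite -gns_commutator_dual; congr ⟨g _, _⟩.
by apply: eq_bigr => n _; rewrite star_involutive.
Qed.

Lemma derivation_star_local m : local_op (local_vec m) (commutator_rate W m) Cd.
Proof. by rewrite -commutator_rate_star; exact: derivation_local. Qed.

Definition derivation_coupling : coupling H :=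
  Coupling local_vec_lin local_vec_mono (fun m => derivation_local m lW) derivation_star_local
    derivation_dual local_vec_dense.
Local Notation Q := derivation_coupling.

Lemma derivation_graph u : core Q u -> derivation S H W (u, C u).
Proof. by move=> [m [x ax <-]]; have [h e] := derivation_val lW ax; rewrite e. Qed.

Lemma derivation_dom p : derivation S H W p -> core Q p.1 /\ p.2 = C p.1.
Proof.
by move=> [m [x [ax ->]]] /=; split; [exists m, x | rewrite (derivation_val lW ax).2].
Qed.

Lemma core_dual u v : core Q u -> core Q v -> ⟨C u, v⟩ = ⟨u, Cd v⟩.
Proof. by move=> cu cv; have [m [hu hv]] := core2 cu cv; exact: derivation_dual hu hv. Qed.

Lemma core_dual' u v : core Q u -> core Q v -> ⟨Cd u, v⟩ = ⟨u, C v⟩.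
Proof. by move=> cu cv; rewrite -inner_conj -core_dual// inner_conj. Qed.

Lemma core_C u : core Q u -> core Q (C u).
Proof. by move=> [m hu]; exists m; have [_ h _ _] := derivation_local m lW; exact: h. Qed.

(** The formal adjoint [Cd] is defined on the dense core. A limit of pairs of the graph therefore
    has the same scalar products with core vectors as [(v, C v)]: the usual proof of closability. *)
Lemma closure_graph v w : core Q v -> gclosure (derivation S H W) (v, w) <-> w = C v.
Proof.
move=> cv; split=> [cl|-> e e0]; last first.
  by exists (v, C v); [exact: derivation_graph | rewrite !subrr hnorm0].
apply: (inner_eq_dense local_vec_dense) => y cy; rewrite -core_dual'//.
apply: eq_by_cmod => e e0; pose k : R := hnorm y + hnorm (Cd y) + 1.
have k0 : 0 < k by rewrite ltr_wpDl// addr_ge0 ?hnorm_ge0.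
have [q /derivation_dom[cq eq] [/= h1 h2]] := cl _ (divr_gt0 e0 k0).
rewrite (_ : _ - _ = ⟨y, w - q.2⟩ - ⟨Cd y, v - q.1⟩); last first.
  by rewrite !innerBr eq [⟨Cd y, q.1⟩]core_dual'//; ring.
rewrite (le_trans (cmodB _ _))// (le_trans (lerD (inner_le _ _) (inner_le _ _)))//.
apply: (@le_trans _ _ ((hnorm y + hnorm (Cd y)) * (e / k))).
  by rewrite mulrDl lerD// ler_wpM2l ?hnorm_ge0 ?ltW.
by rewrite mulrA ler_pdivrMr// [e * k]mulrC ler_wpM2r ?(ltW e0)// lerDl.
Qed.

Lemma adjoint_graph v w : core Q v -> gadjoint (derivation S H W) (v, w) <-> w = Cd v.
Proof.
move=> cv; split=> [h|-> q /derivation_dom[cq ->]]; last exact: core_dual'.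
apply: (inner_eq_dense local_vec_dense) => y cy.
have := h _ (derivation_graph cy); rewrite /= => e.
by rewrite -[LHS]inner_conj e -core_dual'// inner_conj.
Qed.

Lemma closure_core v : core Q v -> gdom (gclosure (derivation S H W)) v /\
  gval (gclosure (derivation S H W)) v = C v.
Proof.
move=> cv; have h : gclosure (derivation S H W) (v, C v) by apply/closure_graph.
by split; [exists (C v) | apply: gval_eq => // w /closure_graph; exact].
Qed.

Lemma adjoint_core v : core Q v -> gdom (gadjoint (derivation S H W)) v /\
  gval (gadjoint (derivation S H W)) v = Cd v.
Proof.
move=> cv; have h : gadjoint (derivation S H W) (v, Cd v) by apply/adjoint_graph.
by split; [exists (Cd v) | apply: gval_eq => // w /adjoint_graph; exact].
Qed.

(** [C] leaves the core invariant, so [C v] lies again where the adjoint is known to be [Cd], and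
    the composition of the closure with the adjoint is [Cd (C v)]. *)
Lemma generator_core v : core Q v -> gdom (generator S H W) v /\
  gval (generator S H W) v = gen_op C Cd v.
Proof.
move=> cv; have cC := core_C cv.
have h : generator S H W (v, gen_op C Cd v).
  by exists (Cd (C v)) => //; exists (C v); [apply/closure_graph | apply/adjoint_graph].
split; first by exists (gen_op C Cd v).
apply: gval_eq => // w [z [y /= hy hz] ->].
by move/closure_graph: hy => /(_ cv) yE; move: hz; rewrite yE => /adjoint_graph ->.
Qed.
End Derivation.

Theorem theorem3p5 (R : realType) (N d : nat) (A : cstar_algebra R)
    (S : uhf N d A) (tr : A -> R[i]) (H : gns tr) (F : fock R)
    (K : hilbert_tensor H F) (W : nat -> A) :
  (0 < N)%N -> (0 < d)%N -> normalized_trace tr ->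
  (forall n, (1 <= n)%N -> local_algebra S (@box_boundary d n) (W n)) ->
  (\sum_(1 <= n <oo) (cnorm (W n))%:E = +oo)%E ->
  let Aloc := local_vectors S H in
  let Cr := derivation S H W in
  let G := generator S H W in
  let L := lindbladian G (gclosure Cr) in
  exists U : R -> K -> K,
    unitary_solution Aloc G (gclosure Cr) (gadjoint Cr) U /\
    star_homomorphisms (conjugation U) /\
    exists T : R -> (H -> H) -> H -> H,
      [/\ expectation_semigroup (conjugation U) T,
          qds T /\ associated Aloc L T,
          minimal_semigroup Aloc L T,
          unique_semigroup Aloc L T
        & conservative T].
Proof.
move=> _ _ trP lW _ Aloc Cr G L.
apply: (@coupling_solution R H F K (derivation_coupling trP H lW) Aloc G (gclosure Cr) (gadjoint Cr)).
- exact: local_vectorsE.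
- exact: generator_core.
- exact: closure_core.
- exact: adjoint_core.
Qed.
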